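(* Let $M$ be a smooth $3$-dimensional contact sub-Riemannian manifold with rank-$2$ distribution $\Delta$. (i) Let $\xi$ be a smooth vector field on $\overline M$, $\Gamma(s)=e^{s\xi}\bar q_0$ its integral curve starting at $\bar q_0\in\overline M$, and $$\mathcal W=\{\bar q(t,s)=(e^{tV}\circ e^{s\xi})\bar q_0:\ t\in[-\varepsilon_1,\varepsilon_2],\ s\in[-\delta_1,\delta_2]\}.$$ Then the projected surface $W=\pi[\mathcal W]$ is a $\Delta$-minimal surface, possibly with characteristic points. In particular, consider the following conditions on vectors $\zeta=\sum_{i=1}^4\zeta_iX_i(\bar q)\in T_{\bar q}\mathcal W$: $$\zeta_1\sin\varphi-\zeta_2\cos\varphi=0,\qquad \zeta_3=0,\qquad g(\bar q)\zeta_1=\zeta_4\cos\varphi,\qquad g(\bar q)\zeta_2=\zeta_4\sin\varphi .$$ If all of these conditions fail at $\bar q=(q,\varphi)\in\mathcal W$, then $\bar q$ is a regular point of $\mathcal W$, its projection $q=\pi[\bar q]$ is a regular point of $W$, and $W$ satisfies the minimal surface equation $X_1\nu_1+X_2\nu_2+\nu_1c_{12}^2-\nu_2c_{12}^1=0$ at $q$. (ii) Moreover, by a suitable choice of the initial curve $\Gamma$, any given piece of a $\Delta$-minimal surface in $M$ can be presented as the projection $\pi[\mathcal W]$ of a piece $\mathcal W$ of the form $\{(e^{tV}\circ e^{s\xi})\bar q_0:\ t\in[-\varepsilon_1,\varepsilon_2],\ s\in[-\delta_1,\delta_2]\}$.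
   Context: $X_1,X_2$ is an orthonormal frame of $\Delta$. The canonical contact form $\omega$ is given (up to sign) by $\ker\omega=\Delta$, $d\omega(X_1,X_2)^2=1$; $X_3$ is its Reeb field ($\omega(X_3)=1$, $d\omega(v,X_3)=0$ for $v\in\Delta$); the functions $c_{ij}^k$ are defined by $[X_i,X_j]=-\sum_{k=1}^3c_{ij}^kX_k$. For a surface $W\subset M$, a point $q\in W$ is characteristic if $T_qW=\Delta_q$. Away from characteristic points the horizontal normal $\nu=\nu_1X_1+\nu_2X_2$ is the projection on $\Delta$, normalized to unit length, of the unit normal of $W$ for the Riemannian metric making $X_1,X_2,X_3$ orthonormal. $W$ is $\Delta$-minimal if $X_1\nu_1+X_2\nu_2+\nu_1c_{12}^2-\nu_2c_{12}^1=0$ on $W$ away from its characteristic points. $\overline M=\{\bar q=(q,\varphi):q\in M,\varphi\in\mathbb R\}$ represents the bundle of unit horizontal vectors via $(q,\varphi)\mapsto\cos\varphi X_1(q)+\sin\varphi X_2(q)$; $\pi:\overline M\to M$ is the projection, $X_4=\partial_\varphi$, and $X_1,X_2,X_3$ are regarded as fields on $\overline M$ with $[X_i,X_4]=0$. The generalized characteristic vector field is $V=\cos\varphi X_1+\sin\varphi X_2+gX_4$ with $g=-c_{12}^1\cos\varphi-c_{12}^2\sin\varphi$. $e^{tV},e^{s\xi}$ denote flows; $\varepsilon_i,\delta_i>0$ are (possibly small) numbers. $T_{\bar q}\mathcal W$ is the span of $\partial_t\bar q=V$ and $\partial_s\bar q$; $\bar q$ is a regular point of $\mathcal W$ if this span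 is $2$-dimensional, and $q=\pi[\bar q]$ is a regular point of $W$ if $\pi_*[T_{\bar q}\mathcal W]$ is $2$-dimensional. *)

(* Defs.v *)
From mathcomp Require Import all_boot all_order all_algebra.
From mathcomp Require Import all_classical all_reals all_analysis.

Set Implicit Arguments.
Unset Strict Implicit.
Unset Printing Implicit Defensive.

Import Order.TTheory GRing.Theory Num.Theory.
Import numFieldNormedType.Exports.

Local Open Scope classical_set_scope.
Local Open Scope ring_scope.

(** ** Smooth maps between normed spaces *)

(* [Ck k A f]: f is of class C^k on the open set A.  For k.+1, f is
   differentiable on A and all its directional derivatives are C^k; on the
   finite-dimensional spaces used below this is the usual notion. *)
Fixpoint Ck (R : realType) (E F : normedModType R) (k : nat) (A : set E)
    (f : E -> F) : Prop :=
  match k with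
  | 0 => forall x, A x -> {for x, continuous f}
  | k'.+1 => (forall x, A x -> differentiable f x) /\
             forall v : E, Ck k' A (fun x => 'D_v f x)
  end.

Definition smooth_on (R : realType) (E F : normedModType R) (A : set E)
    (f : E -> F) : Prop := forall k, Ck k A f.

(** ** Smooth manifolds modelled on a normed space *)

(* Raw data of a chart; [cinv] is only meaningful on the image of [dom], and
   the conditions relating the fields are in [is_chart]. *)
Record chart (M E : Type) : Type := Chart {
  dom : set M;
  cmap : M -> E;
  cinv : E -> M }.

Definition cimg (M E : Type) (c : chart M E) : set E := cmap c @` dom c.

Record is_chart (R : realType) (E : normedModType R) (M : topologicalType)
    (c : chart M E) : Prop := {
  chart_open : open (dom c);
  chart_img_open : open (cimg c);
  chart_cancel : forall p, dom c p -> cinv c (cmap c p) = p;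
  chart_cmap_cont : forall p, dom c p -> {for p, continuous (cmap c)};
  chart_cinv_cont : forall x, cimg c x -> {for x, continuous (cinv c)} }.

Record smooth_manifold (R : realType) (E : normedModType R)
    (M : topologicalType) (A : set (chart M E)) : Prop := {
  mfd_hausdorff : hausdorff_space M;
  mfd_second_countable : @second_countable M;
  mfd_chart : forall c, A c -> is_chart c;
  mfd_cover : forall p : M, exists2 c, A c & dom c p;
  mfd_compat : forall c d, A c -> A d ->
    smooth_on (cmap c @` (dom c `&` dom d)) (cmap d \o cinv c) }.

Definition line_atlas (R : realType) : set (chart R R^o) :=
  [set Chart setT id id].

Definition prod_chart (M N E F : Type) (c : chart M E) (d : chart N F) :
    chart (M * N) (E * F) :=
  Chart [set p | dom c p.1 /\ dom d p.2]
        (fun p => (cmap c p.1, cmap d p.2))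
        (fun x => (cinv c x.1, cinv d x.2)).

Definition prod_atlas (M N E F : Type) (A : set (chart M E))
    (B : set (chart N F)) : set (chart (M * N) (E * F)) :=
  [set c | exists a b, [/\ A a, B b & c = prod_chart a b]].

(* f is smooth in a neighbourhood of p; f itself is a total function, whose
   values away from p are irrelevant. *)
Definition smooth_at (R : realType) (E : normedModType R) (M : Type)
    (A : set (chart M E)) (p : M) (f : M -> R) : Prop :=
  exists c, [/\ A c, dom c p &
    exists U : set E, [/\ open U, U (cmap c p), U `<=` cimg c &
      smooth_on U (f \o cinv c : E -> R^o)]].

(** ** Tangent vectors, vector fields, curves, flows *)

(* Tangent vectors at p are derivations of the functions smooth near p.
   Locality is automatic: the indicator of a neighbourhood of p is itself
   smooth near p, hence is killed by any derivation at p. *)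
Definition vec (R : realType) (M : Type) := (M -> R) -> R.
Definition field (R : realType) (M : Type) := M -> vec R M.

Definition is_tangent (R : realType) (E : normedModType R) (M : Type)
    (A : set (chart M E)) (p : M) (v : vec R M) : Prop :=
  (forall (a : R) (f g : M -> R), smooth_at A p f -> smooth_at A p g ->
     v (fun x => a * f x + g x) = a * v f + v g) /\
  (forall f g : M -> R, smooth_at A p f -> smooth_at A p g ->
     v (fun x => f x * g x) = f p * v g + g p * v f).

(* Equality of tangent vectors at p: values on functions not smooth near p do
   not count. *)
Definition veq (R : realType) (E : normedModType R) (M : Type)
    (A : set (chart M E)) (p : M) (v w : vec R M) : Prop :=
  forall f, smooth_at A p f -> v f = w f.

Definition vcomb (R : realType) (M : Type) (a : R) (v : vec R M) (b : R)
    (w : vec R M) : vec R M := fun f => a * v f + b * w f.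

Definition vfree2 (R : realType) (E : normedModType R) (M : Type)
    (A : set (chart M E)) (p : M) (v w : vec R M) : Prop :=
  forall a b, veq A p (vcomb a v b w) (fun=> 0) -> a = 0 /\ b = 0.

Definition vspan2 (R : realType) (E : normedModType R) (M : Type)
    (A : set (chart M E)) (p : M) (v w : vec R M) : set (vec R M) :=
  [set u | exists a b, veq A p u (vcomb a v b w)].

Record smooth_field (R : realType) (E : normedModType R) (M : Type)
    (A : set (chart M E)) (X : field R M) : Prop := {
  field_tangent : forall p, is_tangent A p (X p);
  field_smooth : forall p f,
    smooth_at A p f -> smooth_at A p (fun q => X q f) }.

Definition lie (R : realType) (M : Type) (X Y : field R M) : field R M :=
  fun p f => X p (fun q => Y q f) - Y p (fun q => X q f).

Record integral_curve (R : realType) (E : normedModType R) (M : Type)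
    (A : set (chart M E)) (X : field R M) (J : set R) (gamma : R -> M) :
    Prop := {
  curve_open : open J;
  curve_interval : is_interval J;
  curve_derive : forall t f, J t -> smooth_at A (gamma t) f ->
    is_derive t 1 (f \o gamma : R^o -> R^o) (X (gamma t) f) }.

Definition velocity (R : realType) (M : Type) (gamma : R -> M) (t : R) :
    vec R M := fun f => 'D_1 (f \o gamma : R^o -> R^o) t.

(* [Phi t p] is e^{tX} p, defined for (t, p) in the open set D. *)
Record is_flow (R : realType) (E : normedModType R) (M : topologicalType)
    (A : set (chart M E)) (X : field R M) (D : set (R * M))
    (Phi : R -> M -> M) : Prop := {
  flow_open : open D;
  flow_dom0 : forall p, D (0, p);
  flow0 : forall p, Phi 0 p = p;
  flow_curve : forall p,
    integral_curve A X [set t | D (t, p)] (fun t => Phi t p);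
  flow_smooth : forall t p f, D (t, p) -> smooth_at A (Phi t p) f ->
    smooth_at (prod_atlas (@line_atlas R) A) (t, p)
      (fun z => f (Phi z.1 z.2)) }.

(** ** Contact sub-Riemannian structures on a 3-manifold *)

Definition i1 : 'I_3 := @Ordinal 3 0 isT.
Definition i2 : 'I_3 := @Ordinal 3 1 isT.
Definition i3 : 'I_3 := @Ordinal 3 2 isT.

(* A distribution Delta and an inner product ip on its fibres.  That Delta has
   rank 2 and that Delta and ip are smooth is expressed by the existence of a
   smooth orthonormal frame, see [orthonormal_frame]. *)
Record sub_riemannian (R : realType) (E : normedModType R) (M : Type)
    (A : set (chart M E)) (Delta : M -> set (vec R M))
    (ip : M -> vec R M -> vec R M -> R) : Prop := {
  sr_tangent : forall q v, Delta q v -> is_tangent A q v;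
  sr_veq : forall q v w, is_tangent A q w -> veq A q v w ->
    Delta q v -> Delta q w;
  sr_subspace : forall q a v b w, Delta q v -> Delta q w ->
    Delta q (vcomb a v b w);
  sr_ip_veq : forall q v v' w, Delta q v -> Delta q v' -> Delta q w ->
    veq A q v v' -> ip q v w = ip q v' w;
  sr_ip_linear : forall q a v b v' w, Delta q v -> Delta q v' -> Delta q w ->
    ip q (vcomb a v b v') w = a * ip q v w + b * ip q v' w;
  sr_ip_sym : forall q v w, Delta q v -> Delta q w -> ip q v w = ip q w v;
  sr_ip_pos : forall q v, Delta q v -> ~ veq A q v (fun=> 0) ->
    0 < ip q v v }.

Record orthonormal_frame (R : realType) (E : normedModType R) (M : Type)
    (A : set (chart M E)) (Delta : M -> set (vec R M))
    (ip : M -> vec R M -> vec R M -> R) (X1 X2 : field R M) : Prop := {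
  frame_smooth1 : smooth_field A X1;
  frame_smooth2 : smooth_field A X2;
  frame_in1 : forall q, Delta q (X1 q);
  frame_in2 : forall q, Delta q (X2 q);
  frame_span : forall q v, Delta q v -> vspan2 A q (X1 q) (X2 q) v;
  frame_unit1 : forall q, ip q (X1 q) (X1 q) = 1;
  frame_unit2 : forall q, ip q (X2 q) (X2 q) = 1;
  frame_orth : forall q, ip q (X1 q) (X2 q) = 0 }.

Record one_form (R : realType) (E : normedModType R) (M : Type)
    (A : set (chart M E)) (omega : M -> vec R M -> R) : Prop := {
  form_veq : forall q v w, is_tangent A q v -> is_tangent A q w ->
    veq A q v w -> omega q v = omega q w;
  form_linear : forall q a v b w, is_tangent A q v -> is_tangent A q w ->
    omega q (vcomb a v b w) = a * omega q v + b * omega q w;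
  form_smooth : forall X q, smooth_field A X ->
    smooth_at A q (fun p => omega p (X p)) }.

Definition dform (R : realType) (M : Type) (omega : M -> vec R M -> R)
    (X Y : field R M) (q : M) : R :=
  X q (fun p => omega p (Y p)) - Y q (fun p => omega p (X p))
  - omega q (lie X Y q).

(* Delta is contact because its annihilator omega satisfies
   d omega (X1, X2) <> 0. *)
Record canonical_contact_form (R : realType) (E : normedModType R) (M : Type)
    (A : set (chart M E)) (Delta : M -> set (vec R M)) (X1 X2 : field R M)
    (omega : M -> vec R M -> R) : Prop := {
  contact_form : one_form A omega;
  contact_ker : forall q v, is_tangent A q v ->
    (omega q v = 0 <-> Delta q v);
  contact_norm : forall q, dform omega X1 X2 q ^+ 2 = 1 }.

Record reeb_field (R : realType) (E : normedModType R) (M : Type)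
    (A : set (chart M E)) (Delta : M -> set (vec R M))
    (omega : M -> vec R M -> R) (X3 : field R M) : Prop := {
  reeb_smooth : smooth_field A X3;
  reeb_one : forall q, omega q (X3 q) = 1;
  reeb_d : forall Y q, smooth_field A Y -> (forall p, Delta p (Y p)) ->
    dform omega Y X3 q = 0 }.

(* [c i j k] is c_{ij}^k. *)
Definition structure_functions (R : realType) (E : normedModType R)
    (M : Type) (A : set (chart M E)) (X : 'I_3 -> field R M)
    (c : 'I_3 -> 'I_3 -> 'I_3 -> M -> R) : Prop :=
  forall i j q, veq A q (lie (X i) (X j) q)
    (fun f => - \sum_(k < 3) c i j k q * X k q f).

(** ** Surfaces in M and the minimal surface equation *)

(* Embedded surfaces (without boundary), as local regular level sets. *)
Definition is_surface (R : realType) (E : normedModType R)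
    (M : topologicalType) (A : set (chart M E)) (S : set M) : Prop :=
  forall q, S q -> exists (U : set M) (h : M -> R),
    [/\ open U, U q, forall p, U p -> smooth_at A p h,
        exists2 v, is_tangent A q v & v h <> 0 &
        forall p, U p -> (S p <-> h p = 0)].

Definition tangent_space (R : realType) (E : normedModType R)
    (M : topologicalType) (A : set (chart M E)) (S : set M) (q : M) :
    set (vec R M) :=
  [set v | is_tangent A q v /\
    forall f, smooth_at A q f -> (\forall p \near q, S p -> f p = 0) ->
      v f = 0].

Definition characteristic (R : realType) (E : normedModType R)
    (M : topologicalType) (A : set (chart M E))
    (Delta : M -> set (vec R M)) (S : set M) (q : M) : Prop :=
  tangent_space A S q = Delta q.

(* n 0, n 1, n 2 are the components in X of a unit normal to S at q, for the
   metric making X orthonormal. *)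
Definition unit_normal (R : realType) (E : normedModType R)
    (M : topologicalType) (A : set (chart M E)) (X : 'I_3 -> field R M)
    (S : set M) (q : M) (n : 'I_3 -> R) : Prop :=
  \sum_(i < 3) n i ^+ 2 = 1 /\
  forall v (a : 'I_3 -> R), tangent_space A S q v ->
    veq A q v (fun f => \sum_(i < 3) a i * X i q f) ->
    \sum_(i < 3) a i * n i = 0.

Definition horizontal_normal (R : realType) (E : normedModType R)
    (M : topologicalType) (A : set (chart M E)) (X : 'I_3 -> field R M)
    (S : set M) (q : M) (nu1 nu2 : R) : Prop :=
  exists n : 'I_3 -> R, let r := Num.sqrt (n i1 ^+ 2 + n i2 ^+ 2) in
    [/\ unit_normal A X S q n, r <> 0, nu1 = n i1 / r & nu2 = n i2 / r].

(* The minimal surface equation at a non-characteristic point q of S.  To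
   differentiate nu along X1, X2 it is extended off S as a smooth *unit*
   horizontal field nu1 X1 + nu2 X2; since nu1^2 + nu2^2 = 1,
   X1 nu1 + X2 nu2 only involves the derivative along -nu2 X1 + nu1 X2, which
   is tangent to S, so that the equation does not depend on the extension. *)
Definition minimal_at (R : realType) (E : normedModType R)
    (M : topologicalType) (A : set (chart M E)) (Delta : M -> set (vec R M))
    (X : 'I_3 -> field R M) (c : 'I_3 -> 'I_3 -> 'I_3 -> M -> R)
    (S : set M) (q : M) : Prop :=
  ~ characteristic A Delta S q /\
  exists nu1 nu2 : M -> R,
    [/\ smooth_at A q nu1, smooth_at A q nu2,
        \forall p \near q, nu1 p ^+ 2 + nu2 p ^+ 2 = 1,
        \forall p \near q, S p -> horizontal_normal A X S p (nu1 p) (nu2 p) &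
        X i1 q nu1 + X i2 q nu2
        + nu1 q * c i1 i2 i2 q - nu2 q * c i1 i2 i1 q = 0].

Definition delta_minimal (R : realType) (E : normedModType R)
    (M : topologicalType) (A : set (chart M E)) (Delta : M -> set (vec R M))
    (X : 'I_3 -> field R M) (c : 'I_3 -> 'I_3 -> 'I_3 -> M -> R)
    (S : set M) : Prop :=
  is_surface A S /\
  forall q, S q -> ~ characteristic A Delta S q -> minimal_at A Delta X c S q.

(** ** The bundle of unit horizontal vectors, trivialised as M * R *)

Definition bar_atlas (R : realType) (E : normedModType R) (M : Type)
    (A : set (chart M E)) : set (chart (M * R) (E * R^o)) :=
  prod_atlas A (@line_atlas R).

(* X regarded as a field on M * R, with zero component along the fibre. *)
Definition lift_field (R : realType) (M : Type) (X : field R M) :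
    field R (M * R) :=
  fun p f => X p.1 (fun q => f (q, p.2)).

Definition X4 (R : realType) (M : Type) : field R (M * R) :=
  fun p f => velocity (fun phi : R => (p.1, phi)) p.2 f.
Arguments X4 {R M}.

Definition push (R : realType) (M : Type) (v : vec R (M * R)) : vec R M :=
  fun f => v (f \o fst).

Definition gfun (R : realType) (M : Type)
    (c : 'I_3 -> 'I_3 -> 'I_3 -> M -> R) (p : M * R) : R :=
  - c i1 i2 i1 p.1 * cos p.2 - c i1 i2 i2 p.1 * sin p.2.

(* The generalized characteristic vector field V. *)
Definition char_field (R : realType) (M : Type) (X : 'I_3 -> field R M)
    (c : 'I_3 -> 'I_3 -> 'I_3 -> M -> R) : field R (M * R) :=
  fun p f => cos p.2 * lift_field (X i1) p f + sin p.2 * lift_field (X i2) p f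
             + gfun c p * X4 p f.

(** ** The swept surface qbar(t,s) = e^{tV} (Gamma s) *)

Section Sweep.
Context (R : realType) (M : Type).
Implicit Types (Phi : R -> (M * R) -> (M * R)) (Gamma : R -> M * R).

Definition sweep Phi Gamma (z : R * R) : M * R := Phi z.1 (Gamma z.2).

Definition sweep_dt Phi Gamma (z : R * R) : vec R (M * R) :=
  velocity (fun t => sweep Phi Gamma (t, z.2)) z.1.

Definition sweep_ds Phi Gamma (z : R * R) : vec R (M * R) :=
  velocity (fun s => sweep Phi Gamma (z.1, s)) z.2.

Definition rectangle (e1 e2 d1 d2 : R) : set (R * R) :=
  [set z | - e1 <= z.1 <= e2 /\ - d1 <= z.2 <= d2].

Definition sweep_dom (D : set (R * (M * R))) (J : set R) Gamma :
    set (R * R) := [set z | J z.2 /\ D (z.1, Gamma z.2)].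

Definition sweep_tangent (E : normedModType R) (A : set (chart M E))
    Phi Gamma (z : R * R) : set (vec R (M * R)) :=
  vspan2 (bar_atlas A) (sweep Phi Gamma z)
    (sweep_dt Phi Gamma z) (sweep_ds Phi Gamma z).

(* z is (the parameter of) a regular point of the swept surface in M * R. *)
Definition bar_regular (E : normedModType R) (A : set (chart M E))
    Phi Gamma (z : R * R) : Prop :=
  vfree2 (bar_atlas A) (sweep Phi Gamma z)
    (sweep_dt Phi Gamma z) (sweep_ds Phi Gamma z).

(* z is (the parameter of) a regular point of its projection to M. *)
Definition proj_regular (E : normedModType R) (A : set (chart M E))
    Phi Gamma (z : R * R) : Prop :=
  vfree2 A (sweep Phi Gamma z).1
    (push (sweep_dt Phi Gamma z)) (push (sweep_ds Phi Gamma z)).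

(* [cond] fails at z: it is violated by some vector
   zeta_1 X_1 + ... + zeta_4 X_4 of the span of the two partial velocities. *)
Definition fails_on_tangent (E : normedModType R) (A : set (chart M E))
    (X : 'I_3 -> field R M) Phi Gamma (z : R * R)
    (cond : R -> R -> R -> R -> Prop) : Prop :=
  exists z1 z2 z3 z4 : R,
    sweep_tangent A Phi Gamma z
      (fun f => let p := sweep Phi Gamma z in
         z1 * lift_field (X i1) p f + z2 * lift_field (X i2) p f
         + z3 * lift_field (X i3) p f + z4 * X4 p f) /\
    ~ cond z1 z2 z3 z4.

End Sweep.

(* B parametrises an embedded surface patch of M around the projection of
   qbar(z), whose tangent planes are the projections of the tangent planes of
   the swept surface.  Restricting to a patch takes care of self-intersections
   and of singular points elsewhere. *)
Definition regular_patch (R : realType) (E : normedModType R)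
    (M : topologicalType) (A : set (chart M E))
    (Phi : R -> (M * R) -> (M * R)) (Gamma : R -> M * R)
    (B : set (R * R)) : Prop :=
  let W := (fst \o sweep Phi Gamma) @` B in
  is_surface A W /\
  forall z, B z -> tangent_space A W (sweep Phi Gamma z).1 =
    [set v | is_tangent A (sweep Phi Gamma z).1 v /\
       vspan2 A (sweep Phi Gamma z).1 (push (sweep_dt Phi Gamma z))
         (push (sweep_ds Phi Gamma z)) v].

(* Main.v *)
(** (i) The flow V rotates phi at the rate g, and its horizontal part is
    cos phi X1 + sin phi X2, so on the swept surface (-sin phi, cos phi) is a
    horizontal unit normal and the minimal surface equation says
    that phi changes at the rate g along the tangent direction.  Where W is
    regular, the inverse function theorem turns (t, s) and a transverse
    parameter into coordinates of M, which makes W a level set and extends phi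
    off W.  Of the four conditions only zeta_3 = 0 matters: its failure says
    that the s-velocity is not horizontal.

    (ii) Let S = {h = 0} and q in S.

    If a smooth angle phi near q satisfies cos phi X1 h + sin phi X2 h = 0 on S,
    then minimality forces phi to change at the rate g, and Gronwall's lemma
    keeps in S the V-trajectories issued from the graph of phi over a transverse
    curve of S.  Such a phi exists unless X1 h = X2 h = 0 at q with
    det (Xi Xj h) <> 0: at a noncharacteristic point it is obvious, and at a
    characteristic one where (Xi Xj h) has rank one (it is never zero, since
    [X1, X2] h <> 0) one component of the rotated horizontal gradient vanishes
    on S wherever the other does, hence is a smooth multiple of it by
    Hadamard's lemma.

    If det (Xi Xj h) <> 0, minimality forces (Xi Xj h) to be antisymmetric at q,
    and S is swept by the trajectories of V issued from q in all directions:
    Gamma is the fibre over q and xi = X4.  Along a trajectory h vanishes to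
    second order at t = 0 and satisfies |h''| <= K (|h| / |t| + |h'|), hence
    vanishes.  That a neighbourhood of q is covered follows from the inverse
    function theorem after a blow-up and from the compactness of the set of
    directions. *)

(* Minimality says nothing at characteristic points, yet these decide whether the angle exists. The
   bridge is [horizontal_mce]: cleared of its denominator, the equation holds at every point of S,
   so it can be differentiated along S and restricted to curves through a characteristic point. For
   a given angle it yields l^3 E = 0, where E is the defect of the law that the angle turns at the
   rate g and l is the derivative of h across the direction. At a rank-one point its derivative
   along S produces the factor [frame_cos] on the zero set of [frame_sin]. At a point with
   independent second derivatives its restriction to rays forces antisymmetry, and Hadamard's lemma
   writes it as h k with k = 0 at q. The last vanishing matters: along a trajectory l^2 h'' = h k -
   h' (l r1 + h' r2), where k, r1, r2, h' are all O(t) while l is of exact order t. This is why the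
   singular coefficient of h is no worse than 1/|t|, the strongest that the elementary maximum
   argument of [second_order_zero] tolerates. In the same case no smooth angle exists around q, so
   the neighbourhood is covered through the pair (X1 h, X2 h), which together with h forms a
   chart. *)
From HB Require Import structures.
Require Import Defs.
From mathcomp Require Import all_boot all_order all_algebra.
From mathcomp Require Import all_classical all_reals all_analysis.
From mathcomp Require Import ring lra.

Set Implicit Arguments.
Unset Strict Implicit.
Unset Printing Implicit Defensive.

Import Order.TTheory GRing.Theory Num.Theory.
Import numFieldNormedType.Exports.

Local Open Scope classical_set_scope.
Local Open Scope ring_scope.

(** * Smooth maps in finite dimension *)

(* Finite dimension, witnessed by a basis [be] with dual coordinates [bl]. *)
Class fbasis (R : realType) (F : normedModType R) := FBasis {
  bI : finType;
  be : bI -> F;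
  bl : bI -> {linear F -> R^o};
  bl_cont : forall i, continuous (bl i : F -> R^o);
  bE : forall x, x = \sum_i bl i x *: be i }.

Section scalev.
Context {R : realType} (F : normedModType R) (v : F).
Definition scalev (a : R^o) : F := a *: v.
Lemma scalev_is_linear : linear scalev.
Proof. by move=> a x y; rewrite /scalev scalerDl scalerA. Qed.
HB.instance Definition _ := GRing.isLinear.Build R R^o F _ scalev scalev_is_linear.
End scalev.

Section Calculus.
Context {R : realType}.
Implicit Types E F G : normedModType R.

Lemma near_open E (U : set E) x (P : E -> Prop) :
  open U -> U x -> (forall y, U y -> P y) -> \forall y \near x, P y.
Proof.
move=> oU Ux UP; have : nbhs x U by exact: open_nbhs_nbhs.
by apply: filterS.
Qed.

Lemma near_at0 E x (P : E -> Prop) :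
  (\forall h \near (0:E), P (h + x)) <-> (\forall y \near x, P y).
Proof.
rewrite [X in _ <-> X](near_shift 0 x) subr0.
by split; apply: filterS.
Qed.

(** Uniqueness of the differential turns one estimate into both its existence and its value; inverse
    maps, integrals with a parameter and [flat] at 0 are all differentiated this way. *)
Lemma diff_eps E F (f : E -> F) x (L : {linear E -> F}) :
  continuous L ->
  (forall e, 0 < e -> \forall h \near (0 : E),
     `|f (h + x) - f x - L h| <= e * `|h|) ->
  differentiable f x /\ 'd f x = L :> (E -> F).
Proof.
move=> cL H.
have H2 : f \o shift x = cst (f x) + L +o_ 0 id.
  apply/eqaddoP => /= e e0; have := H e e0; apply: filterS => h /=.
  by rewrite /cst /= !fctE opprD addrA.
have e := diff_unique cL H2.
by split=> //; apply/diff_locallyP; rewrite e; split.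
Qed.

Lemma diff_epsE E F (f : E -> F) x e : differentiable f x -> 0 < e ->
  \forall h \near (0 : E), `|f (h + x) - f x - 'd f x h| <= e * `|h|.
Proof.
move=> /diff_locallyP[_ df] e0; have /eqaddoP/(_ e e0) := df.
by apply: filterS => h /=; rewrite /cst /= !fctE opprD addrA.
Qed.

Lemma eq_diff E F (f g : E -> F) x :
  (\near x, f x = g x) -> differentiable f x ->
  differentiable g x /\ 'd g x = 'd f x :> (E -> F).
Proof.
move=> fg df; apply: diff_eps; first exact: diff_continuous.
move=> e e0; have := diff_epsE df e0.
have := fg; rewrite -near_at0; apply: filterS2 => h <-.
by rewrite -(nbhs_singleton fg).
Qed.

Lemma Ck_sub E F k (U V : set E) (f : E -> F) :
  V `<=` U -> Ck k U f -> Ck k V f.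
Proof.
elim: k f => [|k IH] f VU /=; first by move=> H x /VU; exact: H.
by move=> [H1 H2]; split=> [x /VU|v]; [exact: H1|exact: IH].
Qed.

Lemma Ck_eq E F k (U : set E) (f g : E -> F) : open U ->
  (forall x, U x -> f x = g x) -> Ck k U f -> Ck k U g.
Proof.
move=> oU; elim: k f g => [|k IH] f g fg /=.
  move=> H x Ux; have fx : f y @[y --> x] --> f x := H _ Ux.
  rewrite /prop_for /continuous_at -(fg _ Ux); apply: cvg_trans fx.
  by apply: near_eq_cvg; exact: near_open oU Ux _.
move=> [H1 H2]; have fgn x : U x -> \near x, f x = g x.
  by move=> Ux; exact: near_open oU Ux _.
split=> [x Ux|v]; first by have [] := eq_diff (fgn x Ux) (H1 x Ux).
by apply: IH (H2 v) => x Ux; exact: near_eq_derive (fgn x Ux).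
Qed.

(** V may be any set containing x: [Ck] constrains the total function f at the points of the set
    only, its derivatives being taken in the whole space. *)
Lemma Ck_local E F k (U : set E) (f : E -> F) :
  (forall x, U x -> exists2 V, V x & Ck k V f) -> Ck k U f.
Proof.
elim: k f => [|k IH] f /= H.
  by move=> x /H[V Vx]; apply.
split=> [x /H[V Vx [+ _]]|v]; first by apply.
by apply: IH => x /H[V Vx [_ HV]]; exists V.
Qed.

Lemma CkS E F k (U : set E) (f : E -> F) : Ck k.+1 U f -> Ck k U f.
Proof.
elim: k f => [|k IH] f; first by move=> [H _] x Ux; exact: differentiable_continuous (H x Ux).
by move=> [H1 H2]; split=> // v; apply: IH.
Qed.

Lemma Ck_leq E F j k (U : set E) (f : E -> F) : (j <= k)%N -> Ck k U f -> Ck j U f.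
Proof.
elim: k => [|k IH]; first by rewrite leqn0 => /eqP->.
by rewrite leq_eqVlt => /predU1P[->//|]; rewrite ltnS => jk /CkS; exact: IH.
Qed.

Lemma Ck_cst E F k (U : set E) (a : F) : Ck k U (fun=> a).
Proof.
elim: k a => [|k IH] a; first by move=> x _; exact: cst_continuous.
split=> [x _|v]; first exact: differentiable_cst.
have -> : 'D_v (fun=> a : F) = (fun=> 0 : F) :> (E -> F).
  by apply/funext => x; exact: derive_cst.
exact: IH.
Qed.

Lemma Ck_add E F k (U : set E) (f g : E -> F) : open U ->
  Ck k U f -> Ck k U g -> Ck k U (fun x => f x + g x).
Proof.
move=> oU; elim: k f g => [|k IH] f g.
  by move=> Hf Hg x Ux; apply: continuousD; [exact: Hf|exact: Hg].
move=> [f1 f2] [g1 g2]; split=> [x Ux|v].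
  by apply: differentiableD; [exact: f1|exact: g1].
apply: Ck_eq (IH _ _ (f2 v) (g2 v)) => // x Ux; rewrite -deriveD //.
  exact/diff_derivable/f1.
exact/diff_derivable/g1.
Qed.

Lemma derive_post E F G (f : E -> F) (l : {linear F -> G}) x v :
  continuous l -> differentiable f x -> 'D_v (fun x => l (f x)) x = l ('D_v f x).
Proof.
move=> cl df; have dl y : differentiable l y by exact: linear_differentiable.
have e := diff_comp df (dl (f x)); have e2 := diff_lin (f x) cl.
rewrite !deriveE //; last exact: differentiable_comp.
by rewrite -[LHS]/('d (l \o f) x v) e /= e2.
Qed.

Lemma Ck_post E F G k (U : set E) (f : E -> F) (l : {linear F -> G}) :
  continuous l -> open U -> Ck k U f -> Ck k U (fun x => l (f x)).
Proof.
move=> cl oU; elim: k f => [|k IH] f.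
  by move=> Hf x Ux; apply: continuous_comp; [exact: Hf|exact: cl].
have dl y : differentiable l y by exact: linear_differentiable.
move=> [f1 f2]; split=> [x Ux|v].
  by apply: differentiable_comp => //; exact: f1.
apply: Ck_eq (IH _ (f2 v)) => // x Ux.
by rewrite derive_post //; exact: f1.
Qed.

Lemma Ck_scale E F k (U : set E) (a : R) (f : E -> F) : open U ->
  Ck k U f -> Ck k U (fun x => a *: f x).
Proof. by move=> oU; apply: (@Ck_post _ _ _ _ _ f ( *:%R a)) => // x; exact: scaler_continuous. Qed.

Lemma Ck_sum E F k (U : set E) (I : Type) (s : seq I) (P : pred I) (f : I -> E -> F) : open U ->
  (forall i, P i -> Ck k U (f i)) -> Ck k U (fun x => \sum_(i <- s | P i) f i x).
Proof.
move=> oU H; elim: s => [|i s IH].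
  by rewrite (_ : (fun x => _) = fun=> 0); [exact: Ck_cst|apply/funext=> x; rewrite big_nil].
case Pi : (P i); last first.
  by rewrite (_ : (fun x => _) = fun x => \sum_(i <- s | P i) f i x) //; apply/funext=> x; rewrite big_cons Pi.
rewrite (_ : (fun x => _) = fun x => f i x + \sum_(i <- s | P i) f i x); last by apply/funext=> x; rewrite big_cons Pi.
by apply: Ck_add => //; exact: H.
Qed.

Lemma Ck_mul E k (U : set E) (f g : E -> R^o) : open U ->
  Ck k U f -> Ck k U g -> Ck k U (fun x => f x * g x : R^o).
Proof.
move=> oU; elim: k f g => [|k IH] f g.
  by move=> Hf Hg x Ux; apply: continuousM; [exact: Hf|exact: Hg].
move=> Hf Hg; have [f1 f2] := Hf; have [g1 g2] := Hg; split=> [x Ux|v].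
  by apply: differentiableM; [exact: f1|exact: g1].
have H := Ck_add oU (IH _ _ (CkS Hf) (g2 v)) (IH _ _ (CkS Hg) (f2 v)).
apply: Ck_eq H => // x Ux; rewrite (deriveM (f := f) (g := g)) //.
  exact/diff_derivable/f1.
exact/diff_derivable/g1.
Qed.

Lemma Ck_prod E k (U : set E) (I : Type) (s : seq I) (P : pred I) (f : I -> E -> R^o) : open U ->
  (forall i, P i -> Ck k U (f i)) -> Ck k U (fun x => \prod_(i <- s | P i) f i x : R^o).
Proof.
move=> oU H; elim: s => [|i s IH].
  by rewrite (_ : (fun x => _) = fun=> 1); [exact: Ck_cst|apply/funext=> x; rewrite big_nil].
case Pi : (P i); last first.
  by rewrite (_ : (fun x => _) = fun x => \prod_(i <- s | P i) f i x) //; apply/funext=> x; rewrite big_cons Pi.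
rewrite (_ : (fun x => _) = fun x => f i x * \prod_(i <- s | P i) f i x : R^o); last by apply/funext=> x; rewrite big_cons Pi.
by apply: Ck_mul => //; exact: H.
Qed.

Lemma Ck_inv E k (U : set E) (f : E -> R^o) : open U ->
  (forall x, U x -> f x != 0) -> Ck k U f -> Ck k U (fun x => (f x)^-1 : R^o).
Proof.
move=> oU f0; elim: k => [|k IH].
  by move=> Hf x Ux; apply: continuousV; [exact: f0|exact: Hf].
move=> Hf; have [f1 f2] := Hf; split=> [x Ux|v].
  by apply: (@differentiableV _ _ f x); [exact: f1|exact: f0].
have Hi := IH (CkS Hf).
have H := Ck_scale (-1) oU (Ck_mul oU (Ck_mul oU Hi Hi) (f2 v)).
apply: Ck_eq H => // x Ux; rewrite (@deriveV _ _ f x v) ?f0 //; last exact/diff_derivable/f1.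
rewrite -!exprVn expr2 /GRing.scale /=; ring.
Qed.

Lemma Ck_lin E F k (U : set E) (l : {linear E -> F}) : continuous l -> Ck k U l.
Proof.
move=> cl; case: k => [|k]; first by move=> x _; exact: cl.
split=> [x _|v]; first exact: linear_differentiable.
have -> : 'D_v l = (fun=> l v) :> (E -> F).
  by apply/funext => x; rewrite deriveE ?diff_lin //; exact: linear_differentiable.
exact: Ck_cst.
Qed.

Definition cCk E F {fF : fbasis F} k (U : set E) (f : E -> F) :=
  forall i : bI, Ck k U (fun x => bl i (f x)).

Lemma cCkP E F {fF : fbasis F} k (U : set E) (f : E -> F) : open U ->
  cCk k U f <-> Ck k U f.
Proof.
move=> oU; split=> [H|H i]; last by apply: Ck_post => //; exact: bl_cont.
rewrite (_ : f = fun x => \sum_i bl i (f x) *: be i); last by apply/funext=> x; exact: bE.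
apply: Ck_sum => // i _.
apply: (@Ck_post _ _ _ _ _ _ (scalev (be i))) => //.
exact: scalel_continuous.
Qed.

Lemma derive_comp E F G {fF : fbasis F} (f : E -> F) (g : F -> G) x v :
  differentiable f x -> differentiable g (f x) ->
  'D_v (fun x => g (f x)) x = \sum_i bl i ('D_v f x) *: 'D_(be i) g (f x).
Proof.
move=> df dg; have e := diff_comp df dg.
rewrite deriveE; last exact: differentiable_comp.
rewrite -[LHS]/('d (g \o f) x v) e /= -(deriveE _ df).
rewrite [in LHS](bE ('D_v f x)) linear_sum; apply: eq_bigr => i _.
by rewrite linearZ (deriveE (be i) dg).
Qed.

(** The induction closes because the chain rule gives a finite sum of products of a coordinate of
    ['D_v f] with a partial derivative of g composed with the same f. *)
Lemma Ck_comp_scalar E F {fF : fbasis F} k (U : set E) (V : set F) (f : E -> F) (g : F -> R^o) :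
  open U -> (forall x, U x -> V (f x)) -> Ck k U f -> Ck k V g -> Ck k U (fun x => g (f x)).
Proof.
move=> oU UV; elim: k g => [|k IH] g.
  by move=> Hf Hg x Ux; apply: continuous_comp; [exact: Hf|exact/Hg/UV].
move=> Hf Hg; have [f1 f2] := Hf; have [g1 g2] := Hg; split=> [x Ux|v].
  by apply: differentiable_comp; [exact: f1|exact/g1/UV].
have H : Ck k U (fun x => \sum_i bl i ('D_v f x) * 'D_(be i) g (f x) : R^o).
  apply: Ck_sum => // i _.
  apply: Ck_mul => //; first by apply: Ck_post (f2 v) => //; exact: bl_cont.
  by apply: IH (CkS Hf) (g2 _).
by apply: Ck_eq H => // x Ux; rewrite derive_comp //; [exact: f1|exact/g1/UV].
Qed.

Lemma Ck_comp E F G {fF : fbasis F} {fG : fbasis G} k (U : set E) (V : set F) (f : E -> F) (g : F -> G) :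
  open U -> open V -> (forall x, U x -> V (f x)) -> Ck k U f -> Ck k V g -> Ck k U (fun x => g (f x)).
Proof.
move=> oU oV UV Hf Hg; apply/cCkP => // i.
apply: (@Ck_comp_scalar _ _ _ _ _ V f (fun y => bl i (g y))) => //.
by apply: Ck_post => //; exact: bl_cont.
Qed.

End Calculus.

#[export] Instance fbasis_R (R : realType) : fbasis (R^o : normedModType R).
Proof.
refine (@FBasis R R^o 'I_1 (fun=> 1) (fun=> idfun) _ _).
  by move=> i x; exact: cvg_id.
by move=> x; rewrite big_ord1 /= /GRing.scale /= mulr1.
Defined.

Section row_coord.
Context {R : realType} (n : nat) (i : 'I_n).
Definition row_coord (x : 'rV[R]_n) : R^o := x ord0 i.
Lemma row_coord_is_linear : linear row_coord.
Proof. by move=> a x y; rewrite /row_coord !mxE. Qed.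
HB.instance Definition _ := GRing.isLinear.Build R 'rV[R]_n R^o _ row_coord row_coord_is_linear.
End row_coord.

#[export] Instance fbasis_rV (R : realType) n : fbasis ('rV[R]_n : normedModType R).
Proof.
refine (@FBasis R 'rV[R]_n 'I_n (fun i => 'e_i) (fun i => row_coord i : {linear _ -> _}) _ _).
  by move=> i x; exact: coord_continuous.
by move=> x; rewrite [LHS]row_sum_delta.
Defined.

Section prod_coord.
Context {R : realType} (E F : normedModType R).
Section c1.
Variable l : {linear E -> R^o}.
Definition fst_coord (x : E * F) : R^o := l x.1.
Lemma fst_coord_is_linear : linear fst_coord.
Proof. by move=> a x y; rewrite /fst_coord linearP. Qed.
HB.instance Definition _ := GRing.isLinear.Build R (E * F)%type R^o _ fst_coord fst_coord_is_linear.
End c1.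
Section c2.
Variable l : {linear F -> R^o}.
Definition snd_coord (x : E * F) : R^o := l x.2.
Lemma snd_coord_is_linear : linear snd_coord.
Proof. by move=> a x y; rewrite /snd_coord linearP. Qed.
HB.instance Definition _ := GRing.isLinear.Build R (E * F)%type R^o _ snd_coord snd_coord_is_linear.
End c2.
End prod_coord.

#[export] Instance fbasis_prod (R : realType) (E F : normedModType R)
  (fE : fbasis E) (fF : fbasis F) : fbasis ((E * F)%type : normedModType R).
Proof.
refine (@FBasis R (E * F)%type (@bI _ _ fE + @bI _ _ fF)%type
  (fun i => match i with inl i => (be i, 0) | inr j => (0, be j) end)
  (fun i => match i with inl i => @fst_coord _ E F (bl i) | inr j => @snd_coord _ E F (bl j) end : {linear _ -> _}) _ _).
  move=> [i|i] x /=.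
    apply: (@continuous_comp _ _ _ fst (bl i : E -> R^o)); [exact: cvg_fst|exact: bl_cont].
  apply: (@continuous_comp _ _ _ snd (bl i : F -> R^o)); [exact: cvg_snd|exact: bl_cont].
move=> z; rewrite big_sumType /= /fst_coord /snd_coord.
have e1 (I : finType) (f : I -> E * F) : (\sum_i f i).1 = \sum_i (f i).1.
  exact: (big_morph fst (fun _ _ => erefl) erefl).
have e2 (I : finType) (f : I -> E * F) : (\sum_i f i).2 = \sum_i (f i).2.
  exact: (big_morph snd (fun _ _ => erefl) erefl).
apply: injective_projections; rewrite /= ?e1 ?e2 /=.
  rewrite [in LHS](bE z.1) [X in _ = _ + X]big1 ?addr0 // => i _.
  by rewrite scaler0.
rewrite [in LHS](bE z.2) [X in _ = X + _]big1 ?add0r // => i _.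
by rewrite scaler0.
Defined.

(** * Inverse function theorem *)

Section Inverse.
Context {R : realType}.
Implicit Types E F G : normedModType R.

Lemma Ck_mxentry_det E k (U : set E) n (A : E -> 'M[R]_n) : open U ->
  (forall i j, Ck k U (fun x => A x i j : R^o)) -> Ck k U (fun x => \det (A x) : R^o).
Proof.
move=> oU H; rewrite /determinant; apply: Ck_sum => // s _.
apply: Ck_mul => //; first exact: Ck_cst.
exact: Ck_prod.
Qed.

Lemma Ck_invmx E k (U : set E) n (A : E -> 'M[R]_n) : open U ->
  (forall i j, Ck k U (fun x => A x i j : R^o)) ->
  (forall x, U x -> A x \in unitmx) ->
  forall i j, Ck k U (fun x => invmx (A x) i j : R^o).
Proof.
move=> oU H Au i j.
have H1 : Ck k U (fun x => (\det (A x))^-1 * (\adj (A x)) i j : R^o).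
  apply: Ck_mul => //.
    apply: Ck_inv => //; last exact: Ck_mxentry_det.
    by move=> x Ux; rewrite -unitfE -unitmxE; exact: Au.
  rewrite (_ : (fun x => _) = fun x => (-1) ^+ (j + i) * \det (row' j (col' i (A x))) : R^o); last first.
    by apply/funext => x; rewrite mxE.
  apply: Ck_mul => //; first exact: Ck_cst.
  apply: Ck_mxentry_det => // a b.
  by rewrite (_ : (fun x => _) = fun x => A x (lift j a) (lift i b)) //; apply/funext => x; rewrite !mxE.
apply: Ck_eq H1 => // x Ux.
by rewrite /invmx Au // [RHS]mxE.
Qed.

Lemma rv_coord_le n (x : 'rV[R]_n) i : `|x 0 i| <= `|x|.
Proof.
rewrite [leRHS]/Num.norm /= mx_normrE.
by apply: (le_trans _ (le_bigmax _ _ (0, i))).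
Qed.

Lemma rv_norm_le n (x : 'rV[R]_n) e : 0 <= e -> (forall i, `|x 0 i| <= e) -> `|x| <= e.
Proof.
move=> e0 H; rewrite [leLHS]/Num.norm /= mx_normrE.
by apply/bigmax_leP; split=> // -[a b] _ /=; rewrite ord1.
Qed.

Lemma line_is_derive E (f : E -> R^o) x h (t : R) :
  differentiable f (x + t *: h) ->
  is_derive t 1 (fun s => f (x + s *: h) : R^o) ('D_h f (x + t *: h)).
Proof.
move=> df.
have dl : is_diff t (fun s : R => x + s *: h) (fun s => s *: h).
  have := is_diffD (is_diff_cst x t) (is_diff_scalel t h).
  by rewrite add0r.
have dg : differentiable (fun s : R => x + s *: h) t by [].
have dc : differentiable (f \o (fun s => x + s *: h)) t by exact: differentiable_comp.
apply: DeriveDef; first exact: diff_derivable.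
have e := diff_comp dg df.
by rewrite deriveE // -[LHS]/('d (f \o (fun s => x + s *: h)) t 1) e /= diff_val /= scale1r deriveE.
Qed.

Lemma MVT_line E (f : E -> R^o) x h :
  (forall t, 0 <= t <= 1 -> differentiable f (x + t *: h)) ->
  exists2 t, 0 <= t <= 1 & f (x + h) - f x = 'D_h f (x + t *: h).
Proof.
move=> df.
have [| |t t01] := @MVT_segment R (fun s => f (x + s *: h)) (fun t => 'D_h f (x + t *: h)) 0 1 ler01.
- move=> t; rewrite in_itv /= => /andP[t0 t1].
  by apply: line_is_derive; apply: df; rewrite !ltW.
- apply: derivable_within_continuous => t; rewrite in_itv /= => t01.
  by have [] := line_is_derive (df _ t01).
by rewrite scale1r scale0r addr0 subr0 mulr1 => ->; exists t.
Qed.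

(** Transpose of the usual Jacobian: vectors are rows and act on the left, as in [derive_Jmx]. *)
Definition Jmx n (f : 'rV[R]_n -> 'rV[R]_n) x : 'M[R]_n :=
  \matrix_(j, i) ('D_('e_j) f x) 0 i.

Lemma derive_sumE E F {fE : fbasis E} (f : E -> F) x v : differentiable f x ->
  'D_v f x = \sum_i bl i v *: 'D_(be i) f x.
Proof.
move=> df; rewrite deriveE // [in LHS](bE v) linear_sum; apply: eq_bigr => i _.
by rewrite linearZ (deriveE _ df).
Qed.

Lemma derive_Jmx n (f : 'rV[R]_n -> 'rV[R]_n) x v : differentiable f x ->
  'D_v f x = v *m Jmx f x.
Proof.
move=> df; rewrite (derive_sumE v df) /=.
apply/rowP => i; rewrite !mxE summxE; apply: eq_bigr => j _.
by rewrite !mxE.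
Qed.

Record diffeo n (V W : set 'rV[R]_n) (f g : 'rV[R]_n -> 'rV[R]_n) : Prop := {
  df_openl : open V;
  df_openr : open W;
  df_map : forall x, V x -> W (f x);
  df_inv : forall y, W y -> V (g y);
  df_K : forall x, V x -> g (f x) = x;
  df_Kr : forall y, W y -> f (g y) = y;
  df_sm : smooth_on V f;
  df_sminv : smooth_on W g }.

Lemma diffeo_sym n (V W : set 'rV[R]_n) f g : diffeo V W f g -> diffeo W V g f.
Proof. by case. Qed.

Lemma Ck_continuous E F k (U : set E) (f : E -> F) x : Ck k U f -> U x -> {for x, continuous f}.
Proof.
by case: k => [|k] => [H Ux|[H _] Ux]; [exact: H|exact/differentiable_continuous/H].
Qed.

Lemma Ck_open_preimage E F k (U : set E) (V : set F) (f : E -> F) :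
  open U -> open V -> Ck k U f -> open (U `&` f @^-1` V).
Proof.
move=> oU oV Hf; rewrite openE => x [Ux Vx]; apply: filterI.
  exact: open_nbhs_nbhs.
exact: (Ck_continuous Hf Ux) (open_nbhs_nbhs (conj oV Vx)).
Qed.

Lemma diffeo_sub n (V W V' : set 'rV[R]_n) f g : diffeo V W f g ->
  open V' -> V' `<=` V -> diffeo V' (W `&` g @^-1` V') f g.
Proof.
move=> [oV oW fm gm K Kr sf sg] oV' VV'; split=> //.
- exact: Ck_open_preimage (sg 0%N).
- by move=> x V'x; split; [apply/fm/VV'|rewrite /= K //; exact: VV'].
- by move=> y [].
- by move=> x /VV'; exact: K.
- by move=> y [/Kr].
- by move=> k; exact: Ck_sub (sf k).
- by move=> k; apply: Ck_sub (sg k) => y [].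
Qed.

Lemma compact_cball n (x0 : 'rV[R]_n) r : 0 < r -> compact [set x | `|x - x0| <= r].
Proof.
move=> r0; apply: bounded_closed_compact.
  exists (`|x0| + r); split; first by rewrite num_real.
  move=> M' MM x /= Kx; rewrite -[x](subrK x0) (le_trans (ler_normD _ _)) //.
  lra.
rewrite (_ : [set _ | _] = closed_ball x0 r); first exact: closed_ball_closed.
by rewrite closed_ballE //; apply/seteqP; split=> x; rewrite /closed_ball_ /= distrC.
Qed.

Lemma lin_continuous E F {fE : fbasis E} (l : {linear E -> F}) : continuous l.
Proof.
have -> : l = (fun x => \sum_i bl i x *: l (be i)) :> (E -> F).
  by apply/funext => x; rewrite [in LHS](bE x) linear_sum; apply: eq_bigr => i _; rewrite linearZ.
move=> x; apply: (@Ck_continuous _ _ 0 setT) => //.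
apply: Ck_sum => [|i _]; first exact: openT.
move=> y _; apply: (@continuous_comp _ _ _ (bl i) (scalev (l (be i)))); first exact: bl_cont.
exact: scalel_continuous.
Qed.

(** With J the Jacobian of f at g y and k the increment of g, k - h J^-1 = - (h - k J) J^-1, and h -
    k J is the first-order remainder of f at g y. It is o(k), hence o(h) by the Lipschitz bound. *)
Lemma derive_inverse n (W : set 'rV[R]_n) (f g : 'rV[R]_n -> 'rV[R]_n) :
  open W -> (forall y, W y -> f (g y) = y) ->
  (forall y, W y -> differentiable f (g y)) ->
  (forall y, W y -> Jmx f (g y) \in unitmx) ->
  (forall y y', W y -> W y' -> `|g y' - g y| <= 2 * `|y' - y|) ->
  forall y, W y -> differentiable g y /\
    forall v, 'D_v g y = v *m invmx (Jmx f (g y)).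
Proof.
move=> oW K df Ju lip y Wy.
pose J := Jmx f (g y).
pose L : {linear 'rV[R]_n -> 'rV[R]_n} := mulmxr (invmx J).
have cL : continuous L by exact: lin_continuous.
suff [d1 d2] : differentiable g y /\ 'd g y = L :> (_ -> _).
  by split=> // v; rewrite deriveE // d2.
apply: diff_eps => // e e0.
have [C C0 LC] := linear_lipschitz cL.
(* C bounds the linear map L and 2 is the Lipschitz constant of g, so the remainder of f is wanted
   with precision e / (2 C). *)
have [e' e'0 eE] : exists2 e', 0 < e' & e = C * (2 * e').
  by exists (e / (2 * C)); [rewrite divr_gt0 ?mulr_gt0|field; lra].
have /nbhs_ballP[d /= d0 Hd] := diff_epsE (df y Wy) e'0.
have H1 : \forall h \near (0 : 'rV[R]_n), `|h| < d / 2.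
  by apply: nbhs0_lt; rewrite divr_gt0.
have H2 : \forall h \near (0 : 'rV[R]_n), W (h + y).
  by rewrite near_at0; exact: near_open oW Wy _.
near=> h.
have Wh : W (h + y) by near: h.
have hd : `|h| < d / 2 by near: h.
pose k := g (h + y) - g y.
have kh : `|k| <= 2 * `|h| by have := lip _ _ Wy Wh; rewrite addrK.
have := Hd k; rewrite -ball_normE /= sub0r normrN => /(_ ltac:(lra)).
rewrite /k subrK !K // addrK -/k -deriveE; last exact: df.
rewrite derive_Jmx; last exact: df.
rewrite -/J => l.
have -> : k - L h = - L (h - k *m J).
  by rewrite linearB /= -mulmxA mulmxV ?Ju // mulmx1 opprB.
rewrite normrN; apply: (le_trans (LC _)).
rewrite eE.
rewrite -mulrA; apply: ler_wpM2l; first exact: ltW.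
apply: (le_trans l); rewrite [2 * e']mulrC -mulrA.
by apply: ler_wpM2l kh; exact: ltW.
Unshelve. all: by end_near. Qed.

(** Bootstrap: the differential of g is the inverse of the Jacobian of f taken at g, rational in its
    entries by Cramer's rule, so g of class C^k makes each ['D_v g] of class C^k. *)
Lemma smooth_inverse n (V W : set 'rV[R]_n) (f g : 'rV[R]_n -> 'rV[R]_n) :
  open V -> open W -> smooth_on V f -> (forall y, W y -> V (g y)) ->
  (forall y, W y -> f (g y) = y) ->
  (forall y, W y -> Jmx f (g y) \in unitmx) ->
  (forall y y', W y -> W y' -> `|g y' - g y| <= 2 * `|y' - y|) ->
  smooth_on W g.
Proof.
move=> oV oW sf gV K Ju lip.
have dg := derive_inverse oW K (fun y Wy => (sf 1%N).1 _ (gV _ Wy)) Ju lip.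
elim=> [|k IH].
  by move=> y /dg[/differentiable_continuous].
split=> [y /dg[]//|v].
suff H : Ck k W (fun y => v *m invmx (Jmx f (g y))).
  by apply: Ck_eq H => // y /dg[_ ->].
apply/(@cCkP _ _ _ (fbasis_rV R n)) => // i /=.
rewrite (_ : (fun y => _) = fun y => \sum_j v 0 j * invmx (Jmx f (g y)) j i : R^o); last first.
  by apply/funext => y; rewrite /row_coord mxE.
apply: Ck_sum => // j _; apply: Ck_mul => //; first exact: Ck_cst.
apply: Ck_invmx => // a b.
rewrite (_ : (fun y => _) = fun y => row_coord b ('D_('e_a) f (g y))); last first.
  by apply/funext => y; rewrite mxE.
apply: (@Ck_comp_scalar _ _ _ _ _ _ V g (fun x => row_coord b ('D_('e_a) f x))) => //.
by apply: Ck_post => //; [exact: coord_continuous|have [_] := sf k.+1; exact].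
Qed.

Section IFT1.
Variables (n : nat) (U : set 'rV[R]_n) (f : 'rV[R]_n -> 'rV[R]_n) (x0 : 'rV[R]_n).
Hypotheses (oU : open U) (Ux0 : U x0) (sf : smooth_on U f) (J1 : Jmx f x0 = 1%:M).

Let df x : U x -> differentiable f x. Proof. by have [+ _] := sf 1; apply. Qed.

Lemma ift_near : \forall x \near x0, U x /\ forall v, `|'D_v f x - v| <= 2^-1 * `|v|.
Proof.
(* The n errors on the basis vectors add up to at most n / (2 (n + 1)) <= 1/2 of the norm of v;
   [n.+1] keeps the constant positive when n = 0. *)
have e0 : 0 < (2 * n.+1%:R)^-1 :> R by rewrite invr_gt0 mulr_gt0.
have H j : \forall x \near x0, `|'D_('e_j) f x - 'e_j| <= (2 * n.+1%:R)^-1.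
  have c : {for x0, continuous ('D_('e_j) f)} by have [_ +] := sf 1; move=> /(_ 'e_j _ Ux0).
  have e : 'D_('e_j) f x0 = 'e_j by rewrite derive_Jmx ?J1 ?mulmx1 //; exact: df.
  move/cvgrPdist_le : c => /(_ _ e0); apply: filterS => x; rewrite e.
  by rewrite distrC.
have HU : \forall x \near x0, U x by apply: near_open oU Ux0 _.
have HA : \forall x \near x0, forall j, `|'D_('e_j) f x - 'e_j| <= (2 * n.+1%:R)^-1.
  exact: (@filter_forall _ _ _ (nbhs x0) _ H).
near=> x.
have Ux : U x by near: x.
have Hx : forall j, `|'D_('e_j) f x - 'e_j| <= (2 * n.+1%:R)^-1 by near: x.
split=> // v; rewrite (derive_sumE v (df Ux)) [X in _ - X](bE v) -sumrB /=.
apply: (le_trans (ler_norm_sum _ _ _)).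
apply: (@le_trans _ _ (\sum_(i < n) `|v| * (2 * n.+1%:R)^-1)).
  apply: ler_sum => i _; rewrite -scalerBr normrZ.
  by apply: ler_pM (Hx i) => //; exact: rv_coord_le.
rewrite sumr_const card_ord -[_ *+ n]mulr_natr -mulrA [leRHS]mulrC; apply: ler_wpM2l => //.
rewrite invfM -mulrA -[leRHS]mulr1; apply: ler_wpM2l; first by rewrite invr_ge0.
by rewrite mulrC ler_pdivrMr ?mul1r ?ler_nat.
Unshelve. all: by end_near. Qed.

Lemma ift_ball : exists2 r, 0 < r & forall x, `|x - x0| <= r ->
  U x /\ forall v, `|'D_v f x - v| <= 2^-1 * `|v|.
Proof.
have /nbhs_ballP[e /= e0 He] := ift_near.
exists (e / 2); first by rewrite divr_gt0.
move=> x xr; apply: He; rewrite -ball_normE /= distrC (le_lt_trans xr) //.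
by rewrite ltr_pdivrMr // ltr_pMr // ltr1n.
Qed.

Lemma ball_segment (E : normedModType R) (x y z : E) r t : 0 <= t <= 1 ->
  `|x - z| <= r -> `|y - z| <= r -> `|x + t *: (y - x) - z| <= r.
Proof.
move=> /andP[t0 t1] xr yr.
rewrite (_ : _ - z = (1 - t) *: (x - z) + t *: (y - z)); last first.
  symmetry; rewrite scalerBl scale1r addrAC -addrA -scalerBr opprB subrKA.
  by rewrite addrAC.
rewrite (le_trans (ler_normD _ _)) // !normrZ !ger0_norm ?subr_ge0 //.
rewrite (_ : r = (1 - t) * r + t * r); last by rewrite -mulrDl subrK mul1r.
by apply: lerD; rewrite ler_wpM2l // subr_ge0.
Qed.

(** The mean value theorem is applied to each coordinate of f - id separately; as the norm is the
    maximum of the coordinates, the constant 1/2 survives. *)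
Lemma ift_lip r : (forall x, `|x - x0| <= r ->
  U x /\ forall v, `|'D_v f x - v| <= 2^-1 * `|v|) ->
  forall x y, `|x - x0| <= r -> `|y - x0| <= r ->
  `|f y - f x - (y - x)| <= 2^-1 * `|y - x|.
Proof.
move=> H x y xr yr; apply: rv_norm_le => [|i]; first by rewrite mulr_ge0.
pose F z : R^o := (f z - z) 0 i.
have dF z : U z -> differentiable F z.
  move=> Uz; apply: (@differentiable_comp _ _ _ _ (fun z => f z - z) (row_coord i)).
    by apply: differentiableB => //; exact: df.
  exact: differentiable_coord.
have [t t01|t t01] := @MVT_line _ F x (y - x).
  by apply: dF; have [] := H _ (ball_segment t01 xr yr).
have [Ut Ht] := H _ (ball_segment t01 xr yr).
rewrite [x + (y - x)]addrC subrK => e.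
have -> : (f y - f x - (y - x)) 0 i = F y - F x by rewrite /F !mxE; ring.
rewrite e.
have -> : 'D_(y - x) F (x + t *: (y - x)) = ('D_(y - x) f (x + t *: (y - x)) - (y - x)) 0 i.
  have dff := df Ut.
  have d1 : differentiable (f \- id) (x + t *: (y - x)) by apply: differentiableB.
  have d2 : differentiable (row_coord i) ((f \- id) (x + t *: (y - x))) by exact: differentiable_coord.
  rewrite -[F]/(fun z => row_coord i ((f \- id) z)) derive_post //; last exact: coord_continuous.
  rewrite (@deriveB _ _ _ f id) ?derive_id //; exact: diff_derivable.
exact: (le_trans (rv_coord_le _ _)).
Qed.

(** Surjectivity comes from a minimum rather than from an iteration. If x minimizes |f x - y| on the
    compact ball, the Newton step x - f x + y stays in the ball and has a residue at most half as
    large, so the residue is 0. *)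
Lemma ift_id : exists V W g, [/\ diffeo V W f g, V x0 & V `<=` U].
Proof.
have [r r0 H] := ift_ball; have lip := ift_lip H.
have x0r : `|x0 - x0| <= r by rewrite subrr normr0 ltW.
have lip2 x y : `|x - x0| <= r -> `|y - x0| <= r -> `|y - x| <= 2 * `|f y - f x|.
  move=> xr yr; have := lip _ _ xr yr; rewrite distrC => l1.
  have := lerB_dist (y - x) (f y - f x) => l2; lra.
have surj y : `|y - f x0| < r / 2 -> exists2 x, `|x - x0| < r & f x = y.
  move=> yr; pose K := [set x | `|x - x0| <= r].
  have K0 : K !=set0 by exists x0.
  have cK : compact K.
    exact: compact_cball.
  have cf : {within K, continuous (fun x => `|f x - y|)}.
    apply: continuous_in_subspaceT => x; rewrite inE => /H[Ux _].
    apply: (@continuous_comp _ _ _ (fun x => f x - y) (fun z => `|z|)); last exact: norm_continuous.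
    apply: continuousB; last exact: cst_continuous.
    exact/differentiable_continuous/df.
  have [x /[!inE] Kx min] := EVT_min_rV K0 cK cf.
  have e : f x = y.
    (* Its distance to x0 is at most r / 2, from [ift_lip], plus |y - f x0|: hence the radius r / 2
       for the ball of targets y. *)
    pose x1 := x - f x + y.
    have Kx1 : K x1.
      have := lip _ _ Kx x0r => l.
      have : `|x1 - x0| <= `|f x0 - f x - (x0 - x)| + `|y - f x0|.
        apply: le_trans (ler_normD _ _); rewrite le_eqVlt; apply/orP; left; apply/eqP; congr (`|_|).
        by apply/rowP => i; rewrite !mxE; ring.
      have Kx' : `|x - x0| <= r := Kx.
      by move: l; rewrite [`|x0 - x|]distrC /K /=; lra.
    have := min x1; rewrite inE => /(_ Kx1).
    have := lip _ _ Kx Kx1.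
    have -> : f x1 - f x - (x1 - x) = f x1 - y.
      by apply/rowP => i; rewrite !mxE; ring.
    have -> : x1 - x = - (f x - y).
      by apply/rowP => i; rewrite !mxE; ring.
    rewrite normrN => l1 l2.
    by apply/eqP; rewrite -subr_eq0 -normr_le0; lra.
  exists x => //; have := lip2 _ _ x0r Kx; rewrite e; lra.
pose g y := get [set x | `|x - x0| < r /\ f x = y].
have gP y : `|y - f x0| < r / 2 -> `|g y - x0| < r /\ f (g y) = y.
  by move=> /surj[x xr fx]; apply: (@getPex _ [set x | `|x - x0| < r /\ f x = y]); exists x.
pose B := ball x0 r; pose B2 := ball (f x0) (r / 2).
have r2 : 0 < r / 2 by rewrite divr_gt0.
have BU x : B x -> U x.
  by rewrite /B -ball_normE /= distrC => /ltW/H[].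
have oV : open (B `&` f @^-1` B2).
  apply: (@Ck_open_preimage _ _ 0); [exact: ball_open|exact: ball_open|].
  exact: Ck_sub (sf 0%N).
have BE x : B x = (`|x - x0| < r) :> Prop by rewrite /B -ball_normE /= distrC.
have B2E y : B2 y = (`|y - f x0| < r / 2) :> Prop by rewrite /B2 -ball_normE /= distrC.
have gK x : (B `&` f @^-1` B2) x -> g (f x) = x.
  move=> []; rewrite BE /= B2E => xr /gP[gr fg].
  by apply/eqP; rewrite -subr_eq0 -normr_le0 (le_trans (lip2 _ _ (ltW xr) (ltW gr))) // fg subrr normr0 mulr0.
exists (B `&` f @^-1` B2), B2, g; split.
- split=> //.
  + exact: ball_open.
  + by move=> x [].
  + by move=> y B2y; have [] := gP y; rewrite -?B2E // -BE => ? e; split=> //; rewrite /= e.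
  + by move=> y; rewrite B2E => /gP[].
  + by move=> k; apply: Ck_sub (sf k) => x [/BU].
  + apply: (@smooth_inverse _ (ball x0 r) _ f g) => //.
    * exact: ball_open.
    * exact: ball_open.
    * by move=> k; exact: Ck_sub (sf k).
    * by move=> y; rewrite B2E -/B BE => /gP[].
    * by move=> y; rewrite B2E => /gP[].
    (* A row v killed by the Jacobian has ['D_v f] = 0, so |v| <= |v| / 2 and v = 0. *)
    * move=> y; rewrite B2E => /gP[/ltW /H[Ug Hg] _].
      rewrite -row_free_unit -kermx_eq0; apply/rowV0P => v /sub_kermxP e.
      have := Hg v; rewrite derive_Jmx ?e ?sub0r ?normrN; last exact: df.
      by move=> l; apply/eqP; rewrite -normr_le0; have := normr_ge0 v; lra.
    * move=> y y'; rewrite !B2E => /gP[g1 e1] /gP[g2 e2].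
      by have := lip2 _ _ (ltW g1) (ltW g2); rewrite e1 e2.
- by split; [exact: ballxx|rewrite /= /B2; exact: ballxx].
- by move=> x [/BU].
Qed.

End IFT1.

Lemma Ck_lincomp E F G {fE : fbasis E} k (U : set F) (l : {linear E -> F}) (f : F -> G) :
  open U -> Ck k U f -> Ck k (l @^-1` U) (fun x => f (l x)).
Proof.
move=> oU; have cl : continuous l by exact: lin_continuous.
elim: k f => [|k IH] f.
  by move=> Hf x Ux; apply: continuous_comp; [exact: cl|exact: Hf].
have dl y : differentiable l y by exact: linear_differentiable.
move=> [f1 f2]; split=> [x Ux|v].
  by apply: differentiable_comp => //; exact: f1.
have oU' : open (l @^-1` U) by apply: open_comp => // x _; exact: cl.
apply: Ck_eq (IH _ (f2 (l v))) => // x Ux.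
have e := diff_comp (dl x) (f1 _ Ux); have e2 := diff_lin x cl.
rewrite !deriveE; [|by apply: differentiable_comp => //; exact: f1|exact: f1].
by rewrite -[RHS]/('d (f \o l) x v) e /= e2.
Qed.

(** Composing f with the inverse of its Jacobian at x0 reduces to the case where that Jacobian is
    the identity. *)
Theorem inverse_function n (U : set 'rV[R]_n) (f : 'rV[R]_n -> 'rV[R]_n) x0 :
  open U -> U x0 -> smooth_on U f -> Jmx f x0 \in unitmx ->
  exists V W g, [/\ diffeo V W f g, V x0 & V `<=` U].
Proof.
move=> oU Ux0 sf Ju.
pose l : {linear 'rV[R]_n -> 'rV[R]_n} := mulmxr (invmx (Jmx f x0)).
pose l' : {linear 'rV[R]_n -> 'rV[R]_n} := mulmxr (Jmx f x0).
have cl : continuous l by exact: lin_continuous.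
have lK y : l' (l y) = y by rewrite /l /l' /= -mulmxA mulVmx // mulmx1.
have lK' y : l (l' y) = y by rewrite /l /l' /= -mulmxA mulmxV // mulmx1.
have df x : U x -> differentiable f x by exact: (sf 1%N).1.
have J1 : Jmx (fun x => l (f x)) x0 = 1%:M.
  apply/row_matrixP => i; rewrite !rowE mulmx1 -derive_Jmx; last first.
    by apply: differentiable_comp; [exact: df|exact: linear_differentiable].
  by rewrite derive_post //; [rewrite derive_Jmx; [rewrite /l /= -mulmxA mulmxV // mulmx1|exact: df]|exact: df].
have sl : smooth_on U (fun x => l (f x)) by move=> k; exact: Ck_post (sf k).
have [V [W [g [[oV oW fm gm K Kr sf' sg] Vx0 VU]]]] := ift_id oU Ux0 sl J1.
exists V, (l @^-1` W), (fun y => g (l y)); split=> //; split=> //.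
- by apply: open_comp => // x _; exact: cl.
- by move=> y /gm.
- by move=> y /Kr /(congr1 l'); rewrite !lK.
- by move=> k; exact: Ck_sub (sf k).
- by move=> k; exact: Ck_lincomp.
Qed.

End Inverse.

(** * Hadamard's lemma *)

Section Integral01.
Context {R : realType}.
Let mu := @lebesgue_measure R.

Definition int01 (f : R -> R) : R := \int[mu]_(t in `[0, 1]%classic) f t.

Definition cont01 (f : R -> R) := forall t : R, 0 <= t <= 1 -> {for t, continuous f}.

Lemma cont01_int f : cont01 f -> mu.-integrable `[0, 1]%classic (EFin \o f).
Proof.
move=> cf; apply: continuous_compact_integrable; first exact: segment_compact.
apply: continuous_in_subspaceT => t; rewrite inE /= in_itv /=; exact: cf.
Qed.

Lemma int01D f g : cont01 f -> cont01 g -> int01 (fun t => f t + g t) = int01 f + int01 g.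
Proof. by move=> cf cg; apply: RintegralD => //; exact: cont01_int. Qed.

Lemma int01Z a f : cont01 f -> int01 (fun t => a * f t) = a * int01 f.
Proof. by move=> cf; apply: RintegralZl => //; exact: cont01_int. Qed.

Lemma int01_cst a : int01 (fun=> a) = a.
Proof.
have e : lebesgue_measure `[(0:R), 1%R]%classic = 1%:E :> \bar R.
  by rewrite lebesgue_measure_itv /= lte01 sube0.
by rewrite /int01 Rintegral_cst // -[X in fine X]/(lebesgue_measure `[(0:R), 1%R]%classic) e /= mulr1.
Qed.

Lemma int01_eq f g : (forall t, 0 <= t <= 1 -> f t = g t) -> int01 f = int01 g.
Proof.
by move=> fg; apply: eq_Rintegral => t; rewrite inE /= in_itv /=; exact: fg.
Qed.

Lemma int01_bound f K : cont01 f -> (forall t, 0 <= t <= 1 -> `|f t| <= K) -> `|int01 f| <= K.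
Proof.
move=> cf fK; apply: (le_trans (le_normr_Rintegral _ (cont01_int cf))) => //.
rewrite -[leRHS]int01_cst; apply: le_Rintegral => //.
- by apply: cont01_int => t t01; apply: continuous_comp; [exact: cf|exact: norm_continuous].
- by apply: cont01_int => t t01; exact: cst_continuous.
Qed.

Lemma int01_FTC (F f : R -> R) : cont01 f ->
  (forall t : R, 0 <= t <= 1 -> is_derive t 1 F (f t)) -> int01 f = F 1 - F 0.
Proof.
move=> cf dF.
have cF t : 0 <= t <= 1 -> {for t, continuous F}.
  by move=> /dF[d _]; apply: differentiable_continuous; exact/derivable1_diffP.
rewrite /int01 /Rintegral (@continuous_FTC2 _ _ F) //.
- apply: continuous_in_subspaceT => t; rewrite inE /= in_itv /=; exact: cf.
- split.
  + by move=> t; rewrite in_itv /= => /andP[t0 t1]; have [] := dF t; rewrite ?ltW.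
  + by apply: cvg_at_right_filter; apply: cF; rewrite lexx ler01.
  + by apply: cvg_at_left_filter; apply: cF; rewrite lexx ler01.
- by move=> t; rewrite in_itv /= => /andP[t0 t1]; rewrite derive1E; have [] := dF t; rewrite ?ltW.
Qed.

Lemma cont01_sum (I : Type) (s : seq I) (P : pred I) (f : I -> R -> R) : (forall i, cont01 (f i)) ->
  cont01 (fun t => \sum_(i <- s | P i) f i t).
Proof.
move=> cf t t01; elim: s => [|j s IH].
  rewrite (_ : (fun _ => _) = fun=> 0); first exact: cst_continuous.
  by apply/funext => x; rewrite big_nil.
case Pj : (P j); last first.
  rewrite (_ : (fun _ => _) = fun t => \sum_(i <- s | P i) f i t) //.
  by apply/funext => x; rewrite big_cons Pj.
rewrite (_ : (fun _ => _) = fun t => f j t + \sum_(i <- s | P i) f i t).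
  by apply: continuousD => //; exact: cf.
by apply/funext => x; rewrite big_cons Pj.
Qed.

Lemma int01_sum (I : finType) (P : pred I) (f : I -> R -> R) : (forall i, cont01 (f i)) ->
  int01 (fun t => \sum_(i | P i) f i t) = \sum_(i | P i) int01 (f i).
Proof.
move=> cf; elim: (index_enum I) => [|i s IH].
  rewrite big_nil -[RHS]int01_cst; apply: int01_eq => t _; by rewrite big_nil.
rewrite big_cons; case: ifP => Pi; last first.
  by rewrite -IH; apply: int01_eq => t _; rewrite big_cons Pi.
rewrite -IH -int01D //; first by apply: int01_eq => t _; rewrite big_cons Pi.
exact: cont01_sum.
Qed.

(** Compactness of a segment, packaged for its uses: uniform continuity along the segments of
    [hline], then a common time and a common radius for a compact set of directions. *)
Lemma segment_uniform (P : R -> R -> Prop) a b :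
  (forall s e e', e' <= e -> P s e -> P s e') ->
  (forall t, a <= t <= b -> exists2 e, 0 < e & forall s, `|s - t| < e -> P s e) ->
  exists2 e, 0 < e & forall s, a <= s <= b -> P s e.
Proof.
move=> mono H.
have /compact_near_coveringP/(_ _ (0^'+) (fun e s => P s e)) := @segment_compact R a b.
have FF : ProperFilter (0 : R)^'+ by exact: at_right_proper_filter.
move=> /(_ _)/(_ _)[|e /= e0 He].
  move=> t; rewrite /= in_itv /= => /H[e e0 He].
  exists (ball t e, [set d | 0 < d /\ d < e]).
    split; first exact: nbhsx_ballx.
    apply: filterI; [exact: nbhs_right_gt|exact: nbhs_right_lt].
  move=> [s d] [/= ts [d0 de]]; apply: mono (ltW de) _; apply: He.
  by move: ts; rewrite -ball_normE /= distrC.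
exists (e / 2); first by rewrite divr_gt0.
move=> s ab; apply: (He (e/2)) => /=.
- by rewrite sub0r normrN gtr0_norm ?divr_gt0 // ltr_pdivrMr // ltr_pMr // ltr1n.
- by rewrite divr_gt0.
- by rewrite in_itv.
Qed.

End Integral01.

Section Hadamard.
Context {R : realType} (n : nat) (x0 : 'rV[R]_n) (r : R) (m : pred 'I_n).
Local Notation B := (ball x0 r).

Definition hcoef (t : R) (j : 'I_n) : R := if m j then 1 else t.
Definition hscale (t : R) (v : 'rV[R]_n) : 'rV[R]_n := \row_j (hcoef t j * v 0 j).
(* [hline t x] joins, for t from 0 to 1, the projection of x on the
   coordinate plane through x0 selected by m to x itself. *)
Definition hline (t : R) (x : 'rV[R]_n) := x0 + hscale t (x - x0).

Lemma hline1 x : hline 1 x = x.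
Proof.
rewrite /hline (_ : hscale 1 _ = x - x0) ?[x0 + _]addrC ?subrK //.
by apply/rowP => j; rewrite !mxE /hcoef; case: ifP => _; rewrite mul1r.
Qed.

Lemma hcoef_norm t j : 0 <= t <= 1 -> `|hcoef t j| <= 1.
Proof.
by move=> /andP[t0 t1]; rewrite /hcoef; case: ifP => _; rewrite ?normr1 // ger0_norm.
Qed.

Lemma hscale_norm t v : 0 <= t <= 1 -> `|hscale t v| <= `|v|.
Proof.
move=> t01; apply: rv_norm_le => // j; rewrite mxE normrM.
apply: le_trans (rv_coord_le v j); rewrite -[leRHS]mul1r.
by apply: ler_wpM2r => //; exact: hcoef_norm.
Qed.

Lemma ballE (E : normedModType R) (x y : E) e : ball x e y <-> `|y - x| < e.
Proof. by rewrite -ball_normE /= distrC. Qed.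

Lemma hline_ball t x : 0 <= t <= 1 -> B x -> B (hline t x).
Proof.
move=> t01 /ballE Bx; apply/ballE; rewrite /hline addrC addKr.
exact: le_lt_trans (hscale_norm _ t01) Bx.
Qed.

Lemma hlineB t x y : hline t y - hline t x = hscale t (y - x).
Proof. by apply/rowP => j; rewrite !mxE; ring. Qed.

Lemma hlineBt t s x : `|hline t x - hline s x| <= `|t - s| * `|x - x0|.
Proof.
apply: rv_norm_le => [|j]; first by rewrite mulr_ge0.
have -> : (hline t x - hline s x) 0 j = (hcoef t j - hcoef s j) * (x - x0) 0 j.
  by rewrite !mxE; ring.
rewrite normrM; apply: ler_pM => //; last exact: rv_coord_le.
by rewrite /hcoef; case: ifP => _ //; rewrite subrr normr0.
Qed.

Lemma hline_uniform f x e : (forall y, B y -> {for y, continuous f}) -> B x -> 0 < e ->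
  \forall y \near x, B y /\ forall t, 0 <= t <= 1 -> `|f (hline t y) - f (hline t x) : R^o| <= e.
Proof.
move=> cf Bx e0.
have [d d0 Hd] : exists2 d, 0 < d & forall t, 0 <= t <= 1 ->
   (fun t d => 0 <= t <= 1 -> forall y, `|y - x| < d -> B y -> `|f (hline t y) - f (hline t x) : R^o| <= e) t d.
  apply: segment_uniform => [s a b ba H s01 y yb By|t t01].
    by apply: H => //; exact: lt_le_trans yb ba.
  have e2 : 0 < e / 2 by rewrite divr_gt0.
  have /cvgrPdist_lt/(_ _ e2)/nbhs_ballP[d /= d0 Hd] : {for hline t x, continuous f}.
    by apply: cf; exact: hline_ball.
  (* Changing t by d' moves [hline t x] by at most d' |x - x0|, and moving x by d' adds at most d';
     together this is d / 2. The summand 1 covers x = x0. *)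
  pose d' := d / (2 * (1 + `|x - x0|)).
  have p1 : 0 < 1 + `|x - x0| by apply: ltr_pwDl.
  have d'0 : 0 < d' by rewrite divr_gt0 ?mulr_gt0.
  have dE : d = 2 * (d' + d' * `|x - x0|) by rewrite /d'; field; lra.
  have k0 : 0 <= d' * `|x - x0| by rewrite mulr_ge0 // ltW.
  exists d' => // s st s01 y yd By.
  have h1 : `|hline s x - hline t x| <= d' * `|x - x0|.
    by apply: le_trans (hlineBt _ _ _) _; apply: ler_wpM2r => //; exact: ltW.
  have h2 : `|hline s y - hline s x| < d'.
    by rewrite hlineB; exact: le_lt_trans (hscale_norm _ s01) yd.
  have b1 : `|f (hline s x) - f (hline t x)| < e / 2.
    by rewrite distrC; apply: Hd; apply/ballE; lra.
  have b2 : `|f (hline s y) - f (hline t x)| < e / 2.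
    rewrite distrC; apply: Hd; apply/ballE.
    rewrite (_ : hline s y - _ = (hline s y - hline s x) + (hline s x - hline t x)).
      by apply: le_lt_trans (ler_normD _ _) _; lra.
    by rewrite addrA subrK.
  rewrite (_ : f _ - f _ = (f (hline s y) - f (hline t x)) - (f (hline s x) - f (hline t x))).
    by apply: le_trans (ler_normB _ _) _; lra.
  by rewrite opprB addrA subrK.
have H1 : \forall y \near x, B y by apply: near_open Bx _ => //; exact: ball_open.
have H2 : \forall y \near x, `|y - x| < d.
  by apply/nbhs_ballP; exists d => //= y /ballE.
near=> y; have By : B y by near: y.
by split=> // t t01; apply: Hd => //; near: y.
Unshelve. all: by end_near. Qed.

Lemma hline_cont01 p f x : (forall y, B y -> {for y, continuous f}) -> B x ->
  cont01 (fun t => t ^+ p * f (hline t x) : R).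
Proof.
move=> cf Bx t t01; apply: continuousM; first exact: exprn_continuous.
apply: (@continuous_comp _ _ _ (fun t => hline t x) f); last by apply: cf; exact: hline_ball.
apply/cvgrPdist_le => e e0.
have p1 : 0 < 1 + `|x - x0| by apply: ltr_pwDl.
near=> s.
rewrite distrC; apply: le_trans (hlineBt _ _ _) _.
apply: (@le_trans _ _ (`|s - t| * (1 + `|x - x0|))); first by apply: ler_wpM2l => //; lra.
rewrite -ler_pdivlMr //; rewrite distrC ltW //.
near: s; apply/nbhs_ballP; exists (e / (1 + `|x - x0|)); first by rewrite /= divr_gt0.
by move=> s /=.
Unshelve. all: by end_near. Qed.

(** The weight [t ^+ p] makes the family stable under differentiation: along a coordinate not
    selected by m, the map [hline t] contributes one more factor t. *)
Definition hint p (f : 'rV[R]_n -> R^o) x : R^o := int01 (fun t => t ^+ p * f (hline t x)).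

Lemma hcoefE p t j : t ^+ (p + ~~ m j) = t ^+ p * hcoef t j.
Proof. by rewrite exprD /hcoef; case: (m j); rewrite ?expr0 ?expr1. Qed.

Lemma hlineD t x h : hline t (h + x) = hline t x + hscale t h.
Proof. by apply/rowP => j; rewrite !mxE; ring. Qed.

Lemma hscaleZ t a h : hscale t (a *: h) = a *: hscale t h.
Proof. by apply/rowP => j; rewrite !mxE; ring. Qed.

(** Differentiation under the integral sign. The remainder is the integral of [phi], which the mean
    value theorem and [hline_uniform] bound uniformly in t. *)
Lemma hint_diff p f x : Ck 1 B f -> B x ->
  differentiable (hint p f) x /\
  forall v, 'D_v (hint p f) x = \sum_j v 0 j * hint (p + ~~ m j) ('D_('e_j) f) x.
Proof.
move=> [df cdf] Bx.
have cf y : B y -> {for y, continuous f} by move=> /df; exact: differentiable_continuous.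
have cD j y : B y -> {for y, continuous ('D_('e_j) f)} by exact: cdf.
pose M : 'cV[R]_n := \col_j hint (p + ~~ m j) ('D_('e_j) f) x.
pose L : {linear 'rV[R]_n -> R^o} := (row_coord ord0 : {linear _ -> _}) \o mulmxr M.
have LE v : L v = \sum_j v 0 j * hint (p + ~~ m j) ('D_('e_j) f) x.
  by rewrite /L /= /row_coord mxE; apply: eq_bigr => j _; rewrite mxE.
have cL : continuous L by exact: lin_continuous.
suff [d1 d2] : differentiable (hint p f) x /\ 'd (hint p f) x = L :> (_ -> _).
  by split=> // v; rewrite deriveE // d2 LE.
apply: diff_eps => // e e0.
have n0 : 0 < n.+1%:R :> R by [].
have [e' e'0 eE] : exists2 e', 0 < e' & e = n.+1%:R * e'.
  by exists (e / n.+1%:R); [rewrite divr_gt0|field; lra].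
have /(@filter_forall _ _ _ (nbhs x) _)/nbhs_ballP[d /= d0 Hd] := fun j => hline_uniform (cD j) Bx e'0.
have [d1 d10 Hd1] : exists2 d, 0 < d & forall y, `|y - x| < d -> B y.
  have : \forall y \near x, B y by apply: near_open Bx _ => //; exact: ball_open.
  by move=> /nbhs_ballP[d1 /= d10 H1]; exists d1 => // y yd; apply: H1; apply/ballE.
have H1 : \forall h \near (0 : 'rV[R]_n), `|h| < d by exact: nbhs0_lt.
have H2 : \forall h \near (0 : 'rV[R]_n), `|h| < d1 by exact: nbhs0_lt.
near=> h.
have hd : `|h| < d by near: h.
have hd1 : `|h| < d1 by near: h.
have xh : B (h + x) by apply: Hd1; rewrite addrK.
have c1 := @hline_cont01 p _ _ cf xh; have c2 := @hline_cont01 p _ _ cf Bx.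
have c3 j : cont01 (fun t => h 0 j * (t ^+ (p + ~~ m j) * 'D_('e_j) f (hline t x)) : R).
  move=> t t01; apply: continuousM; first exact: cst_continuous.
  by have c := @hline_cont01 (p + ~~ m j) _ _ (cD j) Bx; exact: c.
have c4 : cont01 (fun t => \sum_j h 0 j * (t ^+ (p + ~~ m j) * 'D_('e_j) f (hline t x)) : R).
  exact: cont01_sum.
pose phi t : R := t ^+ p * f (hline t (h + x)) + ((-1) * (t ^+ p * f (hline t x))
   + (-1) * \sum_j h 0 j * (t ^+ (p + ~~ m j) * 'D_('e_j) f (hline t x))).
have cN g : cont01 g -> cont01 (fun t => (-1) * g t : R).
  by move=> cg t t01; apply: continuousM; [exact: cst_continuous|exact: cg].
have cA g1 g2 : cont01 g1 -> cont01 g2 -> cont01 (fun t => g1 t + g2 t : R).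
  by move=> cg1 cg2 t t01; apply: continuousD; [exact: cg1|exact: cg2].
have -> : hint p f (h + x) - hint p f x - L h = int01 phi.
  rewrite /phi int01D //; last by apply: cA; exact: cN.
  rewrite int01D; [|exact: cN|exact: cN].
  rewrite !int01Z // int01_sum // !mulN1r -addrA; congr (_ + (_ - _)).
  rewrite LE; apply: eq_bigr => j _; rewrite int01Z //.
  by have c := @hline_cont01 (p + ~~ m j) _ _ (cD j) Bx; exact: c.
apply: int01_bound.
  by have c5 := cA _ _ c1 (cA _ _ (cN _ c2) (cN _ c4)); exact: c5.
move=> t t01.
have Bth th : 0 <= th <= 1 -> B (th *: h + x).
  move=> /andP[? ?]; apply: Hd1; rewrite addrK normrZ.
  by apply: le_lt_trans hd1; rewrite ger0_norm //; exact: ler_piMl.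
have dfl th : 0 <= th <= 1 -> differentiable f (hline t x + th *: hscale t h).
  by move=> th01; rewrite -hscaleZ -hlineD; apply: df; apply: hline_ball => //; exact: Bth.
(* The intermediate point th depends on t without any regularity, which is harmless: it serves only
   to bound [phi t], already known to be continuous in t. *)
have [th th01 eth] := MVT_line dfl.
move: eth; rewrite -hscaleZ -hlineD -hlineD derive_sumE; last by apply: df; apply: hline_ball => //; exact: Bth.
move=> eth.
have eth' : f (hline t (h + x)) = f (hline t x) + \sum_j (hcoef t j * h 0 j) * 'D_('e_j) f (hline t (th *: h + x)).
  rewrite -[LHS](subrK (f (hline t x))) eth addrC; congr (_ + _).
  by apply: eq_bigr => j _; rewrite /= /row_coord mxE.
have e2 : \sum_j h 0 j * (t ^+ (p + ~~ m j) * 'D_('e_j) f (hline t x)) = t ^+ p * \sum_j (hcoef t j * h 0 j) * 'D_('e_j) f (hline t x).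
  by rewrite mulr_sumr; apply: eq_bigr => j _; rewrite hcoefE; ring.
have -> : phi t = t ^+ p * \sum_j (hcoef t j * h 0 j) * ('D_('e_j) f (hline t (th *: h + x)) - 'D_('e_j) f (hline t x)).
  under [in RHS]eq_bigr do rewrite mulrBr.
  by rewrite sumrB /phi eth' e2; ring.
case/andP: (t01) => t0 t1.
rewrite normrM -[leRHS]mul1r; apply: ler_pM => //.
  by rewrite ger0_norm ?exprn_ge0 // exprn_ile1.
apply: (le_trans (ler_norm_sum _ _ _)).
apply: (@le_trans _ _ (\sum_(j < n) `|h| * e')).
  apply: ler_sum => j _; rewrite normrM; apply: ler_pM => //.
    rewrite normrM -[leRHS]mul1r; apply: ler_pM => //; [exact: hcoef_norm|exact: rv_coord_le].
  have [|_] := Hd (th *: h + x) _ j; last exact.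
  apply/ballE; rewrite addrK normrZ; case/andP: th01 => ? ?.
  by apply: le_lt_trans hd; rewrite ger0_norm //; exact: ler_piMl.
rewrite sumr_const card_ord -[_ *+ n]mulr_natr eE mulrC mulrA [n%:R * _]mulrC [leRHS]mulrC -mulrA.
by apply: ler_wpM2l => //; apply: ler_wpM2r; [exact: ltW|rewrite ler_nat].
Unshelve. all: by end_near. Qed.

Lemma Ck_hint k p f : Ck k B f -> Ck k B (hint p f).
Proof.
elim: k p f => [|k IH] p f Hf.
  move=> x Bx; apply/(cvgrPdist_le (F := nbhs x)) => e e0.
  have := hline_uniform Hf Bx e0; apply: filterS => y [By Hy].
  rewrite distrC.
  have c1 := @hline_cont01 p _ _ Hf By; have c2 := @hline_cont01 p _ _ Hf Bx.
  have -> : hint p f y - hint p f x = int01 (fun t => t ^+ p * f (hline t y) + (-1) * (t ^+ p * f (hline t x))).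
    rewrite int01D // ?int01Z ?mulN1r //.
    by move=> t t01; apply: continuousM; [exact: cst_continuous|exact: c2].
  apply: int01_bound.
    move=> t t01; apply: continuousD; first exact: c1.
    by apply: continuousM; [exact: cst_continuous|exact: c2].
  move=> t t01; rewrite mulN1r -mulrBr normrM -[leRHS]mul1r.
  case/andP: (t01) => t0 t1.
  by apply: ler_pM => //; [rewrite ger0_norm ?exprn_ge0 // exprn_ile1|exact: Hy].
have H1 : Ck 1 B f by exact: Ck_leq Hf.
split=> [x Bx|v]; first by have [] := hint_diff p H1 Bx.
have H : Ck k B (fun x => \sum_j v 0 j * hint (p + ~~ m j) ('D_('e_j) f) x : R^o).
  apply: Ck_sum => [|j _]; first exact: ball_open.
  apply: Ck_mul; [exact: ball_open|exact: Ck_cst|].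
  by apply: IH; have [_] := Hf; exact.
by apply: Ck_eq H => [|x Bx]; [exact: ball_open|have [_ ->] := hint_diff p H1 Bx].
Qed.

(** The increment of f along [hline] is the integral of its derivative, and the selected coordinates
    do not move. With m empty this is the first-order expansion at a point; in general it divides a
    function vanishing on a coordinate plane by the equations of the plane. The values of g on the
    plane hold because the integrand is constant there. *)
Lemma hadamard f : 0 < r -> smooth_on B f -> exists g : 'I_n -> 'rV[R]_n -> R^o,
  [/\ forall j, smooth_on B (g j),
      forall x, B x -> f x = f (hline 0 x) + \sum_(j | ~~ m j) (x - x0) 0 j * g j x &
      forall j x, B x -> hline 0 x = x -> g j x = 'D_('e_j) f x].
Proof.
move=> r0 sf; exists (fun j => hint 0 ('D_('e_j) f)); split.
- by move=> j k; apply: Ck_hint; have [_] := sf k.+1; exact.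
- move=> x Bx.
  have df y : B y -> differentiable f y by exact: (sf 1%N).1.
  have cD j y : B y -> {for y, continuous ('D_('e_j) f)} by exact: (sf 1%N).2.
  pose w := hscale 1 (x - x0) - hscale 0 (x - x0).
  have lE t : hline t x = hline 0 x + t *: w.
    by apply/rowP => j; rewrite !mxE /hcoef; case: (m j); ring.
  have wE j : w 0 j = if ~~ m j then (x - x0) 0 j else 0.
    by rewrite !mxE /hcoef; case: (m j) => /=; ring.
  have c j : cont01 (fun t => w 0 j * (t ^+ 0 * 'D_('e_j) f (hline t x)) : R).
    by move=> t t01; apply: continuousM; [exact: cst_continuous|have c := @hline_cont01 0 _ _ (cD j) Bx; exact: c].
  have := @int01_FTC R (fun t => f (hline t x)) (fun t => \sum_j w 0 j * (t ^+ 0 * 'D_('e_j) f (hline t x))).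
  rewrite int01_sum // hline1 => H.
  have e : \sum_j int01 (fun t => w 0 j * (t ^+ 0 * 'D_('e_j) f (hline t x))) = f x - f (hline 0 x).
    apply: H => //; first exact: cont01_sum.
    move=> t t01.
    have := @line_is_derive R _ f (hline 0 x) w t; rewrite -lE => /(_ (df _ (hline_ball t01 Bx))).
    rewrite derive_sumE; last by apply: df; exact: hline_ball.
    rewrite (_ : (fun s => f (hline 0 x + s *: w)) = (fun t => f (hline t x))); last by apply/funext => s; rewrite -lE.
    have -> // : \sum_j w 0 j * (t ^+ 0 * 'D_'e_j f (hline t x)) = \sum_i bl i w *: 'D_(be i) f (hline t x).
    by apply: eq_bigr => j _; rewrite expr0 mul1r.
  rewrite -[LHS](subrK (f (hline 0 x))) -e addrC; congr (_ + _).
  rewrite [RHS]big_mkcond /=; apply: eq_bigr => j _.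
  rewrite int01Z; last by have c1 := @hline_cont01 0 _ _ (cD j) Bx; exact: c1.
  by rewrite wE; case: ifP => _; rewrite ?mul0r.
- move=> j x Bx hx; rewrite /hint -[RHS]int01_cst; apply: int01_eq => t t01.
  rewrite expr0 mul1r; congr ('D_('e_j) f _); rewrite -[RHS]hx /hline; congr (_ + _).
  apply/rowP => i; have /rowP/(_ i) := hx; rewrite !mxE /hcoef.
  case: (m i) => //; rewrite mul0r addr0 => ->; ring.
Qed.

End Hadamard.

(** * Bump functions and growth estimates *)

Section Univariate.
Context {R : realType}.
Implicit Types (U : set R^o) (f g : R^o -> R^o).

Lemma derivable_derive f (x v : R^o) : derivable f x 1 -> 'D_v f x = v * 'D_1 f x.
Proof.
move=> /derivable1_diffP df; rewrite !deriveE //.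
by rewrite -[in LHS](mulr1 v) -[v * 1]/(v *: (1 : R^o)) linearZ.
Qed.

Lemma Ck_antiderive k U f g : open U -> (forall x, U x -> is_derive x 1 f (g x)) ->
  Ck k U g -> Ck k.+1 U f.
Proof.
move=> oU fg Hg; split=> [x /fg[d _]|v]; first exact/derivable1_diffP.
apply: Ck_eq (Ck_scale v oU Hg) => // x Ux.
by have [d e] := fg x Ux; rewrite derivable_derive // e.
Qed.

Lemma Ck_sincos k : Ck k setT (@sin R : R^o -> R^o) /\ Ck k setT (@cos R : R^o -> R^o).
Proof.
elim: k => [|k [IHs IHc]]; first by split=> x _; [exact: continuous_sin|exact: continuous_cos].
split; first by apply: (Ck_antiderive openT _ IHc) => x _; exact: is_derive_sin.
apply: (Ck_antiderive openT _ (Ck_scale (-1) openT IHs)) => x _.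
by rewrite scaleN1r; exact: is_derive_cos.
Qed.

Lemma Ck_id k (E : normedModType R) (V : set E) : Ck k V (id : E -> E).
Proof. exact: (@Ck_lin _ _ _ k V (idfun : {linear E -> E}) (fun x => cvg_id)). Qed.

Lemma smooth_atan : smooth_on setT (@atan R : R^o -> R^o).
Proof.
move=> k; apply: (@CkS _ _ _ k); apply: (Ck_antiderive openT (fun x _ => is_derive1_atan x)).
apply: Ck_inv => [||]; first exact: openT.
  by move=> x _; rewrite gt_eqF // ltr_pwDl // sqr_ge0.
apply: Ck_add; [exact: openT|exact: Ck_cst|].
rewrite (_ : (fun x => x ^+ 2) = fun x : R^o => x * x); last by apply/funext => x; rewrite expr2.
by apply: Ck_mul; [exact: openT|exact: Ck_id|exact: Ck_id].
Qed.

(* The derivatives of exp(-1/u), extended by 0 to u <= 0, are linear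
   combinations of these functions. *)
Definition flat n (u : R^o) : R^o := if 0 < u then u^-1 ^+ n * expR (- u^-1) else 0.

(** With w = 1/u and m = n + 2 the claim reads w^m <= m^m exp w, the m-th power of w / m <= exp (w /
    m). An exponent above 1 on u is what gives derivative 0 at the origin. *)
Lemma flat_bound n : exists2 C, 0 < C & forall u : R, `|flat n u| <= C * u ^+ 2.
Proof.
pose m := n.+2; have m0 : 0 < m%:R :> R by [].
exists (m%:R ^+ m); first by rewrite exprn_gt0.
move=> u; rewrite /flat; case: ifP => u0; last first.
  by rewrite normr0; apply: mulr_ge0; [exact: exprn_ge0|exact: sqr_ge0].
have w0 : 0 < u^-1 by rewrite invr_gt0.
have ->: u ^+ 2 = u^-1 ^- 2 by rewrite exprVn invrK.
move: (u^-1) w0 => {u u0} w w0.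
rewrite ger0_norm; last by rewrite mulr_ge0 ?exprn_ge0 ?expR_ge0 // ltW.
rewrite expRN ler_pdivrMr ?expR_gt0 // mulrAC ler_pdivlMr ?exprn_gt0 // -exprD addn2.
have -> : expR w = expR (w / m%:R) ^+ m by rewrite -expRM_natl mulrCA mulfV ?mulr1 // gt_eqF.
have p : 0 <= w / m%:R by rewrite divr_ge0 ?ltW.
rewrite -exprMn; apply: lerXn2r; rewrite ?nnegrE ?mulr_ge0 ?expR_ge0 ?ltW //.
rewrite mulrC -ltr_pdivrMr //.
by have := expR_ge1Dx (w / m%:R); lra.
Qed.

Lemma flat_derive n (u : R) : is_derive u 1 (flat n : R -> R) (- n%:R * flat n.+1 u + flat n.+2 u).
Proof.
case: (ltgtP u 0) => u0.
- have -> : - n%:R * flat n.+1 u + flat n.+2 u = 0 by rewrite /flat ltNge (ltW u0) /= mulr0 addr0.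
  have dc : is_derive u 1 (cst (0:R) : R -> R) 0 by exact: is_derive_cst.
  apply: near_eq_is_derive dc.
  near=> v; rewrite /flat /cst ifF //; apply/negbTE; rewrite -leNgt ltW //.
  by near: v; exact: lt_nbhsl.
- pose h (w : R) : R := w ^+ n * expR (- w).
  have dh (w : R) : is_derive w 1 h (w ^+ n * - expR (- w) + expR (- w) * (w ^+ n.-1 *+ n)).
    have dN : is_derive w 1 (fun w : R => expR (- w)) (expR (- w) * -1).
      exact: (@is_derive1_comp R expR -%R).
    have dX : is_derive w 1 (fun w : R => w ^+ n) (n%:R *: w ^+ n.-1 *: (1:R)).
      by apply: DeriveDef; [exact: exprn_derivable|exact: exp_derive].
    have := @is_deriveM R R (fun w => w ^+ n) (fun w => expR (- w)) w 1 _ _ dX dN.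
    rewrite (_ : _ *: _ + _ = w ^+ n * - expR (- w) + expR (- w) * (w ^+ n.-1 *+ n)) //.
    by rewrite /GRing.scale /= mulrN1 mulr1 [n%:R * _]mulrC mulr_natr.
  have du : is_derive u 1 (fun u : R => u^-1) (- u ^- 2).
    have := @is_deriveV R id u 1 1; rewrite gt_eqF // => /(_ isT _).
    by rewrite scaleNr /GRing.scale /= mulr1.
  have := @is_derive1_comp R h (fun u => u^-1) u _ _ (dh _) du.
  have -> : (u^-1 ^+ n * - expR (- u^-1) + expR (- u^-1) * (u^-1 ^+ n.-1 *+ n)) * - u ^- 2 = - n%:R * flat n.+1 u + flat n.+2 u.
    rewrite /flat u0 -exprVn; move: (u^-1) (expR _) => w E.
    case: n {h dh} => [|n]; first by rewrite mulr0n mulr0 addr0 expr0 mul1r oppr0 mul0r add0r mulrNN mulrC.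
    by rewrite -[_ *+ _]mulr_natr /= !exprS expr0; move: (w ^+ n) (n.+1%:R) => y z; ring.
  apply: near_eq_is_derive.
    near=> v; rewrite /flat /h /= ifT //.
    by near: v; exact: lt_nbhsr.
- rewrite u0.
  have [C C0 HC] := flat_bound n.
  have f0 k : flat k 0 = 0 by rewrite /flat ltxx.
  have cL : continuous (\0 : R^o -> R^o) by move=> x; exact: cst_continuous.
  have H e : 0 < e -> \forall h \near (0 : R^o), `|flat n (h + 0) - flat n 0 - \0 h| <= e * `|h|.
    move=> e0; near=> h; rewrite addr0 f0 !subr0; apply: (le_trans (HC h)).
    rewrite -(real_normK (num_real h)) expr2 mulrA; apply: ler_wpM2r => //.
    rewrite mulrC -ler_pdivlMr // ltW //; near: h.
    by apply: (@nbhs0_lt R R^o (e / C)); exact: divr_gt0.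
  have [d1 d2] := diff_eps cL H.
  rewrite !f0 mulr0 addr0; apply: DeriveDef; first exact/derivable1_diffP.
  by rewrite deriveE // d2.
Unshelve. all: by end_near. Qed.

Lemma Ck_flat k n : Ck k setT (flat n).
Proof.
elim: k n => [|k IH] n.
  move=> u _; apply: differentiable_continuous; apply/derivable1_diffP.
  by have [] := flat_derive n u.
apply: (Ck_antiderive openT (fun u _ => flat_derive n u)).
by apply: Ck_add; [exact: openT|apply: Ck_scale (IH _); exact: openT|exact: IH].
Qed.

Lemma flat_ge0 u : 0 <= flat 0 u.
Proof. by rewrite /flat; case: ifP => // _; rewrite expr0 mul1r expR_ge0. Qed.

Lemma flat_gt0 u : 0 < u -> 0 < flat 0 u.
Proof. by rewrite /flat => ->; rewrite expr0 mul1r expR_gt0. Qed.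

(** The usual smooth transition; the denominator is positive since u and 1 - u are not both
    nonpositive. *)
Definition step (u : R^o) : R^o := flat 0 u * (flat 0 u + flat 0 (1 - u))^-1.

Lemma step0 u : u <= 0 -> step u = 0.
Proof. by move=> u0; rewrite /step {1}/flat ltNge u0 mul0r. Qed.

Lemma step1 u : 1 <= u -> step u = 1.
Proof.
move=> u1; rewrite /step (_ : flat 0 (1 - u) = 0).
  by rewrite addr0 divff // gt_eqF // flat_gt0 // (lt_le_trans ltr01).
by rewrite /flat ltNge subr_le0 u1.
Qed.

Lemma Ck_step k : Ck k setT step.
Proof.
have c1 : Ck k setT (fun u : R^o => flat 0 (1 - u)).
  apply: (@Ck_comp_scalar _ _ _ _ _ _ setT (fun u : R^o => 1 - u : R^o) (flat 0)) => //.
  - exact: openT.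
  - apply: Ck_add; [exact: openT|exact: Ck_cst|].
    rewrite (_ : -%R = fun x : R^o => (-1) *: x).
      by apply: Ck_scale; [exact: openT|exact: Ck_id].
    by apply/funext => x; rewrite scaleN1r.
  - exact: Ck_flat.
apply: Ck_mul; [exact: openT|exact: Ck_flat|].
apply: Ck_inv; [exact: openT| |by apply: Ck_add; [exact: openT|exact: Ck_flat|]].
move=> u _; rewrite gt_eqF //; have := flat_ge0 u; have := flat_ge0 (1 - u).
by case: (ltP 0 u) => u0; [have := flat_gt0 u0; lra|have := @flat_gt0 (1 - u); lra].
Qed.

Lemma bump n (r : R) : 0 < r -> exists chi : 'rV[R]_n -> R^o,
  [/\ smooth_on setT chi, forall x, `|x| <= r -> chi x = 1 &
      forall x, 2 * r <= `|x| -> chi x = 0].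
Proof.
move=> r0.
(* The argument of [step] is at least 1 when |x_i| <= r and at most -2 when |x_i| >= 2 r; the square
   avoids the corner of the absolute value. The norm being a maximum, one large coordinate
   annihilates the product. *)
exists (fun x => \prod_i step (2 - (x 0 i / r) ^+ 2)); split.
- move=> k; apply: Ck_prod => [|i _]; first exact: openT.
  apply: (@Ck_comp_scalar _ _ _ _ _ _ setT (fun x : 'rV[R]_n => 2 - (x 0 i / r) ^+ 2 : R^o) step) => //.
  + exact: openT.
  + have c : Ck k setT (fun x : 'rV[R]_n => r^-1 *: row_coord i x).
      apply: Ck_scale; first exact: openT.
      by apply: Ck_lin; exact: coord_continuous.
    rewrite (_ : (fun x => _) = fun x : 'rV[R]_n => 2 + (-1) *: (r^-1 *: row_coord i x * (r^-1 *: row_coord i x)) : R^o).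
      apply: Ck_add; [exact: openT|exact: Ck_cst|].
      by apply: Ck_scale; [exact: openT|apply: Ck_mul; [exact: openT|exact: c|exact: c]].
    by apply/funext => x; rewrite scaleN1r /row_coord /GRing.scale /= expr2 mulrC [x 0 i * _]mulrC.
  + exact: Ck_step.
- move=> x xr; rewrite big1 // => i _; apply: step1.
  have h : `|x 0 i / r| <= 1.
    by rewrite normrM [`|r^-1|]gtr0_norm ?invr_gt0 // ler_pdivrMr // mul1r (le_trans (rv_coord_le _ _)).
  by have := ler_pXn2r; have := real_normK (num_real (x 0 i / r)); have := normr_ge0 (x 0 i / r); nra.
- move=> x xr.
  have [i xi] : exists i, 2 * r <= `|x 0 i|.
    apply: contrapT => /forallNP H.
    have x0 : x != 0 by apply/eqP => x0; move: xr; rewrite x0 normr0; lra.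
    have e0 : `|x| != 0 by rewrite normr_eq0.
    have [j e] := mx_norm_neq0 (e0 : mx_norm x != 0).
    by apply: (H j.2); move: xr; rewrite [X in _ <= X -> _]e ord1.
  rewrite (bigD1 i) //= step0 ?mul0r //.
  have h : 2 <= `|x 0 i / r|.
    by rewrite normrM [`|r^-1|]gtr0_norm ?invr_gt0 // ler_pdivlMr.
  by have := real_normK (num_real (x 0 i / r)); nra.
Qed.

End Univariate.

Section OrdinaryDiff.
Context {R : realType}.

Lemma MVT_from0 (f df : R -> R) (e : R) : (forall t : R, `|t| <= e -> is_derive t 1 f (df t)) ->
  forall t : R, `|t| <= e -> exists2 s, `|s| <= `|t| & f t - f 0 = df s * t.
Proof.
move=> fd t te.
have cf s : `|s| <= e -> {for s, continuous f}.
  by move=> /fd[d _]; apply: differentiable_continuous; exact/derivable1_diffP.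
case: (leP 0 t) => t0.
  rewrite ger0_norm // in te *.
  have [||s] := @MVT_segment R f df 0 t t0.
  - by move=> s; rewrite in_itv /= => /andP[s0 s1]; apply: fd; rewrite ger0_norm; [apply: le_trans te; exact: ltW|exact: ltW].
  - apply: continuous_in_subspaceT => s; rewrite inE /= in_itv /= => /andP[s0 s1].
    by apply: cf; rewrite ger0_norm //; lra.
  - rewrite in_itv /= => /andP[s0 s1]; rewrite subr0 => e1.
    by exists s; rewrite // ger0_norm.
rewrite ltr0_norm // in te *.
have [||s] := @MVT_segment R f df t 0 (ltW t0).
- by move=> s; rewrite in_itv /= => /andP[s0 s1]; apply: fd; rewrite ler0_norm; [lra|exact: ltW].
- apply: continuous_in_subspaceT => s; rewrite inE /= in_itv /= => /andP[s0 s1].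
  by apply: cf; rewrite ler0_norm //; lra.
- rewrite in_itv /= => /andP[s0 s1]; rewrite sub0r mulrN => e1.
  by exists s; [rewrite ler0_norm //; lra|rewrite -opprB e1 opprK].
Qed.

(** Gronwall's lemma: N(s t) exp (- C t) is nonincreasing in t >= 0, for s = 1 and for s = -1, which
    treats the two directions of time at once. *)
Lemma growth_zero (N dN : R -> R) (C e : R) :
  (forall t : R, `|t| <= e -> is_derive t 1 N (dN t)) ->
  (forall t : R, `|t| <= e -> 0 <= N t) ->
  (forall t : R, `|t| <= e -> `|dN t| <= C * N t) -> N 0 = 0 ->
  forall t : R, `|t| <= e -> N t = 0.
Proof.
move=> dd N0 le N00.
suff H (s : R) : s = 1 \/ s = -1 -> forall t : R, 0 <= t <= e -> N (s * t) = 0.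
  move=> t te; case: (leP 0 t) => t0.
    by rewrite -[t]mul1r; apply: H; [left|rewrite t0 -[t]ger0_norm].
  rewrite -[t]opprK -mulN1r; apply: H; first by right.
  by rewrite oppr_ge0 ltW // -ltr0_norm.
move=> sE t /andP[t0 te].
have s1 : `|s| = 1 by case: sE => ->; rewrite ?normrN normr1.
have sn (u : R) : `|s * u| = `|u| by rewrite normrM s1 mul1r.
pose M (u : R) : R := N (s * u) * expR (- C * u).
have dM (u : R) : `|u| <= e -> is_derive u 1 M (N (s * u) *: (expR (- C * u) * - C) + expR (- C * u) *: (dN (s * u) * s)).
  move=> ue; apply: (@is_deriveM R R (fun u => N (s * u)) (fun u => expR (- C * u))).
    have dl : is_derive u 1 (fun u : R => s * u) s.
      by have := @is_deriveZ R R R id s u 1 1 _; rewrite /GRing.scale /= mulr1; exact.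
    by apply: (@is_derive1_comp R N (fun u => s * u)) => //; apply: dd; rewrite sn.
  have dl : is_derive u 1 (fun u : R => - C * u) (- C).
    by have := @is_deriveZ R R R id (- C) u 1 1 _; rewrite /GRing.scale /= mulr1; exact.
  exact: (@is_derive1_comp R expR (fun u => - C * u)).
have te' : `|t| <= e by rewrite ger0_norm.
have cM (u : R) : `|u| <= e -> {for u, continuous M}.
  by move=> /dM[d _]; apply: differentiable_continuous; exact/derivable1_diffP.
have [||c] := @MVT_segment R M (fun u => N (s * u) *: (expR (- C * u) * - C) + expR (- C * u) *: (dN (s * u) * s)) 0 t t0.
- by move=> u; rewrite in_itv /= => /andP[u0 u1]; apply: dM; rewrite gtr0_norm //; lra.
- apply: continuous_in_subspaceT => u; rewrite inE /= in_itv /= => /andP[u0 u1].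
  by apply: cM; rewrite ger0_norm //; lra.
- rewrite in_itv /= => /andP[c0 c1].
  have ce : `|s * c| <= e by rewrite sn ger0_norm //; lra.
  have l := le _ ce.
  have l2 : dN (s * c) * s <= C * N (s * c).
    by apply: le_trans l; apply: le_trans (ler_norm _) _; rewrite normrM s1 mulr1.
  rewrite {2}/M mulr0 N00 mul0r !subr0 => eM.
  have Mt : M t <= 0.
    rewrite eM; apply: mulr_le0_ge0 => //; rewrite /GRing.scale /=.
    have -> : N (s * c) * (expR (- C * c) * - C) + expR (- C * c) * (dN (s * c) * s) = expR (- C * c) * (dN (s * c) * s - C * N (s * c)) by ring.
    by apply: mulr_ge0_le0; [exact: expR_ge0|lra].
  apply/eqP; rewrite eq_le N0 ?sn // andbT.
  by move: Mt; rewrite /M pmulr_lle0 // expR_gt0.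
Qed.

(** Let m be the maximum of |F2|, reached at t0. Two mean value estimates give |F1| <= |t| m and |F|
    <= t^2 m, so the inequality at t0 reads t0^2 m <= 2 K |t0|^3 m. As 2 K e < 1, m = 0. *)
Lemma second_order_zero (F F1 F2 : R -> R) (e K : R) : 0 < e -> 0 <= K -> 2 * K * e < 1 ->
  (forall t : R, `|t| <= e -> is_derive t 1 F (F1 t)) ->
  (forall t : R, `|t| <= e -> is_derive t 1 F1 (F2 t)) ->
  (forall t : R, `|t| <= e -> {for t, continuous F2}) ->
  F 0 = 0 -> F1 0 = 0 -> F2 0 = 0 ->
  (forall t : R, `|t| <= e -> t ^+ 2 * `|F2 t| <= K * (`|t| * `|F t| + t ^+ 2 * `|F1 t|)) ->
  forall t : R, `|t| <= e -> F t = 0.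
Proof.
move=> e0 K0 Ke dF dF1 cF2 F00 F10 F20 H.
have ee : - e <= e by lra.
have [|t0] := @EVT_max R (fun t => `|F2 t|) (- e) e ee.
  apply: continuous_in_subspaceT => t; rewrite inE /= in_itv /= -ler_norml => te.
  by apply: continuous_comp; [exact: cF2|exact: norm_continuous].
rewrite in_itv /= -ler_norml => t0e max.
have maxM t : `|t| <= e -> `|F2 t| <= `|F2 t0| by move=> te; apply: max; rewrite in_itv /= -ler_norml.
set m : R := `|F2 t0| in maxM; have mm : 0 <= m by exact: normr_ge0.
have b1 t : `|t| <= e -> `|F1 t| <= `|t| * m.
  move=> te; have [s st] := MVT_from0 dF1 te; rewrite F10 subr0 => ->.
  by rewrite normrM mulrC; apply: ler_wpM2l => //; apply: maxM; exact: le_trans st te.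
have b0 t : `|t| <= e -> `|F t| <= `|t| * (`|t| * m).
  move=> te; have [s st] := MVT_from0 dF te; rewrite F00 subr0 => ->.
  rewrite normrM mulrC; apply: ler_wpM2l => //; apply: le_trans (b1 _ (le_trans st te)) _.
  by apply: ler_wpM2r.
have m0 : m = 0.
  (* The differential inequality is void at t = 0; a maximum reached there is excluded by [F2 0 = 0]
     instead. *)
  have [t00|t00] := eqVneq t0 0; first by rewrite /m t00 F20 normr0.
  have := H _ t0e; rewrite -/m => h.
  have p : 0 < `|t0| by rewrite normr_gt0.
  have := b0 _ t0e; have := b1 _ t0e; rewrite -(real_normK (num_real t0)) in h *.
  move: (`|t0|) (`|F t0|) (`|F1 t0|) p t0e h => a A B a0 ae h h1 h2.
  have h3 : a ^+ 2 * m <= a ^+ 2 * (2 * K * a * m).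
    apply: (le_trans h); rewrite [leRHS](_ : _ = K * (a * (a * (a * m)) + a ^+ 2 * (a * m))); last by ring.
    by apply: ler_wpM2l => //; apply: lerD; apply: ler_wpM2l => //; [exact: ltW|exact: sqr_ge0].
  have h4 : m <= 2 * K * a * m by move: h3; rewrite ler_pM2l // exprn_gt0.
  apply/eqP; rewrite eq_le mm andbT leNgt; apply/negP => m0.
  move: h4; rewrite -{1}[m]mul1r ler_pM2r // leNgt => /negP; apply.
  by apply: le_lt_trans Ke; apply: ler_wpM2l => //; apply: mulr_ge0.
move=> t te; have := b0 _ te; rewrite m0 !mulr0 => h.
by apply/eqP; rewrite -normr_le0.
Qed.

Lemma Ck_lipschitz (E : normedModType R) {fE : fbasis E} (U : set E) (f : E -> R^o) x :
  open U -> U x -> Ck 1 U f ->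
  exists K d, [/\ 0 < K, 0 < d, ball x d `<=` U &
    forall y z, ball x d y -> ball x d z -> `|f y - f z| <= K * `|y - z|].
Proof.
move=> oU Ux [df cdf].
have [C C0 HC] : exists2 C, 0 < C & forall i v, `|bl (fbasis := fE) i v| <= C * `|v|.
  have H i : {C | 0 < C & forall v, `|bl (fbasis := fE) i v| <= C * `|v|}.
    by apply: cid2; apply: linear_lipschitz; exact: bl_cont.
  exists (1 + \sum_i s2val (H i)).
    by rewrite ltr_pwDl // sumr_ge0 // => i _; case: (H i) => /= C /ltW.
  move=> i v; apply: le_trans (s2valP' (H i) v) _; apply: ler_wpM2r => //.
  rewrite (bigD1 i) //= addrCA lerDl addr_ge0 // sumr_ge0 // => j _.
  by case: (H j) => /= C /ltW.
have H : \forall y \near x, forall i, `|'D_(be (fbasis := fE) i) f y| <= `|'D_(be i) f x| + 1.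
  apply: (@filter_forall _ _ _ (nbhs x)) => i.
  have : {for x, continuous ('D_(be i) f)} by exact: cdf.
  move=> /cvgrPdist_le/(_ 1 ltr01); apply: filterS => y.
  rewrite distrC => h; rewrite -lerBlDl; apply: le_trans h; exact: lerB_dist.
have HU : \forall y \near x, U y by exact: near_open oU Ux _.
have /nbhs_ballP[d /= d0 Hd] : \forall y \near x, U y /\ forall i, `|'D_(be (fbasis := fE) i) f y| <= `|'D_(be i) f x| + 1.
  exact: filterI HU H.
pose S := \sum_i (`|'D_(be (fbasis := fE) i) f x| + 1).
exists (C * S + 1), d; split => //.
- rewrite ltr_pwDr //; apply: mulr_ge0; first exact: ltW.
  by apply: sumr_ge0 => i _; exact: addr_ge0.
- by move=> y /Hd[].
- move=> y z By Bz.
  have seg t : 0 <= t <= 1 -> ball x d (z + t *: (y - z)).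
    move=> /andP[t0 t1]; apply/ballE; move: By Bz => /ballE By /ballE Bz.
    have -> : z + t *: (y - z) - x = (1 - t) *: (z - x) + t *: (y - x).
      symmetry; rewrite scalerBl scale1r addrAC -addrA -scalerBr opprB subrKA.
      by rewrite addrAC.
    apply: (le_lt_trans (ler_normD _ _)); rewrite !normrZ !ger0_norm ?subr_ge0 //.
    have [t00|t00] := eqVneq t 0; first by rewrite t00 subr0 mul1r mul0r addr0.
    have tp : 0 < t by rewrite lt_neqAle eq_sym t00.
    have h1 : t * `|y - x| < t * d by rewrite ltr_pM2l.
    have h2 : (1 - t) * `|z - x| <= (1 - t) * d by rewrite ler_wpM2l ?subr_ge0 // ltW.
    lra.
  have [t t01|t t01] := @MVT_line R _ f z (y - z).
    by apply: df; have [] := Hd _ (seg t t01).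
  rewrite [z + (y - z)]addrC subrK => ->.
  have [Ut Dt] := Hd _ (seg t t01).
  rewrite derive_sumE; last exact: df.
  apply: (le_trans (ler_norm_sum _ _ _)).
  apply: (@le_trans _ _ (C * S * `|y - z|)); last by apply: ler_wpM2r => //; lra.
  rewrite mulrAC /S mulr_sumr; apply: ler_sum => i _.
  by rewrite normrM; apply: ler_pM => //; exact: Dt.
Qed.

End OrdinaryDiff.

(** * Manifolds and tangent vectors *)

Section Manifold.
Context {R : realType} {E : normedModType R} {fE : fbasis E} {M : topologicalType}.
Implicit Types (A : set (chart M E)) (c d : chart M E) (p q : M) (f g : M -> R).

(** The conditions on charts alone, which pass directly to the products [M * R] and
    [R * (M * R)]. *)
Record is_atlas A : Prop := {
  atlas_chart : forall c, A c -> is_chart c;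
  atlas_cover : forall p, exists2 c, A c & dom c p;
  atlas_compat : forall c d, A c -> A d ->
    smooth_on (cmap c @` (dom c `&` dom d)) (cmap d \o cinv c) }.

(* Charts of the maximal atlas containing A. *)
Record compatible A d : Prop := {
  compatible_chart : is_chart d;
  compatible_to : forall c, A c ->
    smooth_on (cmap c @` (dom c `&` dom d)) (cmap d \o cinv c);
  compatible_from : forall c, A c ->
    smooth_on (cmap d @` (dom d `&` dom c)) (cmap c \o cinv d) }.

Definition smooth_in d p f := exists U : set E,
  [/\ open U, U (cmap d p), U `<=` cimg d & smooth_on U (f \o cinv d : E -> R^o)].

Lemma atlas_compatible A c : is_atlas A -> A c -> compatible A c.
Proof.
by move=> [h1 _ h2] Ac; split=> [|d Ad|d Ad]; [exact: h1|exact: h2|exact: h2].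
Qed.

Lemma chart_image_open d (V : set M) : is_chart d -> open V -> V `<=` dom d ->
  open (cmap d @` V).
Proof.
move=> [ho1 ho2 K c1 c2] oV Vd.
have -> : cmap d @` V = cimg d `&` cinv d @^-1` V.
  apply/seteqP; split=> x.
    by move=> [q Vq <-]; split; [exists q => //; exact: Vd|rewrite /= K //; exact: Vd].
  by move=> [[q dq <-]] /=; rewrite K // => Vq; exists q.
rewrite openE => x [dx Vx]; apply: filterI; first exact: open_nbhs_nbhs.
exact: (c2 _ dx) (open_nbhs_nbhs (conj oV Vx)).
Qed.

Lemma chart_preimage_open d (U : set E) : is_chart d -> open U -> open (dom d `&` cmap d @^-1` U).
Proof.
move=> [ho1 ho2 K c1 c2] oU; rewrite openE => q [dq Uq]; apply: filterI.
  exact: open_nbhs_nbhs.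
exact: (c1 _ dq) (open_nbhs_nbhs (conj oU Uq)).
Qed.

Lemma chart_inv_dom d x : is_chart d -> cimg d x -> dom d (cinv d x).
Proof. by move=> dd [q dq <-]; rewrite (chart_cancel dd). Qed.

Lemma chart_invK d x : is_chart d -> cimg d x -> cmap d (cinv d x) = x.
Proof. by move=> dd [q dq <-]; rewrite (chart_cancel dd). Qed.

Lemma smooth_in_trans c d p f : is_chart c -> is_chart d -> dom c p -> dom d p ->
  smooth_on (cmap d @` (dom d `&` dom c)) (cmap c \o cinv d) ->
  smooth_in c p f -> smooth_in d p f.
Proof.
move=> cc cd cp dp tr [U [oU Up Uc sU]].
have oD : open (cmap d @` (dom d `&` dom c)).
  apply: chart_image_open => //.
  by apply: openI; [exact: (chart_open cd)|exact: (chart_open cc)].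
have oV := Ck_open_preimage oD oU (tr 0%N).
exists (cmap d @` (dom d `&` dom c) `&` (cmap c \o cinv d) @^-1` U); split=> //.
- by split; [exists p|rewrite /= (chart_cancel cd)].
- by move=> x [[q [dq _] <-] _]; exists q.
- move=> k.
  apply: (@Ck_eq _ _ _ _ _ (fun x => (f \o cinv c) ((cmap c \o cinv d) x)) (f \o cinv d)) => //.
    by move=> x [[q [dq cq] <-] _] /=; rewrite (chart_cancel cd) // (chart_cancel cc).
  apply: Ck_comp_scalar (sU k) => //; first by move=> x [].
  by apply: Ck_sub (tr k) => x [].
Qed.

Lemma smooth_inP A d p f : is_atlas A -> compatible A d -> dom d p ->
  smooth_at A p f <-> smooth_in d p f.
Proof.
move=> [ac av at'] [cd h1 h2] dp; split.
  by move=> [c [Ac cp H]]; apply: (@smooth_in_trans c) => //; [exact: ac|exact: h2].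
have [c Ac cp] := av p.
move=> H; exists c; split=> //; apply: (@smooth_in_trans d) => //; [exact: ac|exact: h1].
Qed.

Section Germs.
Variable A : set (chart M E).
Hypothesis hA : is_atlas A.

Lemma smooth_at_in p : exists c, [/\ compatible A c, A c, is_chart c, dom c p &
  forall f, smooth_at A p f <-> smooth_in c p f].
Proof.
have [c Ac cp] := atlas_cover hA p.
have cc := atlas_compatible hA Ac.
exists c; split=> //; first exact: atlas_chart hA _ Ac.
by move=> f; exact: smooth_inP.
Qed.

Lemma smooth_at_eq p f g : (\forall q \near p, f q = g q) -> smooth_at A p f -> smooth_at A p g.
Proof.
have [c [_ _ cc cp H]] := smooth_at_in p.
move=> fg /H[U [oU Up Uc sU]]; apply/H.
move: fg; rewrite /prop_near1 nbhsE => -[V [oV Vp] VE].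
have oW : open (cmap c @` (dom c `&` V)).
  by apply: chart_image_open => //; apply: openI => //; exact: (chart_open cc).
exists (U `&` cmap c @` (dom c `&` V)); split.
- exact: openI.
- by split=> //; exists p.
- by move=> x [/Uc].
- move=> k; apply: (@Ck_eq _ _ _ _ _ (f \o cinv c)); first exact: openI.
    by move=> x [_ [q [cq Vq] <-]] /=; rewrite (chart_cancel cc) //; exact: VE.
  by apply: Ck_sub (sU k) => x [].
Qed.

Lemma smooth_at_open p f : smooth_at A p f -> \forall q \near p, smooth_at A q f.
Proof.
have [c [kc _ cc cp H]] := smooth_at_in p.
move=> /H[U [oU Up Uc sU]].
have oV := chart_preimage_open cc oU.
have : nbhs p (dom c `&` cmap c @^-1` U) by exact: open_nbhs_nbhs.
apply: filterS => q [cq Uq]; apply/(smooth_inP _ hA kc cq).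
by exists U.
Qed.

Lemma smooth_at_continuous p f : smooth_at A p f -> {for p, continuous f}.
Proof.
have [c [_ _ cc cp H]] := smooth_at_in p.
move=> /H[U [oU Up Uc sU]].
have cf : {for p, continuous ((f \o cinv c) \o cmap c)}.
  apply: continuous_comp; first exact: (chart_cmap_cont cc).
  exact: (sU 0%N).
rewrite /prop_for /continuous_at -[f p](_ : ((f \o cinv c) \o cmap c) p = _); last first.
  by rewrite /= (chart_cancel cc).
apply: cvg_trans cf; apply: near_eq_cvg.
have : nbhs p (dom c) by apply: open_nbhs_nbhs; split=> //; exact: (chart_open cc).
by apply: filterS => q cq /=; rewrite (chart_cancel cc).
Qed.

Lemma smooth_at_cst p a : smooth_at A p (fun=> a).
Proof.
have [c [_ _ cc cp H]] := smooth_at_in p.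
by apply/H; exists (cimg c); split=> // [||k]; [exact: (chart_img_open cc)|exists p|exact: Ck_cst].
Qed.

Lemma smooth_at_op2 (op : R -> R -> R) p f g :
  (forall k (U : set E) (u v : E -> R^o), open U -> Ck k U u -> Ck k U v -> Ck k U (fun x => op (u x) (v x) : R^o)) ->
  smooth_at A p f -> smooth_at A p g -> smooth_at A p (fun q => op (f q) (g q)).
Proof.
have [c [_ _ cc cp H]] := smooth_at_in p.
move=> Hop /H[U [oU Up Uc sU]] /H[V [oV Vp Vc sV]]; apply/H.
exists (U `&` V); split=> //; [exact: openI|by move=> x [/Uc]|].
move=> k; apply: (Hop k (U `&` V) (f \o cinv c) (g \o cinv c)); first exact: openI.
  by apply: Ck_sub (sU k) => x [].
by apply: Ck_sub (sV k) => x [].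
Qed.

Lemma smooth_at_add p f g : smooth_at A p f -> smooth_at A p g ->
  smooth_at A p (fun q => f q + g q).
Proof. by apply: (smooth_at_op2 (op := fun x y => x + y)) => k U u v; exact: Ck_add. Qed.

Lemma smooth_at_mul p f g : smooth_at A p f -> smooth_at A p g ->
  smooth_at A p (fun q => f q * g q).
Proof. by apply: (smooth_at_op2 (op := fun x y => x * y)) => k U u v; exact: Ck_mul. Qed.

Lemma smooth_at_opp p f : smooth_at A p f -> smooth_at A p (fun q => - f q).
Proof.
move=> sf; apply: (@smooth_at_eq p (fun q => -1 * f q)).
  by apply: nearW => q; rewrite mulN1r.
by apply: smooth_at_mul => //; exact: smooth_at_cst.
Qed.

Lemma smooth_at_sub p f g : smooth_at A p f -> smooth_at A p g ->
  smooth_at A p (fun q => f q - g q).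
Proof. by move=> sf sg; apply: smooth_at_add => //; exact: smooth_at_opp. Qed.

Lemma smooth_at_sum p (I : Type) (s : seq I) (P : pred I) (f : I -> M -> R) :
  (forall i, smooth_at A p (f i)) -> smooth_at A p (fun q => \sum_(i <- s | P i) f i q).
Proof.
move=> H; elim: s => [|i s IH].
  by apply: (@smooth_at_eq p (fun=> 0)); [apply: nearW => q; rewrite big_nil|exact: smooth_at_cst].
apply: (@smooth_at_eq p (fun q => (if P i then f i q else 0) + \sum_(i <- s | P i) f i q)).
  by apply: nearW => q; rewrite big_cons; case: ifP => //; rewrite add0r.
by apply: smooth_at_add => //; case: (P i); [exact: H|exact: smooth_at_cst].
Qed.

Lemma smooth_at_prod p (I : Type) (s : seq I) (P : pred I) (f : I -> M -> R) :
  (forall i, smooth_at A p (f i)) -> smooth_at A p (fun q => \prod_(i <- s | P i) f i q).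
Proof.
move=> H; elim: s => [|i s IH].
  by apply: (@smooth_at_eq p (fun=> 1)); [apply: nearW => q; rewrite big_nil|exact: smooth_at_cst].
apply: (@smooth_at_eq p (fun q => (if P i then f i q else 1) * \prod_(i <- s | P i) f i q)).
  by apply: nearW => q; rewrite big_cons; case: ifP => //; rewrite mul1r.
by apply: smooth_at_mul => //; case: (P i); [exact: H|exact: smooth_at_cst].
Qed.

Lemma smooth_at_comp p f (V : set R^o) (g : R^o -> R^o) : open V -> V (f p) ->
  smooth_on V g -> smooth_at A p f -> smooth_at A p (fun q => g (f q)).
Proof.
have [c [_ _ cc cp H]] := smooth_at_in p.
move=> oV Vp sg /H[U [oU Up Uc sU]]; apply/H.
have oW := Ck_open_preimage oU oV (sU 0%N).
exists (U `&` (f \o cinv c) @^-1` V); split=> //.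
- by split=> //=; rewrite (chart_cancel cc).
- by move=> x [/Uc].
- move=> k; apply: (@Ck_comp_scalar _ _ _ _ _ _ V (f \o cinv c) g) => //; first by move=> x [].
  by apply: Ck_sub (sU k) => x [].
Qed.

Lemma smooth_at_inv p f : f p != 0 -> smooth_at A p f -> smooth_at A p (fun q => (f q)^-1).
Proof.
move=> fp; apply: (@smooth_at_comp p f [set x | x != 0] (fun x => x^-1)) => //.
by move=> k; apply: Ck_inv => [||]; [exact: open_neq|by []|exact: Ck_id].
Qed.

Lemma smooth_at_chart d p (V : set E) (g : E -> R^o) : compatible A d -> dom d p ->
  open V -> V (cmap d p) -> smooth_on V g -> smooth_at A p (fun q => g (cmap d q)).
Proof.
move=> kd dp oV Vp sg; have cd := compatible_chart kd.
apply/(smooth_inP _ hA kd dp).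
have oI : open (cimg d `&` V) by apply: openI => //; exact: (chart_img_open cd).
exists (cimg d `&` V); split=> //.
- by split=> //; exists p.
- move=> k; apply: (@Ck_eq _ _ _ _ _ g) => //.
    by move=> x [dx _] /=; rewrite chart_invK.
  by apply: Ck_sub (sg k) => x [].
Qed.

Lemma smooth_at_lcoord d p (l : {linear E -> R^o}) : compatible A d -> dom d p ->
  smooth_at A p (fun q => l (cmap d q)).
Proof.
move=> kd dp; apply: (@smooth_at_chart d p setT l) => //; first exact: openT.
by move=> k; apply: Ck_lin; exact: lin_continuous.
Qed.

Section Tangent.
Variables (p : M) (v : vec R M).
Hypothesis tv : is_tangent A p v.

Lemma tangent0 : v (fun=> 0) = 0.
Proof.
have := tv.1 1 (fun=> 0) (fun=> 0) (smooth_at_cst p 0) (smooth_at_cst p 0).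
rewrite (_ : (fun=> _) = fun=> 0); last by apply/funext => x; rewrite mulr0 addr0.
by move=> h; move: h; rewrite mul1r => h; lra.
Qed.

Lemma tangentD f g : smooth_at A p f -> smooth_at A p g -> v (fun q => f q + g q) = v f + v g.
Proof.
move=> sf sg; rewrite -[v f]mul1r -tv.1 //; congr v.
by apply/funext => q; rewrite mul1r.
Qed.

Lemma tangentZ a f : smooth_at A p f -> v (fun q => a * f q) = a * v f.
Proof.
move=> sf; have := tv.1 a f (fun=> 0) sf (smooth_at_cst p 0).
rewrite tangent0 addr0 => <-; congr v.
by apply/funext => q; rewrite addr0.
Qed.

Lemma tangentN f : smooth_at A p f -> v (fun q => - f q) = - v f.
Proof.
by move=> sf; rewrite -mulN1r -tangentZ //; congr v; apply/funext => q; rewrite mulN1r.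
Qed.

Lemma tangentB f g : smooth_at A p f -> smooth_at A p g -> v (fun q => f q - g q) = v f - v g.
Proof. by move=> sf sg; rewrite tangentD ?tangentN //; exact: smooth_at_opp. Qed.

Lemma tangentM f g : smooth_at A p f -> smooth_at A p g -> v (fun q => f q * g q) = f p * v g + g p * v f.
Proof. exact: tv.2. Qed.

Lemma tangent_cst a : v (fun=> a) = 0.
Proof.
have h : v (fun=> 1) = 0.
  have := tangentM (smooth_at_cst p 1) (smooth_at_cst p 1).
  rewrite (_ : (fun=> 1 * 1) = (fun=> 1)); last by apply/funext => x; rewrite mul1r.
  by rewrite mul1r => h; lra.
have := tangentZ a (smooth_at_cst p 1); rewrite h mulr0 => <-; congr v.
by apply/funext => x; rewrite mulr1.
Qed.

(** The indicator chi of the set where f = g is 1 near p, hence smooth there, and (f - g) chi is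
    identically 0: the product rule then gives v (f - g) = 0. *)
Lemma tangent_eq f g : (\forall q \near p, f q = g q) -> smooth_at A p f -> v f = v g.
Proof.
move=> fg sf; have sg := smooth_at_eq fg sf.
pose chi q : R := (f q == g q)%:R.
have schi : smooth_at A p chi.
  apply: (@smooth_at_eq p (fun=> 1)) (smooth_at_cst p 1).
  by apply: filterS fg => q fq; rewrite /chi fq eqxx.
have e : (fun q => (f q - g q) * chi q) = fun=> 0.
  by apply/funext => q; rewrite /chi; case: eqP => [->|_]; rewrite ?subrr ?mul0r ?mulr0.
have fgp : f p = g p := nbhs_singleton fg.
have := tangentM (smooth_at_sub sf sg) schi.
rewrite e tangent0 fgp subrr mul0r add0r {1}/chi fgp eqxx.
by rewrite mul1r tangentB // => /esym/eqP; rewrite subr_eq0 => /eqP.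
Qed.

Lemma tangent_sum (I : Type) (s : seq I) (P : pred I) (f : I -> M -> R) :
  (forall i, smooth_at A p (f i)) ->
  v (fun q => \sum_(i <- s | P i) f i q) = \sum_(i <- s | P i) v (f i).
Proof.
move=> sf; elim: s => [|i s IH].
  by rewrite big_nil -[RHS]tangent0; congr v; apply/funext => q; rewrite big_nil.
rewrite big_cons -IH; case: ifP => Pi.
  by rewrite -tangentD //; [congr v; apply/funext => q; rewrite big_cons Pi|exact: smooth_at_sum].
by congr v; apply/funext => q; rewrite big_cons Pi.
Qed.

End Tangent.

Lemma is_tangent_comb p a v b w : is_tangent A p v -> is_tangent A p w -> is_tangent A p (vcomb a v b w).
Proof.
move=> [v1 v2] [w1 w2]; split=> [x f g sf sg|f g sf sg]; rewrite /vcomb.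
  by rewrite v1 // w1 //; ring.
by rewrite v2 // w2 //; ring.
Qed.

Definition chart_vec d p (w : E) : vec R M := fun f => 'D_w (f \o cinv d : E -> R^o) (cmap d p).

Lemma smooth_in_differentiable d p f : compatible A d -> dom d p -> smooth_at A p f ->
  differentiable (f \o cinv d : E -> R^o) (cmap d p).
Proof.
by move=> kd dp /(smooth_inP _ hA kd dp)[U [oU Up Uc sU]]; exact: (sU 1%N).1.
Qed.

Lemma chart_vec_tangent d p w : compatible A d -> dom d p -> is_tangent A p (chart_vec d p w).
Proof.
move=> kd dp; split=> [a f g sf sg|f g sf sg].
  have df := smooth_in_differentiable kd dp sf; have dg := smooth_in_differentiable kd dp sg.
  rewrite /chart_vec -[LHS]/('D_w (a *: (f \o cinv d : E -> R^o) + (g \o cinv d)) (cmap d p)).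
  rewrite deriveD ?deriveZ //; apply: diff_derivable => //; exact: differentiableZ.
have df := smooth_in_differentiable kd dp sf; have dg := smooth_in_differentiable kd dp sg.
rewrite /chart_vec -[LHS]/('D_w ((f \o cinv d : E -> R^o) * (g \o cinv d)) (cmap d p)).
rewrite deriveM; [|exact: diff_derivable..].
by rewrite /= (chart_cancel (compatible_chart kd)).
Qed.

End Germs.
End Manifold.

Section ManifoldRn.
Context {R : realType} {n : nat} {M : topologicalType}.
Local Notation V := 'rV[R]_n.
Variable A : set (chart M V).
Hypothesis hA : is_atlas A.
Implicit Types (d : chart M V) (p q : M) (f g : M -> R).

Definition coord d (i : 'I_n) q : R := cmap d q 0 i.

Lemma smooth_at_coord d p i : compatible A d -> dom d p -> smooth_at A p (coord d i).
Proof. by move=> kd dp; exact: (smooth_at_lcoord hA (row_coord i) kd dp). Qed.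

(* Hadamard's lemma is what makes the space of derivations finite-dimensional. *)
Lemma tangentE d p v f : compatible A d -> dom d p -> is_tangent A p v -> smooth_at A p f ->
  v f = \sum_i v (coord d i) * chart_vec d p 'e_i f.
Proof.
move=> kd dp tv sf.
have cd := compatible_chart kd.
have /(smooth_inP _ hA kd dp)[U [oU Up Uc sU]] := sf.
have /nbhs_ballP[r /= r0 rU] := open_nbhs_nbhs (conj oU Up).
have sB : smooth_on (ball (cmap d p) r) (f \o cinv d : V -> R^o).
  by move=> k; exact: Ck_sub (sU k).
have [g [sg Hg Dg]] := hadamard pred0 r0 sB.
have h0 x : hline (cmap d p) pred0 0 x = cmap d p.
  by apply/rowP => i; rewrite !mxE /hcoef /= mul0r addr0.
have Bp : ball (cmap d p) r (cmap d p) by exact: ballxx.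
have sgi i : smooth_at A p (fun q => g i (cmap d q)).
  apply: (smooth_at_chart hA kd dp _ Bp (sg i)); exact: ball_open.
have sci i : smooth_at A p (fun q => coord d i q - coord d i p).
  by apply: smooth_at_sub => //; [exact: smooth_at_coord|exact: smooth_at_cst].
have E1 : \forall q \near p, f q = f p + \sum_i (coord d i q - coord d i p) * g i (cmap d q).
  have : nbhs p (dom d `&` cmap d @^-1` (ball (cmap d p) r)).
    apply: open_nbhs_nbhs; split; last by split.
    by apply: chart_preimage_open => //; exact: ball_open.
  apply: filterS => q [dq Bq].
  have := Hg _ Bq; rewrite h0 /= !(chart_cancel cd) // => ->.
  by congr (_ + _); apply: eq_bigr => i _; rewrite /coord !mxE.
rewrite (tangent_eq hA tv E1 sf) (tangentD tv) //; last 2 first.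
- exact: smooth_at_cst.
- by apply: smooth_at_sum => // i; exact: smooth_at_mul.
rewrite (tangent_cst hA tv) add0r (tangent_sum hA tv); last by move=> i; exact: smooth_at_mul.
apply: eq_bigr => i _.
rewrite (tangentM tv) // subrr mul0r add0r (tangentB hA tv) //; last 2 first.
- exact: smooth_at_coord.
- exact: smooth_at_cst.
rewrite (tangent_cst hA tv) subr0 mulrC; congr (_ * _).
by rewrite Dg.
Qed.

Lemma tangent_comp p v f (U : set R^o) (g : R^o -> R^o) : is_tangent A p v -> smooth_at A p f ->
  open U -> U (f p) -> smooth_on U g -> v (fun q => g (f q)) = 'D_1 g (f p) * v f.
Proof.
move=> tv sf oU Up sg.
have [c [kc _ cc cp H]] := smooth_at_in hA p.
have sgf : smooth_at A p (fun q => g (f q)) by exact: (smooth_at_comp hA oU Up sg sf).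
rewrite (tangentE kc cp tv sgf) (tangentE kc cp tv sf) mulr_sumr; apply: eq_bigr => i _.
rewrite mulrCA; congr (_ * _).
have df : differentiable (f \o cinv c : V -> R^o) (cmap c p) by exact: (smooth_in_differentiable hA kc cp sf).
have dg : differentiable g ((f \o cinv c) (cmap c p)).
  by rewrite /= (chart_cancel cc) //; exact: (sg 1%N).1.
rewrite /chart_vec -[LHS]/('D_('e_i) (fun x => g ((f \o cinv c) x)) (cmap c p)).
rewrite (derive_comp (fF := fbasis_R R)) // [LHS]big_ord1 /= (chart_cancel cc) //.
by rewrite /GRing.scale /= mulrC.
Qed.

Lemma chart_vec_coord d p w i : compatible A d -> dom d p -> chart_vec d p w (coord d i) = w 0 i.
Proof.
move=> kd dp; have cd := compatible_chart kd.
rewrite /chart_vec.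
have e : \forall x \near cmap d p, (row_coord i : V -> R^o) x = (coord d i \o cinv d) x.
  have : nbhs (cmap d p) (cimg d) by apply: open_nbhs_nbhs; split; [exact: (chart_img_open cd)|exists p].
  by apply: filterS => x dx; rewrite /coord /= chart_invK.
rewrite -(near_eq_derive _ e) deriveE; last exact: differentiable_coord.
by rewrite diff_lin //; exact: coord_continuous.
Qed.

(** Every adapted chart below is a given chart followed by a diffeomorphism from the inverse
    function theorem. *)
Lemma compatible_diffeo d p (W W' : set V) (f g : V -> V) : compatible A d -> dom d p ->
  diffeo W W' f g -> W (cmap d p) -> W `<=` cimg d ->
  let d' := Chart (dom d `&` cmap d @^-1` W) (f \o cmap d) (cinv d \o g) in
  [/\ compatible A d', dom d' p & cimg d' = W'].
Proof.
move=> kd dp [oW oW' fm gm K Kr sf sg] Wp Wd d'.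
have cd := compatible_chart kd.
have Ed : cimg d' = W'.
  apply/seteqP; split=> y; first by move=> [q [dq Wq] <-]; exact: fm.
  move=> W'y; have [q dq e] := Wd _ (gm _ W'y).
  by exists q; [split=> //=; rewrite e; exact: gm|rewrite /= e Kr].
split; [split|by split|exact: Ed].
- split.
  + exact: chart_preimage_open.
  + by rewrite Ed.
  + by move=> q [dq Wq]; rewrite /= K // (chart_cancel cd).
  + move=> q [dq Wq]; apply: continuous_comp; first exact: (chart_cmap_cont cd).
    exact: (sf 0%N).
  + rewrite Ed => y W'y; apply: continuous_comp; first exact: (sg 0%N).
    by apply: (chart_cinv_cont cd); apply: Wd; exact: gm.
- move=> c Ac k.
  have tk := compatible_to kd Ac k.
  have oc : open (cmap c @` (dom c `&` dom d)).
    apply: chart_image_open; [exact: atlas_chart hA _ Ac|apply: openI|by move=> q []].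
      exact: (chart_open (atlas_chart hA Ac)).
    exact: (chart_open cd).
  have sub : cmap c @` (dom c `&` dom d') `<=` cmap c @` (dom c `&` dom d).
    by move=> x [q [cq [dq _]] <-]; exists q.
  have oc' : open (cmap c @` (dom c `&` dom d')).
    apply: chart_image_open; [exact: atlas_chart hA _ Ac|apply: openI|by move=> q []].
      exact: (chart_open (atlas_chart hA Ac)).
    exact: chart_preimage_open.
  apply: (@Ck_comp _ _ _ _ _ _ _ _ W (cmap d \o cinv c) f) => //.
    by move=> x [q [cq [dq Wq]] <-] /=; rewrite (chart_cancel (atlas_chart hA Ac)).
  exact: Ck_sub tk.
- move=> c Ac k.
  have tk := compatible_from kd Ac k.
  have oc : open (cmap d @` (dom d `&` dom c)).
    apply: chart_image_open => //; apply: openI; first exact: (chart_open cd).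
    exact: (chart_open (atlas_chart hA Ac)).
  have sub : cmap d' @` (dom d' `&` dom c) `<=` W'.
    by rewrite -Ed => x [q [d'q _] <-]; exists q.
  have oc' : open (cmap d' @` (dom d' `&` dom c)).
    rewrite (_ : _ @` _ = W' `&` g @^-1` (cmap d @` (dom d `&` dom c))).
      exact: Ck_open_preimage (sg 0%N).
    apply/seteqP; split=> y.
      by move=> [q [[dq Wq] cq] <-]; split; [exact: fm|exists q => //=; rewrite K].
    move=> [W'y [q [dq cq] e]]; have Wq : W (cmap d q) by rewrite e; exact: gm.
    by exists q => //=; rewrite e Kr.
  apply: (@Ck_comp _ _ _ _ _ _ _ _ (cmap d @` (dom d `&` dom c)) g (cmap c \o cinv d)) => //.
    by move=> x [q [[dq Wq] cq] <-]; exists q => //=; rewrite K.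
  by apply: Ck_sub (sg k).
Qed.

End ManifoldRn.

(** * Products of manifolds, and charts prescribed by functions *)

Section proj.
Context {R : realType} (E F : normedModType R).
Definition fstL (x : E * F) : E := x.1.
Lemma fstL_is_linear : linear fstL. Proof. by []. Qed.
HB.instance Definition _ := GRing.isLinear.Build R (E * F)%type E _ fstL fstL_is_linear.
Definition sndL (x : E * F) : F := x.2.
Lemma sndL_is_linear : linear sndL. Proof. by []. Qed.
HB.instance Definition _ := GRing.isLinear.Build R (E * F)%type F _ sndL sndL_is_linear.
End proj.

Section ProductCharts.
Context {R : realType}.

Lemma Ck_pair (E F G : normedModType R) {fF : fbasis F} {fG : fbasis G} k (U : set E)
    (f : E -> F) (g : E -> G) : open U -> Ck k U f -> Ck k U g -> Ck k U (fun x => (f x, g x)).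
Proof.
move=> oU Hf Hg; apply/(@cCkP _ _ _ (fbasis_prod fF fG)) => //= -[i|i].
  by apply: (@Ck_post _ _ _ _ _ _ f (bl i)) => //; exact: bl_cont.
by apply: (@Ck_post _ _ _ _ _ _ g (bl i)) => //; exact: bl_cont.
Qed.

Lemma Ck_fst (E F G : normedModType R) {fE : fbasis E} {fF : fbasis F} k (U : set (E * F)) (V : set E) (f : E -> G) :
  open V -> (forall x, U x -> V x.1) -> Ck k V f -> Ck k U (fun x => f x.1).
Proof.
move=> oV UV Hf; apply: Ck_sub (@Ck_lincomp _ (E * F)%type _ _ (fbasis_prod fE fF) k V (@fstL _ E F) f oV Hf).
by move=> x /UV.
Qed.

Lemma Ck_snd (E F G : normedModType R) {fE : fbasis E} {fF : fbasis F} k (U : set (E * F)) (V : set F) (f : F -> G) :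
  open V -> (forall x, U x -> V x.2) -> Ck k V f -> Ck k U (fun x => f x.2).
Proof.
move=> oV UV Hf; apply: Ck_sub (@Ck_lincomp _ (E * F)%type _ _ (fbasis_prod fE fF) k V (@sndL _ E F) f oV Hf).
by move=> x /UV.
Qed.

Section Prod.
Context {E F : normedModType R} {fE : fbasis E} {fF : fbasis F} {M N : topologicalType}.
Implicit Types (c : chart M E) (d : chart N F).

Lemma prod_cimg c d : cimg (prod_chart c d) = [set x | cimg c x.1 /\ cimg d x.2].
Proof.
apply/seteqP; split=> -[x y] /=.
  by move=> [[p q] [/= cp dq] [<- <-]]; split; [exists p|exists q].
by move=> [[p cp <-] [q dq <-]]; exists (p, q).
Qed.

Lemma open_prod (U : set M) (V : set N) : open U -> open V -> open [set z : M * N | U z.1 /\ V z.2].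
Proof.
move=> oU oV; apply: openI; apply: open_comp => // z _; [exact: cvg_fst|exact: cvg_snd].
Qed.

Lemma open_prodV (U : set E) (V : set F) : open U -> open V -> open [set z : E * F | U z.1 /\ V z.2].
Proof.
move=> oU oV; apply: openI; apply: open_comp => // z _; [exact: cvg_fst|exact: cvg_snd].
Qed.

Lemma prod_is_chart c d : is_chart c -> is_chart d -> is_chart (prod_chart c d).
Proof.
move=> [oc oic Kc cc cic] [od oid Kd cd cid]; split.
- exact: open_prod.
- by rewrite prod_cimg; exact: open_prodV.
- by move=> [p q] /= [cp dq]; rewrite Kc ?Kd.
- move=> [p q] /= [cp dq].
  have h1 : {for (p, q), continuous (cmap c \o fst)}.
    by apply: continuous_comp; [exact: cvg_fst|exact: cc].
  have h2 : {for (p, q), continuous (cmap d \o snd)}.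
    by apply: continuous_comp; [exact: cvg_snd|exact: cd].
  exact: cvg_pair h1 h2.
- rewrite prod_cimg => -[x y] /= [cx dy].
  have h1 : {for (x, y), continuous (cinv c \o fst)}.
    by apply: continuous_comp; [exact: cvg_fst|exact: cic].
  have h2 : {for (x, y), continuous (cinv d \o snd)}.
    by apply: continuous_comp; [exact: cvg_snd|exact: cid].
  exact: cvg_pair h1 h2.
Qed.

Lemma prod_transition c c' d d' : is_chart c -> is_chart c' -> is_chart d -> is_chart d' ->
  smooth_on (cmap c @` (dom c `&` dom c')) (cmap c' \o cinv c) ->
  smooth_on (cmap d @` (dom d `&` dom d')) (cmap d' \o cinv d) ->
  smooth_on (cmap (prod_chart c d) @` (dom (prod_chart c d) `&` dom (prod_chart c' d')))
    (cmap (prod_chart c' d') \o cinv (prod_chart c d)).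
Proof.
move=> hc hc' hd hd' sc sd k.
have oc : open (cmap c @` (dom c `&` dom c')).
  by apply: chart_image_open => //; [apply: openI; [exact: (chart_open hc)|exact: (chart_open hc')]].
have od : open (cmap d @` (dom d `&` dom d')).
  by apply: chart_image_open => //; [apply: openI; [exact: (chart_open hd)|exact: (chart_open hd')]].
rewrite (_ : _ @` _ = [set z | (cmap c @` (dom c `&` dom c')) z.1 /\ (cmap d @` (dom d `&` dom d')) z.2]).
  apply: Ck_pair; first exact: open_prodV.
    by apply: (Ck_fst oc _ (sc k)) => z [].
  by apply: (Ck_snd od _ (sd k)) => z [].
apply/seteqP; split=> -[x y] /=.
  by move=> [[p q] [/= [cp dq] [cp' dq']] [<- <-]]; split; [exists p|exists q].
by move=> [[p [cp cp'] <-] [q [dq dq'] <-]]; exists (p, q).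
Qed.

Lemma prod_is_atlas (A : set (chart M E)) (B : set (chart N F)) :
  is_atlas A -> is_atlas B -> is_atlas (prod_atlas A B).
Proof.
move=> [A1 A2 A3] [B1 B2 B3]; split.
- by move=> _ [c [d [Ac Bd ->]]]; apply: prod_is_chart; [exact: A1|exact: B1].
- move=> [p q]; have [c Ac cp] := A2 p; have [d Bd dq] := B2 q.
  by exists (prod_chart c d) => //; exists c, d.
- move=> _ _ [c [d [Ac Bd ->]]] [c' [d' [Ac' Bd' ->]]].
  by apply: prod_transition; [exact: A1|exact: A1|exact: B1|exact: B1|exact: A3|exact: B3].
Qed.

Lemma prod_compatible (A : set (chart M E)) (B : set (chart N F)) c d :
  is_atlas A -> is_atlas B -> compatible A c -> compatible B d ->
  compatible (prod_atlas A B) (prod_chart c d).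
Proof.
move=> [A1 _ _] [B1 _ _] [c1 c2 c3] [d1 d2 d3]; split; first exact: prod_is_chart.
  move=> _ [c' [d' [Ac Bd ->]]].
  by apply: prod_transition => //; [exact: A1|exact: B1|exact: c2|exact: d2].
move=> _ [c' [d' [Ac Bd ->]]].
by apply: prod_transition => //; [exact: A1|exact: B1|exact: c3|exact: d3].
Qed.

End Prod.

Definition line_chart : chart R R^o := Chart setT id id.

Lemma line_chart_is_chart : is_chart (line_chart).
Proof.
have e : cimg line_chart = setT by apply/seteqP; split=> // x _; exists x.
split=> //; rewrite ?e; try exact: openT.
- by move=> p _; exact: cvg_id.
- by move=> p _; exact: cvg_id.
Qed.

Lemma line_is_atlas : is_atlas (@line_atlas R).
Proof.
split.
- by move=> _ ->; exact: line_chart_is_chart.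
- by move=> p; exists line_chart.
- by move=> _ _ -> -> k; exact: Ck_id.
Qed.

Lemma line_compatible : compatible (@line_atlas R) line_chart.
Proof. by apply: atlas_compatible; [exact: line_is_atlas|]. Qed.

End ProductCharts.

Section Functions3.
Context {R : realType}.

Lemma ord3P (P : 'I_3 -> Prop) : P i1 -> P i2 -> P i3 -> forall i, P i.
Proof.
move=> h1 h2 h3 [[|[|[|//]]] h].
- by rewrite (_ : Ordinal h = i1) //; exact: val_inj.
- by rewrite (_ : Ordinal h = i2) //; exact: val_inj.
- by rewrite (_ : Ordinal h = i3) //; exact: val_inj.
Qed.

Lemma sum3 (V : zmodType) (F : 'I_3 -> V) : \sum_(i < 3) F i = F i1 + F i2 + F i3.
Proof.
rewrite !big_ord_recl big_ord0 addr0 addrA.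
by congr (F _ + F _ + F _); apply: val_inj.
Qed.

End Functions3.

Section ChartOfFunctions.
Context {R : realType} {n : nat} {M : topologicalType}.
Local Notation V := 'rV[R]_n.
Variable A : set (chart M V).
Hypothesis hA : is_atlas A.
Implicit Types (d : chart M V) (p q : M) (f g : M -> R).

Lemma tangent_coord0 d p v : compatible A d -> dom d p -> is_tangent A p v ->
  (forall i, v (coord d i) = 0) -> veq A p v (fun=> 0).
Proof.
by move=> kd dp tv v0 f sf; rewrite (tangentE hA kd dp tv sf) big1 // => i _; rewrite v0 mul0r.
Qed.

(** A row in the kernel of the Jacobian of f read in a chart is a coordinate vector killing every
    f_j, hence 0 by hypothesis, and the inverse function theorem applies. The image is cut down to a
    ball so that Hadamard's lemma can be used in the new chart. *)
Lemma chart_of_functions p (f : 'I_n -> M -> R) (U : set M) :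
  open U -> U p -> (forall j, smooth_at A p (f j)) ->
  (forall v, is_tangent A p v -> (forall j, v (f j) = 0) -> veq A p v (fun=> 0)) ->
  exists d r, [/\ compatible A d, dom d p, dom d `<=` U, 0 < r & cimg d = ball (0 : V) r /\
    forall j q, dom d q -> coord d j q = f j q - f j p].
Proof.
move=> oU Up sf inj.
have [c [kc _ cc cp Hc]] := smooth_at_in hA p.
have /choice[WW H] : forall j, exists W : set V, [/\ open W, W (cmap c p), W `<=` cimg c & smooth_on W (f j \o cinv c : V -> R^o)].
  by move=> j; have /Hc := sf j.
pose W0 : set V := (cmap c @` (dom c `&` U)) `&` [set x | forall j, WW j x].
have oW0 : open W0.
  apply: openI.
    by apply: chart_image_open => //; [apply: openI => //; exact: (chart_open cc)].
  rewrite openE => x Wx; apply: (@filter_forall _ _ _ (nbhs x)) => j.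
  by apply: open_nbhs_nbhs; split; [case: (H j)|exact: Wx].
have W0p : W0 (cmap c p).
  by split; [exists p|move=> j; case: (H j)].
pose G (x : V) : V := \row_j (f j (cinv c x) - f j p).
have sG : smooth_on W0 G.
  move=> k; apply/cCkP => // j /=.
  rewrite (_ : (fun x => _) = fun x => (f j \o cinv c) x + (- f j p) : R^o); last by apply/funext => x; rewrite /row_coord mxE.
  apply: Ck_add => //; last exact: Ck_cst.
  by have [_ _ _ /(_ k)] := H j; apply: Ck_sub => x [_ Wx]; exact: Wx.
have dG : differentiable G (cmap c p) by exact: (sG 1%N).1.
have DG w j : ('D_w G (cmap c p)) 0 j = chart_vec c p w (f j).
  have eG : (row_coord j \o G) = (f j \o cinv c : V -> R^o) + cst (- f j p).
    by apply/funext => x; rewrite /= /row_coord mxE.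
  have := derive_post w (@coord_continuous R 1 n ord0 j : continuous (row_coord j)) dG.
  rewrite -[X in 'D_w X _]/(row_coord j \o G) eG => e.
  rewrite -[LHS]/(row_coord j ('D_w G (cmap c p))) -e.
  have df : differentiable (f j \o cinv c : V -> R^o) (cmap c p) by exact: (smooth_in_differentiable hA kc cp (sf j)).
  by rewrite deriveD ?derive_cst ?addr0 //; exact: diff_derivable.
have JG : Jmx G (cmap c p) \in unitmx.
  rewrite -row_free_unit -kermx_eq0; apply/rowV0P => w /sub_kermxP e.
  have tv : is_tangent A p (chart_vec c p w) by exact: chart_vec_tangent.
  have vz : veq A p (chart_vec c p w) (fun=> 0).
    by apply: inj => // j; rewrite -DG derive_Jmx // e mxE.
  apply/rowP => i; rewrite mxE -(chart_vec_coord w i kc cp); apply: vz.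
  exact: smooth_at_coord.
have [V1 [W1 [g [D1 V1p V1W]]]] := inverse_function oW0 W0p sG JG.
have G0 : G (cmap c p) = 0 by apply/rowP => j; rewrite !mxE (chart_cancel cc) // subrr.
have W10 : W1 0 by rewrite -G0; exact: (df_map D1).
have /nbhs_ballP[r /= r0 rW] := open_nbhs_nbhs (conj (df_openr D1) W10).
have D2 := diffeo_sym (diffeo_sub (diffeo_sym D1) (ball_open 0 r) rW).
have V2p : (V1 `&` G @^-1` (ball 0 r)) (cmap c p).
  by split=> //; rewrite /= G0; exact: ballxx.
have V2c : V1 `&` G @^-1` (ball 0 r) `<=` cimg c.
  by move=> x [/V1W[[q [cq _] <-] _] _]; exists q.
have /= [kd dp Ed] := compatible_diffeo hA kc cp D2 V2p V2c.
exists (Chart (dom c `&` cmap c @^-1` (V1 `&` G @^-1` ball 0 r)) (G \o cmap c) (cinv c \o g)), r; split=> //.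
  by move=> q [cq [/V1W[[q' [cq' Uq']] e _] _]]; rewrite -(chart_cancel cc cq) -e (chart_cancel cc).
split=> // j q [cq _].
by rewrite /coord /= /G mxE (chart_cancel cc).
Qed.

End ChartOfFunctions.

(** * Curves, velocities and vector fields read in charts *)

Section Curves.
Context {R : realType} {E : normedModType R} {fE : fbasis E} {M : topologicalType}.
Variable A : set (chart M E).
Hypothesis hA : is_atlas A.
Variables (X : field R M) (J : set R) (gamma : R -> M).
Hypothesis sX : smooth_field A X.
Hypothesis hgamma : integral_curve A X J gamma.
Implicit Types (f : M -> R) (s : R).

Lemma indicator_smooth (V : set M) p : open V -> V p -> smooth_at A p (fun q => `[< V q >]%:R).
Proof.
move=> oV Vp; apply: (@smooth_at_eq _ _ _ _ A hA p (fun=> 1)); last exact: smooth_at_cst.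
have nV : nbhs p V by exact: open_nbhs_nbhs.
by apply: filterS nV => q Vq; rewrite asboolT.
Qed.

(* An integral curve is only assumed to be differentiable against smooth
   functions; testing it on indicators of neighbourhoods gives continuity. *)
Lemma curve_continuous s : J s -> {for s, continuous gamma}.
Proof.
move=> Js V; rewrite nbhsE => -[W [oW Wp] WV].
have [d _] := curve_derive hgamma Js (indicator_smooth oW Wp).
have /differentiable_continuous cf := (derivable1_diffP _ _).1 d.
have : \forall t \near s, (fun q => `[< W q >]%:R) (gamma t) != 0 :> R.
  apply: (cf [set x | x != 0]); apply: open_nbhs_nbhs; split; first exact: open_neq.
  by rewrite /= asboolT // oner_neq0.
by apply: filterS => t; case: asboolP => [/WV //|]; rewrite eqxx.
Qed.

(** The derivative of f along the curve is the smooth function X f along the curve, so the induction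
    on k repeats with X f in place of f. *)
Lemma curve_Ck k (O : set R^o) f : open O -> O `<=` J -> (forall s, O s -> smooth_at A (gamma s) f) ->
  Ck k O (f \o gamma : R^o -> R^o).
Proof.
elim: k f => [|k IH] f oO OJ sf.
  move=> s Os; have [d _] := curve_derive hgamma (OJ _ Os) (sf s Os).
  exact/differentiable_continuous/derivable1_diffP.
apply: (@Ck_antiderive _ _ _ _ ((fun q => X q f) \o gamma)) => //.
  by move=> s Os; apply: (curve_derive hgamma (OJ _ Os)); exact: sf.
by apply: IH => // s Os; apply: (field_smooth sX); exact: sf.
Qed.

End Curves.

Lemma derive_lin (R : realType) (u w : R^o -> R^o) (t a : R) : derivable u t 1 -> derivable w t 1 ->
  'D_1 (fun s : R^o => a * u s + w s : R^o) t = a * 'D_1 u t + 'D_1 w t.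
Proof.
move=> du dw; have da := @derivableZ _ _ _ u a t 1 du.
have e := deriveD da dw; rewrite (@deriveZ _ _ _ u a t 1 du) in e.
exact: e.
Qed.

Lemma derive_mul (R : realType) (u w : R^o -> R^o) (t : R) : derivable u t 1 -> derivable w t 1 ->
  'D_1 (fun s : R^o => u s * w s : R^o) t = u t * 'D_1 w t + w t * 'D_1 u t.
Proof. by move=> du dw; exact: (deriveM du dw). Qed.

Lemma velocity_tangent (R : realType) (E : normedModType R) (N : topologicalType)
    (B : set (chart N E)) (gamma : R -> N) t : 
  (forall g, smooth_at B (gamma t) g -> derivable (g \o gamma : R^o -> R^o) t 1) ->
  is_tangent B (gamma t) (velocity gamma t).
Proof.
move=> dg; split=> [a g h sg sh|g h sg sh].
  exact: (derive_lin a (dg g sg) (dg h sh)).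
exact: (derive_mul (dg g sg) (dg h sh)).
Qed.

Lemma prod_norm_le (R : realType) (E F : normedModType R) (x : E * F) (e : R) :
  `|x.1| <= e -> `|x.2| <= e -> `|x| <= e.
Proof. by move=> h1 h2; rewrite [leLHS]/Num.norm /= ge_max h1 h2. Qed.

Section ChartFields.
Context {R : realType} {E : normedModType R} {fE : fbasis E} {M : topologicalType}.
Variable A : set (chart M E).
Hypothesis hA : is_atlas A.

Lemma chart_vec_smooth d p w (f : M -> R) : compatible A d -> dom d p -> smooth_at A p f ->
  smooth_at A p (fun q => chart_vec d q w f).
Proof.
move=> kd dp /(smooth_inP _ hA kd dp)[U [oU Up Ud sU]].
apply: (smooth_at_chart (g := fun x => 'D_w (f \o cinv d : E -> R^o) x) hA kd dp oU Up) => k.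
exact: (sU k.+1).2.
Qed.

Lemma smooth_on_cimg d (f : M -> R) : compatible A d -> (forall p, dom d p -> smooth_at A p f) ->
  smooth_on (cimg d) (f \o cinv d : E -> R^o).
Proof.
move=> kd sf k; apply: Ck_local => x [p dp <-].
by have /(smooth_inP _ hA kd dp)[U [oU Up Ud sU]] := sf p dp; exists U.
Qed.

End ChartFields.

(** A compact set is closed because M is Hausdorff. This lets a field cut off inside a chart be
    extended smoothly by 0 to all of M. *)
Lemma chart_ball_closed (R : realType) n (M : topologicalType) (d : chart M 'rV[R]_n) r :
  hausdorff_space M -> is_chart d -> 0 < r -> [set x | `|x| <= r] `<=` cimg d ->
  closed [set q | dom d q /\ `|cmap d q| <= r].
Proof.
move=> hM cd r0 rd; apply: compact_closed => //.
have -> : [set q | dom d q /\ `|cmap d q| <= r] = cinv d @` [set x | `|x| <= r].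
  apply/seteqP; split=> [q [dq qr]|_ [x xr <-]].
    by exists (cmap d q) => //; exact: chart_cancel.
  by split; [apply: chart_inv_dom => //; exact: rd|rewrite chart_invK //; exact: rd].
apply: continuous_compact.
  by apply: continuous_in_subspaceT => x; rewrite inE => /rd; exact: chart_cinv_cont.
have := @compact_cball R n 0 r r0.
by rewrite (_ : [set x | `|x - 0| <= r] = [set x | `|x| <= r]) //; apply/seteqP; split=> x /=; rewrite subr0.
Qed.

Lemma linear_add_scale (R : realType) (V : normedModType R) (l : {linear V -> R^o}) (x y : V) (a : R) :
  l (x + a *: y) = l x + a * l y.
Proof. by rewrite linearD linearZ. Qed.

Lemma pair_decomp (R : realType) (E : normedModType R) (v : E) (a : R) :
  ((v, a) : E * R^o) = (v, 0) + a *: (0, 1).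
Proof. by apply: injective_projections; rewrite /= ?scaler0 ?addr0 // add0r [_ *: _]mulr1. Qed.

Lemma derive_graph (R : realType) (E : normedModType R) (fE : fbasis E) (k : E -> R^o) x v :
  differentiable k x -> 'D_v (fun y => (y, k y) : E * R^o) x = (v, 'D_v k x).
Proof.
move=> dk; have dm : differentiable (fun y => (y, k y) : E * R^o) x by exact: differentiable_pair.
apply: injective_projections => /=.
  have := derive_post (l := @fstL _ E R^o) v (@lin_continuous _ _ _ _ (@fstL _ E R^o)) dm.
  by move=> <-; exact: derive_id.
have := derive_post (l := @sndL _ E R^o) v (@lin_continuous _ _ _ _ (@sndL _ E R^o)) dm.
by move=> <-.
Qed.

Lemma derive_comp_graph (R : realType) (E : normedModType R) (fE : fbasis E) (k : E -> R^o) (f : E * R^o -> R^o) x v :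
  differentiable k x -> differentiable f (x, k x) ->
  differentiable (fun x => f (x, k x)) x /\
  'D_v (fun x => f (x, k x)) x = 'D_(v, 0) f (x, k x) + 'D_v k x * 'D_(0, 1) f (x, k x).
Proof.
move=> dk df; pose m x : E * R^o := (x, k x).
have dm : differentiable m x by exact: differentiable_pair.
have dfm : differentiable (f \o m) x := differentiable_comp dm df.
split; first exact: dfm.
have := deriveE v dfm; rewrite (diff_comp dm df) [RHS]/= -(deriveE v dm) derive_graph // => ->.
by rewrite pair_decomp linear_add_scale -!deriveE.
Qed.

(** The letters X, L, DD, FF, KK, V, P1, P2 stand for the absolute values of t, l, h'', h, k, h' and
    the two remainders along a trajectory. *)
Lemma umbilic_estimate_pos (R : realFieldType) (w X L DD FF KK V P1 P2 K0 Ku Kl K1 K2 : R) : 0 <= w ->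
  w * X <= L -> KK <= K0 * X -> V <= Ku * X -> L <= Kl * X -> P1 <= K1 * X -> P2 <= K2 * X ->
  L ^+ 2 * DD <= FF * KK + V * (L * P1 + V * P2) ->
  0 <= X -> 0 <= L -> 0 <= DD -> 0 <= FF -> 0 <= V -> 0 <= P1 -> 0 <= P2 ->
  0 < K0 -> 0 < Ku -> 0 < Kl -> 0 < K1 -> 0 < K2 ->
  w ^+ 2 * (X ^+ 2 * DD) <= (K0 + Kl * K1 + Ku * K2) * (X * FF + X ^+ 2 * V).
Proof.
move=> w0 lw kx ux lx r1x r2x e X0 L0 D0 F0 V0 P10 P20 K00 Ku0 Kl0 K10 K20.
have s1 : w ^+ 2 * (X ^+ 2 * DD) <= L ^+ 2 * DD.
  by rewrite mulrA -exprMn ler_wpM2r // ler_pXn2r // nnegrE mulr_ge0.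
have s2 : FF * KK <= FF * (K0 * X) by rewrite ler_wpM2l.
have s3 : L * P1 <= (Kl * X) * (K1 * X) by apply: ler_pM.
have s4 : V * P2 <= (Ku * X) * (K2 * X) by apply: ler_pM.
have s5 : V * (L * P1 + V * P2) <= V * ((Kl * X) * (K1 * X) + (Ku * X) * (K2 * X)).
  by rewrite ler_wpM2l // lerD.
apply: (le_trans s1); apply: (le_trans e); apply: (le_trans (lerD s2 s5)).
have c0 : 0 <= Kl * K1 + Ku * K2 by rewrite addr_ge0 // mulr_ge0 // ltW.
rewrite -subr_ge0 (_ : _ - _ = (Kl * K1 + Ku * K2) * (X * FF) + K0 * (X ^+ 2 * V)); last by ring.
by rewrite addr_ge0 // mulr_ge0 ?mulr_ge0 ?sqr_ge0 // ltW.
Qed.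

Lemma umbilic_estimate (R : realFieldType) (w x l dd f k u r1 r2 K0 Ku Kl K1 K2 : R) : 0 < w ->
  l ^+ 2 * dd = f * k - u * (l * r1 + u * r2) -> w * `|x| <= `|l| -> `|k| <= K0 * `|x| ->
  `|u| <= Ku * `|x| -> `|l| <= Kl * `|x| -> `|r1| <= K1 * `|x| -> `|r2| <= K2 * `|x| ->
  0 < K0 -> 0 < Ku -> 0 < Kl -> 0 < K1 -> 0 < K2 ->
  x ^+ 2 * `|dd| <= (K0 + Kl * K1 + Ku * K2) / w ^+ 2 * (`|x| * `|f| + x ^+ 2 * `|u|).
Proof.
move=> w0 E lw kx ux lx r1x r2x K00 Ku0 Kl0 K10 K20.
have xx : x ^+ 2 = `|x| ^+ 2 by rewrite real_normK ?num_real.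
have e : `|l| ^+ 2 * `|dd| <= `|f| * `|k| + `|u| * (`|l| * `|r1| + `|u| * `|r2|).
  rewrite -normrX -normrM E; apply: (le_trans (ler_normB _ _)); rewrite !normrM lerD2l ler_wpM2l //.
  by apply: (le_trans (ler_normD _ _)); rewrite !normrM.
rewrite xx [leRHS]mulrAC ler_pdivlMr ?exprn_gt0 // mulrC.
by apply: (umbilic_estimate_pos (ltW w0) lw kx ux lx r1x r2x e).
Qed.

Lemma small_step (R : realFieldType) (K e : R) : 0 < K -> e <= 1 / (4 * K) -> 2 * K * e < 1.
Proof.
by move=> K0; rewrite ler_pdivlMr ?mulr_gt0 // => h; lra.
Qed.

(** A directional derivative sees only the restriction to a line, so it can be computed in another
    space; mostly, a partial derivative becomes the derivative of a function of one variable. *)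
Lemma derive_along (R : realType) (E1 E2 F1 : normedModType R) (f : E1 -> F1) (g : E2 -> F1) x v y w :
  (forall e : R, f (e *: v + x) = g (e *: w + y)) -> 'D_v f x = 'D_w g y.
Proof.
move=> H; rewrite /derive (_ : (fun e : R => _) = (fun e : R => e^-1 *: (g (e *: w + y) - g y))) //.
apply/funext => e; rewrite /= H; congr (_ *: (_ - _)).
by have := H 0; rewrite !scale0r !add0r.
Qed.

(** * A blow-up in the plane *)

Section Plane.
Context {R : realType}.

Definition j0 : 'I_2 := @Ordinal 2 0 isT.
Definition j1 : 'I_2 := @Ordinal 2 1 isT.

Lemma ord2P (P : 'I_2 -> Prop) : P j0 -> P j1 -> forall i, P i.
Proof.
move=> h1 h2 [[|[|//]] h].
- by rewrite (_ : Ordinal h = j0) //; exact: val_inj.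
- by rewrite (_ : Ordinal h = j1) //; exact: val_inj.
Qed.

Lemma sum2 (V : zmodType) (F : 'I_2 -> V) : \sum_(i < 2) F i = F j0 + F j1.
Proof.
by rewrite !big_ord_recl big_ord0 addr0; congr (F _ + F _); apply: val_inj.
Qed.

Definition row2 (a b : R) : 'rV[R]_2 := \row_j (if j == j0 then a else b).

Lemma row2E a b : (row2 a b 0 j0 = a) * (row2 a b 0 j1 = b).
Proof. by rewrite !mxE. Qed.

Definition plane (x : 'rV[R]_2) : R^o * R^o := (x 0 j0, x 0 j1).

Lemma Ck_plane k (U : set 'rV[R]_2) : open U -> Ck k U plane.
Proof.
by move=> oU; apply: Ck_pair => //; [apply: (@Ck_lin _ _ _ _ _ (row_coord j0))|apply: (@Ck_lin _ _ _ _ _ (row_coord j1))]; exact: lin_continuous.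
Qed.

Lemma plane_row2 a b : plane (row2 a b) = (a, b).
Proof. by rewrite /plane !row2E. Qed.

Lemma plane_e0 (e a s : R) : plane (e *: 'e_j0 + row2 a s) = (e + a, s).
Proof. by rewrite /plane !mxE /= mulr1 mulr0 add0r. Qed.

Lemma blowup_open (n1 : 'rV[R]_2 -> R^o) (B : set 'rV[R]_2) : open B -> smooth_on B n1 ->
  open (B `&` n1 @^-1` [set x | x != 0]).
Proof. by move=> oB s1; apply: Ck_open_preimage (s1 0%N) => //; exact: open_neq. Qed.

(* The map (x, s) |-> (x n1, n2 / n1), a blow-up of the pair (x n1, x n2). *)
Lemma blowup_inverse (n1 n2 : 'rV[R]_2 -> R^o) (th0 k0 r : R) : 0 < r -> k0 != 0 ->
  smooth_on (ball (row2 0 th0) r) n1 -> smooth_on (ball (row2 0 th0) r) n2 ->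
  (forall s, `|s - th0| < r -> n1 (row2 0 s) = k0 * cos (s - th0)) ->
  (forall s, `|s - th0| < r -> n2 (row2 0 s) = - k0 * sin (s - th0)) ->
  exists2 e, 0 < e & forall y1 y2 : R, `|y1| < e -> `|y2| < e -> exists x : 'rV[R]_2,
    [/\ ball (row2 0 th0) r x, x 0 j0 * n1 x = y1 & x 0 j0 * n2 x = y1 * y2].
Proof.
move=> r0 k00 s1 s2 N1 N2.
pose x0 := row2 0 th0.
have B0 : ball x0 r x0 by exact: ballxx.
have oB : open (ball x0 r) by exact: ball_open.
have th00 : `|th0 - th0| < r by rewrite subrr normr0.
have n10 : n1 x0 = k0 by rewrite N1 // subrr cos0 mulr1.
have n20 : n2 x0 = 0 by rewrite N2 // subrr sin0 mulr0.
pose U := ball x0 r `&` n1 @^-1` [set x | x != 0].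
have oU : open U by exact: blowup_open.
have Ux0 : U x0 by split=> //=; rewrite n10.
pose m1 (x : 'rV[R]_2) : R^o := row_coord j0 x * n1 x.
pose m2 (x : 'rV[R]_2) : R^o := n2 x * (n1 x)^-1.
pose m x := row2 (m1 x) (m2 x).
have UB : U `<=` ball x0 r by move=> x [].
have sj k (j : 'I_2) : Ck k U (row_coord j : 'rV[R]_2 -> R^o) by apply: Ck_lin; exact: lin_continuous.
have sn1 k : Ck k U n1 by exact: Ck_sub UB (s1 k).
have sn2 k : Ck k U n2 by exact: Ck_sub UB (s2 k).
have sm1 k : Ck k U m1 by exact: Ck_mul.
have sm2 k : Ck k U m2 by apply: Ck_mul => //; apply: Ck_inv => // x [].
have sm : smooth_on U m.
  move=> k; apply/(@cCkP _ _ _ (fbasis_rV R 2)) => //; apply: ord2P.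
    by apply: Ck_eq (sm1 k) => // x _; rewrite /= /row_coord row2E.
  by apply: Ck_eq (sm2 k) => // x _; rewrite /= /row_coord row2E.
have dm : differentiable m x0 by exact: (sm 1%N).1.
have dn1 : differentiable n1 x0 by exact: (sn1 1%N).1.
have dn2 : differentiable n2 x0 by exact: (sn2 1%N).1.
have dj (j : 'I_2) : differentiable (row_coord j : 'rV[R]_2 -> R^o) x0 by exact: (sj 1%N j).1.
have di : differentiable (fun x => (n1 x)^-1 : R^o) x0.
  by have : Ck 1 U (fun x => (n1 x)^-1 : R^o) by [apply: Ck_inv => // x []]; case=> + _; apply.
have Dj v : 'D_v (row_coord j0 : 'rV[R]_2 -> R^o) x0 = v 0 j0.
  rewrite deriveE // (@diff_lin _ _ _ (row_coord j0 : {linear _ -> _})) //.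
  exact: lin_continuous.
have J1 v : 'D_v m1 x0 = v 0 j0 * k0.
  rewrite -[m1]/(row_coord j0 * n1) deriveM; [|exact: diff_derivable|exact: diff_derivable].
  by rewrite Dj n10 /row_coord row2E scale0r add0r [_ *: _]mulrC.
(* Along the axis x = 0 the function n2 is - k0 sin (s - th0); since it vanishes at th0, the
   quotient n2 / n1 has derivative - k0 / k0. *)
have J2 : 'D_('e_j1) m2 x0 = -1.
  rewrite -[m2]/(n2 * (fun x => (n1 x)^-1)) deriveM; [|exact: diff_derivable|exact: diff_derivable].
  rewrite n20 scale0r add0r n10.
  rewrite (@derive_along _ _ _ _ _ (fun s : R^o => n2 (row2 0 s)) _ _ th0 (1 : R^o)); last first.
    move=> e; congr n2; apply/rowP; apply: ord2P; rewrite row2E !mxE /= ?mulr0 ?add0r //.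
  rewrite (near_eq_derive (g := fun s : R^o => - k0 * sin (s - th0) : R^o)); last first.
    have nb : nbhs (th0 : R^o) (ball (th0 : R^o) r) by exact: nbhsx_ballx.
    by apply: filterS nb => s /ballE /N2.
  have ds : is_derive (th0 : R^o) 1 (fun s : R^o => s - th0 : R^o) 1.
    by rewrite -[X in is_derive _ _ _ X]subr0; exact: is_deriveB.
  have dss : is_derive (th0 : R^o) 1 (fun s : R^o => sin (s - th0) : R^o) (cos (th0 - th0) * 1).
    exact: (is_derive1_comp (f := @sin R)).
  have [_ ->] : is_derive (th0 : R^o) 1 (fun s : R^o => - k0 * sin (s - th0) : R^o) (- k0 * (cos (th0 - th0) * 1)).
    exact: is_deriveZ.
  by rewrite subrr cos0 !mulr1 /GRing.scale /= mulrN mulVf.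
have Jm v i : 'D_v m x0 0 i = 'D_v (fun x => row_coord i (m x)) x0.
  by rewrite (derive_post (l := row_coord i)) //; exact: lin_continuous.
have Jm1 : (fun x => row_coord j0 (m x)) = m1 by apply/funext => x; rewrite /row_coord row2E.
have Jm2 : (fun x => row_coord j1 (m x)) = m2 by apply/funext => x; rewrite /row_coord row2E.
(* The Jacobian is triangular with diagonal entries k0 and -1, because m1 = x n1 vanishes on the
   axis x = 0. *)
have uJ : Jmx m x0 \in unitmx.
  rewrite -row_free_unit -kermx_eq0; apply/rowV0P => a /sub_kermxP e.
  have e0 : a 0 j0 * Jmx m x0 j0 j0 + a 0 j1 * Jmx m x0 j1 j0 = 0.
    by have /rowP/(_ j0) := e; rewrite [LHS]mxE [RHS]mxE sum2.
  have e1 : a 0 j0 * Jmx m x0 j0 j1 + a 0 j1 * Jmx m x0 j1 j1 = 0.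
    by have /rowP/(_ j1) := e; rewrite [LHS]mxE [RHS]mxE sum2.
  have E j i : Jmx m x0 j i = 'D_('e_j) m x0 0 i by rewrite mxE.
  have d00 : ('e_j0 : 'rV[R]_2) 0 j0 = 1 by rewrite mxE.
  have d10 : ('e_j1 : 'rV[R]_2) 0 j0 = 0 by rewrite mxE.
  have E0 : Jmx m x0 j0 j0 = k0 by rewrite E Jm Jm1 J1 d00 mul1r.
  have E1 : Jmx m x0 j1 j0 = 0 by rewrite E Jm Jm1 J1 d10 mul0r.
  rewrite E0 E1 mulr0 addr0 in e0.
  have a0 : a 0 j0 = 0 by move/eqP: e0; rewrite mulf_eq0 (negbTE k00) orbF => /eqP.
  rewrite a0 mul0r add0r !E !Jm Jm2 J2 mulrN1 in e1.
  apply/rowP; apply: ord2P; rewrite mxE //.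
  by apply/eqP; rewrite -oppr_eq0 e1.
have [V [W [g [dg Vx0 VU]]]] := inverse_function oU Ux0 sm uJ.
have m0 : m x0 = 0.
  by apply/rowP; apply: ord2P; rewrite row2E mxE /m1 /m2 /row_coord ?row2E ?n20 mul0r.
have W0 : W 0 by have := df_map dg Vx0; rewrite m0.
have nW : nbhs (0 : 'rV[R]_2) W by apply: open_nbhs_nbhs; split=> //; exact: df_openr dg.
move: nW => /nbhs_ballP[e /= e0 He].
exists e => // y1 y2 h1 h2.
have Wy : W (row2 y1 y2).
  apply: He; apply/ballE; rewrite subr0; apply: (@le_lt_trans _ _ (Num.max `|y1| `|y2|)); last by rewrite gt_max h1.
  apply: rv_norm_le; first by rewrite le_max normr_ge0.
  by apply: ord2P; rewrite row2E le_max lexx ?orbT.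
have [Bx nx] := VU _ (df_inv dg Wy).
have my := df_Kr dg Wy; rewrite /m in my.
have M1 : m1 (g (row2 y1 y2)) = y1 by have := congr1 (fun w : 'rV[R]_2 => w 0 j0) my; rewrite !row2E.
have M2 : m2 (g (row2 y1 y2)) = y2 by have := congr1 (fun w : 'rV[R]_2 => w 0 j1) my; rewrite !row2E.
move: Bx nx M1 M2; move: (g _) => x Bx nx M1 M2; exists x; split=> //.
by rewrite -M1 -M2 /m1 /m2 /row_coord -mulrA; congr (_ * _); rewrite mulrCA mulfV // mulr1.
Qed.

End Plane.

Lemma window (R : realFieldType) (x t w : R) : `|x - t| < w -> w <= 1 -> - 2 <= t <= 2 -> - 4 <= x <= 4.
Proof. by rewrite ltr_norml => /andP[h1 h2] h3 /andP[h4 h5]; apply/andP; split; lra. Qed.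

(** * Contact frames and the minimal surface equation *)

Section CrossProduct.
Context {R : realType}.

Lemma sum_sqr3_eq0 (a b c : R) : a ^+ 2 + b ^+ 2 + c ^+ 2 = 0 -> [/\ a = 0, b = 0 & c = 0].
Proof.
have := sqr_ge0 a; have := sqr_ge0 b; have := sqr_ge0 c => h1 h2 h3 h.
by split; apply/eqP; rewrite -sqrf_eq0; apply/eqP; lra.
Qed.

(** Here n is the cross product of x and y. The identities are |n|^2 a = n (n.a) - n x (n x a), in
    which n x a = (a.x) y - (a.y) x. *)
Lemma cross_inj (x1 x2 x3 y1 y2 y3 a1 a2 a3 : R) :
  let n1 := x2 * y3 - x3 * y2 in let n2 := x3 * y1 - x1 * y3 in let n3 := x1 * y2 - x2 * y1 in
  n1 ^+ 2 + n2 ^+ 2 + n3 ^+ 2 != 0 ->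
  a1 * x1 + a2 * x2 + a3 * x3 = 0 -> a1 * y1 + a2 * y2 + a3 * y3 = 0 ->
  n1 * a1 + n2 * a2 + n3 * a3 = 0 -> [/\ a1 = 0, a2 = 0 & a3 = 0].
Proof.
move=> n1 n2 n3 N0 hx hy hn.
have z a : a * (n1 ^+ 2 + n2 ^+ 2 + n3 ^+ 2) = 0 -> a = 0.
  by move=> /eqP; rewrite mulf_eq0 (negbTE N0) orbF => /eqP.
split; apply: z.
- transitivity (n1 * (n1 * a1 + n2 * a2 + n3 * a3)
   + n2 * (x3 * (a1 * y1 + a2 * y2 + a3 * y3) - y3 * (a1 * x1 + a2 * x2 + a3 * x3))
   - n3 * (x2 * (a1 * y1 + a2 * y2 + a3 * y3) - y2 * (a1 * x1 + a2 * x2 + a3 * x3))).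
    by rewrite /n1 /n2 /n3; ring.
  by rewrite hx hy hn; ring.
- transitivity (n2 * (n1 * a1 + n2 * a2 + n3 * a3)
   + n3 * (x1 * (a1 * y1 + a2 * y2 + a3 * y3) - y1 * (a1 * x1 + a2 * x2 + a3 * x3))
   - n1 * (x3 * (a1 * y1 + a2 * y2 + a3 * y3) - y3 * (a1 * x1 + a2 * x2 + a3 * x3))).
    by rewrite /n1 /n2 /n3; ring.
  by rewrite hx hy hn; ring.
- transitivity (n3 * (n1 * a1 + n2 * a2 + n3 * a3)
   + n1 * (x2 * (a1 * y1 + a2 * y2 + a3 * y3) - y2 * (a1 * x1 + a2 * x2 + a3 * x3))
   - n2 * (x1 * (a1 * y1 + a2 * y2 + a3 * y3) - y1 * (a1 * x1 + a2 * x2 + a3 * x3))).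
    by rewrite /n1 /n2 /n3; ring.
  by rewrite hx hy hn; ring.
Qed.

(* Binet-Cauchy: (a x b).(x x y) = (a.x)(b.y) - (a.y)(b.x). *)
Lemma cross_neq0 (x1 x2 x3 y1 y2 y3 a1 a2 a3 b1 b2 b3 : R) :
  let n1 := x2 * y3 - x3 * y2 in let n2 := x3 * y1 - x1 * y3 in let n3 := x1 * y2 - x2 * y1 in
  a1 * x1 + a2 * x2 + a3 * x3 <> 0 -> a1 * y1 + a2 * y2 + a3 * y3 = 0 ->
  b1 * y1 + b2 * y2 + b3 * y3 <> 0 -> n1 ^+ 2 + n2 ^+ 2 + n3 ^+ 2 != 0.
Proof.
move=> n1 n2 n3 ax ay bY; apply/eqP => /sum_sqr3_eq0[m1 m2 m3].
have : (a1 * x1 + a2 * x2 + a3 * x3) * (b1 * y1 + b2 * y2 + b3 * y3) =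
    (a1 * y1 + a2 * y2 + a3 * y3) * (b1 * x1 + b2 * x2 + b3 * x3) +
    ((a2 * b3 - a3 * b2) * n1 + (a3 * b1 - a1 * b3) * n2 + (a1 * b2 - a2 * b1) * n3).
  by rewrite /n1 /n2 /n3; ring.
by rewrite ay m1 m2 m3 !mulr0 mul0r !addr0 => /eqP; rewrite mulf_eq0 => /orP[] /eqP.
Qed.

Lemma cross_dot (x1 x2 x3 y1 y2 y3 a b e : R) :
  let n1 := x2 * y3 - x3 * y2 in let n2 := x3 * y1 - x1 * y3 in let n3 := x1 * y2 - x2 * y1 in
  a * x1 + b * y1 + e * n1 = 0 -> a * x2 + b * y2 + e * n2 = 0 -> a * x3 + b * y3 + e * n3 = 0 ->
  e * (n1 ^+ 2 + n2 ^+ 2 + n3 ^+ 2) = 0.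
Proof.
move=> n1 n2 n3 h1 h2 h3.
transitivity (n1 * (a * x1 + b * y1 + e * n1) + n2 * (a * x2 + b * y2 + e * n2) + n3 * (a * x3 + b * y3 + e * n3)).
  by rewrite /n1 /n2 /n3; ring.
by rewrite h1 h2 h3 !mulr0 !addr0.
Qed.

End CrossProduct.

(** Here xij = Xi nu_j, Aij = Xi Xj h and (l n1, l n2) is the horizontal gradient of h. The
    hypotheses are the derivatives of |nu|^2 = 1, the minimal surface equation, and the derivative
    of X1 h nu2 - X2 h nu1 along - n2 X1 + n1 X2; the xij are eliminated between them. *)
Lemma mce_algebra (R : realType) (A11 A12 A21 A22 n1 n2 l x11 x12 x21 x22 c1 c2 : R) :
  n1 * x11 + n2 * x12 = 0 -> n1 * x21 + n2 * x22 = 0 ->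
  x11 + x22 + n1 * c2 - n2 * c1 = 0 ->
  n2 * (- n2 * A11 + n1 * A21) - n1 * (- n2 * A12 + n1 * A22) +
    l * (n1 * (- n2 * x12 + n1 * x22) - n2 * (- n2 * x11 + n1 * x21)) = 0 ->
  (l * n2) ^+ 2 * A11 - (l * n1) * (l * n2) * (A12 + A21) + (l * n1) ^+ 2 * A22
    + ((l * n1) ^+ 2 + (l * n2) ^+ 2) * (l * n1 * c2 - l * n2 * c1) = 0.
Proof.
move=> u1 u2 e T.
transitivity (- l ^+ 2 * (n2 * (- n2 * A11 + n1 * A21) - n1 * (- n2 * A12 + n1 * A22) +
    l * (n1 * (- n2 * x12 + n1 * x22) - n2 * (- n2 * x11 + n1 * x21)))
  + l ^+ 3 * (n1 ^+ 2 + n2 ^+ 2) * (x11 + x22 + n1 * c2 - n2 * c1)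
  - l ^+ 3 * (n1 * (n1 * x11 + n2 * x12) + n2 * (n1 * x21 + n2 * x22))); first by ring.
by rewrite T e u1 u2; ring.
Qed.

Section Contact.
Variables (R : realType) (M : topologicalType) (A : set (chart M 'rV[R]_3)).
Hypothesis hM : smooth_manifold A.
Variables (Delta : M -> set (vec R M)) (ip : M -> vec R M -> vec R M -> R).
Hypothesis hDelta : sub_riemannian A Delta ip.
Variable X : 'I_3 -> field R M.
Hypothesis hframe : orthonormal_frame A Delta ip (X i1) (X i2).
Variable omega : M -> vec R M -> R.
Hypothesis homega : canonical_contact_form A Delta (X i1) (X i2) omega.
Hypothesis hreeb : reeb_field A Delta omega (X i3).
Variable c : 'I_3 -> 'I_3 -> 'I_3 -> M -> R.
Hypothesis hc : structure_functions A X c.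
Implicit Types (p q : M) (f g h : M -> R) (d : chart M 'rV[R]_3).

Lemma manifold_atlas : is_atlas A.
Proof. by case: hM => _ _ h1 h2 h3; split. Qed.
Let hA := manifold_atlas.

Lemma smooth_at_near p f : smooth_at A p f -> \forall q \near p, smooth_at A q f.
Proof. exact: smooth_at_open. Qed.

Lemma smooth_at_neq0 p f : smooth_at A p f -> f p != 0 -> \forall q \near p, f q != 0.
Proof.
move=> sf f0; have cf : {for p, continuous f} by exact: (smooth_at_continuous hA).
by apply: (cf [set x | x != 0]); apply: open_nbhs_nbhs; split; [exact: open_neq|].
Qed.

Lemma frame_field i : smooth_field A (X i).
Proof.
move: i; apply: ord3P; [exact: (frame_smooth1 hframe)|exact: (frame_smooth2 hframe)|].
exact: (reeb_smooth hreeb).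
Qed.

Lemma frame_tangent i p : is_tangent A p (X i p).
Proof. exact: (field_tangent (frame_field i)). Qed.

Lemma frame_smooth i p f : smooth_at A p f -> smooth_at A p (fun q => X i q f).
Proof. exact: (field_smooth (frame_field i)). Qed.

Definition comb3 p (a1 a2 a3 : R) : vec R M :=
  fun f => a1 * X i1 p f + a2 * X i2 p f + a3 * X i3 p f.

Lemma comb3_tangent p a1 a2 a3 : is_tangent A p (comb3 p a1 a2 a3).
Proof.
rewrite (_ : comb3 _ _ _ _ = vcomb 1 (vcomb a1 (X i1 p) a2 (X i2 p)) a3 (X i3 p)).
  by apply: is_tangent_comb; [apply: is_tangent_comb|]; exact: frame_tangent.
by apply/funext => f; rewrite /vcomb /comb3 mul1r.
Qed.

Lemma omega_comb3 p a1 a2 a3 v : is_tangent A p v -> veq A p v (comb3 p a1 a2 a3) -> omega p v = a3.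
Proof.
move=> tv e; have F := contact_form homega.
rewrite (form_veq F tv (comb3_tangent p a1 a2 a3) e).
rewrite (_ : comb3 _ _ _ _ = vcomb 1 (vcomb a1 (X i1 p) a2 (X i2 p)) a3 (X i3 p)); last first.
  by apply/funext => f; rewrite /vcomb /comb3 mul1r.
have t i := frame_tangent i p.
rewrite (form_linear F) ?(form_linear F) //; last by apply: is_tangent_comb.
have -> : omega p (X i1 p) = 0 by apply/(contact_ker homega (t i1)); exact: (frame_in1 hframe).
have -> : omega p (X i2 p) = 0 by apply/(contact_ker homega (t i2)); exact: (frame_in2 hframe).
rewrite (reeb_one hreeb); ring.
Qed.

(** The form omega reads off the X3-component, after which inner products with X1 and X2 read off
    the other two. *)
Lemma frame_indep p a1 a2 a3 : veq A p (comb3 p a1 a2 a3) (fun=> 0) -> [/\ a1 = 0, a2 = 0 & a3 = 0].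
Proof.
move=> H.
have a30 : a3 = 0.
  rewrite -(@omega_comb3 p 0 0 0 (comb3 p a1 a2 a3)).
  - by apply/esym; apply: (omega_comb3 (a1 := a1) (a2 := a2)) => //; exact: comb3_tangent.
  - exact: comb3_tangent.
  - by move=> f sf; rewrite H // /comb3; ring.
have D12 a b : Delta p (vcomb a (X i1 p) b (X i2 p)).
  by apply: (sr_subspace hDelta); [exact: (frame_in1 hframe)|exact: (frame_in2 hframe)].
have e : veq A p (vcomb a1 (X i1 p) a2 (X i2 p)) (vcomb 0 (X i1 p) 0 (X i2 p)).
  by move=> f sf; have := H f sf; rewrite /comb3 /vcomb a30 => h; lra.
have ipv k : Delta p (X k p) -> a1 * ip p (X i1 p) (X k p) + a2 * ip p (X i2 p) (X k p) = 0.
  move=> Dk; have := sr_ip_veq hDelta (D12 a1 a2) (D12 0 0) Dk e.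
  rewrite !(sr_ip_linear hDelta) //; [|exact: (frame_in1 hframe)|exact: (frame_in2 hframe)|exact: (frame_in1 hframe)|exact: (frame_in2 hframe)].
  by move=> ->; ring.
have := ipv i1 (frame_in1 hframe p); have := ipv i2 (frame_in2 hframe p).
rewrite (frame_unit1 hframe) (frame_unit2 hframe) (frame_orth hframe).
rewrite (sr_ip_sym hDelta (frame_in2 hframe p) (frame_in1 hframe p)) (frame_orth hframe).
by move=> h1 h2; split=> //; lra.
Qed.

Lemma comb3_smooth_neq0 p a1 a2 a3 : ~ [/\ a1 = 0, a2 = 0 & a3 = 0] ->
  exists2 f, smooth_at A p f & comb3 p a1 a2 a3 f <> 0.
Proof.
move=> na; apply: contrapT => /forall2NP H; apply: na; apply: (frame_indep (p := p)) => f sf.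
by have [|/contrapT] := H f.
Qed.

Definition frame_mx d p : 'M[R]_3 := \matrix_(i, j) X i p (coord d j).

Lemma frame_mx_comb d p (a : 'rV[R]_3) : comb3 p (a 0 i1) (a 0 i2) (a 0 i3) =1
  (fun f => \sum_i a 0 i * X i p f).
Proof. by move=> f; rewrite sum3. Qed.

Lemma frame_mx_unit d p : compatible A d -> dom d p -> frame_mx d p \in unitmx.
Proof.
move=> kd dp; rewrite -row_free_unit -kermx_eq0; apply/rowV0P => a /sub_kermxP e.
have : veq A p (comb3 p (a 0 i1) (a 0 i2) (a 0 i3)) (fun=> 0).
  apply: (tangent_coord0 hA kd dp); first exact: comb3_tangent.
  move=> j; rewrite (frame_mx_comb d); have /rowP/(_ j) := e.
  by rewrite !mxE => {2}<-; apply: eq_bigr => i _; rewrite mxE.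
move=> /frame_indep[h1 h2 h3]; apply/rowP => j; rewrite mxE.
by move: j; apply: ord3P.
Qed.

Lemma frame_span3 p v : is_tangent A p v -> exists a1 a2 a3, veq A p v (comb3 p a1 a2 a3).
Proof.
move=> tv; have [d [kd _ cd dp _]] := smooth_at_in hA p.
pose w : 'rV[R]_3 := \row_j v (coord d j).
pose a := w *m invmx (frame_mx d p).
exists (a 0 i1), (a 0 i2), (a 0 i3).
pose u := vcomb 1 v (-1) (comb3 p (a 0 i1) (a 0 i2) (a 0 i3)).
have tu : is_tangent A p u by apply: is_tangent_comb => //; exact: comb3_tangent.
have u0 : veq A p u (fun=> 0).
  apply: (tangent_coord0 hA kd dp) => // j; rewrite /u /vcomb (frame_mx_comb d).
  have e : a *m frame_mx d p = w by rewrite /a -mulmxA mulVmx ?mulmx1 // frame_mx_unit.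
  have /rowP/(_ j) := e; rewrite !mxE => h.
  rewrite (_ : \sum_i _ = v (coord d j)); first ring.
  by rewrite -h; apply: eq_bigr => i _; congr (_ * _); rewrite mxE.
by move=> f sf; have := u0 f sf; rewrite /u /vcomb; lra.
Qed.

Lemma lieE i j q f : smooth_at A q f -> X i q (fun p => X j p f) - X j q (fun p => X i p f) =
  - (c i j i1 q * X i1 q f + c i j i2 q * X i2 q f + c i j i3 q * X i3 q f).
Proof. by move=> sf; have := hc i j sf; rewrite /lie sum3. Qed.

Lemma lie_tangent i j q : is_tangent A q (lie (X i) (X j) q).
Proof.
have t k p := frame_tangent k p.
have sx k p f := @frame_smooth k p f.
split=> [a f g sf sg|f g sf sg]; rewrite /lie.
  have e k : \forall p \near q, X k p (fun x => a * f x + g x) = a * X k p f + X k p g.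
    by have := smooth_at_near sf; have := smooth_at_near sg; apply: filterS2 => p sgp sfp; rewrite (t k p).1.
  have s k : smooth_at A q (fun p => X k p (fun x => a * f x + g x)).
    apply: sx; apply: smooth_at_add => //; apply: smooth_at_mul => //; exact: smooth_at_cst.
  rewrite (tangent_eq hA (t i q) (e j) (s j)) (tangent_eq hA (t j q) (e i) (s i)).
  rewrite (t i q).1 ?(t j q).1; try exact: sx.
  ring.
have e k : \forall p \near q, X k p (fun x => f x * g x) = f p * X k p g + g p * X k p f.
  by have := smooth_at_near sf; have := smooth_at_near sg; apply: filterS2 => p sgp sfp; rewrite (t k p).2.
have s k : smooth_at A q (fun p => X k p (fun x => f x * g x)).
  by apply: sx; exact: smooth_at_mul.
rewrite (tangent_eq hA (t i q) (e j) (s j)) (tangent_eq hA (t j q) (e i) (s i)).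
have m k l := tangentM (t k q) sf (sx l q g sg).
have m' k l := tangentM (t k q) sg (sx l q f sf).
rewrite !(tangentD (t _ q)) ?m ?m'; try by apply: smooth_at_mul => //; exact: sx.
ring.
Qed.

(** Since omega kills X1 and X2, d omega (X1, X2) = - omega [X1, X2], which is the structure
    function itself. *)
Lemma c123_sqr q : c i1 i2 i3 q ^+ 2 = 1.
Proof.
have := contact_norm homega q; rewrite /dform.
have e1 : (fun p => omega p (X i2 p)) = fun=> 0.
  by apply/funext => p; apply/(contact_ker homega (frame_tangent i2 p)); exact: (frame_in2 hframe).
have e2 : (fun p => omega p (X i1 p)) = fun=> 0.
  by apply/funext => p; apply/(contact_ker homega (frame_tangent i1 p)); exact: (frame_in1 hframe).
rewrite e1 e2 !(tangent0 hA (frame_tangent _ _)).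
rewrite (@omega_comb3 q (- c i1 i2 i1 q) (- c i1 i2 i2 q) (- c i1 i2 i3 q)).
- by rewrite subr0 add0r opprK.
- exact: lie_tangent.
- by move=> f sf; rewrite /lie lieE // /comb3; ring.
Qed.

Lemma smooth_at_det n q (B : M -> 'M[R]_n) : (forall i j, smooth_at A q (fun p => B p i j)) ->
  smooth_at A q (fun p => \det (B p)).
Proof.
move=> sB; rewrite /determinant; apply: smooth_at_sum => // s.
by apply: smooth_at_mul => //; [exact: smooth_at_cst|exact: smooth_at_prod].
Qed.

Lemma smooth_at_invmx n q (B : M -> 'M[R]_n) : (forall i j, smooth_at A q (fun p => B p i j)) ->
  B q \in unitmx -> forall i j, smooth_at A q (fun p => invmx (B p) i j).
Proof.
move=> sB Bq i j; have sd := smooth_at_det sB.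
have d0 : \det (B q) != 0 by rewrite -unitfE -unitmxE.
apply: (@smooth_at_eq _ _ _ _ A hA q (fun p => (\det (B p))^-1 * ((-1) ^+ (j + i) * \det (row' j (col' i (B p)))))).
  have := smooth_at_neq0 sd d0.
  by apply: filterS => p dp; rewrite /invmx unitmxE unitfE dp !mxE.
apply: smooth_at_mul => //; first exact: smooth_at_inv.
apply: smooth_at_mul => //; first exact: smooth_at_cst.
apply: smooth_at_det => a b.
by apply: (@smooth_at_eq _ _ _ _ A hA q (fun p => B p (lift j a) (lift i b))) => //; apply: nearW => p; rewrite !mxE.
Qed.

(** The structure functions are given only pointwise, as components of the brackets; evaluating on
    chart coordinates and inverting the frame matrix expresses them smoothly. *)
Lemma c_smooth i j k q : smooth_at A q (c i j k).
Proof.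
have [d [kd _ cd dq _]] := smooth_at_in hA q.
have dn : \forall p \near q, dom d p by apply: open_nbhs_nbhs; split=> //; exact: (chart_open cd).
have sc l : smooth_at A q (coord d l) by exact: smooth_at_coord.
apply: (@smooth_at_eq _ _ _ _ A hA q (fun p => \sum_l (- lie (X i) (X j) p (coord d l)) * invmx (frame_mx d p) l k)).
  apply: filterS dn => p dp.
  pose cr : 'rV[R]_3 := \row_k c i j k p.
  have e : \row_l (- lie (X i) (X j) p (coord d l)) = cr *m frame_mx d p.
    apply/rowP => l; rewrite !mxE (hc i j (smooth_at_coord hA l kd dp)) opprK.
    by apply: eq_bigr => m _; rewrite !mxE.
  have : (\row_l (- lie (X i) (X j) p (coord d l))) *m invmx (frame_mx d p) = cr.
    by rewrite e -mulmxA mulmxV ?mulmx1 // frame_mx_unit.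
  move=> /rowP/(_ k); rewrite !mxE => <-.
  by apply: eq_bigr => l _; rewrite mxE.
apply: smooth_at_sum => // l; apply: smooth_at_mul => //.
  apply: smooth_at_opp => //; rewrite /lie; apply: smooth_at_sub => //; do 2 exact: frame_smooth || apply: frame_smooth.
apply: smooth_at_invmx => [a b|]; last exact: frame_mx_unit.
apply: (@smooth_at_eq _ _ _ _ A hA q (fun p => X a p (coord d b))); first by apply: nearW => p; rewrite mxE.
exact: frame_smooth.
Qed.

Lemma Delta_comb3 p v a1 a2 a3 : is_tangent A p v -> veq A p v (comb3 p a1 a2 a3) -> Delta p v <-> a3 = 0.
Proof.
by move=> tv e; rewrite -(omega_comb3 tv e); split=> /(contact_ker homega tv).
Qed.

Lemma tangent_kernel_chart d (S : set M) q : compatible A d -> dom d q -> S q ->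
  (forall p, dom d p -> S p <-> coord d i3 p = 0) ->
  tangent_space A S q = [set v | is_tangent A q v /\ v (coord d i3) = 0].
Proof.
move=> kd dq Sq Sd; have cd := compatible_chart kd.
have dn : \forall p \near q, dom d p by apply: open_nbhs_nbhs; split=> //; exact: (chart_open cd).
apply/seteqP; split=> v [tv H]; split=> //.
  apply: H; first exact: smooth_at_coord.
  by apply: filterS dn => p dp /(Sd _ dp).
move=> f sf fS; rewrite (tangentE hA kd dq tv sf) sum3 H mul0r addr0.
have dif : differentiable (f \o cinv d : 'rV[R]_3 -> R^o) (cmap d q) by exact: (smooth_in_differentiable hA kd dq sf).
(* A vector killing the third coordinate combines the first two coordinate vectors, whose lines stay
   in S near q, where f vanishes. *)
suff K i : i != i3 -> chart_vec d q 'e_i f = 0 by rewrite !K // !mulr0 addr0.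
move=> ii3.
have L := @line_is_derive R _ (f \o cinv d : 'rV[R]_3 -> R^o) (cmap d q) 'e_i 0.
rewrite scale0r addr0 in L; have [_ e] := L dif.
rewrite /chart_vec -e -[RHS](@derive_cst R R^o R^o (0:R) 0 1); apply: near_eq_derive.
have cl : {for (0:R), continuous (fun s : R => cmap d q + s *: 'e_i)}.
  by apply: continuousD; [exact: cst_continuous|exact: scalel_continuous].
have cl2 : {for (0:R), continuous (fun s : R => cinv d (cmap d q + s *: 'e_i))}.
  apply: (@continuous_comp _ _ _ (fun s : R => cmap d q + s *: 'e_i) (cinv d)) => //.
  by rewrite scale0r addr0; apply: (chart_cinv_cont cd); exists q.
have N1 : \forall s \near (0:R), cimg d (cmap d q + s *: 'e_i).
  apply: cl; rewrite scale0r addr0; apply: open_nbhs_nbhs; split; first exact: (chart_img_open cd).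
  by exists q.
have N2 : \forall s \near (0:R), S (cinv d (cmap d q + s *: 'e_i)) -> f (cinv d (cmap d q + s *: 'e_i)) = 0.
  apply: (cl2 (fun p => S p -> f p = 0)); rewrite scale0r addr0 (chart_cancel cd) //; exact: fS.
apply: filterS2 N1 N2 => s Cs; apply.
apply/(Sd _ (chart_inv_dom cd Cs)).
rewrite /coord chart_invK // !mxE (_ : (i3 == i) = false) ?mulr0 ?addr0; last by rewrite eq_sym; exact: negbTE.
by apply/(Sd _ dq).
Qed.

(* Cross product of the differentials: completes two independent functions to
   local coordinates. *)
Lemma chart_of_two q f1 f2 v1 v2 (U : set M) : open U -> U q ->
  smooth_at A q f1 -> smooth_at A q f2 -> is_tangent A q v1 -> is_tangent A q v2 ->
  v1 f1 <> 0 -> v1 f2 = 0 -> v2 f2 <> 0 ->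
  exists d r, [/\ compatible A d, dom d q, dom d `<=` U, 0 < r &
    [/\ cimg d = ball (0 : 'rV[R]_3) r, cmap d q = 0,
        forall p, dom d p -> coord d i1 p = f1 p - f1 q &
        forall p, dom d p -> coord d i3 p = f2 p - f2 q]].
Proof.
move=> oU Uq s1 s2 t1 t2 v11 v12 v22.
have [e [ke _ ce eq _]] := smooth_at_in hA q.
pose r1 i := chart_vec e q 'e_i f1; pose r2 i := chart_vec e q 'e_i f2.
have E1 v : is_tangent A q v -> v f1 = v (coord e i1) * r1 i1 + v (coord e i2) * r1 i2 + v (coord e i3) * r1 i3.
  by move=> tv; rewrite (tangentE hA ke eq tv s1) sum3.
have E2 v : is_tangent A q v -> v f2 = v (coord e i1) * r2 i1 + v (coord e i2) * r2 i2 + v (coord e i3) * r2 i3.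
  by move=> tv; rewrite (tangentE hA ke eq tv s2) sum3.
pose n1 := r1 i2 * r2 i3 - r1 i3 * r2 i2.
pose n2 := r1 i3 * r2 i1 - r1 i1 * r2 i3.
pose n3 := r1 i1 * r2 i2 - r1 i2 * r2 i1.
pose f3 p := n1 * coord e i1 p + n2 * coord e i2 p + n3 * coord e i3 p.
have sco i a : smooth_at A q (fun p => a * coord e i p).
  by apply: smooth_at_mul => //; [exact: smooth_at_cst|exact: smooth_at_coord].
have s3 : smooth_at A q f3.
  by apply: smooth_at_add => //; apply: smooth_at_add.
have E3 v : is_tangent A q v -> v f3 = n1 * v (coord e i1) + n2 * v (coord e i2) + n3 * v (coord e i3).
  move=> tv; rewrite /f3 !(tangentD tv) // ?(tangentZ hA tv) //; try exact: smooth_at_coord.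
  by apply: smooth_at_add.
pose F (i : 'I_3) := if i == i1 then f1 else if i == i3 then f2 else f3.
have sF j : smooth_at A q (F j) by rewrite /F; case: ifP => // _; case: ifP.
have nn : n1 ^+ 2 + n2 ^+ 2 + n3 ^+ 2 != 0.
  apply: (cross_neq0 (a1 := v1 (coord e i1)) (a2 := v1 (coord e i2)) (a3 := v1 (coord e i3))
    (b1 := v2 (coord e i1)) (b2 := v2 (coord e i2)) (b3 := v2 (coord e i3))).
  - by rewrite -E1.
  - by rewrite -E2.
  - by rewrite -E2.
have inj v : is_tangent A q v -> (forall j, v (F j) = 0) -> veq A q v (fun=> 0).
  move=> tv Hv; apply: (tangent_coord0 hA ke eq tv).
  have h1 := Hv i1; have h2 := Hv i3; have h3 := Hv i2.
  rewrite /F /= in h1 h2 h3; rewrite E1 // in h1; rewrite E2 // in h2; rewrite E3 // in h3.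
  by have [z1 z2 z3] := cross_inj nn h1 h2 h3; apply: ord3P.
have [d [r [kd dq dU r0 [Ed Hd]]]] := chart_of_functions hA oU Uq sF inj.
exists d, r; split=> //; split=> // [|p dp|p dp]; try by rewrite Hd.
by apply/rowP => j; rewrite -[LHS]/(coord d j q) Hd // subrr mxE.
Qed.

(** The regularity required of h at one point by [is_surface] is spread over all of U and tested on
    the frame, where it is a nonvanishing condition on smooth functions. *)
Record defining (S : set M) h (U : set M) : Prop := {
  defining_open : open U;
  defining_smooth : forall p, U p -> smooth_at A p h;
  defining_set : forall p, U p -> S p <-> h p = 0;
  defining_regular : forall p, U p -> exists i, X i p h != 0 }.

Lemma surface_defining S q : is_surface A S -> S q -> exists h U, U q /\ defining S h U.
Proof.
move=> hS Sq; have [U [h [oU Uq sh [v tv vh] SU]]] := hS q Sq.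
have [a1 [a2 [a3 e]]] := frame_span3 tv.
have [i Xi] : exists i, X i q h != 0.
  apply: contrapT => /forallNP H; apply: vh; rewrite e; last exact: sh.
  have z i : X i q h = 0 by have /negP := H i; rewrite negbK => /eqP.
  by rewrite /comb3 !z !mulr0 !addr0.
have := smooth_at_neq0 (frame_smooth i (sh q Uq)) Xi.
rewrite /prop_near1 nbhsE => -[V [oV Vq] VX].
exists h, (U `&` V); split=> //; split.
- exact: openI.
- by move=> p [Up _]; exact: sh.
- by move=> p [Up _]; exact: SU.
- by move=> p [_ Vp]; exists i; exact: VX.
Qed.

Lemma defining_sub S h U V : defining S h U -> open V -> V `<=` U -> defining S h V.
Proof.
by move=> [oU sU SU rU] oV VU; split=> // p /VU; [exact: sU|exact: SU|exact: rU].
Qed.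

(** Some nonzero horizontal vector kills h: X1 itself, or X2 h X1 - X1 h X2. Testing it on a
    function f gives a coordinate independent of h. *)
Lemma defining_transverse S h U p : defining S h U -> U p ->
  exists v f, [/\ is_tangent A p v, smooth_at A p f, v h = 0 & v f <> 0].
Proof.
move=> dS Up; have [X10|X10] := eqVneq (X i1 p h) 0.
  have [|f sf fn] := @comb3_smooth_neq0 p 1 0 0; first by case=> /eqP; rewrite oner_eq0.
  exists (comb3 p 1 0 0), f; split=> //; first exact: comb3_tangent.
  by rewrite /comb3 X10; ring.
have [|f sf fn] := @comb3_smooth_neq0 p (X i2 p h) (- X i1 p h) 0.
  by case=> _ /eqP; rewrite oppr_eq0 (negbTE X10).
exists (comb3 p (X i2 p h) (- X i1 p h) 0), f; split=> //; first exact: comb3_tangent.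
by rewrite /comb3; ring.
Qed.

Lemma defining_chart_of S h U p v f : defining S h U -> U p -> S p -> is_tangent A p v ->
  smooth_at A p f -> v h = 0 -> v f <> 0 ->
  exists d r, [/\ compatible A d, dom d p, dom d `<=` U, 0 < r &
    [/\ cimg d = ball (0 : 'rV[R]_3) r, cmap d p = 0,
        forall q, dom d q -> coord d i1 q = f q - f p &
        forall q, dom d q -> coord d i3 q = h q]].
Proof.
move=> dS Up Sp tv sf vh vf.
have [i Xi] := defining_regular dS Up.
have [d [r [kd dp dU r0 [Ed z0 H1 H3]]]] := chart_of_two (defining_open dS) Up sf (defining_smooth dS Up) tv (frame_tangent i p) vf vh (elimN eqP Xi).
exists d, r; split=> //; split=> // q dq.
by rewrite H3 // ((defining_set dS Up).1 Sp) subr0.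
Qed.

Lemma dom_near d p : compatible A d -> dom d p -> \forall q \near p, dom d q.
Proof.
by move=> kd dp; apply: open_nbhs_nbhs; split=> //; exact: (chart_open (compatible_chart kd)).
Qed.

Lemma defining_tangent S h U p : defining S h U -> U p -> S p ->
  tangent_space A S p = [set v | is_tangent A p v /\ v h = 0].
Proof.
move=> dS Up Sp; have [v [f [tv sf vh vf]]] := defining_transverse dS Up.
have [d [r [kd dp dU r0 [Ed z0 H1 H3]]]] := defining_chart_of dS Up Sp tv sf vh vf.
rewrite (tangent_kernel_chart kd dp Sp); last first.
  by move=> q dq; rewrite H3 //; apply: defining_set dS _ (dU _ dq).
have e w : is_tangent A p w -> w (coord d i3) = w h.
  move=> tw; apply: (tangent_eq hA tw); last exact: smooth_at_coord.
  by apply: filterS (dom_near kd dp) => q dq; exact: H3.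
by apply/seteqP; split=> w [tw wh]; split=> //; [rewrite -e|rewrite e].
Qed.

Lemma defining_vanish S h U p v f : defining S h U -> U p -> S p -> is_tangent A p v -> v h = 0 ->
  smooth_at A p f -> (\forall q \near p, S q -> f q = 0) -> v f = 0.
Proof.
move=> dS Up Sp tv vh sf fS.
have : tangent_space A S p v by rewrite (defining_tangent dS Up Sp).
by move=> [_]; apply.
Qed.

Lemma defining_characteristic S h U p : defining S h U -> U p -> S p ->
  characteristic A Delta S p <-> X i1 p h = 0 /\ X i2 p h = 0.
Proof.
move=> dS Up Sp; rewrite /characteristic (defining_tangent dS Up Sp); split.
  move=> e; split.
    by have : Delta p (X i1 p) := frame_in1 hframe p; rewrite -e => -[].
  by have : Delta p (X i2 p) := frame_in2 hframe p; rewrite -e => -[].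
move=> [X1 X2]; have sh := defining_smooth dS Up.
have X3 : X i3 p h != 0.
  have [i] := defining_regular dS Up; move: i; apply: ord3P => //; rewrite ?X1 ?X2 eqxx //.
apply/seteqP; split=> v.
  move=> [tv]; have [a1 [a2 [a3 e]]] := frame_span3 tv.
  rewrite e // /comb3 X1 X2 !mulr0 !add0r => /eqP; rewrite mulf_eq0 (negbTE X3) orbF => /eqP a30.
  exact/(Delta_comb3 tv e).
move=> Dv; have tv := sr_tangent hDelta Dv; split=> //.
have [a1 [a2 [a3 e]]] := frame_span3 tv.
have /(Delta_comb3 tv e) a30 := Dv.
by rewrite e // /comb3 X1 X2 a30; ring.
Qed.

Lemma horizontal_normal_intro S h U p n1 n2 l : defining S h U -> U p -> S p ->
  n1 ^+ 2 + n2 ^+ 2 = 1 -> l != 0 -> X i1 p h = l * n1 -> X i2 p h = l * n2 ->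
  horizontal_normal A X S p n1 n2.
Proof.
move=> dS Up Sp n12 l0 e1 e2.
have sh := defining_smooth dS Up.
pose N := Num.sqrt (l ^+ 2 + X i3 p h ^+ 2).
have l2 : 0 < l ^+ 2 by rewrite exprn_even_gt0.
have NN : N ^+ 2 = l ^+ 2 + X i3 p h ^+ 2.
  by rewrite sqr_sqrtr // addr_ge0 ?sqr_ge0.
have N0 : 0 < N by rewrite sqrtr_gt0 ltr_pwDl // sqr_ge0.
(* [horizontal_normal] divides by a positive root, so the orientation of the unit normal must follow
   the sign of l for its horizontal part to be (n1, n2) and not its opposite. *)
pose s := Num.sg l.
have s2 : s ^+ 2 = 1 by rewrite sqr_sg l0.
have sl : s * l = `|l| by rewrite /s normrEsg.
have r0 : Num.sqrt ((s * X i1 p h / N) ^+ 2 + (s * X i2 p h / N) ^+ 2) = `|l| / N.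
  rewrite (_ : _ + _ = (`|l| / N) ^+ 2); first by rewrite sqrtr_sqr normrM normr_id gtr0_norm ?invr_gt0.
  rewrite -sl e1 e2 (_ : _ + _ = (n1 ^+ 2 + n2 ^+ 2) * (s * l / N) ^+ 2); first by rewrite n12 mul1r.
  by move: (N^-1) => k; ring.
have aN : `|l| / N != 0 by rewrite mulf_neq0 ?normr_eq0 ?invr_neq0 // gt_eqF.
have div n : s * (l * n) / N / (`|l| / N) = n.
  by rewrite -sl; field; rewrite gt_eqF //= l0 /s sgr_eq0 l0.
exists (fun i => s * X i p h / N); rewrite /= r0; split.
- split.
    rewrite sum3 e1 e2.
    rewrite (_ : _ + _ = s ^+ 2 * (l ^+ 2 * (n1 ^+ 2 + n2 ^+ 2) + X i3 p h ^+ 2) / N ^+ 2).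
      by rewrite n12 mulr1 -NN s2 mul1r divff // expf_neq0 // gt_eqF.
    by field; rewrite gt_eqF.
  move=> v a; rewrite (defining_tangent dS Up Sp) => -[tv vh] e.
  have := e h sh; rewrite vh !sum3 => z.
  rewrite (_ : _ + _ = (s / N) * (a i1 * X i1 p h + a i2 * X i2 p h + a i3 * X i3 p h)); last by ring.
  by rewrite -z mulr0.
- exact/eqP.
- by rewrite e1 div.
- by rewrite e2 div.
Qed.

Lemma horizontal_normal_elim S h U p n1 n2 : defining S h U -> U p -> S p ->
  horizontal_normal A X S p n1 n2 -> exists2 l, l != 0 & X i1 p h = l * n1 /\ X i2 p h = l * n2.
Proof.
move=> dS Up Sp [n [[nn nt] /eqP r0 -> ->]].
have sh := defining_smooth dS Up.
set r := Num.sqrt _ in r0 *.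
pose g i := X i p h.
(* Combinations of the frame that kill h are tangent, so n is orthogonal to everything orthogonal to
   the gradient g. The three choices below say that the cross product of g and n is 0, whence g =
   (g.n) n. *)
have orth a1 a2 a3 : a1 * g i1 + a2 * g i2 + a3 * g i3 = 0 -> a1 * n i1 + a2 * n i2 + a3 * n i3 = 0.
  move=> z; pose a (i : 'I_3) := if i == i1 then a1 else if i == i2 then a2 else a3.
  have := nt (comb3 p a1 a2 a3) a; rewrite !sum3 /a /=; apply.
    by rewrite (defining_tangent dS Up Sp); split; [exact: comb3_tangent|exact: z].
  by move=> f _; rewrite sum3.
have o1 : g i2 * n i1 - g i1 * n i2 = 0.
  by transitivity (g i2 * n i1 + - g i1 * n i2 + 0 * n i3); [ring|apply: orth; ring].
have o2 : g i3 * n i1 - g i1 * n i3 = 0.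
  by transitivity (g i3 * n i1 + 0 * n i2 + - g i1 * n i3); [ring|apply: orth; ring].
have o3 : g i3 * n i2 - g i2 * n i3 = 0.
  by transitivity (0 * n i1 + g i3 * n i2 + - g i2 * n i3); [ring|apply: orth; ring].
rewrite sum3 in nn.
pose m := g i1 * n i1 + g i2 * n i2 + g i3 * n i3.
have gm1 : g i1 = m * n i1.
  rewrite -[LHS]mulr1 -nn /m; apply/eqP; rewrite -subr_eq0; apply/eqP.
  rewrite (_ : _ - _ = - n i2 * (g i2 * n i1 - g i1 * n i2) - n i3 * (g i3 * n i1 - g i1 * n i3)); last by ring.
  by rewrite o1 o2; ring.
have gm2 : g i2 = m * n i2.
  rewrite -[LHS]mulr1 -nn /m; apply/eqP; rewrite -subr_eq0; apply/eqP.
  rewrite (_ : _ - _ = n i1 * (g i2 * n i1 - g i1 * n i2) - n i3 * (g i3 * n i2 - g i2 * n i3)); last by ring.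
  by rewrite o1 o3; ring.
have gm3 : g i3 = m * n i3.
  rewrite -[LHS]mulr1 -nn /m; apply/eqP; rewrite -subr_eq0; apply/eqP.
  rewrite (_ : _ - _ = n i1 * (g i3 * n i1 - g i1 * n i3) + n i2 * (g i3 * n i2 - g i2 * n i3)); last by ring.
  by rewrite o2 o3; ring.
have m0 : m != 0.
  apply/eqP => m0; have [i] := defining_regular dS Up; move: i.
  have z : forall i, g i = 0 by apply: ord3P; rewrite ?gm1 ?gm2 ?gm3 m0 mul0r.
  by move=> i; rewrite -/(g i) z eqxx.
exists (m * r); first by rewrite mulf_neq0.
have k x : m * r * (x / r) = m * x by rewrite -mulrA; congr (_ * _); rewrite mulrC -mulrA mulVf ?mulr1.
by rewrite !k; split.
Qed.

Lemma D_sin (x : R) : 'D_1 (@sin R : R^o -> R^o) x = cos x.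
Proof. by have [_ ->] := is_derive_sin x. Qed.

Lemma D_cos (x : R) : 'D_1 (@cos R : R^o -> R^o) x = - sin x.
Proof. by have [_ ->] := is_derive_cos x. Qed.

Lemma smooth_sin : smooth_on setT (@sin R : R^o -> R^o).
Proof. by move=> k; have [] := Ck_sincos (R := R) k. Qed.

Lemma smooth_cos : smooth_on setT (@cos R : R^o -> R^o).
Proof. by move=> k; have [] := Ck_sincos (R := R) k. Qed.

Lemma smooth_at_sin p f : smooth_at A p f -> smooth_at A p (fun q => sin (f q)).
Proof. by apply: (smooth_at_comp hA (V := setT)) => //; [exact: openT|exact: smooth_sin]. Qed.

Lemma smooth_at_cos p f : smooth_at A p f -> smooth_at A p (fun q => cos (f q)).
Proof. by apply: (smooth_at_comp hA (V := setT)) => //; [exact: openT|exact: smooth_cos]. Qed.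

Lemma tangent_sin p v f : is_tangent A p v -> smooth_at A p f ->
  v (fun q => sin (f q)) = cos (f p) * v f.
Proof. by move=> tv sf; rewrite (tangent_comp hA tv sf openT) ?D_sin //; exact: smooth_sin. Qed.

Lemma tangent_cos p v f : is_tangent A p v -> smooth_at A p f ->
  v (fun q => cos (f q)) = - sin (f p) * v f.
Proof. by move=> tv sf; rewrite (tangent_comp hA tv sf openT) ?D_cos //; exact: smooth_cos. Qed.

Lemma minimal_intro S h U q phi : defining S h U -> U q -> S q ->
  ~ characteristic A Delta S q -> smooth_at A q phi ->
  (\forall p \near q, S p -> cos (phi p) * X i1 p h + sin (phi p) * X i2 p h = 0) ->
  cos (phi q) * X i1 q phi + sin (phi q) * X i2 q phi =
    - c i1 i2 i1 q * cos (phi q) - c i1 i2 i2 q * sin (phi q) ->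
  minimal_at A Delta X c S q.
Proof.
move=> dS Uq Sq nc sphi tgt eqn; split=> //.
have sh := defining_smooth dS Uq.
exists (fun p => - sin (phi p)), (fun p => cos (phi p)); split.
- by apply: smooth_at_opp => //; exact: smooth_at_sin.
- exact: smooth_at_cos.
- by apply: nearW => p; rewrite sqrrN addrC cos2Dsin2.
- pose N p := X i1 p h * X i1 p h + X i2 p h * X i2 p h.
  have sN : smooth_at A q N.
    by apply: smooth_at_add => //; apply: smooth_at_mul => //; exact: frame_smooth.
  have N0 : N q != 0.
    apply/eqP => N0; apply: nc; apply/(defining_characteristic dS Uq Sq).
    have h1 := sqr_ge0 (X i1 q h); have h2 := sqr_ge0 (X i2 q h).
    move: N0; rewrite /N -!expr2 => N0.
    by split; apply/eqP; rewrite -sqrf_eq0 eq_le; apply/andP; split=> //; rewrite -N0 ?lerDl ?lerDr.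
  have nU : \forall p \near q, U p by apply: open_nbhs_nbhs; split=> //; exact: defining_open dS.
  near=> p; move=> Sp.
  have Up : U p by near: p.
  have Np : N p != 0 by near: p; exact: smooth_at_neq0.
  have t : cos (phi p) * X i1 p h + sin (phi p) * X i2 p h = 0.
    have tp : S p -> cos (phi p) * X i1 p h + sin (phi p) * X i2 p h = 0 by near: p.
    exact: tp.
  pose l := - sin (phi p) * X i1 p h + cos (phi p) * X i2 p h.
  have cs := cos2Dsin2 (phi p).
  have e1 : X i1 p h = l * - sin (phi p).
    transitivity (X i1 p h * (cos (phi p) ^+ 2 + sin (phi p) ^+ 2)); first by rewrite cs mulr1.
    transitivity (l * - sin (phi p) + cos (phi p) * (cos (phi p) * X i1 p h + sin (phi p) * X i2 p h)); first by rewrite /l; ring.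
    by rewrite t mulr0 addr0.
  have e2 : X i2 p h = l * cos (phi p).
    transitivity (X i2 p h * (cos (phi p) ^+ 2 + sin (phi p) ^+ 2)); first by rewrite cs mulr1.
    transitivity (l * cos (phi p) + sin (phi p) * (cos (phi p) * X i1 p h + sin (phi p) * X i2 p h)); first by rewrite /l; ring.
    by rewrite t mulr0 addr0.
  apply: (horizontal_normal_intro dS Up Sp _ _ e1 e2); first by rewrite sqrrN addrC.
  by apply/eqP => l0; move: Np; rewrite /N e1 e2 l0 !mul0r addr0 eqxx.
- rewrite (tangentN hA (frame_tangent _ _)); last exact: smooth_at_sin.
  rewrite (tangent_sin (frame_tangent _ _)) // (tangent_cos (frame_tangent _ _)) //.
  rewrite (_ : _ + _ = - (cos (phi q) * X i1 q phi + sin (phi q) * X i2 q phi) - sin (phi q) * c i1 i2 i2 q - cos (phi q) * c i1 i2 i1 q); last by ring.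
  by rewrite eqn; ring.
Unshelve. all: by end_near. Qed.

(* The minimal surface equation multiplied by the cube of the norm of the
   horizontal gradient of h; unlike the equation itself it makes sense at
   characteristic points, where it holds trivially. *)
Definition horizontal_mce h p :=
  X i2 p h ^+ 2 * X i1 p (fun q => X i1 q h)
  - X i1 p h * X i2 p h * (X i1 p (fun q => X i2 q h) + X i2 p (fun q => X i1 q h))
  + X i1 p h ^+ 2 * X i2 p (fun q => X i2 q h)
  + (X i1 p h ^+ 2 + X i2 p h ^+ 2) * (X i1 p h * c i1 i2 i2 p - X i2 p h * c i1 i2 i1 p).

(** The function X1 h nu2 - X2 h nu1 vanishes on S, so - nu2 X1 + nu1 X2, tangent to S at q, kills
    it. This relates the derivatives of nu to the second derivatives of h. *)
Lemma minimal_mce S h U q : defining S h U -> U q -> S q -> minimal_at A Delta X c S q ->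
  horizontal_mce h q = 0.
Proof.
move=> dS Uq Sq [nc [nu1 [nu2 [s1 s2 unit hn eqn]]]].
have sh := defining_smooth dS Uq.
have sa i : smooth_at A q (fun p => X i p h) by exact: frame_smooth.
have [l l0 [e1 e2]] := horizontal_normal_elim dS Uq Sq (nbhs_singleton hn Sq).
have u i : nu1 q * X i q nu1 + nu2 q * X i q nu2 = 0.
  have ti := frame_tangent i q.
  have s12 : smooth_at A q (fun p => nu1 p * nu1 p + nu2 p * nu2 p) by apply: smooth_at_add => //; exact: smooth_at_mul.
  have : X i q (fun p => nu1 p * nu1 p + nu2 p * nu2 p) = 0.
    have e : \forall p \near q, nu1 p * nu1 p + nu2 p * nu2 p = 1 by apply: filterS unit => p; rewrite !expr2.
    by rewrite (tangent_eq hA ti e s12) (tangent_cst hA ti).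
  rewrite (tangentD ti) ?(tangentM ti) //; try exact: smooth_at_mul.
  by move=> z; lra.
pose f p := X i1 p h * nu2 p - X i2 p h * nu1 p.
have sm1 : smooth_at A q (fun p => X i1 p h * nu2 p) by exact: smooth_at_mul.
have sm2 : smooth_at A q (fun p => X i2 p h * nu1 p) by exact: smooth_at_mul.
have sf : smooth_at A q f by exact: smooth_at_sub.
pose v := comb3 q (- nu2 q) (nu1 q) 0.
have tv : is_tangent A q v by exact: comb3_tangent.
have vh : v h = 0 by rewrite /v /comb3 e1 e2; ring.
have nU : \forall p \near q, U p by apply: open_nbhs_nbhs; split=> //; exact: defining_open dS.
have vf : v f = 0.
  apply: (defining_vanish dS Uq Sq tv vh sf).
  apply: filterS2 nU hn => p Up hnp Sp; rewrite /f.
  have [k _ [-> ->]] := horizontal_normal_elim dS Up Sp (hnp Sp).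
  by ring.
rewrite /horizontal_mce e1 e2; apply: (mce_algebra (u i1) (u i2) eqn).
move: vf; rewrite /f (tangentB hA tv) // !(tangentM tv) // e1 e2 /v /comb3.
move=> vf; rewrite -[RHS]vf; ring.
Qed.

Lemma delta_minimal_mce S h U q : delta_minimal A Delta X c S -> defining S h U -> U q -> S q ->
  horizontal_mce h q = 0.
Proof.
move=> [_ mS] dS Uq Sq.
have [|nc] := pselect (characteristic A Delta S q); last first.
  by exact: minimal_mce dS Uq Sq (mS q Sq nc).
move=> /(defining_characteristic dS Uq Sq)[h1 h2].
by rewrite /horizontal_mce h1 h2; ring.
Qed.

(** * Swept surfaces *)

Variables (D : set (R * (M * R))) (Phi : R -> (M * R) -> (M * R)).
Hypothesis hPhi : is_flow (bar_atlas A) (char_field X c) D Phi.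
Local Notation bA := (bar_atlas A).

Lemma bar_is_atlas : is_atlas bA.
Proof. by apply: prod_is_atlas => //; exact: line_is_atlas. Qed.
Let hbA := bar_is_atlas.

Definition bar_chart d : chart (M * R) ('rV[R]_3 * R^o) := prod_chart d line_chart.

Lemma bar_compatible d : compatible A d -> compatible bA (bar_chart d).
Proof. by move=> kd; apply: prod_compatible => //; [exact: line_is_atlas|exact: line_compatible]. Qed.

Lemma smooth_at_fst (p : M * R) f : smooth_at A p.1 f -> smooth_at bA p (f \o fst).
Proof.
have [d [_ Ad cd dp H]] := smooth_at_in hA p.1.
move=> /H[U [oU Up Ud sU]]; exists (bar_chart d); split=> //.
  by exists d, line_chart.
exists [set x | U x.1 /\ setT x.2]; split=> //.
- by apply: open_prodV => //; exact: openT.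
- move=> [x y] [/= Ux _]; rewrite prod_cimg; split; first exact: Ud.
  by exists y.
- by move=> k; apply: (@Ck_fst _ _ _ _ _ _ _ _ U (f \o cinv d)) => // x [].
Qed.

Lemma smooth_at_snd (p : M * R) : smooth_at bA p snd.
Proof.
have [d [_ Ad cd dp H]] := smooth_at_in hA p.1.
exists (bar_chart d); split=> //; first by exists d, line_chart.
have e : cimg (bar_chart d) = [set x | cimg d x.1 /\ setT x.2].
  by rewrite prod_cimg; apply/seteqP; split=> x [h1 h2]; split=> //; exists x.2.
exists (cimg (bar_chart d)); split=> //.
- by rewrite e; apply: open_prodV; [exact: (chart_img_open cd)|exact: openT].
- by exists p.
- move=> k; apply: (@Ck_snd _ _ _ _ _ _ _ _ setT id) => //; first exact: openT.
  exact: Ck_id.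
Qed.

Lemma char_field_fst (p : M * R) f :
  char_field X c p (f \o fst) = comb3 p.1 (cos p.2) (sin p.2) 0 f.
Proof.
rewrite /char_field /comb3 /lift_field /X4 /velocity.
rewrite [X in _ + gfun c p * X = _](_ : _ = 0) ?mulr0 ?mul0r //.
exact: (derive_cst (f p.1 : R^o)).
Qed.

Lemma char_field_snd (p : M * R) : char_field X c p snd = gfun c p.
Proof.
rewrite /char_field /lift_field /X4 /velocity !(tangent_cst hA (frame_tangent _ _)) !mulr0 !add0r.
by rewrite (_ : _ \o _ = id) // derive_id mulr1.
Qed.

Definition row3 (a b e : R) : 'rV[R]_3 := \row_j (if j == i1 then a else if j == i2 then b else e).

Lemma row3E a b e : (row3 a b e 0 i1 = a) * (row3 a b e 0 i2 = b) * (row3 a b e 0 i3 = e).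
Proof. by rewrite !mxE. Qed.

Lemma row3_eta (x : 'rV[R]_3) : x = row3 (x 0 i1) (x 0 i2) (x 0 i3).
Proof. by apply/rowP; apply: ord3P; rewrite row3E. Qed.

(** If the cross product were 0, the relations y_i x - x_i y = 0 would force every x_i to be 0 by
    freeness, and then 1 x + 0 y = 0 would contradict it. *)
Lemma cross_free (x y : 'rV[R]_3) : 
  let n1 := x 0 i2 * y 0 i3 - x 0 i3 * y 0 i2 in
  let n2 := x 0 i3 * y 0 i1 - x 0 i1 * y 0 i3 in
  let n3 := x 0 i1 * y 0 i2 - x 0 i2 * y 0 i1 in
  (forall a b, (forall i, a * x 0 i + b * y 0 i = 0) -> a = 0 /\ b = 0) ->
  n1 ^+ 2 + n2 ^+ 2 + n3 ^+ 2 != 0.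
Proof.
move=> n1 n2 n3 H; apply/eqP => /sum_sqr3_eq0[m1 m2 m3].
have x0 i : x 0 i = 0.
  have [|_ /eqP] := H (y 0 i) (- x 0 i); last by rewrite oppr_eq0 => /eqP.
  move: m1 m2 m3; rewrite /n1 /n2 /n3 => m1 m2 m3.
  by apply: ord3P; move: i; apply: ord3P; lra.
have [|/eqP] := H 1 0; last by rewrite oner_eq0.
by move=> i; rewrite x0 mul0r mulr0 addr0.
Qed.

Lemma tube_Jmx (y : R * R -> 'rV[R]_3) (n x0 : 'rV[R]_3) i :
  let Psi (x : 'rV[R]_3) := y (x 0 i1, x 0 i2) + x 0 i3 *: n in
  differentiable Psi x0 ->
  [/\ Jmx Psi x0 i1 i = 'D_1 (fun t : R^o => y (t, x0 0 i2) 0 i + x0 0 i3 * n 0 i : R^o) (x0 0 i1),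
      Jmx Psi x0 i2 i = 'D_1 (fun s : R^o => y (x0 0 i1, s) 0 i + x0 0 i3 * n 0 i : R^o) (x0 0 i2) &
      Jmx Psi x0 i3 i = n 0 i].
Proof.
move=> Psi dP.
have k (e : R) (j m : 'I_3) : (e *: 'e_j + x0) 0 m = e * (m == j)%:R + x0 0 m by rewrite !mxE.
have J j : Jmx Psi x0 j i = 'D_('e_j) (fun x => row_coord i (Psi x)) x0.
  by rewrite (derive_post (l := row_coord i)) // ?mxE //; exact: lin_continuous.
have E (e : R) j : row_coord i (Psi (e *: 'e_j + x0)) = y (e * (i1 == j)%:R + x0 0 i1, e * (i2 == j)%:R + x0 0 i2) 0 i
   + (e * (i3 == j)%:R + x0 0 i3) * n 0 i.
  by rewrite /Psi /row_coord !k mxE [in X in _ + X]mxE.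
rewrite !J; split.
- by apply: derive_along => e; rewrite E /= !mulr0 !add0r.
- by apply: derive_along => e; rewrite E /= !mulr0 !add0r.
- rewrite (@derive_along _ _ _ _ _ (fun t : R^o => y (x0 0 i1, x0 0 i2) 0 i + t * n 0 i : R^o) _ _ (x0 0 i3) (1 : R^o)).
    by rewrite deriveD // derive_cst add0r deriveM // derive_cst scaler0 add0r derive_id [_ *: _]mulr1.
  by move=> e; rewrite E /= !mulr0 !add0r.
Qed.

Section Sweeping.
Variables (xi : field R (M * R)) (J : set R) (Gamma : R -> M * R).
Hypothesis sxi : smooth_field bA xi.
Hypothesis hGamma : integral_curve bA xi J Gamma.
Local Notation F := (sweep Phi Gamma).
Local Notation SD := (sweep_dom D J Gamma).
Implicit Types z : R * R.

Lemma Gamma_continuous s : J s -> {for s, continuous Gamma}.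
Proof. by move=> Js; apply: (curve_continuous hbA hGamma). Qed.

Lemma sweep_dom_open : open SD.
Proof.
rewrite openE => -[t s] [/= Js Dts].
have nJ : \forall s' \near s, J s' by apply: open_nbhs_nbhs; split=> //; exact: (curve_open hGamma).
have cG := Gamma_continuous Js.
have nD : nbhs (t, Gamma s) D by apply: open_nbhs_nbhs; split=> //; exact: (flow_open hPhi).
have c2 : {for (t, s), continuous (fun z : R * R => (z.1, Gamma z.2))}.
  have h1 : fst z @[z --> (t, s)] --> t by exact: cvg_fst.
  have h2 : Gamma z.2 @[z --> (t, s)] --> Gamma s.
    by apply: (@cvg_comp _ _ _ snd Gamma _ (nbhs s)) => //; exact: cvg_snd.
  exact: cvg_pair h1 h2.
have := c2 _ nD => nD2.
have nJ2 : \forall z \near (t, s), J z.2.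
  have c3 : snd z @[z --> (t, s)] --> s by exact: cvg_snd.
  exact: c3 _ nJ.
by apply: filterS2 nJ2 nD2.
Qed.

Lemma sweep_dt_derive z (f : M * R -> R) : SD z -> smooth_at bA (F z) f ->
  is_derive z.1 1 (fun t : R^o => f (F (t, z.2)) : R^o) (char_field X c (F z) f).
Proof.
move=> [Jz Dz] sf; exact: (curve_derive (flow_curve hPhi (Gamma z.2)) Dz sf).
Qed.

(** The flow is smooth jointly in time and point, and [curve_Ck] makes Gamma smooth in a chart; f
    along the sweep is the composite through (t, s) -> (t, Gamma s). *)
Lemma sweep_smooth z (f : M * R -> R) : SD z -> smooth_at bA (F z) f ->
  exists O : set (R^o * R^o), [/\ open O, O z, O `<=` SD & smooth_on O (f \o F : _ -> R^o)].
Proof.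
move=> [Jz Dz] sf.
have := flow_smooth hPhi Dz sf.
have [d [kd Ad cd dq H]] := smooth_at_in hA (Gamma z.2).1.
pose bd := bar_chart d.
have kbd : compatible bA bd by exact: bar_compatible.
have klbd : compatible (prod_atlas (@line_atlas R) bA) (prod_chart line_chart bd).
  by apply: prod_compatible => //; [exact: line_is_atlas|exact: line_compatible].
have hlbA : is_atlas (prod_atlas (@line_atlas R) bA).
  by apply: prod_is_atlas => //; exact: line_is_atlas.
have dz : dom (prod_chart line_chart bd) (z.1, Gamma z.2) by [].
move=> /(smooth_inP _ hlbA klbd dz)[U [oU Uz Ud sU]].
pose g s : 'rV[R]_3 * R^o := cmap bd (Gamma s).
pose O1 : set R^o := [set s | J s /\ dom bd (Gamma s)].
have oO1 : open O1.
  rewrite openE => s [Js ds]; apply: filterI; first by apply: open_nbhs_nbhs; split=> //; exact: (curve_open hGamma).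
  have cG := Gamma_continuous Js.
  by apply: cG; apply: open_nbhs_nbhs; split=> //; exact: (chart_open (compatible_chart kbd)).
have sg k : Ck k O1 g.
  apply/(@cCkP _ _ _ (fbasis_prod (fbasis_rV R 3) (fbasis_R R))) => // i; apply: (@curve_Ck _ _ _ _ _ _ _ sxi hGamma k O1 (fun q : M * R => bl i (cmap bd q))) => //; first by move=> s [].
  by move=> s [_ ds]; apply: smooth_at_lcoord.
pose O2 : set (R^o * R^o) := [set z | setT z.1 /\ O1 z.2].
have oO2 : open O2 by apply: open_prodV => //; exact: openT.
pose m (z : R^o * R^o) : R^o * ('rV[R]_3 * R^o) := (z.1, g z.2).
have sm k : Ck k O2 m.
  apply: Ck_pair => //; first by apply: (@Ck_fst _ _ _ _ _ _ _ _ setT id) => //; [exact: openT|exact: Ck_id].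
  by apply: (@Ck_snd _ _ _ _ _ _ _ _ O1 g) => // x [].
have oSD : open (SD : set (R^o * R^o)) by exact: sweep_dom_open.
have oO := Ck_open_preimage oO2 oU (sm 0%N).
exists ((O2 `&` m @^-1` U) `&` SD); split.
- exact: openI.
- by [].
- by move=> x [].
- move=> k; apply: (@Ck_eq _ _ _ _ _ (fun z => (fun y => f (Phi y.1 y.2)) (cinv (prod_chart line_chart bd) (m z)))).
  + exact: openI.
  + move=> x [[[_ [Jx dx]] Ux] _]; rewrite /m /g /= /sweep.
    by have := chart_cancel (compatible_chart kbd) dx => /= ->.
  + apply: (@Ck_comp_scalar _ _ _ _ _ _ U m _ _ _ _ (sU k)) => //; first exact: openI.
      by move=> x [[]].
    by apply: Ck_sub (sm k) => x [[]].
Qed.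

Lemma push_tangent (p : M * R) (v : vec R (M * R)) : is_tangent bA p v -> is_tangent A p.1 (push v).
Proof.
move=> [v1 v2]; split=> [a f g sf sg|f g sf sg]; rewrite /push.
  by rewrite -v1 //; exact: smooth_at_fst.
by rewrite -[LHS]/(v (fun x => (f \o fst) x * (g \o fst) x)) v2 //; exact: smooth_at_fst.
Qed.

Lemma sweep_ds_derivable z (f : M * R -> R) : SD z -> smooth_at bA (F z) f ->
  derivable (fun s : R^o => f (F (z.1, s)) : R^o) z.2 1.
Proof.
move=> Sz sf; have [W [oW Wz _ sW]] := sweep_smooth Sz sf.
have df : differentiable (f \o F : R^o * R^o -> R^o) z by exact: (sW 1%N).1.
have e (s : R) : (z.1, 0) + s *: ((0, 1) : R^o * R^o) = (z.1, s) :> R^o * R^o.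
  by congr pair => /=; rewrite ?scaler0 ?addr0 // add0r [_ *: _]mulr1.
have L := @line_is_derive R (R^o * R^o)%type (f \o F) (z.1, 0) (0, 1) z.2.
rewrite e -surjective_pairing in L; have [d _] := L df.
by move: d; under eq_fun do rewrite e.
Qed.

Lemma sweep_ds_tangent z : SD z -> is_tangent bA (F z) (sweep_ds Phi Gamma z).
Proof.
case: z => t s Sz; apply: (velocity_tangent (gamma := fun s => F (t, s))) => // g sg.
exact: (@sweep_ds_derivable (t, s)).
Qed.

Lemma sweep_dt_tangent z : SD z -> is_tangent bA (F z) (sweep_dt Phi Gamma z).
Proof.
case: z => t s Sz; apply: (velocity_tangent (gamma := fun t => F (t, s))) => // g sg.
by have [] := @sweep_dt_derive (t, s) g Sz sg.
Qed.

Lemma push_dt z f : SD z -> smooth_at A (F z).1 f ->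
  push (sweep_dt Phi Gamma z) f = comb3 (F z).1 (cos (F z).2) (sin (F z).2) 0 f.
Proof.
move=> Sz sf; rewrite -char_field_fst.
by have [_ <-] := sweep_dt_derive Sz (smooth_at_fst sf).
Qed.

Lemma sweep_dt_snd z : SD z -> is_derive z.1 1 (fun t : R^o => (F (t, z.2)).2 : R^o) (gfun c (F z)).
Proof. by move=> Sz; rewrite -char_field_snd; apply: (sweep_dt_derive Sz); exact: smooth_at_snd. Qed.

Lemma proj_regular_bar z : proj_regular A Phi Gamma z -> bar_regular A Phi Gamma z.
Proof.
move=> H a b e; apply: H => f sf.
by have := e _ (smooth_at_fst sf).
Qed.

(** The t-velocity projects to the unit horizontal vector with components (cos, sin, 0), so a
    tangent vector with zeta_3 <> 0 gives the s-velocity a nonzero X3-component, and the two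
    projections are independent. *)
Lemma transverse_regular z : SD z -> fails_on_tangent A X Phi Gamma z (fun _ _ y3 _ => y3 = 0) ->
  proj_regular A Phi Gamma z /\ exists a1 a2 a3, a3 <> 0 /\
    veq A (F z).1 (push (sweep_ds Phi Gamma z)) (comb3 (F z).1 a1 a2 a3).
Proof.
move=> Sz [y1 [y2 [y3 [y4 [[a [b e]] y30]]]]].
have ts := push_tangent (sweep_ds_tangent Sz).
have [u1 [u2 [u3 eu]]] := frame_span3 ts.
set p := F z in ts eu e *.
have [_ _ zbu] : [/\ y1 - a * cos p.2 - b * u1 = 0, y2 - a * sin p.2 - b * u2 = 0 & y3 - b * u3 = 0].
  apply: (frame_indep (p := p.1)) => f sf.
  have := e _ (smooth_at_fst sf); rewrite /vcomb.
  rewrite -[sweep_dt _ _ _ _]/(push (sweep_dt Phi Gamma z) f) -[sweep_ds _ _ _ _]/(push (sweep_ds Phi Gamma z) f).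
  rewrite push_dt // eu // -/p /lift_field /X4 /velocity.
  rewrite [X in _ + y4 * X](_ : _ = 0) ?mulr0 ?addr0; last exact: (derive_cst (f p.1 : R^o)).
  by rewrite /comb3 => h; lra.
have u30 : u3 <> 0 by move=> h; apply: y30; move: zbu; rewrite h mulr0 subr0.
split; last by exists u1, u2, u3.
move=> a' b' e'.
have [h1 h2 h3] : [/\ a' * cos p.2 + b' * u1 = 0, a' * sin p.2 + b' * u2 = 0 & b' * u3 = 0].
  apply: (frame_indep (p := p.1)) => f sf.
  have := e' f sf; rewrite /vcomb push_dt // eu // -/p /comb3 => h; lra.
have b0 : b' = 0 by move/eqP: h3; rewrite mulf_eq0 => /orP[/eqP //|/eqP].
split=> //; rewrite b0 !mul0r !addr0 in h1 h2.
rewrite -[a']mulr1 -(cos2Dsin2 p.2) mulrDr !expr2 !mulrA h1 h2; ring.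
Qed.

Lemma sweep_fst_near z (N : set M) : SD z -> open N -> N (F z).1 -> \forall z' \near z, N (F z').1.
Proof.
move=> Sz oN Nz; have [W [oW Wz _ sW]] := sweep_smooth Sz (smooth_at_fst (indicator_smooth hA oN Nz)).
have cf : {for (z : R^o * R^o), continuous (((fun q => `[< N q >]%:R) \o fst) \o F : R^o * R^o -> R^o)}.
  by apply: Ck_continuous (sW 0%N) _.
have : \forall z' \near (z : R^o * R^o), (((fun q => `[< N q >]%:R) \o fst) \o F : R^o * R^o -> R^o) z' != 0.
  apply: (cf [set x | x != 0]); apply: open_nbhs_nbhs; split; first exact: open_neq.
  by rewrite /= asboolT // oner_neq0.
by apply: filterS => t /=; case: asboolP => //; rewrite eqxx.
Qed.

Lemma sweep_chart_smooth z0 d : compatible A d -> SD z0 -> dom d (F z0).1 ->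
  exists W : set (R^o * R^o), [/\ open W, W z0, W `<=` SD, forall z, W z -> dom d (F z).1 &
    smooth_on W (fun z => cmap d (F z).1 : 'rV[R]_3) /\ smooth_on W (fun z => (F z).2 : R^o)].
Proof.
move=> kd Sz dz.
have := sweep_fst_near Sz (chart_open (compatible_chart kd)) dz.
rewrite /prop_near1 nbhsE => -[V [oV Vz] Vd].
have si i := sweep_smooth Sz (smooth_at_fst (smooth_at_coord hA i kd dz)).
have [W1 [oW1 W1z W1S sW1]] := si i1.
have [W2 [oW2 W2z _ sW2]] := si i2.
have [W3 [oW3 W3z _ sW3]] := si i3.
have [W4 [oW4 W4z _ sW4]] := sweep_smooth Sz (smooth_at_snd (F z0)).
exists (V `&` (W1 `&` W2 `&` W3 `&` W4)); split.
- by apply: openI => //; apply: openI => //; apply: openI => //; exact: openI.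
- by [].
- by move=> z [_ [[[h _] _] _]]; exact: W1S.
- by move=> z [/Vd].
- split=> k.
    apply/cCkP; first by apply: openI => //; apply: openI => //; apply: openI => //; exact: openI.
    apply: ord3P.
    + by apply: Ck_sub (sW1 k) => z [_ [[[h1 h2] h3] h4]].
    + by apply: Ck_sub (sW2 k) => z [_ [[[h1 h2] h3] h4]].
    + by apply: Ck_sub (sW3 k) => z [_ [[[h1 h2] h3] h4]].
  by apply: Ck_sub (sW4 k) => z [_ [_ h4]].
Qed.

(** The inverse function theorem for (t, s, e) -> y(t, s) + e n, where y is the projected sweep read
    in d and n is independent of its two velocities. In the new chart the sweep becomes the plane e
    = 0 with its own parameters as coordinates; the last clause says how a nearby point projects
    onto it along n. *)
Lemma tube_chart z0 d (n : 'rV[R]_3) : SD z0 -> compatible A d -> dom d (F z0).1 ->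
  (forall a : 'rV[R]_3, (forall i, a 0 i1 * push (sweep_dt Phi Gamma z0) (coord d i) +
     a 0 i2 * push (sweep_ds Phi Gamma z0) (coord d i) + a 0 i3 * n 0 i = 0) -> a = 0) ->
  exists d' r, [/\ compatible A d', 0 < r,
    forall z, `|z.1 - z0.1| < r -> `|z.2 - z0.2| < r ->
      [/\ SD z, dom d' (F z).1 & cmap d' (F z).1 = row3 z.1 z.2 0],
    cimg d' = ball (row3 z0.1 z0.2 0) r &
    smooth_on (ball (row3 z0.1 z0.2 0) r) (fun x : 'rV[R]_3 => (F (x 0 i1, x 0 i2)).2 : R^o) /\
    forall p, dom d' p -> let z := (coord d' i1 p, coord d' i2 p) in
      [/\ dom d p, dom d (F z).1 & cmap d p = cmap d (F z).1 + coord d' i3 p *: n]].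
Proof.
move=> Sz kd dz ker; have cd := compatible_chart kd.
have [W [oW Wz WS Wd [sy sphi]]] := sweep_chart_smooth kd Sz dz.
pose y z : 'rV[R]_3 := cmap d (F z).1.
pose l (x : 'rV[R]_3) : R^o * R^o := (x 0 i1, x 0 i2).
pose Psi (x : 'rV[R]_3) : 'rV[R]_3 := y (l x) + x 0 i3 *: n.
have sl k (U : set 'rV[R]_3) : open U -> Ck k U l.
  by move=> oU; apply: Ck_pair => //; [apply: (@Ck_lin _ _ _ _ _ (row_coord i1))|apply: (@Ck_lin _ _ _ _ _ (row_coord i2))]; exact: lin_continuous.
pose U := l @^-1` W.
have oU : open U.
  have := Ck_open_preimage openT oW (sl 0%N setT openT).
  by rewrite setTI.
have sP : smooth_on U Psi.
  move=> k; apply: Ck_add => //.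
    by apply: (@Ck_comp _ _ _ _ _ _ _ _ W l y) => //; exact: sl.
  apply: (@Ck_post _ _ _ _ k U (row_coord i3) (scalev n)) => //; first exact: lin_continuous.
  by apply: Ck_lin; exact: lin_continuous.
pose x0 := row3 z0.1 z0.2 0.
have lx0 : l x0 = z0 by rewrite /l !row3E -surjective_pairing.
have Ux0 : U x0 by rewrite /U /= lx0.
have dP : differentiable Psi x0 by exact: (sP 1%N).1.
have uP : Jmx Psi x0 \in unitmx.
  have x3 : x0 0 i3 = 0 by rewrite row3E.
  have x1 : x0 0 i1 = z0.1 by rewrite row3E.
  have x2 : x0 0 i2 = z0.2 by rewrite row3E.
  rewrite -row_free_unit -kermx_eq0; apply/rowV0P => a /sub_kermxP e; apply: ker => i.
  have [h1 h2 h3] := tube_Jmx i dP.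
  have /rowP/(_ i) := e; rewrite [LHS]mxE [RHS]mxE sum3 => e'.
  rewrite -[RHS]e'; congr (_ * _ + _ * _ + _ * _); last by rewrite h3.
  - rewrite h1 x1 x2 x3; by apply: derive_along => t; rewrite mul0r addr0.
  - rewrite h2 x1 x2 x3; by apply: derive_along => t; rewrite mul0r addr0.
have [V [W' [g [dPsi Vx0 VU]]]] := inverse_function oU Ux0 sP uP.
have oC : open (U `&` Psi @^-1` cimg d) by exact: Ck_open_preimage oU (chart_img_open cd) (sP 0%N).
have Cx0 : (U `&` Psi @^-1` cimg d) x0.
  by split=> //; rewrite /Psi /= lx0 row3E scale0r addr0; exists (F z0).1.
have : nbhs x0 ((U `&` Psi @^-1` cimg d) `&` V).
  by apply: open_nbhs_nbhs; split=> //; apply: openI => //; exact: (df_openl dPsi).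
move=> /nbhs_ballP[r /= r0 Hr].
have HV x : ball x0 r x -> V x by move=> /Hr[].
have HU x : ball x0 r x -> U x by move=> /Hr[[]].
have HC x : ball x0 r x -> cimg d (Psi x) by move=> /Hr[[]].
have oB : open (ball x0 r) by exact: ball_open.
have dPsi' := diffeo_sub dPsi oB HV.
have WC : W' `&` g @^-1` ball x0 r `<=` cimg d.
  by move=> w [Ww gw]; rewrite -(df_Kr dPsi Ww); exact: HC.
have Wy0 : (W' `&` g @^-1` ball x0 r) (cmap d (F z0).1).
  have -> : cmap d (F z0).1 = Psi x0 by rewrite /Psi lx0 row3E scale0r addr0.
  by apply: (df_map dPsi'); exact: ballxx.
have := compatible_diffeo hA kd dz (diffeo_sym dPsi') Wy0 WC.
set d' := Chart _ _ _ => -[kd' d'z Ed'].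
have W'y x : ball x0 r x -> x 0 i3 = 0 -> (W' `&` g @^-1` ball x0 r) (y (l x)).
  by move=> xr x3; have := df_map dPsi' xr; rewrite /Psi x3 scale0r addr0.
exists d', r; split=> //.
- move=> z z1 z2.
  have xr : ball x0 r (row3 z.1 z.2 0).
    apply/ballE; apply: (@le_lt_trans _ _ (Num.max `|z.1 - z0.1| `|z.2 - z0.2|)); last by rewrite gt_max z1 z2.
    apply: rv_norm_le; first by rewrite le_max normr_ge0.
    apply: ord3P; rewrite [X in `|X|]mxE [X in _ + X]mxE !row3E.
    + by rewrite le_max lexx.
    + by rewrite le_max lexx orbT.
    + by rewrite subrr normr0 le_max normr_ge0.
  have lz : l (row3 z.1 z.2 0) = z by rewrite /l !row3E -surjective_pairing.
  have Wz' : W z by rewrite -lz; exact: HU.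
  have dFz := Wd _ Wz'.
  have yz := W'y _ xr; rewrite row3E lz in yz.
  split; [exact: WS|by split=> //; exact: yz|].
  have := df_K dPsi' xr; rewrite /Psi lz row3E scale0r addr0; exact.
- split=> [k|p d'p].
    apply: (@Ck_comp _ _ _ _ _ _ _ _ W l (fun z => (F z).2 : R^o)) => //.
    exact: sl.
  have xr : ball x0 r (cmap d' p) by rewrite -Ed'; exists p.
  have [dp Wp] := d'p; split=> //; first by apply: Wd; exact: HU xr.
  rewrite -[RHS]/(Psi (g (cmap d p))) (df_Kr dPsi) //.
  exact: Wp.1.
Qed.

(** The cross product of the two velocities, read in a chart, serves as transverse direction. *)
Lemma patch_chart z0 : SD z0 -> proj_regular A Phi Gamma z0 ->
  exists d r, [/\ compatible A d, 0 < r,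
    forall z, `|z.1 - z0.1| < r -> `|z.2 - z0.2| < r ->
      [/\ SD z, dom d (F z).1 & cmap d (F z).1 = row3 z.1 z.2 0],
    cimg d = ball (row3 z0.1 z0.2 0) r &
    smooth_on (ball (row3 z0.1 z0.2 0) r) (fun x : 'rV[R]_3 => (F (x 0 i1, x 0 i2)).2 : R^o)].
Proof.
move=> Sz reg; have [d [kd _ _ dz _]] := smooth_at_in hA (F z0).1.
pose wt : 'rV[R]_3 := \row_i push (sweep_dt Phi Gamma z0) (coord d i).
pose ws : 'rV[R]_3 := \row_i push (sweep_ds Phi Gamma z0) (coord d i).
have wtE i : wt 0 i = push (sweep_dt Phi Gamma z0) (coord d i) by rewrite mxE.
have wsE i : ws 0 i = push (sweep_ds Phi Gamma z0) (coord d i) by rewrite mxE.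
have free a b : (forall i, a * wt 0 i + b * ws 0 i = 0) -> a = 0 /\ b = 0.
  move=> ab; apply: reg.
  apply: (tangent_coord0 hA kd dz); first apply: is_tangent_comb.
  - by apply: push_tangent; exact: sweep_dt_tangent.
  - by apply: push_tangent; exact: sweep_ds_tangent.
  - by move=> i; have := ab i; rewrite wtE wsE.
pose n : 'rV[R]_3 := row3 (wt 0 i2 * ws 0 i3 - wt 0 i3 * ws 0 i2)
  (wt 0 i3 * ws 0 i1 - wt 0 i1 * ws 0 i3) (wt 0 i1 * ws 0 i2 - wt 0 i2 * ws 0 i1).
have [|d' [r [kd' r0 Hd Ed [sphi _]]]] := tube_chart (n := n) Sz kd dz; last by exists d', r.
move=> a Ha.
have H i : a 0 i1 * wt 0 i + a 0 i2 * ws 0 i + a 0 i3 * n 0 i = 0.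
  by rewrite wtE wsE.
have a3 : a 0 i3 = 0.
  have N := cross_free free.
  have h1 := H i1; have h2 := H i2; have h3 := H i3; rewrite /n !row3E in h1 h2 h3.
  by have /eqP := cross_dot h1 h2 h3; rewrite mulf_eq0 (negbTE N) orbF => /eqP.
have [|h1 h2] := free (a 0 i1) (a 0 i2); first by move=> i; have := H i; rewrite a3 mul0r addr0.
by apply/rowP; apply: ord3P; rewrite mxE.
Qed.

Lemma tangent_coord_eq d p v w : compatible A d -> dom d p -> is_tangent A p v -> is_tangent A p w ->
  (forall i, v (coord d i) = w (coord d i)) -> veq A p v w.
Proof.
by move=> kd dp tv tw e f sf; rewrite (tangentE hA kd dp tv sf) (tangentE hA kd dp tw sf); apply: eq_bigr => i _; rewrite e.
Qed.

Lemma frame_coord_neq0 d p j : compatible A d -> dom d p -> exists i, X i p (coord d j) != 0.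
Proof.
move=> kd dp; apply: contrapT => /forallNP H.
have z i : X i p (coord d j) = 0 by have /negP := H i; rewrite negbK => /eqP.
have u := frame_mx_unit kd dp.
have : (1%:M : 'M[R]_3) j j = 0.
  rewrite -(mulVmx u) mxE big1 // => i _; rewrite [X in _ * X]mxE z mulr0 //.
by rewrite mxE eqxx => /eqP; rewrite oner_eq0.
Qed.

Lemma minimal_patch z0 : SD z0 -> proj_regular A Phi Gamma z0 -> exists B : set (R * R),
  [/\ open B, B z0, B `<=` SD, regular_patch A Phi Gamma B &
      delta_minimal A Delta X c ((fst \o F) @` B)].
Proof.
move=> Sz reg; have [d [r [kd r0 Hd Ed sphi]]] := patch_chart Sz reg.
have cd := compatible_chart kd.
pose B : set (R * R) := [set z | `|z.1 - z0.1| < r /\ `|z.2 - z0.2| < r].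
have oB : open B.
  have -> : B = [set z | ball z0.1 r z.1 /\ ball z0.2 r z.2].
    by apply/seteqP; split=> z [h1 h2]; split; apply/ballE.
  by apply: (@open_prodV R R^o R^o); exact: ball_open.
have Bd z : B z -> dom d (F z).1 by move=> [h1 h2]; have [] := Hd z h1 h2.
have BS z : B z -> SD z by move=> [h1 h2]; have [] := Hd z h1 h2.
have Bc z : B z -> cmap d (F z).1 = row3 z.1 z.2 0 by move=> [h1 h2]; have [] := Hd z h1 h2.
pose W := (fst \o F) @` B.
have Bx x : ball (row3 z0.1 z0.2 0) r x -> B (x 0 i1, x 0 i2).
  move=> /ballE xr; split; apply: le_lt_trans xr => /=.
    by have := rv_coord_le (x - row3 z0.1 z0.2 0) i1; rewrite mxE [X in _ + X]mxE row3E.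
  by have := rv_coord_le (x - row3 z0.1 z0.2 0) i2; rewrite mxE [X in _ + X]mxE row3E.
have Wd p : dom d p -> W p <-> coord d i3 p = 0.
  move=> dp; split; first by move=> [z Bz <-]; rewrite /coord /= Bc // row3E.
  move=> c3; have := Bx (cmap d p); rewrite -Ed => /(_ (ex_intro2 _ _ _ dp erefl)) Bp.
  exists (coord d i1 p, coord d i2 p) => //=.
  transitivity (cinv d (cmap d p)); last exact: chart_cancel.
  rewrite -[LHS](chart_cancel cd (Bd _ Bp)) Bc //=; congr cinv.
  by rewrite [RHS]row3_eta -[cmap d p 0 i3]/(coord d i3 p) c3.
have dW : defining W (coord d i3) (dom d).
  split; [exact: (chart_open cd)|by move=> p dp; exact: smooth_at_coord|exact: Wd|].
  by move=> p dp; exact: frame_coord_neq0.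
have sW : is_surface A W.
  move=> p [z Bz <-]; exists (dom d), (coord d i3); split.
  - exact: (chart_open cd).
  - exact: Bd.
  - by move=> q dq; exact: smooth_at_coord.
  - have [i Xi] := frame_coord_neq0 i3 kd (Bd _ Bz).
    by exists (X i (F z).1); [exact: frame_tangent|exact/eqP].
  - by move=> q; exact: Wd.
have BWt z : B z -> W (F z).1 by move=> Bz; exists z.
have nB z : B z -> \forall t \near (z.1 : R^o), B (t, z.2).
  move=> [z1 z2]; have : nbhs z.1 (ball z0.1 r) by apply: open_nbhs_nbhs; split; [exact: ball_open|exact/ballE].
  by apply: filterS => t /ballE ht; split.
have nB2 z : B z -> \forall s \near (z.2 : R^o), B (z.1, s).
  move=> [z1 z2]; have : nbhs z.2 (ball z0.2 r) by apply: open_nbhs_nbhs; split; [exact: ball_open|exact/ballE].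
  by apply: filterS => t /ballE ht; split.
have dtc z j : B z -> push (sweep_dt Phi Gamma z) (coord d j) = (j == i1)%:R.
  move=> Bz; rewrite /push /sweep_dt /velocity.
  rewrite (near_eq_derive (g := fun t : R^o => row3 t z.2 0 0 j : R^o)); last first.
  - by apply: filterS (nB _ Bz) => t Bt; rewrite /= /coord Bc.
  move: j; apply: ord3P => /=.
  - rewrite (_ : (fun t : R^o => _) = id) ?derive_id //; by apply/funext => t; rewrite row3E.
  - rewrite (_ : (fun t : R^o => _) = cst z.2) ?derive_cst //; by apply/funext => t; rewrite row3E.
  - rewrite (_ : (fun t : R^o => _) = cst 0) ?derive_cst //; by apply/funext => t; rewrite row3E.
have dsc z j : B z -> push (sweep_ds Phi Gamma z) (coord d j) = (j == i2)%:R.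
  move=> Bz; rewrite /push /sweep_ds /velocity.
  rewrite (near_eq_derive (g := fun t : R^o => row3 z.1 t 0 0 j : R^o)); last first.
  - by apply: filterS (nB2 _ Bz) => t Bt; rewrite /= /coord Bc.
  move: j; apply: ord3P => /=.
  - rewrite (_ : (fun t : R^o => _) = cst z.1) ?derive_cst //; by apply/funext => t; rewrite row3E.
  - rewrite (_ : (fun t : R^o => _) = id) ?derive_id //; by apply/funext => t; rewrite row3E.
  - rewrite (_ : (fun t : R^o => _) = cst 0) ?derive_cst //; by apply/funext => t; rewrite row3E.
have pdt z : B z -> is_tangent A (F z).1 (push (sweep_dt Phi Gamma z)).
  by move=> Bz; apply: push_tangent; exact: sweep_dt_tangent (BS _ Bz).
have pds z : B z -> is_tangent A (F z).1 (push (sweep_ds Phi Gamma z)).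
  by move=> Bz; apply: push_tangent; exact: sweep_ds_tangent (BS _ Bz).
exists B; split=> //.
- by split; rewrite /= subrr normr0.
- split=> // z Bz; have dFz := Bd _ Bz.
  rewrite (tangent_kernel_chart kd dFz (BWt _ Bz)) => //.
  apply/seteqP; split=> v.
    move=> [tv v3]; split=> //.
    exists (v (coord d i1)), (v (coord d i2)).
    apply: (tangent_coord_eq kd dFz tv); first by apply: is_tangent_comb; [exact: pdt|exact: pds].
    move=> j; rewrite /vcomb (dtc _ _ Bz) (dsc _ _ Bz); move: j; apply: ord3P.
    + by rewrite mulr1 mulr0 addr0.
    + by rewrite mulr1 mulr0 add0r.
    + by rewrite v3 !mulr0 addr0.
  move=> [tv [a [b e]]]; split=> //.
  by rewrite e; [rewrite /vcomb (dtc _ _ Bz) (dsc _ _ Bz) !mulr0 addr0|exact: smooth_at_coord].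
- split=> // p [z Bz <-] /= nc; have dFz := Bd _ Bz.
  (* The angle, known on the patch, is extended off it as constant along the third coordinate. *)
  pose phi q := (F (coord d i1 q, coord d i2 q)).2.
  have xr : ball (row3 z0.1 z0.2 0) r (cmap d (F z).1) by rewrite -Ed; exists (F z).1.
  have sp : smooth_at A (F z).1 phi.
    apply: (smooth_at_chart hA kd dFz _ xr sphi); exact: ball_open.
  have phiF z' : B z' -> phi (F z').1 = (F z').2.
    by move=> Bz'; rewrite /phi /coord Bc // !row3E -surjective_pairing.
  apply: (minimal_intro dW dFz (BWt _ Bz) nc sp).
    apply: filterS (dom_near kd dFz) => q dq [z' Bz' <-] /=; rewrite phiF //.
    have := push_dt (BS _ Bz') (smooth_at_coord hA i3 kd (Bd _ Bz')).
    by rewrite dtc // /comb3 mul0r addr0.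
  have := push_dt (BS _ Bz) sp; rewrite /comb3 mul0r addr0 phiF // => <-.
  transitivity (gfun c (F z)); last by [].
  have [_ <-] := sweep_dt_snd (BS _ Bz).
  rewrite /push /sweep_dt /velocity; apply: near_eq_derive.
  by apply: filterS (nB _ Bz) => t Bt /=; exact: phiF.
Qed.

End Sweeping.

Lemma sweep_minimal (xi : field R (M * R)) (J : set R) (Gamma : R -> M * R)
    (q0 : M * R) (e1 e2 d1 d2 : R) :
  smooth_field (bar_atlas A) xi ->
  integral_curve (bar_atlas A) xi J Gamma -> Gamma 0 = q0 ->
  0 < e1 -> 0 < e2 -> 0 < d1 -> 0 < d2 ->
  rectangle e1 e2 d1 d2 `<=` sweep_dom D J Gamma ->
  (forall z, rectangle e1 e2 d1 d2 z -> proj_regular A Phi Gamma z ->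
     exists B : set (R * R),
       [/\ open B, B z, B `<=` sweep_dom D J Gamma,
           regular_patch A Phi Gamma B &
           delta_minimal A Delta X c ((fst \o sweep Phi Gamma) @` B)]) /\
  (forall z, rectangle e1 e2 d1 d2 z ->
     let p := sweep Phi Gamma z in
     let phi := p.2 in
     let fails := fails_on_tangent A X Phi Gamma z in
     fails (fun z1 z2 z3 z4 => z1 * sin phi - z2 * cos phi = 0) ->
     fails (fun z1 z2 z3 z4 => z3 = 0) ->
     fails (fun z1 z2 z3 z4 => gfun c p * z1 = z4 * cos phi) ->
     fails (fun z1 z2 z3 z4 => gfun c p * z2 = z4 * sin phi) ->
     [/\ bar_regular A Phi Gamma z, proj_regular A Phi Gamma z &
         exists B : set (R * R),
           [/\ open B, B z, B `<=` sweep_dom D J Gamma,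
               regular_patch A Phi Gamma B &
               minimal_at A Delta X c
                 ((fst \o sweep Phi Gamma) @` B) p.1]]).
Proof.
move=> sxi hG _ _ _ _ _ sub; split=> [z /sub Sz reg|z /sub Sz p phi fails _ f3 _ _].
  exact: minimal_patch sxi hG _ Sz reg.
have [reg [a1 [a2 [a3 [a30 e]]]]] := transverse_regular sxi hG Sz f3.
have [B [oB Bz BS rB mB]] := minimal_patch sxi hG Sz reg.
split=> //; first exact: proj_regular_bar.
exists B; split=> //; apply: mB.2; first by exists z.
(* The s-velocity is tangent to the patch; at a characteristic point it would be horizontal, with
   X3-component a3 = 0. *)
rewrite /characteristic => ch; apply: a30.
have ts : is_tangent A (sweep Phi Gamma z).1 (push (sweep_ds Phi Gamma z)).
  by apply: push_tangent; exact: sweep_ds_tangent sxi hG _ Sz.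
apply/(Delta_comb3 ts e); rewrite -/p -ch rB.2 //; split=> //.
by exists 0, 1 => f _; rewrite /vcomb mul0r mul1r add0r.
Qed.

(** * Ruled pieces of a minimal surface *)

Definition swept_near (S : set M) q :=
  exists (xi : field R (M * R)) (J : set R) (Gamma : R -> M * R)
      (q0 : M * R) (e1 e2 d1 d2 : R),
      [/\ smooth_field (bar_atlas A) xi,
          integral_curve (bar_atlas A) xi J Gamma, Gamma 0 = q0,
          [/\ 0 < e1, 0 < e2, 0 < d1 & 0 < d2] &
          let W := (fst \o sweep Phi Gamma) @` rectangle e1 e2 d1 d2 in
          [/\ rectangle e1 e2 d1 d2 `<=` sweep_dom D J Gamma,
              W `<=` S &
              exists U : set M, [/\ open U, U q & S `&` U `<=` W]]].

Lemma zero_tangent (p : M * R) : is_tangent bA p (fun=> 0).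
Proof. by split=> *; rewrite !mulr0 addr0. Qed.

Lemma delta_norm (s : R) (j : 'I_3) : `|s *: ('e_j : 'rV[R]_3)| <= `|s|.
Proof.
apply: rv_norm_le => // i; rewrite !mxE normrM -[leRHS]mulr1 ler_wpM2l //.
by case: (_ && _); rewrite ?normr0 ?normr1.
Qed.

Lemma horizontal_smooth (k : M -> R) (p : M * R) : (forall i, smooth_at A p.1 (fun q => X i q k)) ->
  smooth_at bA p (fun p : M * R => comb3 p.1 (cos p.2) (sin p.2) 0 k).
Proof.
move=> sk; have s2 := smooth_at_snd p.
have ss : smooth_at bA p (fun q : M * R => sin q.2) by apply: (smooth_at_comp hbA openT _ smooth_sin).
have sc : smooth_at bA p (fun q : M * R => cos q.2) by apply: (smooth_at_comp hbA openT _ smooth_cos).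
have sX i : smooth_at bA p (fun q : M * R => X i q.1 k) by exact: (smooth_at_fst (sk i)).
rewrite /comb3; apply: smooth_at_add => //.
  by apply: smooth_at_add => //; apply: smooth_at_mul.
by apply: smooth_at_mul => //; exact: smooth_at_cst.
Qed.

Lemma gfun_smooth (p : M * R) : smooth_at bA p (gfun c).
Proof.
have s2 := smooth_at_snd p.
have ss : smooth_at bA p (fun q : M * R => sin q.2) by apply: (smooth_at_comp hbA openT _ smooth_sin).
have sc : smooth_at bA p (fun q : M * R => cos q.2) by apply: (smooth_at_comp hbA openT _ smooth_cos).
have sX i : smooth_at bA p (fun q : M * R => c i1 i2 i q.1) by exact: (smooth_at_fst (c_smooth i1 i2 i p.1)).
apply: smooth_at_sub => //; apply: smooth_at_mul => //; exact: smooth_at_opp.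
Qed.

(** The derivative of a^2 + b^2 when a' = u and b' = v; the constant 4 K comes from (x + y)^2 <= 2
    (x^2 + y^2). *)
Lemma growth_bound (a b u v K : R) : 0 <= K -> `|u| <= K * (`|a| + `|b|) -> `|v| <= K * (`|a| + `|b|) ->
  `|2 * a * u + 2 * b * v| <= 4 * K * (a * a + b * b).
Proof.
move=> K0 hu hv; apply: (le_trans (ler_normD _ _)); rewrite !normrM ger0_norm //.
have h1 : `|a| * `|u| <= `|a| * (K * (`|a| + `|b|)) by rewrite ler_wpM2l.
have h2 : `|b| * `|v| <= `|b| * (K * (`|a| + `|b|)) by rewrite ler_wpM2l.
have ea : a * a = `|a| * `|a| by rewrite -normrM ger0_norm // -expr2 sqr_ge0.
have eb : b * b = `|b| * `|b| by rewrite -normrM ger0_norm // -expr2 sqr_ge0.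
rewrite ea eb; move: (`|a|) (`|b|) (`|u|) (`|v|) h1 h2 => x y p q h1 h2.
have h3 : 0 <= K * (x - y) ^+ 2 by rewrite mulr_ge0 ?sqr_ge0.
nra.
Qed.

Lemma triangular_free (a1 a2 a3 x1 x2 x3 : R) : x1 <> 0 -> a1 * x1 + a2 * 0 + a3 * 0 = 0 ->
  a1 * x2 + a2 * 1 + a3 * 0 = 0 -> a1 * x3 + a2 * 0 + a3 * 1 = 0 -> [/\ a1 = 0, a2 = 0 & a3 = 0].
Proof.
move=> /eqP x0; rewrite !mulr0 !mulr1 !addr0 => /eqP; rewrite mulf_eq0 (negbTE x0) orbF => /eqP ->.
by rewrite !mul0r !add0r.
Qed.

(** * Sweeping S from the graph of an angle over a transverse curve *)

Section Ruled.
Variables (S : set M) (h : M -> R) (d : chart M 'rV[R]_3) (r : R) (q0 : M) (phi : M -> R).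
Hypothesis kd : compatible A d.
Hypothesis r0 : 0 < r.
Hypothesis Ed : cimg d = ball (0 : 'rV[R]_3) r.
Hypothesis dq0 : dom d q0.
Hypothesis dq0E : cmap d q0 = 0.
Hypothesis Sd : forall p, dom d p -> S p <-> coord d i3 p = 0.
Hypothesis sphi : forall p, dom d p -> smooth_at A p phi.
Hypothesis tangency : forall p, dom d p -> S p ->
  cos (phi p) * X i1 p (coord d i3) + sin (phi p) * X i2 p (coord d i3) = 0.
Hypothesis rotation : forall p, dom d p -> S p ->
  cos (phi p) * X i1 p phi + sin (phi p) * X i2 p phi = gfun c (p, phi p).
Hypothesis transverse :
  cos (phi q0) * X i1 q0 (coord d i1) + sin (phi q0) * X i2 q0 (coord d i1) <> 0.

Let cd := compatible_chart kd.
Local Notation bd := (bar_chart d).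
Let kbd := bar_compatible kd.
Let hatphi : 'rV[R]_3 -> R^o := phi \o cinv d.

Lemma ruled_chart_ball x : `|x| < r -> cimg d x.
Proof. by rewrite Ed => xr; apply/ballE; rewrite subr0. Qed.

Lemma ruled_hatphi : smooth_on (cimg d) hatphi.
Proof.
have H := @smooth_on_cimg R _ _ _ A hA d phi kd sphi.
exact: H.
Qed.

(** Straightening the angle to w = p.2 - phi p.1 turns the graph of phi over S into x3 = w = 0; a
    Lipschitz bound between a point and its projection to that plane gives the estimate. *)
Lemma ruled_bound (G : M * R -> R) : (forall p : M * R, dom d p.1 -> smooth_at bA p G) ->
  (forall p : M, dom d p -> S p -> G (p, phi p) = 0) ->
  exists K e, [/\ 0 < K, 0 < e & forall p : M * R, dom d p.1 -> `|cmap d p.1| < e ->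
    `|p.2 - phi p.1| < e -> `|G p| <= K * (`|coord d i3 p.1| + `|p.2 - phi p.1|)].
Proof.
move=> sG G0.
have sGh : smooth_on (cimg bd) (G \o cinv bd : 'rV[R]_3 * R^o -> R^o).
  exact: (smooth_on_cimg hbA kbd (fun (p : M * R) (dp : dom bd p) => sG p dp.1)).
pose U : set ('rV[R]_3 * R^o) := [set y | cimg d y.1 /\ setT y.2].
have oU : open U by apply: open_prodV; [exact: (chart_img_open cd)|exact: openT].
pose m (y : 'rV[R]_3 * R^o) : 'rV[R]_3 * R^o := (y.1, y.2 + hatphi y.1).
have sm k : Ck k U m.
  apply: Ck_pair => //.
    by apply: (@Ck_fst _ _ _ _ _ _ _ _ setT id) => //; [exact: openT|exact: Ck_id].
  apply: Ck_add => //.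
    by apply: (@Ck_snd _ _ _ _ _ _ _ _ setT id) => //; [exact: openT|exact: Ck_id].
  apply: (@Ck_fst _ _ _ _ _ _ _ _ (cimg d) hatphi); [exact: (chart_img_open cd)|by move=> x []|].
  exact: ruled_hatphi.
have eU : cimg bd = U.
  by rewrite prod_cimg; apply/seteqP; split=> x [h1 _]; split=> //; exists x.2.
pose Gt y : R^o := (G \o cinv bd) (m y).
have sGt : Ck 1 U Gt.
  apply: (@Ck_comp_scalar _ _ _ _ 1 U (cimg bd) m _ oU) => //; try exact: sGh.
  by rewrite eU => x [].
have U0 : U (0, 0) by split=> //; exists q0.
have [K [e [K0 e0 eB lip]]] := Ck_lipschitz oU U0 sGt.
exists K, e; split=> // p dp xe we.
pose x := cmap d p.1; pose w := p.2 - phi p.1.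
pose x' := row3 (x 0 i1) (x 0 i2) 0.
have pair_ball (a : 'rV[R]_3) (b : R) : `|a| < e -> `|b| < e -> ball ((0, 0) : 'rV[R]_3 * R^o) e (a, b).
  by move=> ha hb; split; apply/ballE; rewrite subr0.
have x'x : `|x'| <= `|x|.
  apply: rv_norm_le => //; apply: ord3P; rewrite row3E ?normr0 //; exact: rv_coord_le.
have By := pair_ball x w xe we.
have By' := pair_ball x' 0 (le_lt_trans x'x xe) (eq_ind_r (fun y => y < e) e0 (normr0 _)).
have := lip _ _ By By'.
have -> : Gt (x, w) = G p.
  rewrite /Gt /= /hatphi /= /x (chart_cancel cd dp) /w subrK; by case: (p).
have -> : Gt (x', 0) = 0.
  have [dx' _] := eB _ By'.
  rewrite /Gt /= add0r /hatphi /=; apply: G0; first exact: chart_inv_dom.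
  by apply/Sd; [exact: chart_inv_dom|rewrite /coord chart_invK // row3E].
rewrite subr0 => H; apply: (le_trans H); rewrite ler_pM2l //.
apply: prod_norm_le => /=; last by rewrite subr0 lerDr.
apply: rv_norm_le; first by rewrite addr_ge0.
by apply: ord3P; rewrite mxE [X in _ + X]mxE !row3E ?subrr ?normr0 ?addr_ge0 // subr0 lerDl.
Qed.

Section Cutoff.
Variable chi : 'rV[R]_3 -> R^o.
Hypothesis chi_smooth : smooth_on setT chi.
Hypothesis chi1 : forall x, `|x| <= r / 4 -> chi x = 1.
Hypothesis chi0 : forall x, 2 * (r / 4) <= `|x| -> chi x = 0.

(* The lift of the coordinate field along the second axis, tangent to the
   graph of phi and cut off outside the chart. *)
Definition ruled_field : field R (M * R) := fun p : M * R =>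
  if `[< dom d p.1 >] then
    vcomb (chi (cmap d p.1)) (chart_vec bd p ('e_i2, 0))
      (chi (cmap d p.1) * chart_vec d p.1 'e_i2 phi) (chart_vec bd p (0, 1))
  else fun=> 0.

Lemma ruled_field_smooth : smooth_field bA ruled_field.
Proof.
split=> [p|p f sf]; rewrite /ruled_field.
  case: asboolP => dp; last exact: zero_tangent.
  by apply: is_tangent_comb; apply: chart_vec_tangent.
have [dp|dp] := pselect (dom d p.1).
  have bdp : dom bd p by [].
  pose F (q : M * R) : R := chi (cmap d q.1) * chart_vec bd q ('e_i2, 0) f
    + (chi (cmap d q.1) * chart_vec d q.1 'e_i2 phi) * chart_vec bd q (0, 1) f.
  apply: (@smooth_at_eq _ _ _ _ bA hbA p F).
    apply: filterS (open_nbhs_nbhs (conj (chart_open (compatible_chart kbd)) bdp)) => q [dq _].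
    by rewrite asboolT.
  have schi : smooth_at bA p (fun q : M * R => chi (cmap d q.1)).
    apply: (smooth_at_fst (f := fun q => chi (cmap d q))).
    exact: (smooth_at_chart hA kd dp openT I chi_smooth).
  have sv w : smooth_at bA p (fun q : M * R => chart_vec bd q w f) by exact: chart_vec_smooth.
  have se : smooth_at bA p (fun q : M * R => chart_vec d q.1 'e_i2 phi).
    apply: (smooth_at_fst (f := fun q => chart_vec d q 'e_i2 phi)).
    by apply: chart_vec_smooth => //; exact: sphi.
  by apply: smooth_at_add => //; apply: smooth_at_mul => //; apply: smooth_at_mul.
(* The field vanishes outside K. A point p outside the chart, even on the boundary of its domain,
   has a neighbourhood disjoint from the closed set K. *)
pose K := [set q | dom d q /\ `|cmap d q| <= r / 2].
have r2 : r / 2 < r by rewrite ltr_pdivrMr // ltr_pMr // ltr1n.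
have cK : closed K.
  apply: chart_ball_closed; [exact: mfd_hausdorff hM|exact: cd|by rewrite divr_gt0|].
  by move=> x xr; apply: ruled_chart_ball; exact: le_lt_trans xr r2.
have nK : (~` K) p.1 by move=> [].
have oK : open [set q : M * R | (~` K) q.1 /\ setT q.2].
  by apply: open_prod; [exact: closed_openC|exact: openT].
apply: (@smooth_at_eq _ _ _ _ bA hbA p (fun=> 0)); last exact: smooth_at_cst.
apply: filterS (open_nbhs_nbhs (conj oK (conj nK I))) => q [Kq _].
case: asboolP => // dq; rewrite /vcomb chi0 ?mul0r ?addr0 //.
rewrite (_ : 2 * (r / 4) = r / 2); last by field.
by rewrite leNgt; apply/negP => l; apply: Kq; split=> //; exact: ltW.
Qed.

Definition ruled_curve (s : R) : M * R := (cinv d (s *: 'e_i2), hatphi (s *: 'e_i2)).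

Lemma ruled_curve_img s : `|s| < r -> cimg d (s *: 'e_i2).
Proof. by move=> sr; apply: ruled_chart_ball; exact: le_lt_trans (delta_norm _ _) sr. Qed.

Lemma ruled_integral_curve : integral_curve bA ruled_field [set s | `|s| < r / 4] ruled_curve.
Proof.
split.
- rewrite (_ : [set s | _] = ball 0 (r / 4)); first exact: ball_open.
  by apply/seteqP; split=> s; rewrite ballE subr0.
- move=> x y /=; rewrite !ltr_norml => /andP[x1 x2] /andP[y1 y2] z /andP[xz zy].
  by rewrite ltr_norml (lt_le_trans x1 xz) (le_lt_trans zy y2).
move=> s f /= sr sf.
have r4 : r / 4 < r by rewrite ltr_pdivrMr // ltr_pMr // ltr1n.
have ds := ruled_curve_img (lt_trans sr r4).
have dG : dom bd (ruled_curve s) by split=> //=; exact: chart_inv_dom.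
have cG : cmap bd (ruled_curve s) = (s *: 'e_i2, hatphi (s *: 'e_i2)).
  by rewrite /= chart_invK.
have df : differentiable (f \o cinv bd : 'rV[R]_3 * R^o -> R^o) (s *: 'e_i2, hatphi (s *: 'e_i2)).
  by rewrite -cG; exact: (smooth_in_differentiable hbA).
have dk : differentiable hatphi (s *: 'e_i2) by exact: (ruled_hatphi 1%N).1.
have [dm Dm] := derive_comp_graph (fbasis_rV R 3) ('e_i2) dk df.
have := @line_is_derive R _ (fun x : 'rV[R]_3 => (f \o cinv bd) (x, hatphi x) : R^o) 0 'e_i2 s.
rewrite add0r => /(_ dm).
rewrite Dm /ruled_field asboolT; last exact: chart_inv_dom.
rewrite /vcomb chi1; last first.
  by rewrite /= chart_invK //; apply: le_trans (delta_norm _ _) (ltW sr).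
rewrite !mul1r /chart_vec cG [cmap d _]chart_invK //.
rewrite (_ : (fun s0 : R^o => _) = f \o ruled_curve) //.
by apply/funext => t; rewrite /= add0r.
Qed.

Local Notation J := [set s | `|s| < r / 4].
Local Notation F := (sweep Phi ruled_curve).
Local Notation SD := (sweep_dom D J ruled_curve).
Let sxi := ruled_field_smooth.
Let hG := ruled_integral_curve.

Lemma ruled_curve0 : ruled_curve 0 = (q0, phi q0).
Proof. by rewrite /ruled_curve scale0r /hatphi /= -dq0E (chart_cancel cd). Qed.

Lemma ruled_sweep0 s : F (0, s) = ruled_curve s.
Proof. exact: (flow0 hPhi). Qed.

Lemma ruled_dom0 : SD (0, 0).
Proof. by split; [rewrite /= normr0 divr_gt0|exact: (flow_dom0 hPhi)]. Qed.

Let Tang (p : M * R) := comb3 p.1 (cos p.2) (sin p.2) 0 (coord d i3).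
Let Rot (p : M * R) := gfun c p - comb3 p.1 (cos p.2) (sin p.2) 0 phi.

(** Along a trajectory the height x3 above S and the deviation of the angle from phi have
    derivatives [Tang] and [Rot]. Both functions vanish on the graph of phi over S, so [ruled_bound]
    makes the system homogeneous and Gronwall's lemma applies from zero initial data. *)
Lemma ruled_in : exists2 e, 0 < e & forall z : R * R, `|z.1| <= e -> `|z.2| <= e ->
  SD z /\ S (F z).1.
Proof.
have sT (p : M * R) : dom d p.1 -> smooth_at bA p Tang.
  by move=> dp; apply: horizontal_smooth => i; apply: frame_smooth; exact: smooth_at_coord.
have sR (p : M * R) : dom d p.1 -> smooth_at bA p Rot.
  move=> dp; apply: smooth_at_sub => //; first exact: gfun_smooth.
  by apply: horizontal_smooth => i; apply: frame_smooth; exact: sphi.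
have [|K1 [e1 [K10 e10 B1]]] := ruled_bound sT.
  by move=> p dp Sp; rewrite /Tang /comb3 /= mul0r addr0 tangency.
have [|K2 [e2 [K20 e20 B2]]] := ruled_bound sR.
  by move=> p dp Sp; rewrite /Rot /comb3 /= mul0r addr0 rotation // subrr.
pose e' := Num.min e1 e2; have e'0 : 0 < e' by rewrite lt_min e10.
pose K := Num.max K1 K2.
have Fz0 : F (0, 0) = (q0, phi q0) by rewrite ruled_sweep0 ruled_curve0.
have dF0 : dom d (F (0, 0)).1 by rewrite Fz0.
have [W [oW W0 WS Wd [sy sw]]] := sweep_chart_smooth sxi hG kd ruled_dom0 dF0.
pose k (z : R^o * R^o) : 'rV[R]_3 * R^o := (cmap d (F z).1, (F z).2 - hatphi (cmap d (F z).1)).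
have sk j : Ck j W k.
  have sN : Ck j W (fun z => hatphi (cmap d (F z).1)).
    apply: (@Ck_comp_scalar _ _ _ _ j W (cimg d) _ hatphi oW _ (sy j) (ruled_hatphi j)).
    by move=> z Wz; exists (F z).1 => //; exact: Wd.
  have sN' : Ck j W (fun z => - hatphi (cmap d (F z).1) : R^o).
    by have := Ck_scale (-1) oW sN; apply: Ck_eq => // z _; rewrite scaleN1r.
  exact: (Ck_pair oW (sy j) (Ck_add oW (sw j) sN')).
have ck : {for (0, 0), continuous k} by apply: (sk 0%N).
have k0 : k (0, 0) = (0, 0).
  by rewrite /k Fz0 /= dq0E /hatphi /= -dq0E (chart_cancel cd) // subrr.
have : nbhs ((0, 0) : R^o * R^o) (W `&` k @^-1` ball (0, 0) e').
  apply: filterI; first exact: open_nbhs_nbhs.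
  by apply: ck; rewrite k0; exact: nbhsx_ballx.
move=> /nbhs_ballP[e /= e0 He].
have e20' : 0 < e / 2 by rewrite divr_gt0.
have H z : `|z.1| <= e / 2 -> `|z.2| <= e / 2 -> [/\ SD z, dom d (F z).1, `|cmap d (F z).1| < e' &
    `|(F z).2 - phi (F z).1| < e'].
  have le2 : e / 2 < e by rewrite ltr_pdivrMr // ltr_pMr // ltr1n.
  move=> z1 z2; have [|Wz [/ballE kz1 /ballE kz2]] := He z.
    by split; apply/ballE; rewrite subr0; apply: le_lt_trans le2.
  have dz := Wd _ Wz; rewrite /= !subr0 in kz1 kz2.
  split=> //; first exact: WS.
  by move: kz2; rewrite /hatphi /= (chart_cancel cd).
exists (e / 2) => // -[t s] /= te se.
have [St dt _ _] := H (t, s) te se; split=> //.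
apply/(Sd dt).
pose F1 (t : R) := coord d i3 (F (t, s)).1.
pose F2 (t : R) := (F (t, s)).2 - phi (F (t, s)).1.
pose N t := F1 t * F1 t + F2 t * F2 t.
have dF1 (u : R) : `|u| <= e / 2 -> is_derive u 1 (F1 : R^o -> R^o) (Tang (F (u, s))).
  move=> ue; have [Su du _ _] := H (u, s) ue se.
  have := sweep_dt_derive Su (smooth_at_fst (smooth_at_coord hA i3 kd du)).
  by rewrite char_field_fst.
have dF2 (u : R) : `|u| <= e / 2 -> is_derive u 1 (F2 : R^o -> R^o) (Rot (F (u, s))).
  move=> ue; have [Su du _ _] := H (u, s) ue se.
  have h1 := sweep_dt_derive Su (smooth_at_fst (sphi du)).
  have h2 := sweep_dt_snd Su.
  rewrite char_field_fst in h1.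
  exact: (is_deriveB h2 h1).
have N0 : N t = 0.
  apply: (growth_zero (dN := fun u => 2 * F1 u * Tang (F (u, s)) + 2 * F2 u * Rot (F (u, s))) (C := 4 * K) _ _ _ _ te).
  - move=> u ue; have h1 := dF1 u ue; have h2 := dF2 u ue.
    rewrite -!mulrA !(mulr_natl _ 2) !mulr2n.
    exact: is_deriveD (is_deriveM h1 h1) (is_deriveM h2 h2).
  - by move=> u ue; rewrite addr_ge0 // -expr2 sqr_ge0.
  - move=> u ue; have [Su du l1 l2] := H (u, s) ue se.
    have q0' : 0 <= `|F1 u| + `|F2 u| by rewrite addr_ge0.
    apply: growth_bound; first by rewrite le_max (ltW K10).
      apply: le_trans (B1 _ du _ _) _; [by apply: lt_le_trans l1 _; rewrite ge_min lexx|by apply: lt_le_trans l2 _; rewrite ge_min lexx|].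
      by rewrite ler_wpM2r // le_max lexx.
    apply: le_trans (B2 _ du _ _) _; [by apply: lt_le_trans l1 _; rewrite ge_min lexx orbT|by apply: lt_le_trans l2 _; rewrite ge_min lexx orbT|].
    by rewrite ler_wpM2r // le_max lexx orbT.
  - have s0 : `|0 : R| <= e / 2 by rewrite normr0 ltW.
    have [[Js _] _ _ _] := H (0, s) s0 se; rewrite /= in Js.
    have r4 : r / 4 < r by rewrite ltr_pdivrMr // ltr_pMr // ltr1n.
    have ds := ruled_curve_img (lt_trans Js r4).
    rewrite /N /F1 /F2 ruled_sweep0 /ruled_curve /= /hatphi /= subrr /coord chart_invK //.
    by rewrite !mxE /= !mulr0 addr0.
have /eqP := N0; rewrite paddr_eq0 -?expr2 ?sqr_ge0 // => /andP[].
by rewrite sqrf_eq0 => /eqP.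
Qed.

Lemma ruled_ds j : push (sweep_ds Phi ruled_curve (0, 0)) (coord d j) = (j == i2)%:R.
Proof.
rewrite /push /sweep_ds /velocity.
rewrite (near_eq_derive (g := fun s : R^o => s * (j == i2)%:R : R^o)); last first.
  have nr : \forall s \near (0 : R^o), ball (0 : R^o) r s by exact: nbhsx_ballx.
  apply: filterS nr => s /ballE; rewrite subr0 => sr.
  rewrite /= ruled_sweep0 /ruled_curve /coord /= chart_invK ?mxE //.
  exact: ruled_curve_img.
by rewrite deriveM // derive_cst scaler0 add0r derive_id [_ *: _]mulr1.
Qed.

Lemma ruled_swept : swept_near S q0.
Proof.
have [e e0 H] := ruled_in.
have Fz0 : F (0, 0) = (q0, phi q0) by rewrite ruled_sweep0 ruled_curve0.
have dF0 : dom d (F (0, 0)).1 by rewrite Fz0.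
have dtE j : push (sweep_dt Phi ruled_curve (0, 0)) (coord d j) =
    cos (phi q0) * X i1 q0 (coord d j) + sin (phi q0) * X i2 q0 (coord d j).
  by rewrite (push_dt ruled_dom0) ?Fz0 ?/comb3 ?mul0r ?addr0 //; exact: smooth_at_coord.
have Sq0 : S q0 by apply/(Sd dq0); rewrite /coord dq0E mxE.
have e3 (j : 'I_3) : ('e_i3 : 'rV[R]_3) 0 j = (j == i3)%:R by rewrite mxE.
(* The tube runs along the third axis of d, so a point and its foot on the sweep differ only in the
   coordinate that cuts out S; if both lie in S they coincide. *)
have [|d' [r' [kd' r'0 Hd Ed' [_ Hd']]]] := tube_chart sxi hG (n := 'e_i3) ruled_dom0 kd dF0.
  move=> a Ha.
  have Ha' j : a 0 i1 * (cos (phi q0) * X i1 q0 (coord d j) + sin (phi q0) * X i2 q0 (coord d j)) +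
      a 0 i2 * (j == i2)%:R + a 0 i3 * (j == i3)%:R = 0.
    by rewrite -dtE -ruled_ds -e3; exact: Ha.
  have [a1 a2 a3] := triangular_free transverse (Ha' i1) (Ha' i2) (Ha' i3).
  by apply/rowP; apply: ord3P; rewrite mxE.
have e0' : (0 : R) < e by [].
exists ruled_field, J, ruled_curve, (ruled_curve 0), e, e, e, e; split=> //.
have recE z : rectangle e e e e z -> `|z.1| <= e /\ `|z.2| <= e by rewrite !ler_norml.
split.
- by move=> z /recE[z1 z2]; have [] := H z z1 z2.
- by move=> _ [z /recE[z1 z2] <-]; have [] := H z z1 z2.
exists (dom d' `&` cmap d' @^-1` ball (row3 0 0 0) e); split.
- by apply: chart_preimage_open; [exact: compatible_chart kd'|exact: ball_open].
- have [||_ dq' cq'] := Hd (0, 0); rewrite /= ?subrr ?normr0 //.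
  by rewrite Fz0 in dq' cq'; split=> //=; rewrite cq'; exact: ballxx.
move=> p [Sp [dp pe]].
have cle j : `|coord d' j p| <= e.
  move/ballE: pe => pe; apply: le_trans (ltW pe); apply: le_trans (rv_coord_le _ j).
  rewrite mxE [X in _ + X]mxE /coord /row3 mxE.
  by case: ifP => _; [|case: ifP => _]; rewrite subr0.
have [dp' dFz e'] := Hd' p dp.
set z := (_, _) in dFz e'.
have [_ SFz] := H z (cle i1) (cle i2).
exists z; first by rewrite /rectangle /= -!ler_norml; split; exact: cle.
have x3 : coord d' i3 p = 0.
  have := congr1 (fun x : 'rV[R]_3 => x 0 i3) e'; rewrite mxE [X in _ = _ + X]mxE e3 eqxx mulr1.
  by rewrite -![cmap d _ 0 i3]/(coord d i3 _) (Sd dp').1 // (Sd dFz).1 // add0r => <-.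
by rewrite -(chart_cancel cd dp') -[LHS](chart_cancel cd dFz) e' x3 scale0r addr0.
Qed.

End Cutoff.

Lemma ruled_surface : swept_near S q0.
Proof.
have r4 : 0 < r / 4 by rewrite divr_gt0.
have [chi [s1 c1 c0]] := bump 3 r4.
exact: ruled_swept s1 c1 c0.
Qed.

End Ruled.

Lemma near_setP (q : M) (P : M -> Prop) : (\forall p \near q, P p) ->
  exists V, [/\ open V, V q & forall p, V p -> P p].
Proof. by rewrite /prop_near1 nbhsE => -[V [oV Vq] VP]; exists V. Qed.

Lemma ruled_swept_near S h U q phi : defining S h U -> U q -> S q -> smooth_at A q phi ->
  (\forall p \near q, S p -> cos (phi p) * X i1 p h + sin (phi p) * X i2 p h = 0) ->
  (\forall p \near q, S p -> cos (phi p) * X i1 p phi + sin (phi p) * X i2 p phi = gfun c (p, phi p)) ->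
  swept_near S q.
Proof.
move=> dS Uq Sq sphi tgt rot.
have [V [oV Vq HV]] := near_setP (filterI (smooth_at_near sphi) (filterI tgt rot)).
have dS' : defining S h (U `&` V).
  by apply: (defining_sub dS) => [|p []//]; apply: openI => //; exact: defining_open dS.
have UVq : (U `&` V) q by [].
pose v := comb3 q (cos (phi q)) (sin (phi q)) 0.
have tv : is_tangent A q v by exact: comb3_tangent.
have vh : v h = 0 by rewrite /v /comb3 mul0r addr0; exact: (HV q Vq).2.1.
(* The first coordinate is built from f, which varies along the direction phi: the initial curve, on
   which that coordinate is 0, is thus transverse to the trajectories. *)
have [|f sf vf] := @comb3_smooth_neq0 q (cos (phi q)) (sin (phi q)) 0.
  by case=> c0 s0 _; have := cos2Dsin2 (phi q); rewrite c0 s0 expr0n /= addr0 => /eqP; rewrite eq_sym oner_eq0.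
have [d [r [kd dq dU r0 [Ed cq H1 H3]]]] := defining_chart_of dS' UVq Sq tv sf vh vf.
have Xc p i j g : dom d p -> smooth_at A p g -> (forall p', dom d p' -> coord d j p' = g p') ->
    X i p (coord d j) = X i p g.
  move=> dp sg e; apply/esym; apply: (tangent_eq hA (frame_tangent i p)) sg.
  by apply: filterS (dom_near kd dp) => p' dp'; rewrite e.
have sh p : dom d p -> smooth_at A p h by move=> dp; exact: (defining_smooth dS' (dU _ dp)).
apply: (ruled_surface (d := d) (r := r) (phi := phi)) => //.
- by move=> p dp; rewrite H3 //; exact: (defining_set dS' (dU _ dp)).
- by move=> p /dU[_ /HV[]].
- move=> p dp Sp; rewrite !(Xc p _ i3 h) //; try exact: sh.
  by have [_ Vp] := dU _ dp; exact: (HV p Vp).2.1.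
- by move=> p dp Sp; have [_ Vp] := dU _ dp; exact: (HV p Vp).2.2.
- have sf' : smooth_at A q (fun p => f p - f q) by apply: smooth_at_sub => //; exact: smooth_at_cst.
  rewrite !(Xc q _ i1 (fun p => f p - f q)) //.
  rewrite !(tangentB hA (frame_tangent _ _)) //; try exact: smooth_at_cst.
  rewrite !(tangent_cst hA (frame_tangent _ _)) !subr0.
  by move: vf; rewrite /v /comb3 mul0r addr0.
Qed.

(** C and Sn are the cosine and sine of phi, (a, b) the horizontal gradient of h, and xi = Xi phi.
    The fourth hypothesis differentiates C a + Sn b = 0 along C X1 + Sn X2, the fifth is
    [horizontal_mce]; substituting (a, b) = l (- Sn, C) leaves l^3 times the defect of the rotation
    law. *)
Lemma rotation_algebra (C Sn a b A11 A12 A21 A22 k1 k2 x1 x2 l : R) :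
  C ^+ 2 + Sn ^+ 2 = 1 -> C * a + Sn * b = 0 -> l = - Sn * a + C * b ->
  C * (C * A11 - Sn * x1 * a + (Sn * A12 + C * x1 * b)) +
  Sn * (C * A21 - Sn * x2 * a + (Sn * A22 + C * x2 * b)) = 0 ->
  b ^+ 2 * A11 - a * b * (A12 + A21) + a ^+ 2 * A22 + (a ^+ 2 + b ^+ 2) * (a * k2 - b * k1) = 0 ->
  l ^+ 3 * (C * x1 + Sn * x2 - (- k1 * C - k2 * Sn)) = 0.
Proof.
move=> cs t lE.
have ea : a = - l * Sn.
  transitivity (a * (C ^+ 2 + Sn ^+ 2)); first by rewrite cs mulr1.
  transitivity (C * (C * a + Sn * b) - l * Sn); first by rewrite lE; ring.
  by rewrite t mulr0 add0r mulNr.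
have eb : b = l * C.
  transitivity (b * (C ^+ 2 + Sn ^+ 2)); first by rewrite cs mulr1.
  transitivity (Sn * (C * a + Sn * b) + l * C); first by rewrite lE; ring.
  by rewrite t mulr0 add0r.
clear lE t; subst a b => T m.
transitivity (l ^+ 2 * (C * (C * A11 - Sn * x1 * (- l * Sn) + (Sn * A12 + C * x1 * (l * C))) +
  Sn * (C * A21 - Sn * x2 * (- l * Sn) + (Sn * A22 + C * x2 * (l * C))))
  - ((l * C) ^+ 2 * A11 - (- l * Sn) * (l * C) * (A12 + A21) + (- l * Sn) ^+ 2 * A22
     + ((- l * Sn) ^+ 2 + (l * C) ^+ 2) * ((- l * Sn) * k2 - (l * C) * k1))
  - (C ^+ 2 + Sn ^+ 2 - 1) * l ^+ 3 * (C * x1 + Sn * x2 + (k1 * C + k2 * Sn))); first by ring.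
by rewrite T m cs; ring.
Qed.

Lemma horizontal_frame_smooth i h p U S : defining S h U -> U p -> smooth_at A p (fun q => X i q h).
Proof. by move=> dS Up; apply: frame_smooth; exact: (defining_smooth dS). Qed.

(** By [rotation_algebra] the product l E vanishes on S. Where l = 0 the point is characteristic,
    and differentiating l E along a tangent v with v l <> 0 gives E = 0. *)
Lemma tangent_rotation S h U q phi : delta_minimal A Delta X c S -> defining S h U -> U q -> S q ->
  smooth_at A q phi ->
  (\forall p \near q, S p -> cos (phi p) * X i1 p h + sin (phi p) * X i2 p h = 0) ->
  (\forall p \near q, S p -> X i1 p h = 0 -> X i2 p h = 0 ->
     exists v, [/\ is_tangent A p v, v h = 0 & v (fun p => X i1 p h) <> 0 \/ v (fun p => X i2 p h) <> 0]) ->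
  \forall p \near q, S p -> cos (phi p) * X i1 p phi + sin (phi p) * X i2 p phi = gfun c (p, phi p).
Proof.
move=> mS dS Uq Sq sphi tgt nd.
have [V [oV Vq HV]] := near_setP (filterI (smooth_at_near sphi) (filterI tgt nd)).
have UV p : (U `&` V) p -> \forall p' \near p, (U `&` V) p'.
  by move=> UVp; apply: open_nbhs_nbhs; split=> //; apply: openI => //; exact: defining_open dS.
have sX i p : (U `&` V) p -> smooth_at A p (fun q => X i q h).
  by move=> [Up _]; exact: horizontal_frame_smooth dS Up.
have sP p : (U `&` V) p -> smooth_at A p phi by move=> [_ /HV[]].
have ss p : (U `&` V) p -> smooth_at A p (fun q => sin (phi q)) by move=> /sP; exact: smooth_at_sin.
have sc p : (U `&` V) p -> smooth_at A p (fun q => cos (phi q)) by move=> /sP; exact: smooth_at_cos.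
have sXp i p : (U `&` V) p -> smooth_at A p (fun q => X i q phi) by move=> /sP; exact: frame_smooth.
pose a p := X i1 p h; pose b p := X i2 p h.
pose l p := - sin (phi p) * a p + cos (phi p) * b p.
pose u p := cos (phi p) * a p + sin (phi p) * b p.
pose E p := cos (phi p) * X i1 p phi + sin (phi p) * X i2 p phi - (- c i1 i2 i1 p * cos (phi p) - c i1 i2 i2 p * sin (phi p)).
have sl p : (U `&` V) p -> smooth_at A p l.
  move=> UVp; apply: smooth_at_add => //; apply: smooth_at_mul => //; try exact: sX; try exact: sc.
  by apply: smooth_at_opp => //; exact: ss.
have suc p : (U `&` V) p -> smooth_at A p (fun p => cos (phi p) * a p).
  by move=> UVp; apply: smooth_at_mul => //; [exact: sc|exact: sX].
have sus p : (U `&` V) p -> smooth_at A p (fun p => sin (phi p) * b p).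
  by move=> UVp; apply: smooth_at_mul => //; [exact: ss|exact: sX].
have su p : (U `&` V) p -> smooth_at A p u.
  by move=> UVp; apply: smooth_at_add => //; [exact: suc|exact: sus].
have sE p : (U `&` V) p -> smooth_at A p E.
  move=> UVp; apply: smooth_at_sub => //.
    by apply: smooth_at_add => //; apply: smooth_at_mul => //; [exact: sc|exact: sXp|exact: ss|exact: sXp].
  apply: smooth_at_sub => //; apply: smooth_at_mul => //; try exact: c_smooth; [|exact: sc|exact: ss].
  by apply: smooth_at_opp => //; exact: c_smooth.
have u0 p : (U `&` V) p -> S p -> u p = 0 by move=> [_ Vp] Sp; exact: (HV p Vp).2.1.
have vu p v : (U `&` V) p -> S p -> is_tangent A p v -> v h = 0 -> v u = 0.
  move=> UVp Sp tv vh; apply: (defining_vanish dS UVp.1 Sp tv vh (su _ UVp)).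
  by apply: filterS (UV _ UVp) => p' UVp'; exact: u0.
have vuE p v : (U `&` V) p -> is_tangent A p v -> v u =
    cos (phi p) * v a - sin (phi p) * v phi * a p + (sin (phi p) * v b + cos (phi p) * v phi * b p).
  move=> UVp tv; rewrite /u (tangentD tv); [|exact: suc|exact: sus].
  rewrite (tangentM tv); [|exact: sc|exact: sX]; rewrite (tangentM tv); [|exact: ss|exact: sX].
  rewrite (tangent_cos tv (sP _ UVp)) (tangent_sin tv (sP _ UVp)).
  by move: (v a) (v b) (v phi) (cos _) (sin _) (a p) (b p) => *; ring.
have lE p : (U `&` V) p -> S p -> l p * E p = 0.
  move=> UVp Sp.
  pose v := comb3 p (cos (phi p)) (sin (phi p)) 0.
  have tv : is_tangent A p v by exact: comb3_tangent.
  have vh : v h = 0 by rewrite /v /comb3 mul0r addr0; exact: u0.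
  have := vu p v UVp Sp tv vh; rewrite /v /comb3 mul0r addr0 !(vuE _ _ UVp (frame_tangent _ _)).
  move=> T; have m := delta_minimal_mce mS dS UVp.1 Sp.
  have := rotation_algebra (cos2Dsin2 (phi p)) (u0 p UVp Sp) erefl T m.
  rewrite -/(l p) => /eqP; rewrite mulf_eq0 expf_eq0 /= => /orP[/eqP -> |/eqP e]; first by rewrite mul0r.
  by rewrite /E e mulr0.
suff E0 p : (U `&` V) p -> S p -> E p = 0.
  apply: filterS (UV _ (conj Uq Vq)) => p UVp Sp.
  by have := E0 p UVp Sp; rewrite /E => /eqP; rewrite subr_eq0 => /eqP.
move=> UVp Sp; have [l0|l0] := eqVneq (l p) 0; last first.
  by move/eqP: (lE p UVp Sp); rewrite mulf_eq0 (negbTE l0) => /eqP.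
have cs := cos2Dsin2 (phi p).
have up := u0 p UVp Sp.
have a0 : a p = 0.
  transitivity (cos (phi p) * u p - sin (phi p) * l p + (1 - (cos (phi p) ^+ 2 + sin (phi p) ^+ 2)) * a p).
    by rewrite /u /l; move: (a p) (b p) (cos _) (sin _) => *; ring.
  by rewrite up l0 cs subrr !mulr0 mul0r subrr addr0.
have b0 : b p = 0.
  transitivity (sin (phi p) * u p + cos (phi p) * l p + (1 - (cos (phi p) ^+ 2 + sin (phi p) ^+ 2)) * b p).
    by rewrite /u /l; move: (a p) (b p) (cos _) (sin _) => *; ring.
  by rewrite up l0 cs subrr !mulr0 mul0r !addr0.
have [v [tv vh vab]] := (HV p UVp.2).2.2 Sp a0 b0.
have v1 := vu p v UVp Sp tv vh; rewrite (vuE p v UVp tv) a0 b0 !mulr0 subr0 addr0 in v1.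
(* Since u vanishes on S, v u = 0; if v l were 0 too, rotating back would make v kill both X1 h and
   X2 h. *)
have vl : v l <> 0.
  rewrite /l (tangentD tv); last 2 first.
  - by apply: smooth_at_mul => //; [apply: smooth_at_opp => //; exact: ss|exact: sX].
  - by apply: smooth_at_mul => //; [exact: sc|exact: sX].
  have sn : smooth_at A p (fun q => - sin (phi q)) by apply: smooth_at_opp => //; exact: ss.
  rewrite (tangentM tv sn (sX i1 p UVp)) (tangentM tv (sc p UVp) (sX i2 p UVp)).
  rewrite -/(a p) -/(b p) a0 b0 !mul0r !addr0 => v2.
  have va : v a = 0.
    transitivity (cos (phi p) * (cos (phi p) * v a + sin (phi p) * v b) - sin (phi p) * (- sin (phi p) * v a + cos (phi p) * v b)
      + (1 - (cos (phi p) ^+ 2 + sin (phi p) ^+ 2)) * v a); last by rewrite v1 v2 cs subrr !mulr0 mul0r subrr addr0.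
    by move: (v a) (v b) (cos _) (sin _) => *; ring.
  have vb : v b = 0.
    transitivity (sin (phi p) * (cos (phi p) * v a + sin (phi p) * v b) + cos (phi p) * (- sin (phi p) * v a + cos (phi p) * v b)
      + (1 - (cos (phi p) ^+ 2 + sin (phi p) ^+ 2)) * v b); last by rewrite v1 v2 cs subrr !mulr0 mul0r !addr0.
    by move: (v a) (v b) (cos _) (sin _) => *; ring.
  by case: vab.
have := defining_vanish dS UVp.1 Sp tv vh (smooth_at_mul hA (sl _ UVp) (sE _ UVp)).
rewrite (tangentM tv); [|exact: sl|exact: sE]; rewrite l0 mul0r add0r => z.
have /eqP : E p * v l = 0.
  by apply: z; apply: filterS (UV _ UVp) => p' UVp'; exact: lE.
by rewrite mulf_eq0 => /orP[/eqP //|/eqP].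
Qed.

(** * Finding the angle at noncharacteristic and at rank-one points *)

Lemma sin_atan_cos (x : R) : sin (atan x) = x * cos (atan x).
Proof.
have c0 : cos (atan x) != 0 by rewrite gt_eqF // cos_gt0_pihalf // atan_gtNpi2 atan_ltpi2.
by rewrite -[X in X * _](atanK x) /tan -mulrA mulVf ?mulr1.
Qed.

(* Components of the horizontal gradient of h in the frame rotated by th, for
   the direction th expected to be tangent. *)
Definition frame_sin (th : R) h p := - sin th * X i1 p h + cos th * X i2 p h.
Definition frame_cos (th : R) h p := cos th * X i1 p h + sin th * X i2 p h.

Definition nondegenerate (S : set M) h p := S p -> X i1 p h = 0 -> X i2 p h = 0 ->
  exists v, [/\ is_tangent A p v, v h = 0 & v (fun p => X i1 p h) <> 0 \/ v (fun p => X i2 p h) <> 0].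

(** The angle is th + atan kappa: the tangency condition becomes cos (atan kappa) times [frame_cos]
    + kappa [frame_sin]. *)
Lemma swept_of_ratio S h U q th kappa : delta_minimal A Delta X c S -> defining S h U -> U q -> S q ->
  smooth_at A q kappa ->
  (\forall p \near q, S p -> frame_cos th h p = - kappa p * frame_sin th h p) ->
  (\forall p \near q, nondegenerate S h p) -> swept_near S q.
Proof.
move=> mS dS Uq Sq sk ratio nd; pose phi p := th + atan (kappa p).
have sphi : smooth_at A q phi.
  apply: smooth_at_add => //; first exact: smooth_at_cst.
  exact: (smooth_at_comp hA openT I smooth_atan).
have tgt : \forall p \near q, S p -> cos (phi p) * X i1 p h + sin (phi p) * X i2 p h = 0.
  apply: filterS ratio => p rp Sp; have := rp Sp; rewrite /frame_cos /frame_sin /phi cosD sinD sin_atan_cos.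
  move: (cos (atan (kappa p))) => k; move: (X i1 p h) (X i2 p h) (cos th) (sin th) (kappa p) => a b C Sn x e.
  transitivity (k * (C * a + Sn * b + x * (- Sn * a + C * b))); first by ring.
  by rewrite e; ring.
by apply: (ruled_swept_near dS Uq Sq sphi tgt); exact: tangent_rotation mS dS Uq Sq sphi tgt nd.
Qed.

Lemma frame_sin_smooth S h U p th : defining S h U -> U p -> smooth_at A p (frame_sin th h).
Proof.
move=> dS Up; apply: smooth_at_add => //; apply: smooth_at_mul => //; try exact: smooth_at_cst;
  exact: horizontal_frame_smooth dS Up.
Qed.

Lemma frame_cos_smooth S h U p th : defining S h U -> U p -> smooth_at A p (frame_cos th h).
Proof.
move=> dS Up; apply: smooth_at_add => //; apply: smooth_at_mul => //; try exact: smooth_at_cst;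
  exact: horizontal_frame_smooth dS Up.
Qed.

Lemma swept_noncharacteristic S h U q : delta_minimal A Delta X c S -> defining S h U -> U q -> S q ->
  ~ (X i1 q h = 0 /\ X i2 q h = 0) -> swept_near S q.
Proof.
move=> mS dS Uq Sq nc.
have [th th0] : exists th, frame_sin th h q != 0.
  have [b0|b0] := eqVneq (X i2 q h) 0; last by exists 0; rewrite /frame_sin sin0 cos0 oppr0 mul0r add0r mul1r.
  have [a0|a0] := eqVneq (X i1 q h) 0; first by exfalso; apply: nc.
  by exists (pi / 2); rewrite /frame_sin sin_pihalf cos_pihalf mul0r addr0 mulN1r oppr_eq0.
have sa := frame_sin_smooth th dS Uq; have sb := frame_cos_smooth th dS Uq.
apply: (swept_of_ratio (th := th) (kappa := fun p => - frame_cos th h p * (frame_sin th h p)^-1) mS dS Uq Sq).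
- by apply: smooth_at_mul => //; [exact: smooth_at_opp|exact: smooth_at_inv].
- apply: filterS (smooth_at_neq0 sa th0) => p p0 _.
  by rewrite !mulNr opprK mulfVK.
- have na : \forall p \near q, frame_sin th h p != 0 by exact: smooth_at_neq0.
  by apply: filterS na => p + _ a0 b0; rewrite /frame_sin a0 b0 !mulr0 addr0 eqxx.
Qed.

(** Where [frame_sin] vanishes, (a, b) = t (C, s) with t the value of [frame_cos], so the derivative
    of a P + b Q is divisible by t. *)
Lemma first_order_algebra (s C a b A11 B A22 L t zP zQ za zb : R) :
  s ^+ 2 + C ^+ 2 = 1 -> - s * a + C * b = 0 -> t = C * a + s * b ->
  (za * (- b * B + a * A22 + a * L) + a * zP) + (zb * (b * A11 + b * L) + b * zQ) =
  - t * (za * (s * B - C * (A22 + L)) - C * zP - s * zb * (A11 + L) - s * zQ).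
Proof.
move=> cs t0 tE.
have ea : a = C * t.
  transitivity (a * (s ^+ 2 + C ^+ 2)); first by rewrite cs mulr1.
  transitivity (C * t - s * (- s * a + C * b)); first by rewrite tE; ring.
  by rewrite t0 mulr0 subr0.
have eb : b = s * t.
  transitivity (b * (s ^+ 2 + C ^+ 2)); first by rewrite cs mulr1.
  transitivity (s * t + C * (- s * a + C * b)); first by rewrite tE; ring.
  by rewrite t0 mulr0 addr0.
by clear tE t0 cs; subst a b; ring.
Qed.

Section RankOne.
Variables (S : set M) (h : M -> R) (U : set M) (q : M) (th : R) (i : 'I_3).
Hypothesis mS : delta_minimal A Delta X c S.
Hypothesis dS : defining S h U.
Hypothesis Uq : U q.
Hypothesis Sq : S q.
Hypothesis a0 : X i1 q h = 0.
Hypothesis b0 : X i2 q h = 0.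
Hypothesis i0 : X i q h = 0.
Local Notation a := (fun p => X i1 p h).
Local Notation b := (fun p => X i2 p h).
Local Notation A' j k := (fun p => X j p (fun p' => X k p' h)).
Local Notation B := (fun p => A' i1 i2 p + A' i2 i1 p).
(** X i is tangent to S at q, so [slope] makes [frame_sin] a coordinate on S there; [pivot] is the
    value at q of the factor K introduced below. *)
Hypothesis slope : X i q (frame_sin th h) != 0.
Hypothesis pivot : A' i i1 q * (sin th * B q - 2 * cos th * A' i2 i2 q)
  + A' i i2 q * (cos th * B q - 2 * sin th * A' i1 i1 q) != 0.

Let L p := a p * c i1 i2 i2 p - b p * c i1 i2 i1 p.
Let P p := a p * (A' i2 i2 p + L p) - b p * B p.
Let Q p := b p * (A' i1 i1 p + L p).
(* The derivative along z, tangent to S, of [horizontal_mce] is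
   - frame_cos * K where frame_sin = 0; since K q <> 0, frame_cos vanishes there. *)
Let z p : vec R M := vcomb 1 (X i p) (- (X i p h * (X i3 p h)^-1)) (X i3 p).
Let K p := z p a * (sin th * B p - cos th * (A' i2 i2 p + L p)) - cos th * z p P
  - sin th * z p b * (A' i1 i1 p + L p) - sin th * z p Q.

Let sX j p : U p -> smooth_at A p (fun p => X j p h).
Proof. exact: horizontal_frame_smooth dS. Qed.

Let sA j k p : U p -> smooth_at A p (A' j k).
Proof. by move=> Up; apply: frame_smooth; exact: sX. Qed.

Let sB p : U p -> smooth_at A p B.
Proof. by move=> Up; apply: smooth_at_add => //; exact: sA. Qed.

Let sL p : U p -> smooth_at A p L.
Proof. by move=> Up; apply: smooth_at_sub => //; apply: smooth_at_mul => //; solve [exact: sX|exact: c_smooth]. Qed.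

Let sAL j p : U p -> smooth_at A p (fun p => A' j j p + L p).
Proof. by move=> Up; apply: smooth_at_add => //; [exact: sA|exact: sL]. Qed.

Let sP p : U p -> smooth_at A p P.
Proof. by move=> Up; apply: smooth_at_sub => //; apply: smooth_at_mul => //; solve [exact: sX|exact: sAL|exact: sB]. Qed.

Let sQ p : U p -> smooth_at A p Q.
Proof. by move=> Up; apply: smooth_at_mul => //; [exact: sX|exact: sAL]. Qed.

Let X3 : X i3 q h != 0.
Proof.
have [j] := defining_regular dS Uq; move: j; apply: ord3P => //; by rewrite ?a0 ?b0 eqxx.
Qed.

Let tz p : is_tangent A p (z p).
Proof. by apply: is_tangent_comb; exact: frame_tangent. Qed.

Let zq f : z q f = X i q f.
Proof. by rewrite /z /vcomb i0 mul0r oppr0 mul0r addr0 mul1r. Qed.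

Let zh p : X i3 p h != 0 -> z p h = 0.
Proof. by move=> p3; rewrite /z /vcomb mul1r mulNr mulfVK // subrr. Qed.

Let sz f : smooth_at A q f -> smooth_at A q (fun p => z p f).
Proof.
move=> sf; apply: smooth_at_add => //; apply: smooth_at_mul => //; try exact: smooth_at_cst; try exact: frame_smooth.
apply: smooth_at_opp => //; apply: smooth_at_mul => //; first exact: sX.
by apply: smooth_at_inv => //; exact: sX.
Qed.

Let sK : smooth_at A q K.
Proof.
have cst_mul (x : R) f : smooth_at A q f -> smooth_at A q (fun p => x * f p).
  by move=> sf; apply: smooth_at_mul => //; exact: smooth_at_cst.
have sw (x y : R) f g : smooth_at A q f -> smooth_at A q g -> smooth_at A q (fun p => x * f p - y * g p).
  by move=> sf sg; apply: smooth_at_sub => //; exact: cst_mul.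
apply: smooth_at_sub => //; last by apply: cst_mul; apply: sz; exact: sQ.
apply: smooth_at_sub => //; last first.
  by apply: smooth_at_mul => //; [apply: cst_mul; apply: sz; exact: sX|exact: sAL].
apply: smooth_at_sub => //; last by apply: cst_mul; apply: sz; exact: sP.
by apply: smooth_at_mul => //; [apply: sz; exact: sX|apply: sw; [exact: sB|exact: sAL]].
Qed.

Let K0 : K q != 0.
Proof.
have L0 : L q = 0 by rewrite /L a0 b0 !mul0r subrr.
have ti := frame_tangent i q.
have zP : X i q P = A' i i1 q * A' i2 i2 q - A' i i2 q * B q.
  rewrite /P (tangentB hA ti); [|apply: smooth_at_mul => //; [exact: sX|exact: sAL]|apply: smooth_at_mul => //; [exact: sX|exact: sB]].
  rewrite (tangentM ti (sX i1 Uq) (sAL i2 Uq)) (tangentM ti (sX i2 Uq) (sB Uq)) a0 b0 !mul0r !add0r L0 addr0.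
  by rewrite mulrC [B q * _]mulrC.
have zQ : X i q Q = A' i i2 q * A' i1 i1 q.
  by rewrite /Q (tangentM ti (sX i2 Uq) (sAL i1 Uq)) b0 !mul0r !add0r L0 addr0 mulrC.
move: pivot; rewrite /K !zq zP zQ L0 !addr0.
move: (A' i i1 q) (A' i i2 q) (A' i2 i2 q) (A' i1 i1 q) (B q) (sin th) (cos th) => x y A22 A11 b' s C.
by rewrite (_ : x * (s * b' - 2 * C * A22) + y * (C * b' - 2 * s * A11) =
  x * (s * b' - C * A22) - C * (x * A22 - y * b') - s * y * A11 - s * (y * A11)) //; ring.
Qed.

Let zero_set : \forall p \near q, S p -> frame_sin th h p = 0 -> frame_cos th h p = 0.
Proof.
have nU : \forall p \near q, U p by apply: open_nbhs_nbhs; split=> //; exact: defining_open dS.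
apply: filterS (filterI nU (filterI (smooth_at_neq0 sK K0) (smooth_at_neq0 (sX i3 Uq) X3))) => p [Up [Kp p3]] Sp s0.
have smP : smooth_at A p (fun p => a p * P p) by apply: smooth_at_mul => //; [exact: sX|exact: sP].
have smQ : smooth_at A p (fun p => b p * Q p) by apply: smooth_at_mul => //; [exact: sX|exact: sQ].
(* The sum a P + b Q is [horizontal_mce h], which vanishes on S, and z is tangent to S wherever X3 h
   <> 0. *)
have : z p (fun p => a p * P p + b p * Q p) = 0.
  apply: (defining_vanish dS Up Sp (tz p) (zh p3)); first exact: smooth_at_add.
  apply: filterS (open_nbhs_nbhs (conj (defining_open dS) Up)) => p' Up' Sp'.
  rewrite -[RHS](delta_minimal_mce mS dS Up' Sp') /horizontal_mce /P /Q /L.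
  by move: (a p') (b p') (A' i1 i1 p') (A' i1 i2 p') (A' i2 i1 p') (A' i2 i2 p') (c i1 i2 i2 p') (c i1 i2 i1 p') => *; ring.
rewrite (tangentD (tz p) smP smQ) (tangentM (tz p) (sX i1 Up) (sP Up)) (tangentM (tz p) (sX i2 Up) (sQ Up)).
have cs : sin th ^+ 2 + cos th ^+ 2 = 1 by rewrite addrC cos2Dsin2.
have := first_order_algebra (A' i1 i1 p) (B p) (A' i2 i2 p) (L p) (z p P) (z p Q) (z p a) (z p b) cs s0 erefl.
rewrite -/(K p) => e e2.
have /eqP : - frame_cos th h p * K p = 0.
  rewrite -[RHS]e2; apply: (etrans (esym e)); move: (z p P) (z p Q) => zP zQ; rewrite /P /Q.
  by move: (z p a) (z p b) (a p) (b p) (A' i1 i1 p) (A' i2 i2 p) (B p) (L p) => *; ring.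
by rewrite mulf_eq0 (negbTE Kp) orbF oppr_eq0 => /eqP.
Qed.

(** In a chart with first coordinate [frame_sin] and third coordinate h, [frame_cos] vanishes on the
    second axis, so Hadamard's lemma writes it as x1 g1 + x3 g3. On S this is [frame_sin] times g1,
    and kappa = - g1. *)
Lemma swept_rank1 : swept_near S q.
Proof.
have [V [oV Vq HV]] := near_setP zero_set.
have dS' : defining S h (U `&` V).
  by apply: (defining_sub dS) => [|p []//]; apply: openI => //; exact: defining_open dS.
have sa p : U p -> smooth_at A p (frame_sin th h) by exact: frame_sin_smooth dS.
have sb p : U p -> smooth_at A p (frame_cos th h) by exact: frame_cos_smooth dS.
have [d [r [kd dq dU r0 [Ed cq H1 H3]]]] := defining_chart_of dS' (conj Uq Vq) Sq (frame_tangent i q) (sa q Uq) i0 (elimN eqP slope).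
have cd := compatible_chart kd.
have fs0 : frame_sin th h q = 0 by rewrite /frame_sin a0 b0 !mulr0 addr0.
have H1' p : dom d p -> coord d i1 p = frame_sin th h p by move=> dp; rewrite H1 // fs0 subr0.
have Sd p : dom d p -> S p <-> coord d i3 p = 0.
  by move=> dp; rewrite H3 //; exact: (defining_set dS' (dU _ dp)).
have sf : smooth_on (ball (0 : 'rV[R]_3) r) (frame_cos th h \o cinv d : 'rV[R]_3 -> R^o).
  by rewrite -Ed; apply: (smooth_on_cimg hA kd) => p dp; apply: sb; exact: (dU _ dp).1.
have [g [sg Hg _]] := hadamard (fun j : 'I_3 => j == i2) r0 sf.
have g1 : smooth_at A q (fun p => - g i1 (cmap d p)).
  apply: smooth_at_opp => //; apply: (smooth_at_chart hA kd dq _ _ (sg i1)); first exact: ball_open.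
  by rewrite -Ed; exists q.
apply: (swept_of_ratio (th := th) mS dS Uq Sq g1).
- apply: filterS (dom_near kd dq) => p dp Sp.
  have Bp : ball (0 : 'rV[R]_3) r (cmap d p) by rewrite -Ed; exists p.
  have := Hg _ Bp; rewrite /= (chart_cancel cd dp) => ->.
  have Bp' := hline_ball (fun j : 'I_3 => j == i2) (t := 0) (introT andP (conj (lexx 0) ler01)) Bp.
  set x' := hline 0 _ 0 _ in Bp' *.
  have cx' : cimg d x' by rewrite Ed.
  have dx' := chart_inv_dom cd cx'.
  have x'E j : j != i2 -> coord d j (cinv d x') = 0.
    by move=> /negbTE j2; rewrite /coord chart_invK // /x' /hline /hscale !mxE /hcoef j2 mul0r addr0.
  have -> : frame_cos th h (cinv d x') = 0.
    apply: (HV _ (dU _ dx').2); first by apply/(Sd _ dx'); exact: x'E.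
    by rewrite -H1' // x'E.
  rewrite opprK add0r big_mkcond sum3 /= subr0 addr0 -![cmap d p 0 _]/(coord d _ p) H1' //.
  by rewrite (Sd p dp).1 // mul0r addr0 mulrC.
- have nz : \forall p \near q, z p (frame_sin th h) != 0.
    by apply: smooth_at_neq0; [apply: sz; exact: sa|rewrite zq].
  have nU : \forall p \near q, U p by apply: open_nbhs_nbhs; split=> //; exact: defining_open dS.
  apply: filterS (filterI nU (filterI nz (smooth_at_neq0 (sX i3 Uq) X3))) => p [Up [zp p3]] Sp ap bp.
  exists (z p); split; [exact: tz|exact: zh|].
  have [za|] := pselect (z p a = 0); last by left.
  have [zb|] := pselect (z p b = 0); last by right.
  move: zp; rewrite /frame_sin (tangentD (tz p)) ?(tangentZ hA (tz p)) //; try exact: sX.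
  + by rewrite za zb !mulr0 addr0 eqxx.
  + by apply: smooth_at_mul => //; [exact: smooth_at_cst|exact: sX].
  + by apply: smooth_at_mul => //; [exact: smooth_at_cst|exact: sX].
Qed.

End RankOne.

(** At a characteristic point only the X3-term of [X1, X2] h survives, and the contact condition
    makes its coefficient 1 or -1. *)
Lemma frame_commutator S h U q : defining S h U -> U q -> X i1 q h = 0 -> X i2 q h = 0 ->
  X i1 q (fun p => X i2 p h) - X i2 q (fun p => X i1 p h) != 0.
Proof.
move=> dS Uq a0 b0; rewrite (lieE i1 i2 (defining_smooth dS Uq)) a0 b0 !mulr0 !add0r oppr_eq0.
have X3 : X i3 q h != 0.
  by have [j] := defining_regular dS Uq; move: j; apply: ord3P => //; rewrite ?a0 ?b0 eqxx.
rewrite mulf_neq0 //; apply/eqP => c0; have := c123_sqr q.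
by rewrite c0 expr0n /= => /eqP; rewrite eq_sym oner_eq0.
Qed.

Lemma frame_sin_tangent S h U q th v : defining S h U -> U q -> is_tangent A q v ->
  v (frame_sin th h) = - sin th * v (fun p => X i1 p h) + cos th * v (fun p => X i2 p h).
Proof.
move=> dS Uq tv.
have sX j : smooth_at A q (fun p => X j p h) by exact: horizontal_frame_smooth dS Uq.
have sc (x : R) j : smooth_at A q (fun p => x * X j p h) by apply: smooth_at_mul => //; exact: smooth_at_cst.
by rewrite /frame_sin (tangentD tv) // !(tangentZ hA tv).
Qed.

Lemma frame_cos_tangent S h U q th v : defining S h U -> U q -> is_tangent A q v ->
  v (frame_cos th h) = cos th * v (fun p => X i1 p h) + sin th * v (fun p => X i2 p h).
Proof.
move=> dS Uq tv.
have sX j : smooth_at A q (fun p => X j p h) by exact: horizontal_frame_smooth dS Uq.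
have sc (x : R) j : smooth_at A q (fun p => x * X j p h) by apply: smooth_at_mul => //; exact: smooth_at_cst.
by rewrite /frame_cos (tangentD tv) // !(tangentZ hA tv).
Qed.

Lemma rotate_back (C s a b f g : R) : C ^+ 2 + s ^+ 2 = 1 -> - s * a + C * b = f -> C * a + s * b = g ->
  a = C * g - s * f /\ b = s * g + C * f.
Proof. by move=> cs <- <-; split; rewrite -[LHS]mul1r -cs; ring. Qed.

(** Write Aij = Xi Xj h, so that A12 <> A21. If A21 = 0, then A11 A22 = 0, and th = 0, i = 1 give
    slope A12 and pivot A12^2. Otherwise th = pi / 2, i = 2 give slope - A21 and pivot A21 (A21 -
    A12). *)
Lemma swept_degenerate S h U q : delta_minimal A Delta X c S -> defining S h U -> U q -> S q ->
  X i1 q h = 0 -> X i2 q h = 0 ->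
  X i1 q (fun p => X i1 p h) * X i2 q (fun p => X i2 p h) =
  X i1 q (fun p => X i2 p h) * X i2 q (fun p => X i1 p h) -> swept_near S q.
Proof.
move=> mS dS Uq Sq a0 b0 det.
have := frame_commutator dS Uq a0 b0.
have fs th i := frame_sin_tangent th dS Uq (frame_tangent i q).
have [A21|A21] := eqVneq (X i2 q (fun p => X i1 p h)) 0 => tau.
  rewrite A21 subr0 in tau; rewrite A21 mulr0 in det.
  apply: (swept_rank1 (th := 0) (i := i1) mS dS Uq Sq a0 b0 a0).
    by rewrite fs sin0 cos0 oppr0 mul0r add0r mul1r.
  rewrite sin0 cos0 A21 mul0r add0r mulr1 mul1r mulr0 mul0r subr0 addr0.
  by rewrite mulrN mulrCA det mulr0 oppr0 add0r mulf_neq0.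
apply: (swept_rank1 (th := pi / 2) (i := i2) mS dS Uq Sq a0 b0 b0).
  by rewrite fs sin_pihalf cos_pihalf mul0r addr0 mulN1r oppr_eq0.
rewrite sin_pihalf cos_pihalf !mul1r mulr0 !mul0r subr0 add0r mulr1 mulrN.
rewrite mulrCA [X in _ - 2 * X]mulrC det.
move: tau A21; move: (X i1 q _) (X i2 q _) => x y tau y0.
rewrite (_ : _ - _ = - (y * (x - y))); last by ring.
by rewrite oppr_eq0 mulf_neq0.
Qed.

(** * Characteristic points with independent second derivatives *)

Lemma continuous_zero (f : R -> R) : {for (0 : R), continuous f} ->
  (\forall t \near (0 : R), t != 0 -> f t = 0) -> f 0 = 0.
Proof.
move=> cf f0; apply/eqP; apply: contrapT => /negP fn.
have n : \forall t \near (0 : R), f t != 0.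
  by apply: (cf [set x | x != 0]); apply: open_nbhs_nbhs; split; [exact: open_neq|].
have nn : nbhs (0 : R) [set t | (t != 0 -> f t = 0) /\ f t != 0] by exact: filterI.
move: nn => /nbhs_ballP[e /= e0 He].
have e2 : 0 < e / 2 by rewrite divr_gt0.
have [|h1 /eqP] := He (e / 2); last by apply; apply: h1; rewrite gt_eqF.
by apply/ballE; rewrite subr0 gtr0_norm // ltr_pdivrMr // ltr_pMr // ltr1n.
Qed.

(** Negative rho are allowed, so th in [- pi / 2, pi / 2] is enough; the rational bound 2 replaces
    pi / 2. *)
Lemma polar (a b : R) : exists th rho, [/\ - 2 <= th <= 2, a = - rho * sin th, b = rho * cos th &
  `|rho| <= `|a| + `|b|].
Proof.
have /andP[pi0 pi2'] := pihalf_02 R; have pi2 := ltW pi2'.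
have [->|b0] := eqVneq b 0.
  exists (pi / 2), (- a); rewrite sin_pihalf cos_pihalf mulr1 mulr0 opprK normrN lerDl normr_ge0; split=> //.
  by rewrite pi2 (le_trans _ (ltW pi0)) // oppr_le0.
pose th := atan (- a / b); have c0 : 0 < cos th by apply: cos_gt0_pihalf; rewrite atan_gtNpi2 atan_ltpi2.
have cn : cos th != 0 by rewrite gt_eqF.
have sE : sin th = (- a / b) * cos th by exact: sin_atan_cos.
have ea : a = - (b / cos th) * sin th by rewrite sE; move: cn; move: (cos th) => k k0; field; rewrite ?k0 ?b0.
have eb : b = (b / cos th) * cos th by rewrite mulfVK.
exists th, (b / cos th); split=> //.
  by rewrite (le_trans _ (ltW (atan_gtNpi2 _))) ?lerN2 // (le_trans (ltW (atan_ltpi2 _))).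
rewrite -(@ler_pXn2r _ 2) ?nnegrE ?addr_ge0 // real_normK ?num_real //.
have -> : (b / cos th) ^+ 2 = a ^+ 2 + b ^+ 2.
  have sq (x y k s C : R) : C ^+ 2 + s ^+ 2 = 1 -> x = - k * s -> y = k * C -> k ^+ 2 = x ^+ 2 + y ^+ 2.
    by move=> cs -> ->; rewrite -[LHS]mulr1 -cs; ring.
  exact: sq (cos2Dsin2 th) ea eb.
rewrite sqrrD !real_normK ?num_real // -addrA lerD2l lerDr mulrn_wge0 // mulr_ge0 //.
Qed.

Lemma X4_chart (p : M * R) (f : M * R -> R) d : is_chart d -> dom d p.1 ->
  X4 p f = chart_vec (bar_chart d) p (0, 1) f.
Proof.
move=> cd dp; rewrite /X4 /velocity /chart_vec; apply: derive_along => e /=.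
by rewrite scaler0 add0r (chart_cancel cd).
Qed.

Lemma X4_smooth : smooth_field bA X4.
Proof.
split=> [p|p f sf]; have [d [kd _ cd dp _]] := smooth_at_in hA p.1;
  have kbd := bar_compatible kd; have bdp : dom (bar_chart d) p by [].
  have [t1 t2] : is_tangent bA p (chart_vec (bar_chart d) p (0, 1)) by exact: chart_vec_tangent.
  by split=> *; rewrite !(X4_chart _ cd dp); [exact: t1|exact: t2].
have sv : smooth_at bA p (fun q : M * R => chart_vec (bar_chart d) q (0, 1) f) by exact: chart_vec_smooth.
apply: smooth_at_eq sv => //.
have nd : \forall z \near p, dom (bar_chart d) z.
  by apply: open_nbhs_nbhs; split=> //; exact: (chart_open (compatible_chart kbd)).
by apply: filterS nd => z [dz _]; rewrite (X4_chart _ cd dz).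
Qed.

Lemma X4_curve q : integral_curve bA X4 setT (fun s => (q, s)).
Proof.
split; [exact: openT|by []|move=> s f _ sf].
have [d [kd _ cd dq _]] := smooth_at_in hA q.
have dqs : dom (bar_chart d) (q, s) by [].
have kbd := bar_compatible kd.
have df : differentiable (f \o cinv (bar_chart d) : 'rV[R]_3 * R^o -> R^o) (cmap (bar_chart d) (q, s)).
  by exact: (smooth_in_differentiable hbA).
have e (t : R) : (cmap d q, 0) + t *: ((0, 1) : 'rV[R]_3 * R^o) = (cmap d q, t) :> 'rV[R]_3 * R^o.
  by congr pair => /=; rewrite ?scaler0 ?addr0 // add0r [_ *: _]mulr1.
have := @line_is_derive R ('rV[R]_3 * R^o)%type (f \o cinv (bar_chart d)) (cmap d q, 0) (0, 1) s.
rewrite e => /(_ df); rewrite (@X4_chart (q, s) _ d cd dq) /chart_vec.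
rewrite (_ : (fun s0 : R^o => _) = f \o (fun s0 : R => (q, s0))) //.
by apply/funext => t; rewrite e /= (chart_cancel cd).
Qed.

Section SweepCalculus.
Variables (xi : field R (M * R)) (J : set R) (Gamma : R -> M * R).
Hypothesis sxi : smooth_field bA xi.
Hypothesis hGamma : integral_curve bA xi J Gamma.
Local Notation F := (sweep Phi Gamma).
Local Notation SD := (sweep_dom D J Gamma).

Lemma sweep_comp_smooth (W : set (R^o * R^o)) (G : M * R -> R) : W `<=` SD ->
  (forall z, W z -> smooth_at bA (F z) G) -> smooth_on W (G \o F : R^o * R^o -> R^o).
Proof.
move=> WS sG k; apply: Ck_local => z Wz.
by have [V [oV Vz _ sV]] := sweep_smooth sxi hGamma (WS _ Wz) (sG _ Wz); exists V.
Qed.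

Lemma sweep_dt_fst (z : R * R) f : SD z -> smooth_at A (F z).1 f ->
  is_derive z.1 1 (fun t : R^o => f (F (t, z.2)).1 : R^o)
    (cos (F z).2 * X i1 (F z).1 f + sin (F z).2 * X i2 (F z).1 f).
Proof.
move=> Sz sf; have := sweep_dt_derive Sz (smooth_at_fst sf).
by rewrite char_field_fst /comb3 mul0r addr0.
Qed.

End SweepCalculus.

Lemma rotated_derive (C Sn a b : R -> R) (t g da db : R) :
  is_derive t 1 (C : R^o -> R^o) (- Sn t * g) -> is_derive t 1 (Sn : R^o -> R^o) (C t * g) ->
  is_derive t 1 (a : R^o -> R^o) da -> is_derive t 1 (b : R^o -> R^o) db ->
  is_derive t 1 (fun t : R^o => C t * a t + Sn t * b t : R^o) (C t * da + Sn t * db + g * (- Sn t * a t + C t * b t)) /\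
  is_derive t 1 (fun t : R^o => - Sn t * a t + C t * b t : R^o) (- Sn t * da + C t * db - g * (C t * a t + Sn t * b t)).
Proof.
move=> dC dS da' db'; split.
  rewrite (_ : C t * da + _ + _ = (C t * da + a t * (- Sn t * g)) + (Sn t * db + b t * (C t * g))); last by ring.
  exact: is_deriveD (is_deriveM dC da') (is_deriveM dS db').
rewrite (_ : - Sn t * da + _ - _ = (- Sn t * da + a t * (- (C t * g))) + (C t * db + b t * (- Sn t * g))); last by ring.
exact: is_deriveD (is_deriveM (is_deriveN dS) da') (is_deriveM dC db').
Qed.

(* With u and l the first derivatives of h along the trajectory and across it,
   l^2 h'' is the left-hand side of the minimal surface equation up to a multiple of u. *)
Lemma umbilic_algebra (C Sn a b A11 B A22 k1 k2 u l g gp : R) : C ^+ 2 + Sn ^+ 2 = 1 ->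
  u = C * a + Sn * b -> l = - Sn * a + C * b -> g = - k1 * C - k2 * Sn -> gp = C * k2 - Sn * k1 ->
  l ^+ 2 * (C ^+ 2 * A11 + Sn * C * B + Sn ^+ 2 * A22 + g * l) =
  b ^+ 2 * A11 - a * b * B + a ^+ 2 * A22 + (a ^+ 2 + b ^+ 2) * (a * k2 - b * k1) -
  u * (l * (2 * (Sn * C * A11) - (C ^+ 2 - Sn ^+ 2) * B - 2 * (C * Sn * A22) + u * g + l * gp) +
       u * (Sn ^+ 2 * A11 - C * Sn * B + C ^+ 2 * A22 + u * gp)).
Proof.
move=> cs uE lE gE gpE.
have ea : a = C * u - Sn * l.
  by rewrite uE lE -[LHS]mul1r -cs; ring.
have eb : b = Sn * u + C * l.
  by rewrite uE lE -[LHS]mul1r -cs; ring.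
clear uE lE; subst a b g gp.
set stuff := (u ^+ 2 + l ^+ 2) * (u * (C * k2 - Sn * k1) + l * (- k1 * C - k2 * Sn)).
transitivity (l ^+ 2 * (C ^+ 2 * A11 + Sn * C * B + Sn ^+ 2 * A22 + (- k1 * C - k2 * Sn) * l) +
  (C ^+ 2 + Sn ^+ 2 - 1) * stuff).
  by rewrite cs subrr mul0r addr0.
by rewrite /stuff; ring.
Qed.

Section Umbilic.
Variables (S : set M) (h : M -> R) (U : set M) (q : M).
Hypothesis mS : delta_minimal A Delta X c S.
Hypothesis dS : defining S h U.
Hypothesis Uq : U q.
Hypothesis Sq : S q.
Hypothesis a0 : X i1 q h = 0.
Hypothesis b0 : X i2 q h = 0.
Local Notation a := (fun p => X i1 p h).
Local Notation b := (fun p => X i2 p h).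
Local Notation A' j k := (fun p => X j p (fun p' => X k p' h)).
Local Notation B := (fun p => A' i1 i2 p + A' i2 i1 p).

(** X3 h <> 0 at q and the determinant make the differentials of X1 h, X2 h and h independent; S is
    then parametrized by its horizontal gradient. *)
Lemma umbilic_chart : A' i1 i1 q * A' i2 i2 q <> A' i1 i2 q * A' i2 i1 q ->
  exists d r, [/\ compatible A d, dom d q, dom d `<=` U, 0 < r &
    [/\ cimg d = ball (0 : 'rV[R]_3) r, cmap d q = 0 & forall p, dom d p ->
      cmap d p = row3 (X i1 p h) (X i2 p h) (h p)]].
Proof.
move=> det.
have sX j : smooth_at A q (fun p => X j p h) by exact: horizontal_frame_smooth dS Uq.
have sh := defining_smooth dS Uq.
have hq : h q = 0 by apply/(defining_set dS Uq).
have X3 : X i3 q h != 0.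
  by have [j] := defining_regular dS Uq; move: j; apply: ord3P => //; rewrite ?a0 ?b0 eqxx.
pose f (j : 'I_3) : M -> R := if j == i1 then (fun p => X i1 p h) else if j == i2 then (fun p => X i2 p h) else h.
have sf j : smooth_at A q (f j) by rewrite /f; case: ifP => _; [exact: sX|case: ifP => _; [exact: sX|exact: sh]].
have inj v : is_tangent A q v -> (forall j, v (f j) = 0) -> veq A q v (fun=> 0).
  move=> tv vf; have [v1 [v2 [v3 e]]] := frame_span3 tv.
  have h3 := vf i3; have h1 := vf i1; have h2 := vf i2; rewrite /f /= in h1 h2 h3.
  rewrite (e _ sh) /comb3 a0 b0 !mulr0 !add0r in h3.
  have z3 : v3 = 0 by move/eqP: h3; rewrite mulf_eq0 (negbTE X3) orbF => /eqP.
  rewrite (e _ (sX i1)) /comb3 z3 mul0r addr0 in h1; rewrite (e _ (sX i2)) /comb3 z3 mul0r addr0 in h2.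
  have lin (x11 x12 x21 x22 : R) : x11 * x22 <> x12 * x21 -> v1 * x11 + v2 * x21 = 0 -> v1 * x12 + v2 * x22 = 0 ->
      v1 = 0 /\ v2 = 0.
    move=> /eqP; rewrite -subr_eq0 => D0 k1 k2.
    have dvd x : x * (x11 * x22 - x12 * x21) = 0 -> x = 0.
      by move=> /eqP; rewrite mulf_eq0 (negbTE D0) orbF => /eqP.
    split; apply: dvd.
      transitivity (x22 * (v1 * x11 + v2 * x21) - x21 * (v1 * x12 + v2 * x22)); first by ring.
      by rewrite k1 k2 !mulr0 subrr.
    transitivity (x11 * (v1 * x12 + v2 * x22) - x12 * (v1 * x11 + v2 * x21)); first by ring.
    by rewrite k1 k2 !mulr0 subrr.
  have [z1 z2] := lin _ _ _ _ det h1 h2.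
  by move=> g sg; rewrite (e g sg) /comb3 z1 z2 z3 !mul0r !addr0.
have [d [r [kd dq dU r0 [Ed Hd]]]] := chart_of_functions hA (defining_open dS) Uq sf inj.
have fq j : f j q = 0 by rewrite /f; case: ifP => // _; case: ifP.
exists d, r; split=> //; split=> //.
  by apply/rowP => j; rewrite -[LHS]/(coord d j q) Hd // subrr mxE.
move=> p dp; apply/rowP; apply: ord3P; rewrite row3E -[LHS]/(coord d _ p) Hd // fq subr0 //.
Qed.

Section UmbilicChart.
Variables (d : chart M 'rV[R]_3) (r : R).
Hypothesis kd : compatible A d.
Hypothesis dq : dom d q.
Hypothesis dU : dom d `<=` U.
Hypothesis r0 : 0 < r.
Hypothesis Ed : cimg d = ball (0 : 'rV[R]_3) r.
Hypothesis cq : cmap d q = 0.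
Hypothesis Hd : forall p, dom d p -> cmap d p = row3 (X i1 p h) (X i2 p h) (h p).
Let cd := compatible_chart kd.

Let sX j p : U p -> smooth_at A p (fun p => X j p h).
Proof. exact: horizontal_frame_smooth dS. Qed.

Let sA j k p : U p -> smooth_at A p (A' j k).
Proof. by move=> Up; apply: frame_smooth; exact: sX. Qed.

(* Along the ray of slope (x, y) of the surface the equation is
   t^2 (y^2 A11 - x y B + x^2 A22) + O(t^3) = 0. *)
Lemma umbilic_ray (x y : R) :
  y ^+ 2 * A' i1 i1 q - x * y * B q + x ^+ 2 * A' i2 i2 q = 0.
Proof.
pose p (t : R) := cinv d (row3 (t * x) (t * y) 0).
pose G m := y ^+ 2 * A' i1 i1 m - x * y * B m + x ^+ 2 * A' i2 i2 m.
pose H m := (x ^+ 2 + y ^+ 2) * (x * c i1 i2 i2 m - y * c i1 i2 i1 m).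
have p0 : p 0 = q.
  rewrite /p !mul0r (_ : row3 0 0 0 = cmap d q) ?(chart_cancel cd) //.
  by rewrite cq; apply/rowP; apply: ord3P; rewrite row3E mxE.
have crow : {for (0 : R), continuous (fun t : R => row3 (t * x) (t * y) 0 : 'rV[R]_3)}.
  have -> : (fun t : R => row3 (t * x) (t * y) 0 : 'rV[R]_3) = (fun t => 0 + t *: row3 x y 0).
    by apply/funext => t; rewrite add0r; apply/rowP; apply: ord3P; rewrite [RHS]mxE !row3E ?mulr0.
  by apply: continuousD; [exact: cst_continuous|exact: scalel_continuous].
have img0 : cimg d (row3 (0 * x) (0 * y) 0).
  by exists q => //; rewrite cq !mul0r; apply/rowP; apply: ord3P; rewrite row3E mxE.
have cp : {for (0 : R), continuous p}.
  by apply: continuous_comp crow _; exact: (chart_cinv_cont cd).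
have cst_mul (e : R) f : smooth_at A q f -> smooth_at A q (fun p => e * f p).
  by move=> sf; apply: smooth_at_mul => //; exact: smooth_at_cst.
have sG : smooth_at A q G.
  apply: smooth_at_add => //; last by apply: cst_mul; exact: sA.
  apply: smooth_at_sub => //; apply: cst_mul; first exact: sA.
  by apply: smooth_at_add => //; exact: sA.
have sH : smooth_at A q H.
  by apply: (cst_mul); apply: smooth_at_sub => //; apply: cst_mul; exact: c_smooth.
pose f t := G (p t) + t * H (p t).
have cf : {for (0 : R), continuous f}.
  have cG : {for q, continuous G} by exact: (smooth_at_continuous hA).
  have cH : {for q, continuous H} by exact: (smooth_at_continuous hA).
  apply: continuousD; first by apply: continuous_comp cp _; rewrite p0.
  apply: continuousM; first exact: cvg_id.
  by apply: continuous_comp cp _; rewrite p0.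
have := continuous_zero cf; rewrite /f p0 mul0r addr0; apply.
have nimg : \forall t \near (0 : R), cimg d (row3 (t * x) (t * y) 0).
  by apply: crow; apply: open_nbhs_nbhs; split=> //; exact: (chart_img_open cd).
apply: filterS nimg => t ct t0.
have dp : dom d (p t) by exact: chart_inv_dom.
have := Hd dp; rewrite /p chart_invK // -/(p t) => e.
have ea : X i1 (p t) h = t * x by have := congr1 (fun w : 'rV[R]_3 => w 0 i1) e; rewrite !row3E.
have eb : X i2 (p t) h = t * y by have := congr1 (fun w : 'rV[R]_3 => w 0 i2) e; rewrite !row3E.
have eh : h (p t) = 0 by have := congr1 (fun w : 'rV[R]_3 => w 0 i3) e; rewrite !row3E.
have Sp : S (p t) by apply/(defining_set dS (dU dp)).
have := delta_minimal_mce mS dS (dU dp) Sp; rewrite /horizontal_mce ea eb => m.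
have /eqP : t ^+ 2 * f t = 0.
  rewrite -[RHS]m /f /G /H.
  by move: (A' i1 i1 (p t)) (A' i1 i2 (p t)) (A' i2 i1 (p t)) (A' i2 i2 (p t)) (c i1 i2 i2 (p t)) (c i1 i2 i1 (p t)) => *; ring.
by rewrite mulf_eq0 expf_eq0 /= (negbTE t0) => /eqP.
Qed.

Lemma umbilic_A11 : A' i1 i1 q = 0.
Proof. by have := umbilic_ray 0 1; rewrite expr0n /= !mul0r subr0 addr0 expr1n mul1r. Qed.

Lemma umbilic_A22 : A' i2 i2 q = 0.
Proof. by have := umbilic_ray 1 0; rewrite expr0n /= !mul0r mulr0 mul0r subr0 add0r expr1n mul1r. Qed.

Lemma umbilic_A21 : A' i2 i1 q = - A' i1 i2 q.
Proof.
have := umbilic_ray 1 1; rewrite umbilic_A11 umbilic_A22 !mulr0 add0r addr0 !mul1r => /eqP.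
by rewrite oppr_eq0 addrC addr_eq0 => /eqP.
Qed.

Lemma umbilic_A12 : A' i1 i2 q != 0.
Proof.
have := frame_commutator dS Uq a0 b0; rewrite umbilic_A21 opprK -mulr2n.
by rewrite mulrn_eq0.
Qed.

(** [horizontal_mce] vanishes on S and h is the third coordinate, so Hadamard's lemma divides it by
    h. At q the quotient is a first derivative of a P + b Q, in which a, b, P and Q all vanish at
    q. *)
Lemma umbilic_mce : exists k : M -> R, [/\ forall p, dom d p -> smooth_at A p k, k q = 0 &
  forall p, dom d p -> horizontal_mce h p = h p * k p].
Proof.
have sL p : U p -> smooth_at A p (fun p => X i1 p h * c i1 i2 i2 p - X i2 p h * c i1 i2 i1 p).
  by move=> Up; apply: smooth_at_sub => //; apply: smooth_at_mul => //; solve [exact: sX|exact: c_smooth].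
pose P p := X i1 p h * (A' i2 i2 p + (X i1 p h * c i1 i2 i2 p - X i2 p h * c i1 i2 i1 p)) - X i2 p h * B p.
pose Q p := X i2 p h * (A' i1 i1 p + (X i1 p h * c i1 i2 i2 p - X i2 p h * c i1 i2 i1 p)).
have sAL j p : U p -> smooth_at A p (fun p => A' j j p + (X i1 p h * c i1 i2 i2 p - X i2 p h * c i1 i2 i1 p)).
  by move=> Up; apply: smooth_at_add => //; [exact: sA|exact: sL].
have sB p : U p -> smooth_at A p B by move=> Up; apply: smooth_at_add => //; exact: sA.
have sP p : U p -> smooth_at A p P.
  by move=> Up; apply: smooth_at_sub => //; apply: smooth_at_mul => //; solve [exact: sX|exact: sAL|exact: sB].
have sQ p : U p -> smooth_at A p Q.
  by move=> Up; apply: smooth_at_mul => //; solve [exact: sX|exact: sAL].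
pose m p := X i1 p h * P p + X i2 p h * Q p.
have smP p : U p -> smooth_at A p (fun p => X i1 p h * P p) by move=> Up; apply: smooth_at_mul => //; solve [exact: sX|exact: sP].
have smQ p : U p -> smooth_at A p (fun p => X i2 p h * Q p) by move=> Up; apply: smooth_at_mul => //; solve [exact: sX|exact: sQ].
have mE p : horizontal_mce h p = m p.
  rewrite /horizontal_mce /m /P /Q.
  by move: (X i1 p h) (X i2 p h) (A' i1 i1 p) (A' i1 i2 p) (A' i2 i1 p) (A' i2 i2 p) (c i1 i2 i2 p) (c i1 i2 i1 p) => *; ring.
have sm p : U p -> smooth_at A p m by move=> Up; apply: smooth_at_add => //; [exact: smP|exact: smQ].
have sf : smooth_on (ball (0 : 'rV[R]_3) r) (m \o cinv d : 'rV[R]_3 -> R^o).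
  by rewrite -Ed; apply: (smooth_on_cimg hA kd) => p dp; apply: sm; exact: dU.
have [g [sg Hg g0]] := hadamard (fun j : 'I_3 => j != i3) r0 sf.
have Bq : ball (0 : 'rV[R]_3) r 0 by exact: ballxx.
exists (fun p => g i3 (cmap d p)); split.
- move=> p dp; apply: (smooth_at_chart hA kd dp _ _ (sg i3)); first exact: ball_open.
  by rewrite -Ed; exists p.
- rewrite cq g0 //; last first.
    by rewrite /hline add0r; apply/rowP => j; rewrite !mxE subrr mulr0.
  have tv : is_tangent A q (chart_vec d q 'e_i3) by exact: chart_vec_tangent.
  have -> : 'D_'e_i3 (m \o cinv d : 'rV[R]_3 -> R^o) 0 = chart_vec d q 'e_i3 m by rewrite /chart_vec cq.
  rewrite /m (tangentD tv (smP q Uq) (smQ q Uq)) (tangentM tv (sX i1 Uq) (sP q Uq)) (tangentM tv (sX i2 Uq) (sQ q Uq)).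
  by rewrite /P /Q a0 b0 !mul0r subrr !mul0r !addr0.
move=> p dp; rewrite mE.
have Bp : ball (0 : 'rV[R]_3) r (cmap d p) by rewrite -Ed; exists p.
have := Hg _ Bp; rewrite /= (chart_cancel cd dp) => ->.
have Bp' := hline_ball (fun j : 'I_3 => j != i3) (t := 0) (introT andP (conj (lexx 0) ler01)) Bp.
set x' := hline 0 _ 0 _ in Bp' *.
have cx' : cimg d x' by rewrite Ed.
have dx' := chart_inv_dom cd cx'.
have Sx' : S (cinv d x').
  apply/(defining_set dS (dU dx')).
  have := congr1 (fun w : 'rV[R]_3 => w 0 i3) (Hd dx'); rewrite row3E chart_invK // => <-.
  by rewrite /x' /hline /hscale !mxE /hcoef /= mul0r addr0.
have -> : m (cinv d x') = 0 by rewrite -mE; exact: delta_minimal_mce mS dS (dU dx') Sx'.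
rewrite add0r big_mkcond sum3 /= !add0r subr0; congr (_ * _).
by rewrite Hd // row3E.
Qed.

Local Notation Gamma := (fun s : R => (q, s)).
Local Notation F := (sweep Phi Gamma).
Local Notation SD := (sweep_dom D setT Gamma).
Let hG := X4_curve q.

(* [ub] is the derivative of h along V and [lb] along the horizontal direction
   orthogonal to it; [du] and [dl] are the derivatives of [ub] and [lb] along V.
   [al1] and [al2] are the remainders in [umbilic_algebra]. *)
Let ub (p : M * R) : R := cos p.2 * X i1 p.1 h + sin p.2 * X i2 p.1 h.
Let lb (p : M * R) : R := - sin p.2 * X i1 p.1 h + cos p.2 * X i2 p.1 h.
Let gp (p : M * R) : R := cos p.2 * c i1 i2 i2 p.1 - sin p.2 * c i1 i2 i1 p.1.
Let al1 (p : M * R) : R := 2 * (sin p.2 * cos p.2 * A' i1 i1 p.1) - (cos p.2 ^+ 2 - sin p.2 ^+ 2) * B p.1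
  - 2 * (cos p.2 * sin p.2 * A' i2 i2 p.1) + ub p * gfun c p + lb p * gp p.
Let al2 (p : M * R) : R := sin p.2 ^+ 2 * A' i1 i1 p.1 - cos p.2 * sin p.2 * B p.1
  + cos p.2 ^+ 2 * A' i2 i2 p.1 + ub p * gp p.
Let du (p : M * R) : R := cos p.2 ^+ 2 * A' i1 i1 p.1 + sin p.2 * cos p.2 * B p.1
  + sin p.2 ^+ 2 * A' i2 i2 p.1 + gfun c p * lb p.
Let dl (p : M * R) : R := cos p.2 ^+ 2 * A' i1 i2 p.1 - sin p.2 ^+ 2 * A' i2 i1 p.1
  + sin p.2 * cos p.2 * (A' i2 i2 p.1 - A' i1 i1 p.1) - gfun c p * ub p.

Lemma smooth_at_sqr (p : M * R) (f : M * R -> R) : smooth_at bA p f -> smooth_at bA p (fun p : M * R => f p ^+ 2).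
Proof. by move=> sf; exact: (smooth_at_mul hbA sf sf). Qed.

Let sS (p : M * R) : smooth_at bA p (fun p : M * R => sin p.2).
Proof. exact: (smooth_at_comp hbA openT I smooth_sin (smooth_at_snd p)). Qed.

Let sC (p : M * R) : smooth_at bA p (fun p : M * R => cos p.2).
Proof. exact: (smooth_at_comp hbA openT I smooth_cos (smooth_at_snd p)). Qed.

Let sXb j (p : M * R) : dom d p.1 -> smooth_at bA p (fun p : M * R => X j p.1 h).
Proof. by move=> dp; apply: (smooth_at_fst (sX j (dU dp))). Qed.

Let sAb j k (p : M * R) : dom d p.1 -> smooth_at bA p (fun p : M * R => A' j k p.1).
Proof. by move=> dp; apply: (smooth_at_fst (sA j k (dU dp))). Qed.

Let scb j (p : M * R) : smooth_at bA p (fun p : M * R => c i1 i2 j p.1).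
Proof. exact: (smooth_at_fst (c_smooth i1 i2 j p.1)). Qed.

Local Ltac smooth := repeat first [assumption | exact: sS | exact: sC | by apply: sXb | by apply: sAb | exact: scb
  | exact: gfun_smooth | exact: (smooth_at_cst hbA) | apply: smooth_at_sqr | apply: (smooth_at_add hbA)
  | apply: (smooth_at_opp hbA) | apply: (smooth_at_mul hbA)].

Let sub (p : M * R) : dom d p.1 -> smooth_at bA p ub. Proof. by move=> dp; rewrite /ub; smooth. Qed.
Let slb (p : M * R) : dom d p.1 -> smooth_at bA p lb. Proof. by move=> dp; rewrite /lb; smooth. Qed.
Let sgp (p : M * R) : smooth_at bA p gp. Proof. by rewrite /gp; smooth. Qed.
Let sal1 (p : M * R) : dom d p.1 -> smooth_at bA p al1.
Proof. by move=> dp; have su := sub dp; have sl := slb dp; have sg := sgp p; rewrite /al1; smooth. Qed.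
Let sal2 (p : M * R) : dom d p.1 -> smooth_at bA p al2.
Proof. by move=> dp; have su := sub dp; have sg := sgp p; rewrite /al2; smooth. Qed.
Let sdu (p : M * R) : dom d p.1 -> smooth_at bA p du.
Proof. by move=> dp; have sl := slb dp; rewrite /du; smooth. Qed.
Let sdl (p : M * R) : dom d p.1 -> smooth_at bA p dl.
Proof. by move=> dp; have su := sub dp; rewrite /dl; smooth. Qed.

Lemma umbilic_sweep0 s : F (0, s) = (q, s).
Proof. exact: (flow0 hPhi). Qed.

Lemma umbilic_dom0 s : SD (0, s).
Proof. by split=> //; exact: (flow_dom0 hPhi). Qed.

Lemma umbilic_nbhd s : exists W : set (R^o * R^o), [/\ open W, W (0, s), W `<=` SD &
  forall z, W z -> dom d (F z).1].
Proof.
have dF : dom d (F (0, s)).1 by rewrite umbilic_sweep0.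
by have [W [oW Wz WS Wd _]] := sweep_chart_smooth X4_smooth hG kd (umbilic_dom0 s) dF; exists W.
Qed.

(** All trajectories start on the fibre over q, where G vanishes; a Lipschitz bound between times t
    and 0 gives a constant valid for all nearby directions. *)
Lemma umbilic_bound (G : M * R -> R) s0 : (forall p : M * R, dom d p.1 -> smooth_at bA p G) ->
  (forall s, G (q, s) = 0) ->
  exists2 K, 0 < K & \forall z \near ((0, s0) : R^o * R^o), `|G (F z)| <= K * `|z.1|.
Proof.
move=> sG G0; have [W [oW Wz WS Wd]] := umbilic_nbhd s0.
have sm := sweep_comp_smooth X4_smooth hG WS (fun z Wz => sG _ (Wd z Wz)).
have [K [e [K0 e0 eW lip]]] := Ck_lipschitz oW Wz (sm 1%N).
exists K => //; have nb : nbhs ((0, s0) : R^o * R^o) (ball ((0, s0) : R^o * R^o) e) by exact: nbhsx_ballx.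
apply: filterS nb => -[t s] [ht hs].
have b1 : ball ((0, s0) : R^o * R^o) e (t, s) by split.
have b2 : ball ((0, s0) : R^o * R^o) e (0, s) by split => //; exact: ballxx.
have := lip _ _ b1 b2; rewrite [(G \o F) (0, s)]/= umbilic_sweep0 G0 subr0 => H.
apply: (le_trans H); rewrite ler_pM2l //; apply: prod_norm_le; rewrite /= ?subr0 //.
by rewrite subrr normr0.
Qed.

Lemma umbilic_derive (z : R * R) : SD z -> dom d (F z).1 ->
  is_derive z.1 1 (fun t : R^o => ub (F (t, z.2)) : R^o) (du (F z)) /\
  is_derive z.1 1 (fun t : R^o => lb (F (t, z.2)) : R^o) (dl (F z)).
Proof.
case: z => t s Sz dz.
have dphi := sweep_dt_snd Sz; rewrite /= in dphi.
have da := sweep_dt_fst Sz (sX i1 (dU dz)); have db := sweep_dt_fst Sz (sX i2 (dU dz)); rewrite /= in da db.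
have dC : is_derive t 1 (fun t : R^o => cos (F (t, s)).2 : R^o) (- sin (F (t, s)).2 * gfun c (F (t, s))).
  exact: (is_derive1_comp (f := @cos R)).
have dS' : is_derive t 1 (fun t : R^o => sin (F (t, s)).2 : R^o) (cos (F (t, s)).2 * gfun c (F (t, s))).
  exact: (is_derive1_comp (f := @sin R)).
have [h1 h2] := rotated_derive dC dS' da db.
split.
  rewrite /= /du /ub; apply: (is_derive_eq h1).
  rewrite /lb; move: (cos _) (sin _) (A' i1 i1 _) (A' i1 i2 _) (A' i2 i1 _) (A' i2 i2 _) (X i1 _ h) (X i2 _ h) (gfun _ _) => *; ring.
rewrite /= /dl /lb; apply: (is_derive_eq h2).
rewrite /ub; move: (cos _) (sin _) (A' i1 i1 _) (A' i1 i2 _) (A' i2 i1 _) (A' i2 i2 _) (X i1 _ h) (X i2 _ h) (gfun _ _) => *; ring.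
Qed.

(** By antisymmetry the second derivatives at q form k0 times a quarter turn. Hence [ub], [lb],
    [al1], [al2], [du] vanish on the fibre over q, while [lb] grows at the same rate k0 in every
    direction s. *)
Let k0 := A' i1 i2 q.
Let A11 := umbilic_A11.
Let A22 := umbilic_A22.
Let A21 : A' i2 i1 q = - k0 := umbilic_A21.
Let k0n : k0 != 0 := umbilic_A12.

Let ub0 s : ub (q, s) = 0. Proof. by rewrite /ub a0 b0 !mulr0 addr0. Qed.
Let lb0 s : lb (q, s) = 0. Proof. by rewrite /lb a0 b0 !mulr0 addr0. Qed.
Let al10 s : al1 (q, s) = 0.
Proof. by rewrite /al1 ub0 lb0 /= A11 A22 A21 subrr !mulr0 !mul0r subrr !addr0 subrr. Qed.
Let al20 s : al2 (q, s) = 0.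
Proof. by rewrite /al2 ub0 /= A11 A22 A21 subrr !mulr0 !mul0r subrr !addr0. Qed.
Let du0 s : du (q, s) = 0.
Proof. by rewrite /du lb0 /= A11 A22 A21 subrr !mulr0 !addr0. Qed.
Let dl0 s : dl (q, s) = k0.
Proof.
by rewrite /dl ub0 /= A11 A22 A21 subrr !mulr0 addr0 subr0 mulrN opprK -mulrDl cos2Dsin2 mul1r.
Qed.

(** By the mean value theorem from t = 0, where [lb] vanishes: its derivative [dl] stays within |k0|
    / 2 of k0 near the fibre. *)
Lemma umbilic_lower s0 :
  \forall z \near ((0, s0) : R^o * R^o), `|k0| / 2 * `|z.1| <= `|lb (F z)|.
Proof.
have [W [oW Wz WS Wd]] := umbilic_nbhd s0.
have sm := sweep_comp_smooth X4_smooth hG WS (fun z Wz => sdl (Wd z Wz)).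
have cf : {for ((0, s0) : R^o * R^o), continuous (dl \o F : R^o * R^o -> R^o)}.
  by apply: Ck_continuous (sm 0%N) _.
have k2 : 0 < `|k0| / 2 by rewrite divr_gt0 // normr_gt0.
have nb : nbhs ((0, s0) : R^o * R^o) (W `&` [set z | `|k0| / 2 <= `|dl (F z)|]).
  apply: filterI; first exact: open_nbhs_nbhs.
  have nd : \forall z \near ((0, s0) : R^o * R^o), ball (k0 : R^o) (`|k0| / 2) (dl (F z)).
    by apply: (cf (ball (k0 : R^o) (`|k0| / 2))); rewrite /= umbilic_sweep0 dl0; exact: nbhsx_ballx.
  apply: filterS nd => z /ballE /= hz.
  have : `|k0| <= `|dl (F z) - k0| + `|dl (F z)|.
    by rewrite distrC; apply: le_trans (ler_normD _ _); rewrite subrK.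
  move: hz; move: (`|dl (F z) - k0|) (`|dl (F z)|) (`|k0|) => x y w h1 h2.
  lra.
move: nb => /nbhs_ballP[e /= e0 He].
have nb : nbhs ((0, s0) : R^o * R^o) (ball ((0, s0) : R^o * R^o) e) by exact: nbhsx_ballx.
apply: filterS nb => -[t s] [ht hs].
have H u : `|u| <= `|t| -> W (u, s) /\ `|k0| / 2 <= `|dl (F (u, s))|.
  move=> ut; apply: He; split=> //; apply/ballE; move/ballE: ht; rewrite /= !subr0; exact: le_lt_trans.
have [|v vt] := @MVT_from0 R (fun u => lb (F (u, s))) (fun u => dl (F (u, s))) `|t| _ t (lexx _).
  move=> u /H[Wu _]; exact: (umbilic_derive (WS _ Wu) (Wd _ Wu)).2.
by rewrite umbilic_sweep0 lb0 subr0 /= => ->; rewrite normrM ler_wpM2r //; exact: (H v vt).2.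
Qed.

Lemma umbilic_zero s0 : exists2 e, 0 < e & forall s, `|s - s0| < e -> forall t, `|t| <= e ->
  [/\ SD (t, s), dom d (F (t, s)).1 & S (F (t, s)).1].
Proof.
have [k [sk kq kE]] := umbilic_mce.
have [W [oW Wz WS Wd]] := umbilic_nbhd s0.
have skb (p : M * R) : dom d p.1 -> smooth_at bA p (k \o fst) by move=> dp; exact: (smooth_at_fst (sk _ dp)).
have [K0 K00 n0] := umbilic_bound s0 skb (fun s => kq).
have [Ku Ku0 nu] := umbilic_bound s0 sub ub0.
have [Kl Kl0 nl] := umbilic_bound s0 slb lb0.
have [K1 K10 n1] := umbilic_bound s0 sal1 al10.
have [K2 K20 n2] := umbilic_bound s0 sal2 al20.
have nw := umbilic_lower s0.
pose w := `|k0| / 2; have w0 : 0 < w by rewrite divr_gt0 // normr_gt0.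
pose K := (K0 + Kl * K1 + Ku * K2) / w ^+ 2.
have Kp : 0 < K by rewrite divr_gt0 ?exprn_gt0 // !addr_gt0 // mulr_gt0.
have nW : nbhs ((0, s0) : R^o * R^o) W by exact: open_nbhs_nbhs.
have nall : nbhs ((0, s0) : R^o * R^o) [set z | [/\ W z, w * `|z.1| <= `|lb (F z)|,
    `|k (F z).1| <= K0 * `|z.1| & [/\ `|ub (F z)| <= Ku * `|z.1|, `|lb (F z)| <= Kl * `|z.1|,
    `|al1 (F z)| <= K1 * `|z.1| & `|al2 (F z)| <= K2 * `|z.1|]]].
  near=> z; split; [near: z; exact: nW|near: z; exact: nw|near: z; exact: n0|].
  by split; near: z; [exact: nu|exact: nl|exact: n1|exact: n2].
move: nall => /nbhs_ballP[e' /= e'0 He'].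
(* The first bound keeps the trajectories where the estimates hold, the second gives 2 K e <= 1/2,
   as [second_order_zero] demands. *)
pose e := Num.min (e' / 2) (1 / (4 * K)).
have e0 : 0 < e by rewrite lt_min !divr_gt0 // mulr_gt0.
have ee' : e < e'.
  by apply: (@le_lt_trans _ _ (e' / 2)); [rewrite ge_min lexx|rewrite ltr_pdivrMr // ltr_pMr // ltr1n].
have Ke : 2 * K * e < 1.
  by apply: (small_step Kp); rewrite ge_min lexx orbT.
exists e => // s ss t te.
have H u : `|u| <= e -> (fun z => [/\ W z, w * `|z.1| <= `|lb (F z)|,
    `|k (F z).1| <= K0 * `|z.1| & [/\ `|ub (F z)| <= Ku * `|z.1|, `|lb (F z)| <= Kl * `|z.1|,
    `|al1 (F z)| <= K1 * `|z.1| & `|al2 (F z)| <= K2 * `|z.1|]]) (u, s).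
  move=> ue; apply: He'; split; apply/ballE; rewrite /= ?subr0; first exact: le_lt_trans ue ee'.
  exact: lt_trans ss ee'.
have [Wt _ _ _] := H t te.
split; [exact: WS|exact: Wd|apply/(defining_set dS (dU (Wd _ Wt)))].
have hq : h q = 0 by apply/(defining_set dS Uq).
apply: (@second_order_zero R (fun u => h (F (u, s)).1) (fun u => ub (F (u, s))) (fun u => du (F (u, s))) e K e0 (ltW Kp) Ke) => //.
- move=> u /H[Wu _ _ _].
  exact: (sweep_dt_fst (WS _ Wu) (defining_smooth dS (dU (Wd _ Wu)))).
- move=> u /H[Wu _ _ _]; exact: (umbilic_derive (WS _ Wu) (Wd _ Wu)).1.
- move=> u /H[Wu _ _ _]; have [df _] := sweep_dt_derive (WS _ Wu) (sdu (Wd _ Wu)).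
  exact/differentiable_continuous/derivable1_diffP.
- by rewrite umbilic_sweep0.
- by rewrite umbilic_sweep0 ub0.
- by rewrite umbilic_sweep0 du0.
move=> u /H[Wu lw lk [lu ll l1 l2]]; rewrite /= in lw lk lu ll l1 l2.
have dF := Wd _ Wu; set p := F (u, s) in lw lk lu ll l1 l2 dF *.
(* With [horizontal_mce] replaced by h k, this is the equation lb^2 h'' = h k - ub (lb al1 + ub
   al2), whose terms are controlled by the six bounds above. *)
have E := umbilic_algebra (a := X i1 p.1 h) (b := X i2 p.1 h) (A' i1 i1 p.1) (B p.1) (A' i2 i2 p.1)
  (k1 := c i1 i2 i1 p.1) (k2 := c i1 i2 i2 p.1) (cos2Dsin2 p.2) erefl erefl erefl erefl.
have m := kE _ dF; rewrite /horizontal_mce in m; rewrite m in E.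
rewrite -/(ub p) -/(lb p) -/(gfun c p) -/(gp p) -/(al1 p) -/(al2 p) -/(du p) in E.
by apply: (umbilic_estimate w0 E lw lk lu ll l1 l2).
Unshelve. all: by end_near. Qed.

Lemma umbilic_uniform : exists2 e, 0 < e & forall s, - 4 <= s <= 4 -> forall t, `|t| <= e ->
  [/\ SD (t, s), dom d (F (t, s)).1 & S (F (t, s)).1].
Proof.
apply: (segment_uniform (P := fun s e => forall t, `|t| <= e -> [/\ SD (t, s), dom d (F (t, s)).1 & S (F (t, s)).1])).
  by move=> s e e' ee' H t te; apply: H; exact: le_trans te ee'.
move=> s0 _; have [e e0 H] := umbilic_zero s0.
by exists e => // s ss; exists e => // t; exact: H.
Qed.

(** Along the sweep f vanishes at t = 0 whatever s, so Hadamard's lemma divides it by t; at t = 0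
    the quotient is the derivative of f along the direction s. *)
Lemma umbilic_factor (W : set (R^o * R^o)) th0 r' (f : M -> R) : open W -> W `<=` SD ->
  (forall z, W z -> dom d (F z).1) -> 0 < r' -> (forall x, ball (row2 0 th0) r' x -> W (plane x)) ->
  (forall p, U p -> smooth_at A p f) -> f q = 0 ->
  exists n : 'rV[R]_2 -> R^o, [/\ smooth_on (ball (row2 0 th0) r') n,
    forall x, ball (row2 0 th0) r' x -> f (F (plane x)).1 = x 0 j0 * n x &
    forall s, `|s - th0| < r' -> n (row2 0 s) = cos s * X i1 q f + sin s * X i2 q f].
Proof.
move=> oW WS Wd r'0 BW sf fq.
pose G (x : 'rV[R]_2) : R^o := f (F (plane x)).1.
have sfb (z : R^o * R^o) : W z -> smooth_at bA (F z) (f \o fst).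
  by move=> Wz; apply: smooth_at_fst; apply: sf; exact: dU (Wd _ Wz).
have sG : smooth_on (ball (row2 0 th0) r') G.
  move=> k; apply: (@Ck_comp_scalar _ _ _ _ k _ W plane ((f \o fst) \o F) _ BW).
  - exact: ball_open.
  - by apply: Ck_plane; exact: ball_open.
  - exact: (sweep_comp_smooth X4_smooth hG WS sfb).
have [g [sg Hg g0]] := hadamard (fun j : 'I_2 => j != j0) r'0 sG.
have hl x : hline (row2 0 th0) (fun j : 'I_2 => j != j0) 0 x = row2 0 (x 0 j1).
  apply/rowP; apply: ord2P; rewrite row2E /hline /hscale /hcoef mxE row2E mxE /= ?mul0r ?addr0 //.
  by rewrite mul1r mxE [X in _ + (_ + X)]mxE row2E addrC subrK.
have F0 s : (F (0, s)).1 = q by rewrite umbilic_sweep0.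
exists (g j0); split=> //.
  move=> x Bx; rewrite -/(G x) (Hg x Bx) hl /G plane_row2 F0 fq add0r.
  by rewrite big_mkcond sum2 /= addr0 mxE [X in _ + X]mxE row2E subr0.
move=> s ss.
have Bs : ball (row2 0 th0) r' (row2 0 s).
  apply/ballE; apply: le_lt_trans ss; apply: rv_norm_le => //.
  by apply: ord2P; rewrite mxE [X in _ + X]mxE !row2E // subrr normr0.
rewrite g0 // ?hl ?row2E //.
have Ws : W (0, s) by have := BW _ Bs; rewrite plane_row2.
have dF := Wd _ Ws.
rewrite (@derive_along _ _ _ _ _ (fun t : R^o => f (F (t, s)).1 : R^o) _ _ 0 (1 : R^o)); last first.
  move=> e; rewrite /G; congr (f (F _).1).
  by rewrite plane_e0 [e *: _]mulr1.
have [_ ->] := sweep_dt_fst (WS _ Ws) (sf _ (dU dF)).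
by rewrite umbilic_sweep0.
Qed.

(** Divided by t, the components [frame_sin] and [frame_cos] of the gradient along the sweep
    restrict at t = 0 to k0 cos (s - th0) and - k0 sin (s - th0), the data of [blowup_inverse]. Its
    radius does not shrink with rho, which is what covering a full neighbourhood of q requires. *)
Lemma umbilic_cover e th0 : 0 < e -> - 2 <= th0 <= 2 -> exists2 e', 0 < e' &
  forall th, `|th - th0| < e' -> forall rho : R, `|rho| < e' -> exists z : R * R,
  [/\ `|z.1| <= e, - 4 <= z.2 <= 4, X i1 (F z).1 h = - rho * sin th & X i2 (F z).1 h = rho * cos th].
Proof.
move=> e0 /andP[th1 th2]; have [W [oW Wz WS Wd]] := umbilic_nbhd th0.
have nW : nbhs ((0, th0) : R^o * R^o) W by exact: open_nbhs_nbhs.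
move: nW => /nbhs_ballP[r1 /= r10 Hr1].
(* The three bounds keep (t, s) in W, the time within e, and the direction within 1 of th0, hence in
   [- 4, 4]. *)
pose r' := Num.min r1 (Num.min e 1).
have r'0 : 0 < r' by rewrite !lt_min r10 e0 ltr01.
have r'1 : r' <= r1 by rewrite ge_min lexx.
have r'e : r' <= e by rewrite !ge_min lexx orbT.
have r'o : r' <= 1 by rewrite !ge_min lexx !orbT.
have Bx x : ball (row2 0 th0) r' x -> `|x 0 j0| < r' /\ `|x 0 j1 - th0| < r'.
  move=> /ballE xr; split; apply: le_lt_trans xr.
    by have := rv_coord_le (x - row2 0 th0) j0; rewrite mxE [X in _ + X]mxE row2E subr0.
  by have := rv_coord_le (x - row2 0 th0) j1; rewrite mxE [X in _ + X]mxE row2E.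
have BW x : ball (row2 0 th0) r' x -> W (plane x).
  move=> /Bx[h1 h2]; apply: Hr1; split; apply/ballE; rewrite /= ?subr0; exact: lt_le_trans r'1.
have sfs p : U p -> smooth_at A p (frame_sin th0 h) by exact: frame_sin_smooth dS.
have sfc p : U p -> smooth_at A p (frame_cos th0 h) by exact: frame_cos_smooth dS.
have fs0 : frame_sin th0 h q = 0 by rewrite /frame_sin a0 b0 !mulr0 addr0.
have fc0 : frame_cos th0 h q = 0 by rewrite /frame_cos a0 b0 !mulr0 addr0.
have [n1 [s1 e1 v1]] := umbilic_factor oW WS Wd r'0 BW sfs fs0.
have [n2 [s2 e2 v2]] := umbilic_factor oW WS Wd r'0 BW sfc fc0.
have fsi i : X i q (frame_sin th0 h) = - sin th0 * A' i i1 q + cos th0 * A' i i2 q.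
  exact: frame_sin_tangent dS Uq (frame_tangent i q).
have fci i : X i q (frame_cos th0 h) = cos th0 * A' i i1 q + sin th0 * A' i i2 q.
  exact: frame_cos_tangent dS Uq (frame_tangent i q).
have N1 s : `|s - th0| < r' -> n1 (row2 0 s) = k0 * cos (s - th0).
  by move=> ss; rewrite v1 // !fsi A11 A22 A21 cosB; rewrite -/k0; move: k0 (cos s) (sin s) (cos th0) (sin th0) => *; ring.
have N2 s : `|s - th0| < r' -> n2 (row2 0 s) = - k0 * sin (s - th0).
  by move=> ss; rewrite v2 // !fci A11 A22 A21 sinB; rewrite -/k0; move: k0 (cos s) (sin s) (cos th0) (sin th0) => *; ring.
have [e3 e30 H] := blowup_inverse r'0 k0n s1 s2 N1 N2.
have ntan : \forall x \near (0 : R), `|tan x| < e3 /\ cos x != 0.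
  have c0 : cos (0 : R) != 0 by rewrite cos0 oner_neq0.
  have nt : \forall x \near (0 : R), `|tan x| < e3.
    have ct : {for (0 : R), continuous (@tan R)} by exact: continuous_tan.
    have nd : \forall x \near (0 : R), ball (0 : R^o) e3 (tan x).
      by apply: (ct (ball (0 : R^o) e3)); rewrite tan0; exact: nbhsx_ballx.
    by apply: filterS nd => x /ballE; rewrite subr0.
  have nc : \forall x \near (0 : R), cos x != 0.
    have cc : {for (0 : R), continuous (@cos R)} by exact: continuous_cos.
    by apply: (cc [set x | x != 0]); apply: open_nbhs_nbhs; split; [exact: open_neq|].
  by apply: filterS2 nt nc.
move: ntan => /nbhs_ballP[e4 /= e40 He4].
exists (Num.min e3 e4); first by rewrite lt_min e30.
move=> th; rewrite lt_min => /andP[_ hth] rho; rewrite lt_min => /andP[hr _].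
have [dlt thE] : exists dlt, th = th0 + dlt by exists (th - th0); rewrite addrC subrK.
rewrite thE addrAC subrr add0r in hth.
have [tl cl] : `|tan dlt| < e3 /\ cos dlt != 0 by apply: He4; apply/ballE; rewrite subr0.
(* In the frame rotated by th0 the target is (rho cos dlt, - rho sin dlt), with second-to-first
   ratio - tan dlt even as rho tends to 0. *)
have [||x [Bxx x1 x2]] := H (rho * cos dlt) (- tan dlt).
- rewrite normrM; apply: le_lt_trans hr; rewrite -[leRHS]mulr1 ler_wpM2l // ler_norml.
  by rewrite cos_geN1 cos_le1.
- by rewrite normrN.
exists (plane x); have [h1 h2] := Bx _ Bxx.
have fsE : frame_sin th0 h (F (plane x)).1 = rho * cos dlt by rewrite e1.
have fcE : frame_cos th0 h (F (plane x)).1 = - rho * sin dlt.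
  rewrite e2 // x2 mulrN mulNr; congr (- _); rewrite -mulrA; congr (_ * _).
  by rewrite /tan mulrCA mulfV ?mulr1.
have [ra rb] := rotate_back (cos2Dsin2 th0) fsE fcE.
split.
- by apply: le_trans r'e; exact: ltW.
- by apply: (window h2 r'o); rewrite th1 th2.
- by rewrite ra thE sinD; move: (cos th0) (sin th0) (cos dlt) (sin dlt) => *; ring.
- by rewrite rb thE cosD; move: (cos th0) (sin th0) (cos dlt) (sin dlt) => *; ring.
Qed.

Lemma umbilic_swept : swept_near S q.
Proof.
have [e e0 He] := umbilic_uniform.
have [e' e'0 He'] : exists2 e', 0 < e' & forall th, - 2 <= th <= 2 -> forall rho : R, `|rho| < e' -> exists z : R * R,
    [/\ `|z.1| <= e, - 4 <= z.2 <= 4, X i1 (F z).1 h = - rho * sin th & X i2 (F z).1 h = rho * cos th].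
  apply: (segment_uniform (P := fun th e' => forall rho : R, `|rho| < e' -> exists z : R * R,
    [/\ `|z.1| <= e, - 4 <= z.2 <= 4, X i1 (F z).1 h = - rho * sin th & X i2 (F z).1 h = rho * cos th])).
    by move=> s x x' xx' H rho hr; apply: H; exact: lt_le_trans hr xx'.
  move=> th0 hth; have [e' e'0 H] := umbilic_cover e0 hth.
  by exists e' => // th /H H'; exists e'.
(* Angles in [- 2, 2] reach every gradient by [polar]; the solutions s of [umbilic_cover] may leave
   this segment by less than 1, and 4 leaves room. *)
exists X4, setT, Gamma, (q, 0), e, e, 4, 4; split=> //; [exact: X4_smooth|].
have rec z : rectangle e e 4 4 z -> `|z.1| <= e /\ - 4 <= z.2 <= 4 by rewrite ler_norml.
split.
- by move=> [t s] /rec[z1 z2]; have [] := He _ z2 _ z1.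
- by move=> _ [[t s] /rec[z1 z2] <-]; have [] := He _ z2 _ z1.
have e'2 : 0 < e' / 2 by rewrite divr_gt0.
(* Half of e', because [polar] bounds |rho| by the sum of two coordinates. *)
exists (dom d `&` cmap d @^-1` ball 0 (e' / 2)); split.
- by apply: chart_preimage_open; [exact: cd|exact: ball_open].
- by split=> //=; rewrite cq; exact: ballxx.
move=> p [Sp [dp /ballE]]; rewrite /= subr0 => pe.
have pc j : `|coord d j p| < e' / 2 by apply: le_lt_trans pe; exact: rv_coord_le.
have ca p' : dom d p' -> coord d i1 p' = X i1 p' h by move=> dp'; rewrite /coord Hd // row3E.
have cb p' : dom d p' -> coord d i2 p' = X i2 p' h by move=> dp'; rewrite /coord Hd // row3E.
have [th [rho [hth pa pb hrho]]] := polar (X i1 p h) (X i2 p h).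
have hr : `|rho| < e'.
  apply: le_lt_trans hrho _; have := pc i1; have := pc i2; rewrite ca // cb //.
  by move: (`|X i1 p h|) (`|X i2 p h|) => x y *; lra.
have [[t s] [z1 z2 za zb]] := He' th hth rho hr.
exists (t, s); first by rewrite /rectangle /= -ler_norml.
(* The sweep reaches a point of S with the same values of X1 h and X2 h as p; with h = 0 at both,
   all three chart coordinates agree. *)
have [_ dF SF] := He s z2 t z1.
have zero p' : dom d p' -> S p' -> h p' = 0 by move=> dp' Sp'; apply/(defining_set dS (dU dp')).
rewrite -[RHS](chart_cancel cd dp) -[LHS](chart_cancel cd dF); congr (cinv d).
by rewrite !Hd // za zb -pa -pb !zero.
Qed.

End UmbilicChart.

Lemma umbilic_point_swept : A' i1 i1 q * A' i2 i2 q <> A' i1 i2 q * A' i2 i1 q -> swept_near S q.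
Proof.
move=> /umbilic_chart[d [r [kd dq dU r0 [Ed cq Hd]]]].
exact: umbilic_swept kd dq dU r0 Ed cq Hd.
Qed.

End Umbilic.

Lemma delta_minimal_swept S q : delta_minimal A Delta X c S -> S q -> swept_near S q.
Proof.
move=> mS Sq; have [h [U [Uq dS]]] := surface_defining mS.1 Sq.
have [[a0 b0]|nc] := pselect (X i1 q h = 0 /\ X i2 q h = 0); last exact: swept_noncharacteristic mS dS Uq Sq nc.
have [det|det] := pselect (X i1 q (fun p => X i1 p h) * X i2 q (fun p => X i2 p h) =
    X i1 q (fun p => X i2 p h) * X i2 q (fun p => X i1 p h)).
  exact: swept_degenerate mS dS Uq Sq a0 b0 det.
exact: umbilic_point_swept mS dS Uq Sq a0 b0 det.
Qed.

End Contact.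

Theorem mainTheorem4 (R : realType) (M : topologicalType)
    (A : set (chart M 'rV[R]_3)) (hM : smooth_manifold A)
    (Delta : M -> set (vec R M)) (ip : M -> vec R M -> vec R M -> R)
    (hDelta : sub_riemannian A Delta ip)
    (X : 'I_3 -> field R M)
    (hframe : orthonormal_frame A Delta ip (X i1) (X i2))
    (omega : M -> vec R M -> R)
    (homega : canonical_contact_form A Delta (X i1) (X i2) omega)
    (hreeb : reeb_field A Delta omega (X i3))
    (c : 'I_3 -> 'I_3 -> 'I_3 -> M -> R)
    (hc : structure_functions A X c)
    (D : set (R * (M * R))) (Phi : R -> (M * R) -> (M * R))
    (hPhi : is_flow (bar_atlas A) (char_field X c) D Phi) :
  (forall (xi : field R (M * R)) (J : set R) (Gamma : R -> M * R)
      (q0 : M * R) (e1 e2 d1 d2 : R),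
    smooth_field (bar_atlas A) xi ->
    integral_curve (bar_atlas A) xi J Gamma -> Gamma 0 = q0 ->
    0 < e1 -> 0 < e2 -> 0 < d1 -> 0 < d2 ->
    rectangle e1 e2 d1 d2 `<=` sweep_dom D J Gamma ->
    (forall z, rectangle e1 e2 d1 d2 z -> proj_regular A Phi Gamma z ->
       exists B : set (R * R),
         [/\ open B, B z, B `<=` sweep_dom D J Gamma,
             regular_patch A Phi Gamma B &
             delta_minimal A Delta X c ((fst \o sweep Phi Gamma) @` B)]) /\
    (forall z, rectangle e1 e2 d1 d2 z ->
       let p := sweep Phi Gamma z in
       let phi := p.2 in
       let fails := fails_on_tangent A X Phi Gamma z in
       fails (fun z1 z2 z3 z4 => z1 * sin phi - z2 * cos phi = 0) ->
       fails (fun z1 z2 z3 z4 => z3 = 0) ->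
       fails (fun z1 z2 z3 z4 => gfun c p * z1 = z4 * cos phi) ->
       fails (fun z1 z2 z3 z4 => gfun c p * z2 = z4 * sin phi) ->
       [/\ bar_regular A Phi Gamma z, proj_regular A Phi Gamma z &
           exists B : set (R * R),
             [/\ open B, B z, B `<=` sweep_dom D J Gamma,
                 regular_patch A Phi Gamma B &
                 minimal_at A Delta X c
                   ((fst \o sweep Phi Gamma) @` B) p.1]])) /\
  (forall S : set M, delta_minimal A Delta X c S -> forall q, S q ->
    exists (xi : field R (M * R)) (J : set R) (Gamma : R -> M * R)
      (q0 : M * R) (e1 e2 d1 d2 : R),
      [/\ smooth_field (bar_atlas A) xi,
          integral_curve (bar_atlas A) xi J Gamma, Gamma 0 = q0,
          [/\ 0 < e1, 0 < e2, 0 < d1 & 0 < d2] &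
          let W := (fst \o sweep Phi Gamma) @` rectangle e1 e2 d1 d2 in
          [/\ rectangle e1 e2 d1 d2 `<=` sweep_dom D J Gamma,
              W `<=` S &
              exists U : set M, [/\ open U, U q & S `&` U `<=` W]]]).
Proof.
split=> [xi J Gamma q0 e1 e2 d1 d2|S mS q Sq].
  exact: (sweep_minimal hM hDelta hframe homega hreeb hPhi).
exact: (delta_minimal_swept hM hDelta hframe homega hreeb hc hPhi mS Sq).
Qed.
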